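(* Suppose $\alpha>1$. Then $P$ is not essentially self-adjoint on $C_c^\infty(\mathbb{R}^n)$, and it is not essentially self-adjoint on $\mathcal{S}(\mathbb{R}^n)$ (as an operator in $L^2(\mathbb{R}^n)$).
   Context: $n\ge 1$, $\langle y\rangle=(1+|y|^2)^{1/2}$. $V(x,\xi)=\sum_{j,k=1}^n a_{jk}(x)\xi_j\xi_k+\sum_{j=1}^n b_j(x)\xi_j+c(x)$, where $a_{jk}=a_{kj}$, $b_j$, $c$ are real-valued smooth functions on $\mathbb{R}^n$ such that, for some $0<\mu<1/2$ and all multi-indices $\beta$ (with constants $C_\beta>0$), $|\partial_x^\beta a_{jk}(x)|\le C_\beta(1+|x|)^{-\mu-|\beta|}$, $|\partial_x^\beta b_j(x)|\le C_\beta(1+|x|)^{\alpha-\mu-|\beta|}$, $|\partial_x^\beta c(x)|\le C_\beta(1+|x|)^{2\alpha-\mu-|\beta|}$. $\mathrm{Op}(a)$ is the Weyl quantization, $\mathrm{Op}(a)u(x)=(2\pi)^{-n}\int\int e^{i(x-y)\cdot\xi}a(\frac{x+y}{2},\xi)u(y)\,dy\,d\xi$. $P=-\Delta-\langle x\rangle^{2\alpha}+\mathrm{Op}(V)$ (a symmetric differential operator) and $p(x,\xi)=|\xi|^2-\langle x\rangle^{2\alpha}+V(x,\xi)$. It is assumed that for any $M>0$ there are $C>0$ and $R_M>0$ with $|p(x,\xi)|\ge C\langle\xi\rangle^2$ whenever $|x|\le M$, $|\xi|\ge R_M$. *)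

(* Defs.v *)
From HB Require Import structures.
From mathcomp Require Import all_boot all_order all_algebra.
From mathcomp Require Import all_classical all_reals all_analysis.
From mathcomp Require Import complex.

Set Implicit Arguments.
Unset Strict Implicit.
Unset Printing Implicit Defensive.
Import Order.TTheory GRing.Theory Num.Theory.
Import numFieldNormedType.Exports.
Import ComplexField.Normc.

Local Open Scope classical_set_scope.
Local Open Scope ring_scope.
Local Open Scope complex_scope.

(* R^n is ['rV[R]_n]; it carries the sigma-algebra generated by the coordinates,
   which is its Borel sigma-algebra. *)

(* [Re] and [Im] would denote the projections of a [numClosedFieldType] into
   itself; here the real and imaginary parts are elements of R. *)
Local Notation Re := complex.Re.
Local Notation Im := complex.Im.

Definition rV_display : measure_display.
Proof. exact: default_measure_display. Qed.

Section rV_measurable.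
Context {R : realType} {n : nat}.

Let coord (i : 'I_n) (x : 'rV[R]_n) : measurableTypeR R := x ord0 i.

Let rV_set0 : g_sigma_preimage coord set0.
Proof. exact: sigma_algebra0. Qed.

Let rV_setC A : g_sigma_preimage coord A -> g_sigma_preimage coord (~` A).
Proof. exact: sigma_algebraC. Qed.

Let rV_bigcup (F : (set 'rV[R]_n)^nat) :
  (forall i, g_sigma_preimage coord (F i)) ->
  g_sigma_preimage coord (\bigcup_i (F i)).
Proof. exact: sigma_algebra_bigcup. Qed.

HB.instance Definition _ := @isMeasurable.Build rV_display 'rV[R]_n
  (g_sigma_preimage coord) rV_set0 rV_setC rV_bigcup.

Lemma measurable_rV_coord (i : 'I_n) :
  measurable_fun [set: 'rV[R]_n] (fun x => x ord0 i : measurableTypeR R).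
Proof.
move=> _ Y mY; rewrite setTI; apply: sub_sigma_algebra => /=.
rewrite -bigcup_seq/=; exists i => /=; first by rewrite mem_index_enum.
by exists Y => //; rewrite setTI.
Qed.

Lemma measurable_fun_rVP d (T : measurableType d) (f : T -> 'rV[R]_n) :
  (forall i, measurable_fun [set: T] (fun t => f t ord0 i : measurableTypeR R)) ->
  measurable_fun [set: T] f.
Proof.
move=> mf _ A mA; rewrite setTI.
have : g_sigma_preimage (fun i => coord i \o f) (f @^-1` A).
  rewrite g_sigma_preimage_comp; exists A => //.
  by rewrite setTI.
apply: smallest_sub; first exact: sigma_algebra_measurable.
rewrite -bigcup_seq => B [i _ [C mC <-]].
exact: mf.
Qed.

End rV_measurable.

Section rV_lebesgue.
Context {R : realType}.

Definition rV_cons n (xv : measurableTypeR R * 'rV[R]_n) : 'rV[R]_n.+1 :=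
  \row_(i < n.+1) oapp (fun j => xv.2 ord0 j) xv.1 (unlift ord0 i).

Definition rV_uncons n (x : 'rV[R]_n.+1) : measurableTypeR R * 'rV[R]_n :=
  (x ord0 ord0, \row_(j < n) x ord0 (lift ord0 j)).

Lemma rV_consK n : cancel (@rV_cons n) (@rV_uncons n).
Proof.
move=> [x v]; rewrite /rV_uncons /rV_cons mxE unlift_none; congr pair.
by apply/rowP => j; rewrite !mxE liftK.
Qed.

Lemma measurable_rV_cons n : measurable_fun setT (@rV_cons n).
Proof.
apply: measurable_fun_rVP => i.
rewrite /rV_cons; case: (unliftP ord0 i) => [j|] ->.
  under eq_fun do rewrite mxE liftK /=.
  exact: (measurableT_comp (measurable_rV_coord j) measurable_snd).
under eq_fun do rewrite mxE unlift_none /=.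
exact: measurable_fst.
Qed.

Lemma measurable_rV_uncons n : measurable_fun setT (@rV_uncons n).
Proof.
apply: measurable_fun_pair; first exact: measurable_rV_coord.
apply: measurable_fun_rVP => i; under eq_fun do rewrite mxE.
exact: measurable_rV_coord.
Qed.

Section rV_cons_measure.
Variables (n : nat) (mu : {sigma_finite_measure set 'rV[R]_n -> \bar R}).

Definition rV_cons_measure :=
  pushforward (@lebesgue_measure R \x mu)%E (@rV_cons n).

Let rV_cons_measure0 : rV_cons_measure set0 = 0%E.
Proof. by rewrite /rV_cons_measure /pushforward preimage_set0 measure0. Qed.

Let measurable_preimage A :
  measurable A -> measurable (@rV_cons n @^-1` A).
Proof. by move=> mA; rewrite -[X in measurable X]setTI; exact: measurable_rV_cons. Qed.

Let rV_cons_measure_ge0 A : (0 <= rV_cons_measure A)%E.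
Proof. by rewrite /rV_cons_measure /pushforward measure_ge0. Qed.

Let rV_cons_measure_sigma_additive : semi_sigma_additive rV_cons_measure.
Proof.
move=> F mF tF mUF; rewrite /rV_cons_measure /pushforward preimage_bigcup.
apply: measure_semi_sigma_additive.
- by move=> k; exact: measurable_preimage.
- apply/trivIsetP => /= i j _ _ ij; rewrite -preimage_setI.
  by move/trivIsetP : tF => /(_ _ _ _ _ ij) ->//; rewrite preimage_set0.
- by rewrite -preimage_bigcup; exact: measurable_preimage.
Qed.

HB.instance Definition _ := isMeasure.Build _ _ _ rV_cons_measure
  rV_cons_measure0 rV_cons_measure_ge0 rV_cons_measure_sigma_additive.

Let rV_cons_measure_sigma_finite : sigma_finite setT rV_cons_measure.
Proof.
have /sigma_finiteP[F [FT ndF Foo]] := sigma_finiteT (@lebesgue_measure R).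
have /sigma_finiteP[G [GT ndG Goo]] := sigma_finiteT mu.
exists (fun k => @rV_uncons n @^-1` (F k `*` G k)).
  rewrite -preimage_bigcup -(preimage_setT (@rV_uncons n)); congr (_ @^-1` _).
  apply/seteqP; split => [[x v] _|//].
  have [i _ Fi] : (\bigcup_i F i) x by rewrite -FT.
  have [j _ Gj] : (\bigcup_j G j) v by rewrite -GT.
  exists (maxn i j) => //; split => /=.
  - by move: x Fi; exact/subsetPset/ndF/leq_maxl.
  - by move: v Gj; exact/subsetPset/ndG/leq_maxr.
move=> k; have [mF Fk] := Foo k; have [mG Gk] := Goo k; split.
  rewrite -[X in measurable X]setTI; apply: measurable_rV_uncons => //.
  exact: measurableX.
rewrite /rV_cons_measure /pushforward -comp_preimage.
rewrite (_ : _ \o _ = id); last by apply/funext => x /=; rewrite rV_consK.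
by rewrite preimage_id product_measure1E// lte_mul_pinfty// ge0_fin_numE.
Qed.

HB.instance Definition _ := Measure_isSigmaFinite.Build _ _ _ rV_cons_measure
  rV_cons_measure_sigma_finite.

End rV_cons_measure.

(* n-dimensional Lebesgue measure: R^0 carries the unit point mass, and R^n.+1
   the image of the product of the Lebesgue measures of R and R^n. *)
Fixpoint lebesgue_rV n : {sigma_finite_measure set 'rV[R]_n -> \bar R} :=
  if n is n'.+1 then rV_cons_measure (lebesgue_rV n') else \d_(0 : 'rV[R]_0).

Lemma lebesgue_rV_box n (A : 'I_n -> set (measurableTypeR R)) :
  (forall i, measurable (A i)) ->
  lebesgue_rV n [set x | forall i, A i (x ord0 i)] =
  (\prod_(i < n) lebesgue_measure (A i))%E.
Proof.
elim: n A => [|n IHn] A mA.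
  rewrite big_ord0 /= diracE mem_set//=; by case.
rewrite big_ord_recl /= /rV_cons_measure /pushforward.
have -> : @rV_cons n @^-1` [set x | forall i, A i (x ord0 i)] =
    A ord0 `*` [set v : 'rV[R]_n | forall i, A (lift ord0 i) (v ord0 i)].
  apply/seteqP; split => [[x v] /= H|[x v] /= [H0 H] i].
    split; first by have := H ord0; rewrite mxE unlift_none.
    by move=> i; have := H (lift ord0 i); rewrite mxE liftK.
  by rewrite mxE; case: unliftP => [j|] ->.
rewrite product_measure1E//; first by rewrite (IHn (fun i => A (lift ord0 i))).
rewrite (_ : mkset _ = \bigcap_(i in [set: 'I_n])
    ((fun v : 'rV[R]_n => v ord0 i) @^-1` A (lift ord0 i))); last first.
  by apply/seteqP; split => [v H i _|v H i]; exact: H.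
apply: fin_bigcap_measurable => // i _.
by rewrite -[X in measurable X]setTI; exact: measurable_rV_coord.
Qed.

End rV_lebesgue.

Section calculus.
Context {R : realType} {n : nat}.
Implicit Types (x y xi : 'rV[R]_n) (f g : 'rV[R]_n -> R) (u v : 'rV[R]_n -> R[i]).

Definition dotp x y : R := \sum_(j < n) x ord0 j * y ord0 j.

(* The norm [`|x|] of ['rV[R]_n] is the sup norm, hence this one. *)
Definition enorm x : R := Num.sqrt (dotp x x).

Definition jap x : R := Num.sqrt (1 + enorm x ^+ 2).

Definition partial (j : 'I_n) f : 'rV[R]_n -> R :=
  fun x => 'D_(delta_mx ord0 j) f x.

(* Existence and continuity of all iterated partial derivatives, in any order. *)
Definition smooth f : Prop := forall s : seq 'I_n,
  continuous (foldr partial f s) /\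
  forall j x, derivable (foldr partial f s) x (delta_mx ord0 j).

Definition multi_index := 'I_n -> nat.

Definition multi_order (beta : multi_index) : nat := (\sum_(j < n) beta j)%N.

Definition multi_partial (beta : multi_index) f : 'rV[R]_n -> R :=
  foldr (fun j => iter (beta j) (partial j)) f (enum 'I_n).

Definition symbol_bound (m : R) f : Prop := forall beta : multi_index,
  exists C : R, 0 < C /\ forall x,
    `|multi_partial beta f x| <= C * (1 + enorm x) `^ (m - (multi_order beta)%:R).

Definition csmooth u : Prop :=
  smooth (fun x => Re (u x)) /\ smooth (fun x => Im (u x)).

Definition cmulti_partial (beta : multi_index) u : 'rV[R]_n -> R[i] := fun x =>
  multi_partial beta (fun y => Re (u y)) x
    +i* multi_partial beta (fun y => Im (u y)) x.

Definition laplacian f : 'rV[R]_n -> R :=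
  fun x => \sum_(j < n) partial j (partial j f) x.

Definition claplacian u : 'rV[R]_n -> R[i] := fun x =>
  laplacian (fun y => Re (u y)) x +i* laplacian (fun y => Im (u y)) x.

Definition Cc_infty : set ('rV[R]_n -> R[i]) :=
  [set u | csmooth u /\ compact (closure [set x | u x != 0])].

Definition schwartz : set ('rV[R]_n -> R[i]) :=
  [set u | csmooth u /\ forall beta gamma : multi_index, exists C : R, forall x,
    `|\prod_(j < n) x ord0 j ^+ gamma j| * normc (cmulti_partial beta u x) <= C].

Definition cintegral u : R[i] :=
  (\int[lebesgue_rV n]_x Re (u x)) +i* (\int[lebesgue_rV n]_x Im (u x)).

Definition expi (t : R) : R[i] := cos t +i* sin t.

(* An iterated integral: for u in the Schwartz space and a polynomial in xi with
   smooth coefficients of tempered growth (with their derivatives), the integral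
   in y converges absolutely and is rapidly decreasing in xi, so that no
   regularization is needed. *)
Definition weyl (a : 'rV[R]_n -> 'rV[R]_n -> R) u : 'rV[R]_n -> R[i] := fun x =>
  (((2 * pi) ^+ n)^-1)%:C *
  cintegral (fun xi => cintegral (fun y =>
    expi (dotp (x - y) xi) * (a (2^-1 *: (x + y)) xi)%:C * u y)).

End calculus.

(* L^2(R^n; C) is represented by functions rather than by classes modulo almost
   everywhere equality. Unbounded operators are given by their graphs; graph
   closures and adjoints are saturated for a.e. equality, so that equality of
   such sets is equality of the operators they define in the quotient. *)
Section operators.
Context {R : realType} {n : nat}.
Let mu := @lebesgue_rV R n.
Let fct := 'rV[R]_n -> R[i].

Definition L2norm (u : fct) : \bar R := Lnorm mu 2%:E (fun x => (normc (u x))%:E).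

Definition L2dist (u v : fct) : \bar R := L2norm (fun x => u x - v x).

Definition L2 : set fct := [set u |
  measurable_fun setT (fun x => Re (u x)) /\
  measurable_fun setT (fun x => Im (u x)) /\ (L2norm u < +oo)%E].

Definition L2dot (u v : fct) : R[i] := cintegral (fun x => u x * (v x)^*).

Definition graph (D : set fct) (A : fct -> fct) : set (fct * fct) :=
  [set uf | D uf.1 /\ L2 uf.1 /\ L2 uf.2 /\ uf.2 = A uf.1].

Definition graph_closure (G : set (fct * fct)) : set (fct * fct) :=
  [set uf | L2 uf.1 /\ L2 uf.2 /\ forall e : R, 0 < e ->
    exists2 vg, G vg &
      (L2dist uf.1 vg.1 < e%:E)%E /\ (L2dist uf.2 vg.2 < e%:E)%E].

Definition graph_adjoint (G : set (fct * fct)) : set (fct * fct) :=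
  [set vg | L2 vg.1 /\ L2 vg.2 /\
    forall uf, G uf -> L2dot uf.2 vg.1 = L2dot uf.1 vg.2].

Definition selfadjoint (G : set (fct * fct)) : Prop := graph_adjoint G = G.

Definition essentially_selfadjoint (D : set fct) (A : fct -> fct) : Prop :=
  selfadjoint (graph_closure (graph D A)).

End operators.

Section hamiltonian.
Context {R : realType} {n : nat}.
Variables (alpha : R) (a : 'I_n -> 'I_n -> 'rV[R]_n -> R)
  (b : 'I_n -> 'rV[R]_n -> R) (c : 'rV[R]_n -> R).

Definition potential (x xi : 'rV[R]_n) : R :=
  \sum_(j < n) \sum_(k < n) a j k x * xi ord0 j * xi ord0 k
  + \sum_(j < n) b j x * xi ord0 j + c x.

Definition psymbol (x xi : 'rV[R]_n) : R :=
  enorm xi ^+ 2 - jap x `^ (2 * alpha) + potential x xi.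

Definition hamiltonian (u : 'rV[R]_n -> R[i]) : 'rV[R]_n -> R[i] := fun x =>
  - claplacian u x - (jap x `^ (2 * alpha))%:C * u x + weyl potential u x.

End hamiltonian.

(* Main.v *)
Require Import Defs.
From HB Require Import structures.
From mathcomp Require Import all_boot all_order all_algebra.
From mathcomp Require Import all_classical all_reals all_analysis.
From mathcomp Require Import measurable_realfun complex ring lra.
Set Implicit Arguments.
Unset Strict Implicit.
Unset Printing Implicit Defensive.
Import Order.TTheory GRing.Theory Num.Theory.
Import numFieldNormedType.Exports.
Local Open Scope classical_set_scope.
Local Open Scope ring_scope.

(** If the closure of the operator were self-adjoint, every pair (v, f) in its
    adjoint would satisfy <f, v> = <v, f>.  The proof constructs a pair that does
    not: a function v in L2, of WKB form, whose image f under the differential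
    operator is again in L2 although v carries a nonzero flux of energy to
    infinity.  Since alpha > 1, classical trajectories reach infinity in finite
    time, and v describes particles that leave.  The pair is in the adjoint for
    the domain of Schwartz functions, hence for every smaller domain, so that one
    pair settles both assertions.

    The differential operator.  V is a polynomial of degree 2 in xi; by Fourier
    inversion its Weyl quantization is the expected second order operator, and
    P = L - i K with L u = - d_j (g_jk d_k u) + c2 u, where g = 1 + a, and
    K u = b . grad u + (div b) u / 2 ([hamiltonianE]).  The inversion theorem
    ([fourier_inversion]) is proved by regularizing with exp (- e |xi_j|), whose
    transform is a product of Cauchy densities.  Pairing P u with v, for u in the
    Schwartz space and v of moderate growth, produces no boundary terms
    ([green_integrals]).

    The quasimode.  For v = exp (rho + i phi), P v = (E1 + i E2) v, where E1 and
    E2 are the residuals of the eikonal and of the transport equation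
    ([mode_image]).  The unperturbed choice is phi0 = <x>^(1 + alpha) / (1 + alpha)
    and rho0 = - ((n - 1 + alpha) / 2) log <x>.  As grad phi0 is radial, the
    linearized residuals at (phi0, rho0) are, to leading order and up to sign,
    multiplication by 2 <x>^(alpha - 1) composed with the Euler field x . grad.
    The Euler field is inverted on symbols of nonzero order by integration along
    rays, from the origin or from infinity ([sy_euler]).  Each correction improves
    the residuals by a fixed power of |x| ([wkb_step]), and after finitely many of
    them f is square integrable ([wkb_exists], [image_square_integrable]); v is
    square integrable because |v|^2 has size |x|^-(n - 1 + alpha) with alpha > 1
    ([mode_square_integrable]).  The corrections are singular at the origin.  An
    additional factor exp (- |x|^-s) makes v vanish there to infinite order, and
    is close to 1 at infinity.

    The flux.  The imaginary part of f times the conjugate of v is minus the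
    divergence of the current exp (2 rho) (g grad phi + b / 2) ([flux_balance]).
    The outward component of the current has size |x|^(1 - n), so that its flux
    through large spheres does not tend to 0; hence the imaginary part of <f, v>
    is negative ([outgoing_flux_lt0], [pairing_lt0]).  The divergence theorem is
    replaced by an integration by parts against polynomially decaying cutoffs. *)

(** * Euclidean space *)

Lemma continuous_sum {R : realType} (T : topologicalType) (I : Type) (r : seq I)
    (F : I -> T -> R) (x : T) :
  (forall i, {for x, continuous (F i)}) ->
  {for x, continuous (fun y => \sum_(i <- r) F i y)}.
Proof.
move=> cF; elim: r => [|i r IH].
  rewrite (_ : (fun _ => _) = cst 0); first exact: cst_continuous.
  by apply/funext => y; rewrite big_nil.
rewrite (_ : (fun _ => _) = F i + (fun y => \sum_(j <- r) F j y)); last first.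
  by apply/funext => y; rewrite big_cons.
exact: continuousD.
Qed.

Section euclidean.
Context {R : realType} {n : nat}.
Implicit Types x y v : 'rV[R]_n.

Lemma dotpC x y : dotp x y = dotp y x.
Proof. by apply: eq_bigr => j _; rewrite mulrC. Qed.

Lemma dotpDl x y v : dotp (x + y) v = dotp x v + dotp y v.
Proof. by rewrite /dotp -big_split/=; apply: eq_bigr => j _; rewrite mxE mulrDl. Qed.

Lemma dotpZl t x v : dotp (t *: x) v = t * dotp x v.
Proof. by rewrite /dotp big_distrr/=; apply: eq_bigr => j _; rewrite mxE mulrA. Qed.

Lemma dotpDr x y v : dotp v (x + y) = dotp v x + dotp v y.
Proof. by rewrite dotpC dotpDl !(dotpC v). Qed.

Lemma dotpZr t x v : dotp v (t *: x) = t * dotp v x.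
Proof. by rewrite dotpC dotpZl (dotpC v). Qed.

Lemma dotp_ge0 x : 0 <= dotp x x.
Proof. by apply: sumr_ge0 => j _; rewrite -expr2 sqr_ge0. Qed.

Lemma enorm_ge0 x : 0 <= enorm x.
Proof. exact: sqrtr_ge0. Qed.

Lemma sqr_enorm x : enorm x ^+ 2 = dotp x x.
Proof. by rewrite sqr_sqrtr// dotp_ge0. Qed.

Lemma enormZ t x : enorm (t *: x) = `|t| * enorm x.
Proof.
rewrite /enorm dotpZl dotpZr mulrA -expr2 sqrtrM ?sqr_ge0//.
by rewrite sqrtr_sqr.
Qed.

Lemma coord_le_enorm x j : `|x ord0 j| <= enorm x.
Proof.
rewrite -sqrtr_sqr ler_wsqrtr// /dotp (bigD1 j)//= -expr2 lerDl.
by apply: sumr_ge0 => i _; rewrite -expr2 sqr_ge0.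
Qed.

Lemma dotp_delta x j : dotp x (delta_mx ord0 j) = x ord0 j.
Proof.
rewrite /dotp (bigD1 j)//= mxE !eqxx mulr1 big1 ?addr0// => i ij.
by rewrite mxE (negbTE ij) andbF mulr0.
Qed.

Lemma enorm_eq0 x : (enorm x == 0) = (x == 0).
Proof.
apply/eqP/eqP => [x0|->]; last first.
  by rewrite -(scale0r 0) enormZ normr0 mul0r.
apply/rowP => j; rewrite mxE; apply/eqP; rewrite -normr_eq0 eq_le normr_ge0 andbT.
by rewrite -x0 coord_le_enorm.
Qed.

Lemma enorm0 : enorm (0 : 'rV[R]_n) = 0.
Proof. by apply/eqP; rewrite enorm_eq0. Qed.

Lemma enorm_gt0 x : (0 < enorm x) = (x != 0).
Proof. by rewrite lt_neqAle enorm_ge0 andbT eq_sym enorm_eq0. Qed.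

Lemma enormN x : enorm (- x) = enorm x.
Proof. by rewrite -scaleN1r enormZ normrN1 mul1r. Qed.

Lemma enormD_le x y : enorm (x + y) <= 2 * (enorm x + enorm y).
Proof.
rewrite -(@ler_pXn2r _ 2)// ?nnegrE ?mulr_ge0 ?addr_ge0 ?enorm_ge0//.
rewrite sqr_enorm dotpDl !dotpDr (dotpC y x).
have : dotp x x + dotp y y - 2 * dotp x y >= 0.
  have := dotp_ge0 (x - y); rewrite -scaleN1r dotpDl !dotpDr !dotpZl !dotpZr.
  by rewrite (dotpC y x) => h; lra.
have := enorm_ge0 x; have := enorm_ge0 y.
by rewrite -!sqr_enorm; nra.
Qed.

Lemma oneDenorm_gt0 x : 0 < 1 + enorm x.
Proof. by rewrite ltr_pwDl ?enorm_ge0. Qed.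

Lemma oneDenormD_le x y : 1 + enorm (x + y) <= 2 * (1 + enorm x) * (1 + enorm y).
Proof.
have := enormD_le x y; have := enorm_ge0 x; have := enorm_ge0 y; nra.
Qed.

Lemma dotp_continuous x : {for x, continuous (fun y => dotp y y)}.
Proof.
apply: continuous_sum => j; apply: continuousM; exact: coord_continuous.
Qed.

Lemma enorm_continuous x : {for x, continuous (@enorm R n)}.
Proof.
apply: (@continuous_comp _ _ _ (fun y : 'rV[R]_n => dotp y y)); last exact: sqrt_continuous.
exact: dotp_continuous.
Qed.

End euclidean.
#[global] Hint Resolve enorm_ge0 : core.

(** * Differentiation along lines *)

Section line_derivative.
Context {R : realType} {V : normedModType R}.
Implicit Types (f g : V -> R) (x v : V).

(** Derivatives in a direction reduce to derivatives at 0 of functions of one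
    variable, to which the chain rule and the mean value theorem apply. *)
Lemma is_derive_lineP f x v (d : R) :
  is_derive x v f d <-> is_derive (0 : R) (1 : R) (fun h => f (h *: v + x)) d.
Proof.
have E : 'D_v f x = 'D_1 (fun h : R => f (h *: v + x)) 0.
  rewrite /derive.
  set F := (X in X @ 0^'); set G := (X in _ = lim (X @ 0^')).
  have -> // : F = G.
  apply/funext => h; rewrite /F /G /=.
  by rewrite addr0 scale0r add0r /GRing.scale/= mulr1.
split => -[H <-].
  by split; [exact: (iffLR (derivable1P f x v))|rewrite -E].
by split; [exact: (iffRL (derivable1P f x v))|rewrite E].
Qed.

Lemma is_derive_compo (F : R -> R) f x v (a d : R) :
  is_derive (f x) 1 F a -> is_derive x v f d -> is_derive x v (F \o f) (a * d).
Proof.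
move=> HF /is_derive_lineP Hf; apply/is_derive_lineP.
apply: (@is_derive1_comp _ F (fun h => f (h *: v + x))) => //.
by rewrite scale0r add0r.
Qed.

Lemma is_derive_mul f g x v (df dg : R) : is_derive x v f df -> is_derive x v g dg ->
  is_derive x v (fun y => f y * g y) (df * g x + f x * dg).
Proof.
move=> Hf Hg; apply: (@is_derive_eq _ _ _ (f * g)); rewrite /GRing.scale/= addrC; congr (_ + _).
by rewrite mulrC.
Qed.

Lemma is_derive_add f g x v (df dg : R) : is_derive x v f df -> is_derive x v g dg ->
  is_derive x v (fun y => f y + g y) (df + dg).
Proof. by move=> Hf Hg; exact: is_deriveD. Qed.

Lemma is_derive_const (c : R) x v : is_derive x v (fun=> c) 0.
Proof. exact: is_derive_cst. Qed.

Lemma is_derive_cmul (c : R) f x v (df : R) : is_derive x v f df ->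
  is_derive x v (fun y => c * f y) (c * df).
Proof.
move=> Hf; have := is_derive_mul (is_derive_const c x v) Hf.
by rewrite mul0r add0r.
Qed.

Lemma is_derive_opp f x v (df : R) : is_derive x v f df ->
  is_derive x v (fun y => - f y) (- df).
Proof. by move=> Hf; exact: is_deriveN. Qed.

Lemma is_derive_bigsum (I : Type) (r : seq I) (F : I -> V -> R) (dF : I -> R) x v :
  (forall i, is_derive x v (F i) (dF i)) ->
  is_derive x v (fun y => \sum_(i <- r) F i y) (\sum_(i <- r) dF i).
Proof.
move=> H; elim: r => [|i r IH].
  rewrite big_nil (_ : (fun _ => _) = cst 0); first exact: is_derive_const.
  by apply/funext => y; rewrite big_nil.
rewrite big_cons (_ : (fun _ => _) = fun y => F i y + \sum_(j <- r) F j y).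
  exact: is_derive_add.
by apply/funext => y; rewrite big_cons.
Qed.

Lemma is_derive_local (A : set V) f g x v (d : R) : open A -> A x ->
  (forall y, A y -> f y = g y) -> is_derive x v f d -> is_derive x v g d.
Proof.
move=> oA Ax fg; apply: near_eq_is_derive.
by near=> y; apply: fg; near: y; exact: open_nbhs_nbhs.
Unshelve. all: by end_near. Qed.

Lemma continuous_local (T : topologicalType) (A : set T) (f g : T -> R) (x : T) : open A -> A x ->
  (forall y, A y -> f y = g y) -> {for x, continuous f} -> {for x, continuous g}.
Proof.
move=> oA Ax fg cf; rewrite /prop_for /continuous_at -(fg x Ax).
apply: cvg_trans cf; apply: near_eq_cvg.
by near=> y; apply: fg; near: y; exact: open_nbhs_nbhs.
Unshelve. all: by end_near. Qed.

End line_derivative.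

Lemma is_derive_line {R : realType} {V : normedModType R} (f : V -> R) x v (t d : R) :
  is_derive (t *: v + x) v f d -> is_derive t (1 : R) (fun h => f (h *: v + x)) d.
Proof.
move=> /is_derive_lineP H; apply: (iffRL (is_derive_lineP (V := R^o) _ t 1 d)).
by under eq_fun do rewrite scalerDl -addrA [_%:A]mulr1.
Qed.

Lemma is_derive_coord {R : realType} {n : nat} (x v : 'rV[R]_n) i :
  is_derive x v (fun y : 'rV[R]_n => y ord0 i) (v ord0 i).
Proof.
apply/is_derive_lineP.
rewrite (_ : (fun h : R => _) = fun h : R => h * v ord0 i + x ord0 i); last first.
  by apply/funext => h; rewrite !mxE.
have := is_derive_add (is_derive_mul (is_derive_id (0:R) 1) (is_derive_const (v ord0 i) (0:R) 1))
  (is_derive_const (x ord0 i) (0:R) (1:R)).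
by rewrite mul1r mulr0 !addr0.
Qed.

Lemma is_derive_sqnorm {R : realType} {n : nat} (x : 'rV[R]_n) j :
  is_derive x (delta_mx ord0 j) (fun y => dotp y y) (2 * x ord0 j).
Proof.
have : is_derive x (delta_mx ord0 j) (fun y : 'rV[R]_n => dotp y y)
    (\sum_(i < n) ((delta_mx ord0 j : 'rV[R]_n) ord0 i * x ord0 i
      + x ord0 i * (delta_mx ord0 j : 'rV[R]_n) ord0 i)).
  by apply: is_derive_bigsum => i; apply: is_derive_mul; exact: is_derive_coord.
have -> // : \sum_(i < n) ((delta_mx ord0 j : 'rV[R]_n) ord0 i * x ord0 i
      + x ord0 i * (delta_mx ord0 j : 'rV[R]_n) ord0 i) = 2 * x ord0 j.
rewrite big_split/= -/(dotp x (delta_mx ord0 j)) -/(dotp (delta_mx ord0 j) x).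
by rewrite dotpC dotp_delta; lra.
Qed.

(** * Functions with weighted bounds on their derivatives *)

Section weighted_classes.
Context {R : realType} {n : nat} (D : set 'rV[R]_n) (q : 'rV[R]_n -> R).
Implicit Types (f g w : 'rV[R]_n -> R) (x : 'rV[R]_n).

Definition cls0 w f : Prop := (forall x, D x -> {for x, continuous f}) /\
  exists2 C : R, 0 <= C & forall x, D x -> `|f x| <= C * w x.

(** Symbol classes and classes of functions of moderate growth are the cases
    q = 1 / |x| and q = 1 of one notion: w bounds the function and each
    derivative costs a factor q.  Only finitely many derivatives are counted, so
    that membership can be proved by induction on k, for all weights at once. *)
Fixpoint cls k w f : Prop :=
  if k is k'.+1 then cls0 w f /\ forall j,
      (forall x, D x -> derivable f x (delta_mx ord0 j)) /\
      cls k' (fun x => q x * w x) (partial j f)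
  else cls0 w f.

Lemma cls_cls0 k w f : cls k w f -> cls0 w f.
Proof. by case: k => [//|k []]. Qed.

Lemma cls_cont k w f x : cls k w f -> D x -> {for x, continuous f}.
Proof. by move=> /cls_cls0[cf _]; exact: cf. Qed.

Lemma cls_partial k w f j : cls k.+1 w f -> cls k (fun x => q x * w x) (partial j f).
Proof. by case=> _ /(_ j)[]. Qed.

Lemma cls_derive k w f x j : cls k.+1 w f -> D x ->
  is_derive x (delta_mx ord0 j) f (partial j f x).
Proof. by case=> _ /(_ j)[df _] Dx; exact/derivableP/df. Qed.

Hypothesis oD : open D.
Hypothesis q0 : forall x, D x -> 0 <= q x.

Lemma cls0_ext w f g : (forall x, D x -> f x = g x) -> cls0 w f -> cls0 w g.
Proof.
move=> fg [cf [C C0 fC]]; split.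
  by move=> x Dx; apply: (continuous_local oD Dx fg); exact: cf.
by exists C => // x Dx; rewrite -fg// fC.
Qed.

Lemma cls_ext k w f g : (forall x, D x -> f x = g x) -> cls k w f -> cls k w g.
Proof.
elim: k w f g => [|k IH] w f g fg; first exact: cls0_ext.
case=> f0 fS; split; first exact: cls0_ext f0.
move=> j; have [df Hf] := fS j.
have E x : D x -> is_derive x (delta_mx ord0 j) g (partial j f x).
  by move=> Dx; apply: (is_derive_local oD Dx fg); exact/derivableP/df.
split; first by move=> x /E[].
by apply: IH Hf => x /E H; rewrite [RHS]derive_val.
Qed.

Lemma cls_weight (c : R) k w w' f : 0 <= c -> (forall x, D x -> w x <= c * w' x) ->
  cls k w f -> cls k w' f.
Proof.
move=> c0; elim: k w w' f => [|k IH] w w' f ww'.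
  move=> [cf [C C0 fC]]; split=> //; exists (C * c); first exact: mulr_ge0.
  by move=> x Dx; rewrite (le_trans (fC x Dx))// -mulrA ler_wpM2l// ww'.
case=> f0 fS; split.
  case: f0 => [cf [C C0 fC]]; split=> //; exists (C * c); first exact: mulr_ge0.
  by move=> x Dx; rewrite (le_trans (fC x Dx))// -mulrA ler_wpM2l// ww'.
move=> j; have [df Hf] := fS j; split=> //.
by apply: IH Hf => x Dx; rewrite mulrCA ler_wpM2l ?q0// ww'.
Qed.

Lemma cls_weight_le k w w' f : (forall x, D x -> w x <= w' x) -> cls k w f -> cls k w' f.
Proof. by move=> H; apply: (@cls_weight 1) => // x Dx; rewrite mul1r H. Qed.

Lemma clsSI k w f : cls0 w f ->
  (forall j, exists2 g, (forall x, D x -> is_derive x (delta_mx ord0 j) f (g x)) &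
    cls k (fun x => q x * w x) g) -> cls k.+1 w f.
Proof.
move=> f0 H; split=> // j; have [g fg Hg] := H j; split=> [x /fg[]//|].
by apply: cls_ext Hg => x /fg E; rewrite /partial [RHS]derive_val.
Qed.

Lemma clsS k w f : cls k.+1 w f -> cls k w f.
Proof.
elim: k w f => [|k IH] w f; first by case.
by case=> f0 fS; split=> // j; have [df Hf] := fS j; split=> //; exact: IH.
Qed.

Lemma cls_leq k k' w f : (k <= k')%N -> cls k' w f -> cls k w f.
Proof.
move=> kk'; rewrite -(subnK kk'); elim: (k' - k)%N => [//|i IH].
by rewrite addSn => /clsS; exact: IH.
Qed.

Lemma cls_zero k w : (forall x, D x -> 0 <= w x) -> cls k w (fun=> 0).
Proof.
elim: k w => [|k IH] w w0.
  split; first by move=> x _; exact: cst_continuous.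
  by exists 0 => // x Dx; rewrite normr0 mul0r.
apply: clsSI.
  split; first by move=> x _; exact: cst_continuous.
  by exists 0 => // x Dx; rewrite normr0 mul0r.
move=> j; exists (fun=> 0); first by move=> x _; exact: is_derive_const.
by apply: IH => x Dx; rewrite mulr_ge0 ?q0 ?w0.
Qed.

Lemma cls_const k (c : R) : cls k (fun=> 1) (fun=> c).
Proof.
have H0 : cls0 (fun=> 1) (fun=> c).
  split; first by move=> x _; exact: cst_continuous.
  by exists `|c| => // x Dx; rewrite mulr1.
case: k => [//|k]; apply: clsSI => // j; exists (fun=> 0).
  by move=> x _; exact: is_derive_const.
by apply: cls_zero => x Dx; rewrite mulr1 q0.
Qed.

Lemma cls_add k w f g : cls k w f -> cls k w g -> cls k w (fun x => f x + g x).
Proof.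
elim: k w f g => [|k IH] w f g Hf Hg.
  case: Hf Hg => [cf [C C0 fC]] [cg [C' C'0 gC]]; split.
    by move=> x Dx; apply: continuousD; [exact: cf|exact: cg].
  exists (C + C'); first exact: addr_ge0.
  by move=> x Dx; rewrite mulrDl (le_trans (ler_normD _ _))// lerD ?fC ?gC.
apply: clsSI.
  have [cf [C C0 fC]] := cls_cls0 Hf; have [cg [C' C'0 gC]] := cls_cls0 Hg; split.
    by move=> x Dx; apply: continuousD; [exact: cf|exact: cg].
  exists (C + C'); first exact: addr_ge0.
  by move=> x Dx; rewrite mulrDl (le_trans (ler_normD _ _))// lerD ?fC ?gC.
move=> j; exists (fun x => partial j f x + partial j g x).
  by move=> x Dx; apply: is_derive_add; [exact: cls_derive Hf _|exact: cls_derive Hg _].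
by apply: IH; exact: cls_partial.
Qed.

Lemma cls0_mul w w' f g : cls0 w f -> cls0 w' g ->
  cls0 (fun x => w x * w' x) (fun x => f x * g x).
Proof.
move=> [cf [C C0 fC]] [cg [C' C'0 gC]]; split.
  by move=> x Dx; apply: continuousM; [exact: cf|exact: cg].
exists (C * C'); first exact: mulr_ge0.
by move=> x Dx; rewrite normrM mulrACA ler_pM ?fC ?gC.
Qed.

Lemma cls_mul k w w' f g : cls k w f -> cls k w' g ->
  cls k (fun x => w x * w' x) (fun x => f x * g x).
Proof.
elim: k w w' f g => [|k IH] w w' f g Hf Hg; first exact: cls0_mul.
apply: clsSI; first by apply: cls0_mul; [exact: cls_cls0 Hf|exact: cls_cls0 Hg].
move=> j; exists (fun x => partial j f x * g x + f x * partial j g x).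
  by move=> x Dx; apply: is_derive_mul; [exact: cls_derive Hf _|exact: cls_derive Hg _].
apply: cls_add.
  apply: (cls_weight_le (w := fun x => q x * w x * w' x)).
    by move=> x Dx; rewrite mulrA.
  by apply: IH; [exact: cls_partial|exact: clsS].
apply: (cls_weight_le (w := fun x => w x * (q x * w' x))).
  by move=> x Dx; rewrite mulrCA.
by apply: IH; [exact: clsS|exact: cls_partial].
Qed.

Lemma cls_cmul k w (c : R) f : cls k w f -> cls k w (fun x => c * f x).
Proof.
move=> Hf; apply: (cls_weight_le (w := fun x => 1 * w x)).
  by move=> x Dx; rewrite mul1r.
by apply: cls_mul => //; exact: cls_const.
Qed.

Lemma cls_opp k w f : cls k w f -> cls k w (fun x => - f x).
Proof.
move=> /(@cls_cmul _ _ (-1)); apply: cls_ext => x _.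
by rewrite mulN1r.
Qed.

Lemma cls_sum k w (I : Type) (r : seq I) (F : I -> 'rV[R]_n -> R) :
  (forall x, D x -> 0 <= w x) -> (forall i, cls k w (F i)) ->
  cls k w (fun x => \sum_(i <- r) F i x).
Proof.
move=> w0 HF; elim: r => [|i r IH].
  apply: (cls_ext (f := fun=> 0)); first by move=> x _; rewrite big_nil.
  exact: cls_zero.
apply: (cls_ext (f := fun x => F i x + \sum_(j <- r) F j x)).
  by move=> x _; rewrite big_cons.
exact: cls_add.
Qed.

(** A derivative of f^s is a multiple of f^(s-1) times a derivative of f, whose
    weight is w^(s-1) (q w) = q w^s: the induction on the number of derivatives
    runs over all exponents simultaneously.  The lower bound on f serves the
    negative exponents. *)
Lemma cls_powR k w f (c s : R) : 0 < c -> (forall x, D x -> 0 < w x) ->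
  (forall x, D x -> c * w x <= f x) -> cls k w f ->
  cls k (fun x => w x `^ s) (fun x => f x `^ s).
Proof.
move=> c0 w0 cw.
have f0 x : D x -> 0 < f x by move=> Dx; rewrite (lt_le_trans _ (cw x Dx))// mulr_gt0 ?w0.
have H0 t : cls0 w f -> cls0 (fun x => w x `^ t) (fun x => f x `^ t).
  move=> [cf [C C0 fC]]; split.
    move=> x Dx; apply: (@continuous_comp _ _ _ f (fun y => y `^ t)); first exact: cf.
    have [H _] := is_derive1_powR t (f0 x Dx).
    by apply: differentiable_continuous; exact/derivable1_diffP.
  exists (C `^ t + c `^ t); first by rewrite addr_ge0 ?powR_ge0.
  move=> x Dx; rewrite ger0_norm ?powR_ge0// mulrDl.
  have [t0|t0] := leP 0 t.
    rewrite ler_wpDr ?mulr_ge0 ?powR_ge0// -powRM ?(ltW (w0 _ _))//.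
    rewrite ge0_ler_powR ?nnegrE ?mulr_ge0 ?(ltW (w0 _ _)) ?(ltW (f0 _ _))//.
    by rewrite (le_trans _ (fC x Dx))// ler_norm.
  rewrite ler_wpDl ?mulr_ge0 ?powR_ge0// -powRM ?(ltW (w0 _ _)) ?(ltW c0)//.
  rewrite -[t]opprK !(powRN _ (- t)) lef_pV2 ?posrE ?powR_gt0 ?mulr_gt0 ?w0 ?f0//.
  rewrite ge0_ler_powR ?nnegrE ?mulr_ge0 ?(ltW (w0 _ _)) ?(ltW (f0 _ _)) ?(ltW c0)//.
    by rewrite oppr_ge0 ltW.
  exact: cw.
elim: k s => [|k IH] s Hf; first exact: H0.
apply: clsSI; first by apply: H0; exact: cls_cls0 Hf.
move=> j; exists (fun x => s * (f x `^ (s - 1) * partial j f x)).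
  move=> x Dx; rewrite mulrA.
  apply: (is_derive_compo (F := fun y => y `^ s)); last exact: cls_derive Hf _.
  by apply: is_derive1_powR; exact: f0.
apply: cls_cmul.
apply: (cls_weight_le (w := fun x => w x `^ (s - 1) * (q x * w x))).
  move=> x Dx; rewrite mulrCA -{2}[w x]powRr1 ?(ltW (w0 _ _))// -powRD ?subrK//.
  by rewrite (gt_eqF (w0 _ Dx)) implybT.
by apply: cls_mul; [apply: IH; exact: clsS|exact: cls_partial].
Qed.

End weighted_classes.

(** * Directional derivatives and symmetry of second derivatives *)

Lemma is_derive_epsP {R : realType} {V : normedModType R} (f : V -> R) x v (d : R) :
  is_derive x v f d <-> forall e : R, 0 < e ->
    \forall h \near (0 : R), `|f (h *: v + x) - f x - h * d| <= e * `|h|.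
Proof.
split.
  move=> [df <-] e e0; have := df; rewrite /derivable => /cvgrPdist_le/(_ e e0).
  rewrite near_withinE => H.
  near=> h; have [->|h0] := eqVneq h 0.
    by rewrite scale0r add0r subrr mul0r subr0 normr0 mulr0.
  have : h != 0 -> `|'D_v f x - h^-1 *: ((f \o shift x) (h *: v) - f x)| <= e by near: h.
  move/(_ h0) => /=; rewrite /GRing.scale/= => H'.
  rewrite -(ler_pM2r (_ : 0 < `|h|)) ?normr_gt0// in H'.
  by rewrite -normrM mulrBl mulrAC mulVf// mul1r distrC [_ * h]mulrC in H'.
move=> H; have C : h^-1 *: ((f \o shift x) (h *: v) - f x) @[h --> 0^'] --> d.
  apply/cvgrPdist_le => e e0; rewrite near_withinE.
  have := H e e0; apply: filterS => h He h0 /=; rewrite /GRing.scale/=.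
  rewrite -(ler_pM2r (_ : 0 < `|h|)) ?normr_gt0// -normrM mulrBl mulrAC mulVf// mul1r.
  by rewrite distrC [d * h]mulrC.
split; first by apply/cvg_ex; exists d.
exact: cvg_lim C.
Unshelve. all: by end_near. Qed.

Lemma MVT_line {R : realType} (g dg : R -> R) (s : R) :
  (forall t : R, 0 <= t <= 1 -> is_derive (t * s) 1 g (dg (t * s))) ->
  exists2 t : R, 0 <= t <= 1 & g s - g 0 = s * dg (t * s).
Proof.
move=> H; pose G t := g (t * s).
have dG (t : R) : 0 <= t <= 1 -> is_derive t (1 : R) G (dg (t * s) * s).
  move=> /H Ht; apply: (@is_derive1_comp _ g (fun t => t * s)) => //.
  have H1 : is_derive t (1 : R) (fun y : R => y) 1 := is_derive_id t 1.
  by have := is_derive_mul H1 (is_derive_const s t (1 : R)); rewrite mul1r mulr0 addr0.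
have [||t] := @MVT _ G (fun t => dg (t * s) * s) 0 1 ltr01.
- move=> t; rewrite in_itv/= => /andP[t0 t1]; apply: dG.
  by rewrite !ltW.
- apply: derivable_within_continuous => t; rewrite in_itv/= => tI.
  by have [] := dG t tI.
rewrite in_itv/= => /andP[t0 t1]; rewrite /G mul1r mul0r subr0 mulr1 => E.
by exists t; [rewrite !ltW|rewrite E mulrC].
Qed.

Lemma MVT_dir {R : realType} {V : normedModType R} (f df : V -> R) x v (s : R) :
  (forall t : R, 0 <= t <= 1 -> is_derive (t * s *: v + x) v f (df (t * s *: v + x))) ->
  exists2 t : R, 0 <= t <= 1 & f (s *: v + x) - f x = s * df (t * s *: v + x).
Proof.
move=> H.
have [|t t01 E] := @MVT_line _ (fun h => f (h *: v + x)) (fun h => df (h *: v + x)) s.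
  by move=> t /H Ht; exact: is_derive_line.
by exists t => //; move: E; rewrite scale0r add0r.
Qed.

Lemma normZ {R : realType} {V : normedModType R} (a : R) (x : V) : `|a *: x| = `|a| * `|x|.
Proof. exact: normrZ. Qed.

Lemma normD_scale {R : realType} {V : normedModType R} (a b : R) (x y : V) :
  `|a *: x + b *: y| <= `|a| * `|x| + `|b| * `|y|.
Proof. by rewrite (le_trans (ler_normD _ _))// !normZ. Qed.

Lemma mulr_div_succ_le {R : realType} (a e : R) : 0 <= a -> 0 <= e -> a * (e / (a + 1)) <= e.
Proof.
move=> a0 e0; have a1 : 0 < a + 1 by rewrite ltr_wpDl.
by rewrite mulrCA ler_piMr// ler_pdivrMr// mul1r lerDl.
Qed.

Lemma near_dist {R : realType} {V : normedModType R} (x : V) (P : V -> Prop) :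
  (\forall y \near x, P y) -> exists2 d : R, 0 < d & forall y, `|x - y| < d -> P y.
Proof.
move=> /nbhs_ballP[d /= d0 Hd]; exists d => // y xy; apply: Hd.
by rewrite -ball_normE.
Qed.

Section C1.
Context {R : realType} {n : nat}.
Implicit Types (f : 'rV[R]_n -> R) (x v : 'rV[R]_n).

Lemma rV_sum_delta v : v = \sum_(j < n) v ord0 j *: delta_mx ord0 j.
Proof.
apply/rowP => i; rewrite summxE (bigD1 i)//= !mxE !eqxx mulr1 big1 ?addr0// => j ji.
by rewrite !mxE [i == j]eq_sym (negbTE ji) andbF mulr0.
Qed.

(** The increment along v is split into increments along the coordinate axes;
    the mean value theorem turns each of them into a value of a partial
    derivative at a nearby point, and these values converge by continuity. *)
Lemma is_derive_dir (D : set 'rV[R]_n) f (df : 'I_n -> 'rV[R]_n -> R) x v :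
  open D -> D x ->
  (forall j y, D y -> is_derive y (delta_mx ord0 j) f (df j y)) ->
  (forall j, {for x, continuous (df j)}) ->
  is_derive x v f (\sum_(j < n) v ord0 j * df j x).
Proof.
move=> oD Dx Hf cdf.
suff H (r : seq 'I_n) : is_derive x (\sum_(j <- r) v ord0 j *: delta_mx ord0 j) f
    (\sum_(j <- r) v ord0 j * df j x).
  by rewrite {1}(rV_sum_delta v); exact: H.
elim: r => [|j r IH]; first by rewrite !big_nil; exact: is_derive0.
rewrite !big_cons; set w := (X in _ *: _ + X); set dw := (X in _ * _ + X).
set c := v ord0 j; set ej : 'rV[R]_n := delta_mx ord0 j.
apply/is_derive_epsP => e e0.
have e20 : 0 < e / 2 by rewrite divr_gt0.
have IHe := (iffLR (is_derive_epsP _ _ _ _)) IH (e / 2) e20.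
pose M := `|c| * `|ej| + `|w| + 1.
have M0 : 0 < M by rewrite /M ltr_wpDl// addr_ge0// mulr_ge0.
have e'0 : 0 < e / 2 / (`|c| + 1) by rewrite divr_gt0// ltr_wpDl.
have [d /= d0 Hd] : exists2 d : R, 0 < d & forall y : 'rV[R]_n, `|x - y| < d ->
    D y /\ `|df j x - df j y| <= e / 2 / (`|c| + 1).
  apply: near_dist; apply: filterI; first exact: open_nbhs_nbhs.
  by have /cvgrPdist_le := cdf j; apply.
have near_small : \forall h \near (0 : R), `|h| < d / M.
  by apply: (@nbhs0_lt _ R^o); exact: divr_gt0.
near=> h.
have hM : `|h| * M < d by rewrite -ltr_pdivlMr//; near: h; exact: near_small.
have hIH : `|f (h *: w + x) - f x - h * dw| <= e / 2 * `|h| by near: h.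
have Hpt (t : R) : 0 <= t <= 1 ->
    `|x - (t * (h * c) *: ej + (h *: w + x))| < d.
  move=> /andP[t0 t1]; apply: le_lt_trans hM.
  rewrite addrA [X in `|x - X|]addrC opprD addrA subrr add0r normrN.
  apply: le_trans (normD_scale _ _ _ _) _; rewrite !normrM (ger0_norm t0) /M !mulrDr.
  rewrite -addrA lerD//; first by rewrite -mulrA -[`|h| * `|c| * _]mulrA ler_piMl// !mulr_ge0.
  by rewrite mulr1 lerDl.
have [|t t01 E] := @MVT_dir _ _ f (df j) (h *: w + x) ej (h * c).
  by move=> t t01; apply: Hf; have [] := Hd _ (Hpt t t01).
have [_ Hdf] := Hd _ (Hpt t t01).
have -> : h *: (c *: ej + w) + x = h * c *: ej + (h *: w + x).
  by rewrite scalerDr scalerA addrA.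
move: E Hdf; set y := (X in df j X) => E Hdf.
rewrite -(subrK (f (h *: w + x)) (f _)) E.
rewrite (_ : _ - _ = (f (h *: w + x) - f x - h * dw) - h * c * (df j x - df j y)); last by ring.
rewrite (le_trans (ler_normB _ _))// [leRHS](_ : _ = e / 2 * `|h| + e / 2 * `|h|); last by field.
rewrite lerD// !normrM -mulrA mulrC ler_wpM2r//.
rewrite (le_trans (ler_wpM2l _ Hdf))//.
by apply: mulr_div_succ_le => //; rewrite ltW.
Unshelve. all: by end_near. Qed.

End C1.

Section schwarz.
Context {R : realType} {n : nat}.
Implicit Types (f : 'rV[R]_n -> R) (x : 'rV[R]_n).

(** The mean value theorem is applied first in the direction i, to the increment
    of f along j, and then in the direction j. *)
Lemma second_difference f (fi fij : 'rV[R]_n -> R) (i j : 'I_n) x (s : R) :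
  (forall y, is_derive y (delta_mx ord0 i) f (fi y)) ->
  (forall y, is_derive y (delta_mx ord0 j) fi (fij y)) ->
  exists t u : R, [/\ 0 <= t <= 1, 0 <= u <= 1 &
  (f (s *: delta_mx ord0 i + (s *: delta_mx ord0 j + x)) - f (s *: delta_mx ord0 i + x)) -
    (f (s *: delta_mx ord0 j + x) - f x) =
  s * s * fij (t * s *: delta_mx ord0 i + (u * s *: delta_mx ord0 j + x))].
Proof.
move=> Hf Hfi; set ei : 'rV[R]_n := delta_mx ord0 i; set ej : 'rV[R]_n := delta_mx ord0 j.
have Hsh (y : 'rV[R]_n) : is_derive y ei (fun y => f (s *: ej + y)) (fi (s *: ej + y)).
  have /is_derive_lineP H := Hf (s *: ej + y).
  by apply/is_derive_lineP; under eq_fun do rewrite addrCA.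
have [t t01 E] := @MVT_dir _ _ (fun y => f (s *: ej + y) - f y)
   (fun y => fi (s *: ej + y) - fi y) x ei s
   (fun t _ => is_derive_add (Hsh _) (is_derive_opp (Hf _))).
have [u u01 E'] := @MVT_dir _ _ fi fij (t * s *: ei + x) ej s (fun u _ => Hfi _).
exists t, u; split=> //; rewrite [s *: ei + (_ + _)]addrCA E E' -mulrA.
by rewrite [u * s *: ej + (_ + _)]addrCA.
Qed.

(** The second difference over a small square does not depend on the order of
    the two directions, and after division by the area it is close to both mixed
    derivatives. *)
Lemma mixed_partials f (fi fj fij fji : 'rV[R]_n -> R) (i j : 'I_n) x :
  (forall y, is_derive y (delta_mx ord0 i) f (fi y)) ->
  (forall y, is_derive y (delta_mx ord0 j) f (fj y)) ->
  (forall y, is_derive y (delta_mx ord0 j) fi (fij y)) ->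
  (forall y, is_derive y (delta_mx ord0 i) fj (fji y)) ->
  {for x, continuous fij} -> {for x, continuous fji} -> fij x = fji x.
Proof.
move=> Hi Hj Hij Hji cij cji; set ei : 'rV[R]_n := delta_mx ord0 i.
set ej : 'rV[R]_n := delta_mx ord0 j.
apply/eqP; rewrite -subr_eq0 -normr_le0; apply/ler_addgt0Pr => e e0; rewrite add0r.
have e20 : 0 < e / 2 by rewrite divr_gt0.
have [d /= d0 Hd] : exists2 d : R, 0 < d & forall y : 'rV[R]_n, `|x - y| < d ->
    `|fij x - fij y| <= e / 2 /\ `|fji x - fji y| <= e / 2.
  by apply: near_dist; apply: filterI; [move/cvgrPdist_le: cij|move/cvgrPdist_le: cji]; apply.
pose M := `|ei| + `|ej| + 1.
have M0 : 0 < M by rewrite ltr_wpDl// addr_ge0.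
pose s := d / 2 / M; have s0 : 0 < s by rewrite !divr_gt0.
have sM : s * M < d by rewrite /s divfK ?gt_eqF// ltr_pdivrMr//; lra.
have Hpt (t u : R) (a b : 'rV[R]_n) : `|a| + `|b| + 1 = M -> 0 <= t <= 1 -> 0 <= u <= 1 ->
    `|x - (t * s *: a + (u * s *: b + x))| < d.
  move=> EM /andP[t0 t1] /andP[u0 u1]; apply: le_lt_trans sM.
  rewrite addrA [X in `|x - X|]addrC opprD addrA subrr add0r normrN.
  apply: le_trans (normD_scale _ _ _ _) _; rewrite (normrM t s) (normrM u s) (ger0_norm t0) (ger0_norm u0).
  rewrite (gtr0_norm s0) -EM.
  have : t * (s * `|a|) <= s * `|a| by rewrite ler_piMl// mulr_ge0// ltW.
  have : u * (s * `|b|) <= s * `|b| by rewrite ler_piMl// mulr_ge0// ltW.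
  by have := s0; lra.
have [t [u [t01 u01 E]]] := @second_difference f fi fij i j x s Hi Hij.
have [t' [u' [t'01 u'01 E']]] := @second_difference f fj fji j i x s Hj Hji.
have [H1 _] := Hd _ (Hpt t u ei ej erefl t01 u01).
have [_ H2] := Hd _ (Hpt t' u' ej ei (congr1 (+%R^~ 1) (addrC _ _)) t'01 u'01).
have EE : s * s * fij (t * s *: ei + (u * s *: ej + x)) = s * s * fji (t' * s *: ej + (u' * s *: ei + x)).
  by rewrite -E -E' -/ei -/ej [s *: ei + (_ + _)]addrCA; ring.
have ss : s * s != 0 by rewrite mulf_neq0 ?gt_eqF.
move/(mulfI ss): EE => EE; rewrite EE in H1.
rewrite -(subrKA (fji (t' * s *: ej + (u' * s *: ei + x)))) (le_trans (ler_normD _ _))//.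
by rewrite (splitr e) lerD// distrC.
Qed.

Lemma smooth_partial f j : smooth f -> smooth (partial j f).
Proof.
move=> sf s; have := sf (rcons s j).
by rewrite -cats1 foldr_cat.
Qed.

Lemma smooth_cont f x : smooth f -> {for x, continuous f}.
Proof. by move=> sf; have [H _] := sf [::]; exact: H. Qed.

Lemma smooth_derive f x j : smooth f -> is_derive x (delta_mx ord0 j) f (partial j f x).
Proof. by move=> sf; have [_ H] := sf [::]; exact/derivableP/H. Qed.

Lemma smooth_foldr f s : smooth f -> smooth (foldr partial f s).
Proof. by move=> sf; elim: s => [//|j s IH]; exact: (smooth_partial j IH). Qed.

Lemma partialC f i j : smooth f -> partial i (partial j f) = partial j (partial i f).
Proof.
move=> sf; apply/funext => x.
have si := smooth_partial i sf; have sj := smooth_partial j sf.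
apply: (@mixed_partials f (partial j f) (partial i f) _ _ j i x).
- by move=> y; exact: (smooth_derive y j sf).
- by move=> y; exact: (smooth_derive y i sf).
- by move=> y; exact: (smooth_derive y i sj).
- by move=> y; exact: (smooth_derive y j si).
- by apply: smooth_cont; exact: (smooth_partial i sj).
- by apply: smooth_cont; exact: (smooth_partial j si).
Qed.

Lemma foldr_partial_move f i s s' : smooth f ->
  foldr partial f (s ++ i :: s') = partial i (foldr partial f (s ++ s')).
Proof.
move=> sf; elim: s => [//|j s]; rewrite !cat_cons => /= ->.
exact: (partialC _ _ (smooth_foldr _ sf)).
Qed.

Lemma foldr_partial_perm f s s' : smooth f -> perm_eq s s' ->
  foldr partial f s = foldr partial f s'.
Proof.
move=> sf; elim: s s' => [|i s IH] s'.
  by rewrite perm_sym => /perm_nilP ->.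
move=> H; have : i \in s' by rewrite -(perm_mem H) mem_head.
move=> /splitPr is'; case: is' H => s1 s2.
rewrite perm_sym -[i :: s2]cat1s perm_catCA/= perm_cons perm_sym => H.
by rewrite foldr_partial_move//= (IH (s1 ++ s2) H).
Qed.

(** The bounds on symbols speak of multi-indices, the weighted classes of
    derivatives in an arbitrary order; symmetry of the second derivatives
    identifies the two. *)
Lemma foldr_partial_multi f s : smooth f ->
  foldr partial f s = multi_partial (fun j => count_mem j s) f.
Proof.
move=> sf; rewrite /multi_partial.
have E (r : seq 'I_n) : foldr (fun j => iter (count_mem j s) (partial j)) f r =
    foldr partial f (flatten [seq nseq (count_mem j s) j | j <- r]).
  elim: r => //= j r ->; rewrite foldr_cat.
  by elim: (count_mem j s) => //= k ->.
rewrite E; apply: foldr_partial_perm => //; apply/allP => i _ /=; apply/eqP.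
rewrite count_flatten -!map_comp sumnE big_map (bigD1_seq i) ?mem_index_enum ?index_enum_uniq//=.
rewrite count_nseq/= eqxx mul1n big1 ?addn0// => j ji.
by rewrite count_nseq/= (negbTE ji) mul0n.
Qed.

Lemma multi_order_count (s : seq 'I_n) : multi_order (fun j => count_mem j s) = size s.
Proof.
rewrite /multi_order; elim: s => [|i s IH] /=; first by rewrite big1.
rewrite big_split/= IH (bigD1 i)//= eqxx big1 ?addn0 ?add1n// => j ji.
by rewrite eq_sym (negbTE ji).
Qed.

Lemma cls_smooth (D : set 'rV[R]_n) q k (w : nat -> 'rV[R]_n -> R) f : smooth f ->
  (forall i x, D x -> w i.+1 x = q x * w i x) ->
  (forall s, exists2 C : R, 0 <= C & forall x, D x -> `|foldr partial f s x| <= C * w (size s) x) ->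
  open D -> (forall x, D x -> 0 <= q x) -> cls D q k (w 0%N) f.
Proof.
move=> sf wS Hf oD q0; elim: k w f sf wS Hf => [|k IH] w f sf wS Hf.
  by split; [move=> x _; exact: smooth_cont|exact: (Hf [::])].
split; first by split; [move=> x _; exact: smooth_cont|exact: (Hf [::])].
move=> j; split; first by move=> x _; have [] := smooth_derive x j sf.
apply: (cls_weight_le q0 (w := w 1%N)); first by move=> x Dx; rewrite wS.
apply: (IH (fun i => w i.+1)); [exact: smooth_partial|by move=> i; exact: wS|].
move=> s; have [C C0 H] := Hf (rcons s j); exists C => // x Dx.
by have := H x Dx; rewrite size_rcons -cats1 foldr_cat.
Qed.

End schwarz.

(** * Symbols on the punctured space *)

Section symbols.
Context {R : realType} {n : nat}.
Implicit Types (f g w : 'rV[R]_n -> R) (x : 'rV[R]_n).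

(** The symbols are studied away from the origin, where |x| is smooth and
    homogeneous; the quasimode vanishes at the origin to infinite order, so that
    nothing is lost there. *)
Definition Omega : set 'rV[R]_n := [set x | x != 0].
Definition rinv x : R := (enorm x)^-1.

Lemma open_Omega : open Omega.
Proof.
rewrite (_ : Omega = (@enorm R n) @^-1` [set r | r != 0]); last first.
  by apply/seteqP; split => x; rewrite /Omega/= enorm_eq0.
apply: open_comp; last exact: open_neq.
by move=> x _; exact: enorm_continuous.
Qed.

Lemma rinv_ge0 x : Omega x -> 0 <= rinv x.
Proof. by rewrite /rinv invr_ge0 enorm_ge0. Qed.

Lemma enorm_Omega x : Omega x -> 0 < enorm x.
Proof. by rewrite enorm_gt0. Qed.

Notation symb := (cls Omega rinv).

Lemma rinv_powR x (m : R) : Omega x -> rinv x * enorm x `^ m = enorm x `^ (m - 1).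
Proof.
move=> /enorm_Omega x0; rewrite powRD; last by rewrite (gt_eqF x0) implybT.
by rewrite powR_inv1 ?ltW// mulrC.
Qed.

Lemma powR_scale x (m p : R) : Omega x ->
  enorm x `^ m * enorm x `^ p = enorm x `^ (m + p).
Proof. by move=> /enorm_Omega x0; rewrite powRD// (gt_eqF x0) implybT. Qed.

Lemma symb_coord k i : symb k (@enorm R n) (fun x => x ord0 i).
Proof.
have H0 : cls0 Omega (@enorm R n) (fun x => x ord0 i).
  split; first by move=> x _; exact: coord_continuous.
  by exists 1 => // x _; rewrite mul1r coord_le_enorm.
case: k => [//|k]; apply: (clsSI open_Omega) => // j.
exists (fun=> (delta_mx ord0 j : 'rV[R]_n) ord0 i).
  by move=> x _; exact: is_derive_coord.
apply: (cls_weight_le rinv_ge0 (w := fun=> 1)).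
  by move=> x /enorm_Omega x0; rewrite mulVf// gt_eqF.
exact: (cls_const open_Omega rinv_ge0).
Qed.

Lemma symb_sqnorm k : symb k (fun x => enorm x ^+ 2) (fun x => dotp x x).
Proof.
apply: (cls_sum open_Omega rinv_ge0); first by move=> x _; exact: sqr_ge0.
move=> i; apply: (cls_weight_le rinv_ge0 (w := fun x => enorm x * enorm x)).
  by move=> x _; rewrite expr2.
by apply: (cls_mul open_Omega rinv_ge0); exact: symb_coord.
Qed.

Lemma sqr_enorm_powR x (s : R) : (enorm x ^+ 2) `^ s = enorm x `^ (2 * s).
Proof. by rewrite powRrM -powR_mulrn. Qed.

(** |x| is the square root of the polynomial |x|^2, which is comparable to its
    weight, so that real powers are controlled as powers of |x|^2. *)
Lemma symb_powR k (m : R) : symb k (fun x => enorm x `^ m) (fun x => dotp x x `^ (m / 2)).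
Proof.
apply: (cls_weight_le rinv_ge0 (w := fun x => (enorm x ^+ 2) `^ (m / 2))).
  by move=> x _; rewrite sqr_enorm_powR mulrC divfK.
apply: (cls_powR open_Omega rinv_ge0 (c := 1)) => //.
- by move=> x /enorm_Omega x0; rewrite exprn_gt0.
- by move=> x _; rewrite mul1r sqr_enorm.
- exact: symb_sqnorm.
Qed.

Lemma jap_sqr x : jap x ^+ 2 = 1 + dotp x x.
Proof. by rewrite sqr_sqrtr sqr_enorm// addr_ge0// dotp_ge0. Qed.

Lemma jap_gt0 x : 0 < jap x.
Proof. by rewrite sqrtr_gt0 ltr_pwDl// sqr_ge0. Qed.

Lemma jap_ge1 x : 1 <= jap x.
Proof.
by rewrite -[leLHS]sqrtr1 ler_wsqrtr// lerDl sqr_ge0.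
Qed.

Lemma enorm_le_jap x : enorm x <= jap x.
Proof.
rewrite -(@ler_pXn2r _ 2)// ?nnegrE ?enorm_ge0 ?(ltW (jap_gt0 x))//.
by rewrite jap_sqr sqr_enorm lerDr.
Qed.

Lemma jap_powR x (s : R) : jap x `^ s = (1 + dotp x x) `^ (s / 2).
Proof.
rewrite -jap_sqr -powR_mulrn ?(ltW (jap_gt0 x))// -powRrM.
by rewrite mulrC divfK.
Qed.

Lemma symb_jap2 k : symb k (fun x => 1 + dotp x x) (fun x => 1 + dotp x x).
Proof.
apply: (cls_add (f := fun=> 1) (g := fun x => dotp x x) open_Omega).
  apply: (cls_weight_le rinv_ge0 (w := fun=> 1)); last exact: (cls_const open_Omega rinv_ge0).
  by move=> x _; rewrite lerDl dotp_ge0.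
apply: (cls_weight_le rinv_ge0 (w := fun x => enorm x ^+ 2)); last exact: symb_sqnorm.
by move=> x _; rewrite sqr_enorm lerDr.
Qed.

Lemma symb_jap k (s : R) : symb k (fun x => jap x `^ s) (fun x => jap x `^ s).
Proof.
apply: (cls_ext open_Omega (f := fun x => (1 + dotp x x) `^ (s / 2))).
  by move=> x _; rewrite jap_powR.
apply: (cls_weight_le rinv_ge0 (w := fun x => (1 + dotp x x) `^ (s / 2))).
  by move=> x _; rewrite jap_powR.
apply: (cls_powR open_Omega rinv_ge0 (c := 1)) => //.
- by move=> x _; rewrite ltr_pwDl// dotp_ge0.
- by move=> x _; rewrite mul1r.
- exact: symb_jap2.
Qed.

(** A smooth cutoff without plateaus, the rational function t / (1 + t) of
    t = |x|^s: it vanishes like |x|^s at the origin, and 1 - kappa decays like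
    |x|^-s at infinity.  Finite orders of vanishing suffice, and s can be as
    large as needed. *)
Definition kappa (s : R) x : R := dotp x x `^ (s / 2) * (1 + dotp x x `^ (s / 2)) `^ (- 1).

Lemma symb_kappa_compl k (s : R) :
  symb k (fun x => (1 + enorm x `^ s) `^ (-1)) (fun x => (1 + dotp x x `^ (s / 2)) `^ (- 1)).
Proof.
have E x : dotp x x `^ (s / 2) = enorm x `^ s.
  by rewrite -sqr_enorm sqr_enorm_powR mulrC divfK.
apply: (cls_powR open_Omega rinv_ge0 (c := 1)) => //.
- by move=> x _; rewrite ltr_pwDl// powR_ge0.
- by move=> x _; rewrite mul1r E.
- apply: (cls_add (f := fun=> 1) (g := fun x => dotp x x `^ (s / 2)) open_Omega).
    apply: (cls_weight_le rinv_ge0 (w := fun=> 1)); last exact: (cls_const open_Omega rinv_ge0).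
    by move=> x _; rewrite lerDl powR_ge0.
  apply: (cls_weight_le rinv_ge0 (w := fun x => enorm x `^ s)); last exact: symb_powR.
  by move=> x _; rewrite lerDr.
Qed.

Lemma symb_kappa k (s : R) :
  symb k (fun x => enorm x `^ s * (1 + enorm x `^ s) `^ (-1)) (kappa s).
Proof.
by apply: (cls_mul open_Omega rinv_ge0); [exact: symb_powR|exact: symb_kappa_compl].
Qed.

Lemma kappa_compl (s : R) x : 1 - kappa s x = (1 + dotp x x `^ (s / 2)) `^ (- 1).
Proof.
have h : 0 < 1 + dotp x x `^ (s / 2) by rewrite ltr_pwDl// powR_ge0.
rewrite /kappa powR_inv1 ?ltW//.
by field; rewrite gt_eqF.
Qed.

Lemma powR_between x (a b c : R) : Omega x -> a <= c <= b ->
  enorm x `^ c <= enorm x `^ b + enorm x `^ a.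
Proof.
move=> /enorm_Omega x0 /andP[ac cb]; have [x1|x1] := leP 1 (enorm x).
  by rewrite ler_wpDr ?powR_ge0// ler_powR.
by rewrite ler_wpDl ?powR_ge0// ger_powR// x0 ltW.
Qed.

End symbols.
Notation symb := (cls Omega rinv).

(** * Integration along rays *)

Section integral_tools.
Context {R : realType} d (T : measurableType d) (mu : {measure set T -> \bar R}).
Variables (D : set T) (mD : measurable D).

Lemma integrable_le (f g : T -> R) : measurable_fun D f ->
  mu.-integrable D (EFin \o g) -> (forall x, D x -> `|f x| <= g x) ->
  mu.-integrable D (EFin \o f).
Proof.
move=> mf ig fg; apply: (le_integrable mD _ _ ig).
  by apply/measurable_EFinP.
by move=> x Dx /=; rewrite lee_fin (le_trans (fg x Dx))// ler_norm.
Qed.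

Lemma integrable_cmul (c : R) (f : T -> R) : mu.-integrable D (EFin \o f) ->
  mu.-integrable D (EFin \o (fun x => c * f x)).
Proof. by move=> H; exact: (integrableZl mD c H). Qed.

Lemma Rintegral_dominated (f_ : nat -> T -> R) (f g : T -> R) :
  (forall k, measurable_fun D (f_ k)) ->
  (forall x, D x -> f_ k x @[k --> \oo] --> f x) ->
  mu.-integrable D (EFin \o g) ->
  (forall k x, D x -> `|f_ k x| <= g x) ->
  \int[mu]_(x in D) f_ k x @[k --> \oo] --> \int[mu]_(x in D) f x.
Proof.
move=> mf cf ig fg.
have mlim : measurable_fun D f by exact: (measurable_fun_cvg mf cf).
have fg' x : D x -> `|f x| <= g x.
  move=> Dx; have /cvg_norm H := cf x Dx.
  rewrite -(cvg_lim _ H)//; apply: limr_le; first by apply/cvg_ex; eexists; exact: H.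
  by apply: nearW => k; exact: fg.
have if_ : mu.-integrable D (EFin \o f) by exact: integrable_le fg'.
apply: fine_cvg; rewrite /Rintegral fineK; last exact: integrable_fin_num.
apply: (@dominated_cvg _ _ _ mu D mD (fun k x => (f_ k x)%:E) _ (EFin \o g)) => //.
- by move=> k; apply/measurable_EFinP.
- by move=> x Dx; apply: cvg_EFin; [exact: nearW|exact: cf].
Qed.

Lemma Rintegral_le_bound (f g : T -> R) : measurable_fun D f ->
  mu.-integrable D (EFin \o g) -> (forall x, D x -> `|f x| <= g x) ->
  `|\int[mu]_(x in D) f x| <= \int[mu]_(x in D) g x.
Proof.
move=> mf ig fg; have if_ := integrable_le mf ig fg.
apply: (le_trans (le_normr_Rintegral mD if_)).
apply: le_Rintegral => //; exact: (integrable_norm if_).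
Qed.

Lemma Rintegral_sum (I : Type) (r : seq I) (F : I -> T -> R) :
  (forall i, mu.-integrable D (EFin \o F i)) ->
  mu.-integrable D (EFin \o (fun x => \sum_(i <- r) F i x)) /\
  \int[mu]_(x in D) (\sum_(i <- r) F i x) = \sum_(i <- r) \int[mu]_(x in D) F i x.
Proof.
move=> iF; elim: r => [|i r [IH1 IH2]].
  rewrite (_ : (fun _ => _) = cst 0); last by apply/funext => x; rewrite big_nil.
  rewrite big_nil; split; first exact: integrable0.
  by rewrite /Rintegral integral0.
rewrite (_ : (fun _ => _) = F i \+ (fun x => \sum_(j <- r) F j x)); last first.
  by apply/funext => x; rewrite big_cons.
have iS : mu.-integrable D (EFin \o (F i \+ (fun x => \sum_(j <- r) F j x))).
  by have := integrableD mD (iF i) IH1.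
by split=> //; rewrite RintegralD// IH2 big_cons.
Qed.

End integral_tools.

(** The dominated convergence theorem speaks of sequences, and gives the
    continuity of integrals depending on a parameter in this form. *)
Lemma sequential_continuous {R : realType} {V : normedModType R} (f : V -> R) x :
  (forall u : nat -> V, u k @[k --> \oo] --> x -> f (u k) @[k --> \oo] --> f x) ->
  {for x, continuous f}.
Proof.
move=> H; apply/cvgrPdist_lt => e e0.
apply: contrapT => nH.
have P (k : nat) : exists y, `|x - y| < k.+1%:R^-1 /\ e <= `|f x - f y|.
  apply: contrapT => nP; apply: nH; apply/nbhs_ballP; exists k.+1%:R^-1 => /=.
    by rewrite invr_gt0.
  move=> y; rewrite -ball_normE/= => xy; rewrite ltNge; apply/negP => fy.
  by apply: nP; exists y.
have [u Hu] := choice P.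
have /H/cvgrPdist_lt/(_ e e0)[N _ HN] : u k @[k --> \oo] --> x.
  apply/cvgrPdist_lt => e' e'0; have [N _ HN] := near_infty_natSinv_lt (PosNum e'0).
  exists N => // k /HN/=; apply: lt_trans.
  by have [] := Hu k.
by have := HN N (leqnn N); rewrite ltNge; have [_ ->] := Hu N.
Qed.

Section half_line.
Context {R : realType}.
Notation leb := (@lebesgue_measure R).
Notation half := (`[0, +oo[%classic : set R).

Lemma measurable_half : measurable (half : set (measurableTypeR R)).
Proof. exact: measurable_itv. Qed.

Lemma continuous_measurable_on (f : R -> R) (D : set R) : continuous f -> measurable D ->
  measurable_fun D f.
Proof. by move=> cf mD; apply: measurable_funTS; exact: continuous_measurable_fun. Qed.

Lemma is_derive_lin (c t : R) : is_derive t (1 : R) (fun s => c * s) c.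
Proof.
have H1 : is_derive t (1 : R) (fun y : R => y) 1 := is_derive_id t 1.
by have := is_derive_cmul c H1; rewrite mulr1.
Qed.

Lemma is_derive_expR_lin (c t : R) :
  is_derive t (1 : R) (fun s => expR (c * s)) (c * expR (c * t)).
Proof.
have := @is_derive1_comp _ expR (fun s => c * s) t _ _ (is_derive_expR _) (is_derive_lin c t).
by rewrite mulrC.
Qed.

Lemma derive_continuous (f : R -> R) (x df : R) : is_derive x (1 : R) f df -> {for x, continuous f}.
Proof. by move=> [H _]; apply: differentiable_continuous; exact/derivable1_diffP. Qed.

Lemma expR_lin_continuous (c : R) : continuous (fun s : R => expR (c * s)).
Proof. by move=> s; apply: derive_continuous; exact: is_derive_expR_lin. Qed.

Lemma expR_lin_cvg0 (c : R) : c < 0 -> expR (c * s) @[s --> +oo] --> 0.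
Proof.
move=> c0; have H : (- c) * s @[s --> +oo] --> +oo.
  by apply: gt0_cvgMry; [rewrite oppr_gt0|exact: cvg_id].
have := cvg_comp _ _ H (@cvgr_expR R).
by apply: cvg_trans; apply: near_eq_cvg; near=> s; rewrite /= mulNr opprK.
Unshelve. all: by end_near.
Qed.

Lemma integrable_expR (c : R) : c < 0 -> leb.-integrable half (EFin \o (fun s => expR (c * s))).
Proof.
move=> c0; apply/integrableP; split.
  by apply/measurable_EFinP; apply: continuous_measurable_on; [exact: expR_lin_continuous|exact: measurable_half].
under eq_integral do rewrite /= ger0_norm ?expR_ge0//.
rewrite (@ge0_continuous_FTC2y _ _ (fun s => c^-1 * expR (c * s)) 0 0).
- by rewrite -EFinB ltry.
- by move=> x _; exact: expR_ge0.
- by apply: continuous_subspaceT; exact: expR_lin_continuous.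
- by rewrite -[X in _ --> X](mulr0 c^-1); apply: cvgMr; exact: expR_lin_cvg0.
- by move=> x _; have [] := is_derive_cmul c^-1 (is_derive_expR_lin c x).
- apply: cvg_at_right_filter.
  exact: (derive_continuous (is_derive_cmul c^-1 (is_derive_expR_lin c 0))).
- move=> x _; rewrite derive1E.
  have [_ ->] := is_derive_cmul c^-1 (is_derive_expR_lin c x).
  by rewrite mulrA mulVf ?mul1r// lt_eqF.
Qed.

(** The fundamental theorem on [0, k], and dominated convergence as k grows,
    which suits integrands that change sign. *)
Lemma half_line_FTC (f F : R -> R) (l : R) : continuous f ->
  (forall x, is_derive x (1 : R) F (f x)) -> F x @[x --> +oo] --> l ->
  leb.-integrable half (EFin \o f) -> \int[leb]_(x in half) f x = l - F 0.
Proof.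
move=> cf dF Fl intf.
have mf : measurable_fun half f by apply: continuous_measurable_on.
have cF : continuous F by move=> x; exact: derive_continuous.
have C1 : \int[leb]_(x in half) (f \_ `[0, k.+1%:R]) x @[k --> \oo] --> \int[leb]_(x in half) f x.
  apply: (@Rintegral_dominated R _ _ leb half measurable_half
    (fun k => f \_ `[0, k.+1%:R]) f (fun x => `|f x|)).
  - move=> k; apply: measurable_funTS.
    apply: (iffLR (measurable_restrictT f (measurable_itv `[0, k.+1%:R]))).
    exact: (continuous_measurable_on cf (measurable_itv _)).
  - move=> x; rewrite /= in_itv/= andbT => x0.
    apply: cvg_near_cst; near=> k; rewrite patchE mem_set//= in_itv/= x0/=.
    apply: (@le_trans _ _ k%:R); first by near: k; exact: nbhs_infty_ger.
    by rewrite ler_nat.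
  - exact: (integrable_norm intf).
  - by move=> k x _; rewrite patchE; case: ifPn; rewrite ?normr0.
have C2 : \int[leb]_(x in half) (f \_ `[0, k.+1%:R]) x @[k --> \oo] --> l - F 0.
  have -> : (fun k => \int[leb]_(x in half) (f \_ `[0, k.+1%:R]) x) = fun k : nat => F k.+1%:R - F 0.
    apply/funext => k; rewrite -Rintegral_mkcondr setIidr; last first.
      by move=> x /=; rewrite !in_itv/= => /andP[-> _].
    rewrite /Rintegral (@continuous_FTC2 _ f F)//.
    + by apply: continuous_subspaceT.
    + split; first by move=> x _; have [] := dF x.
      * by apply: cvg_at_right_filter; exact: cF.
      * by apply: cvg_at_left_filter; exact: cF.
    + by move=> x _; rewrite derive1E; have [] := dF x.
  apply: cvgB; last exact: cvg_cst.
  apply: cvg_comp Fl.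
  apply/cvgryPge => A; near=> k; apply: (@le_trans _ _ k%:R); last by rewrite ler_nat.
  by near: k; exact: nbhs_infty_ger.
by rewrite -(cvg_lim _ C2)// (cvg_lim _ C1).
Unshelve. all: by end_near. Qed.

End half_line.

Section radial_integral.
Context {R : realType} {n : nat}.
Notation leb := (@lebesgue_measure R).
Notation half := (`[0, +oo[%classic : set R).
Implicit Types (f g h w : 'rV[R]_n -> R) (x : 'rV[R]_n).
Variable sg : R.

Definition ray (p : R) h x (s : R) : R := expR (sg * p * s) * h (expR (sg * s) *: x).

(** For sg = -1 an integral over the segment from 0 to x, for sg = 1 over the
    ray from x to infinity, in logarithmic arc length.  The factor exp (sg p s)
    is what p differentiations in x bring out. *)
Definition radint (p : R) h x : R := \int[leb]_(s in half) ray p h x s.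

(** With this decay the integrals along rays converge and inherit the weight of
    the integrand.  It persists when p becomes p + 1 and w becomes w / |x|,
    hence under differentiation. *)
Definition ray_decay (lam p : R) w := forall x s, Omega x -> 0 <= s ->
  expR (sg * p * s) * w (expR (sg * s) *: x) <= expR (- lam * s) * w x.

Definition locally_bounded w := forall x, Omega x ->
  exists B : R, \forall y \near x, w y <= B.

Lemma Omega_scale x s : Omega x -> Omega (expR s *: x).
Proof. by move=> x0; rewrite /Omega/= scaler_eq0 negb_or x0 gt_eqF ?expR_gt0. Qed.

Lemma ray_decay_rinv lam p w : ray_decay lam p w ->
  ray_decay lam (p + 1) (fun x => rinv x * w x).
Proof.
move=> H x s x0 s0; have E : expR (sg * (p + 1) * s) = expR (sg * p * s) * expR (sg * s).
  by rewrite -expRD; congr expR; ring.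
rewrite /rinv enormZ ger0_norm ?expR_ge0// E.
rewrite (_ : _ * _ = rinv x * (expR (sg * p * s) * w (expR (sg * s) *: x))); last first.
  by rewrite /rinv; field; rewrite !gt_eqF ?expR_gt0 ?enorm_Omega.
by rewrite [leRHS]mulrCA ler_wpM2l ?rinv_ge0//; exact: H.
Qed.

Lemma locally_bounded_rinv w : locally_bounded w ->
  (forall x, Omega x -> 0 <= w x) -> locally_bounded (fun x => rinv x * w x).
Proof.
move=> H w0 x x0; have [B HB] := H x x0; have r0 := enorm_Omega x0.
exists ((enorm x / 2)^-1 * B).
have cr := @enorm_continuous R n x.
have Hr : \forall y \near x, enorm x / 2 < enorm y.
  by move/cvgr_gt: cr; apply; rewrite ltr_pdivrMr// ltr_pMr// ltr1n.
near=> y.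
have y2 : enorm x / 2 < enorm y by near: y.
have yB : w y <= B by near: y.
have y0 : Omega y by rewrite /Omega/= -enorm_gt0 (lt_trans _ y2)// divr_gt0.
rewrite ler_pM ?w0 ?rinv_ge0// lef_pV2 ?posrE ?divr_gt0// ?enorm_gt0//.
exact: ltW.
Unshelve. all: by end_near. Qed.

Lemma ray_continuous p h x : Omega x -> (forall y, Omega y -> {for y, continuous h}) ->
  continuous (ray p h x).
Proof.
move=> x0 ch s; have c1 := @expR_lin_continuous R (sg * p) s.
have c2 : {for s, continuous (fun s : R => h (expR (sg * s) *: x))}.
  apply: (@continuous_comp _ _ _ (fun s : R => expR (sg * s) *: x) h).
    by apply: cvgZr_tmp; exact: expR_lin_continuous.
  by apply: ch; exact: Omega_scale.
exact: (continuousM c1 c2).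
Qed.

Section dominated.
Variables (lam p : R) (w h : 'rV[R]_n -> R).
Hypotheses (lam0 : 0 < lam) (Hw : ray_decay lam p w) (h0 : cls0 Omega w h).

Lemma ray_bound : exists2 C : R, 0 <= C & forall x s, Omega x -> 0 <= s ->
  `|ray p h x s| <= C * w x * expR (- lam * s).
Proof.
have [ch [C C0 hC]] := h0; exists C => // x s x0 s0.
rewrite /ray normrM ger0_norm ?expR_ge0//.
have := hC _ (Omega_scale (sg * s) x0).
move/(ler_wpM2l (expR_ge0 (sg * p * s)))/le_trans; apply.
by rewrite [leLHS]mulrCA -[leRHS]mulrA ler_wpM2l// [leRHS]mulrC; exact: Hw.
Qed.

Lemma integrable_ray x : Omega x -> leb.-integrable half (EFin \o ray p h x).
Proof.
move=> x0; have [C C0 HC] := ray_bound.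
apply: (@integrable_le _ _ _ leb half measurable_half _ (fun s => C * w x * expR (- lam * s))).
- apply: continuous_measurable_on; last exact: measurable_half.
  by apply: ray_continuous => //; have [] := h0.
- by apply: integrable_cmul; [exact: measurable_half|apply: integrable_expR; rewrite oppr_lt0].
- by move=> s; rewrite /= in_itv/= andbT => s0; exact: HC.
Qed.

Lemma radint_cls0 : locally_bounded w -> cls0 Omega w (radint p h).
Proof.
move=> lw; have [C C0 HC] := ray_bound; have [ch _] := h0.
have iexp : leb.-integrable half (EFin \o (fun s => expR (- lam * s))).
  by apply: integrable_expR; rewrite oppr_lt0.
split; last first.
  exists (C * \int[leb]_(s in half) expR (- lam * s)).
    by rewrite mulr_ge0// Rintegral_ge0// => s _; exact: expR_ge0.
  move=> x x0; rewrite mulrAC -(RintegralZl _ measurable_half iexp).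
  apply: Rintegral_le_bound.
  - exact: measurable_half.
  - by apply: continuous_measurable_on; [exact: ray_continuous|exact: measurable_half].
  - by apply: integrable_cmul; [exact: measurable_half|].
  - by move=> s; rewrite /= in_itv/= andbT => s0; exact: HC.
move=> x x0; apply: sequential_continuous => u ux.
have [B HB] := lw x x0.
have [N _ HN] : \forall k \near \oo, w (u k) <= B /\ Omega (u k).
  have H : nbhs x (fun y => w y <= B /\ Omega y).
    by apply: filterI; [exact: HB|apply: open_nbhs_nbhs; split; [exact: open_Omega|]].
  exact: (ux _ H).
rewrite -(cvg_shiftn N); rewrite /radint.
apply: (@Rintegral_dominated R _ _ leb half measurable_half
  (fun k => ray p h (u (k + N)%N)) (ray p h x) (fun s => C * B * expR (- lam * s))).
- move=> k; apply: continuous_measurable_on; last exact: measurable_half.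
  by apply: ray_continuous => //; have [] := HN (k + N)%N (leq_addl _ _).
- move=> s _; apply: cvgMl_tmp.
  apply: (@cvg_comp _ _ _ (fun k => expR (sg * s) *: u (k + N)%N) h); last first.
    by apply: ch; exact: Omega_scale.
  by apply: cvgZl_tmp; rewrite cvg_shiftn.
- by apply: integrable_cmul; [exact: measurable_half|].
- move=> k s; rewrite /= in_itv/= andbT => s0.
  have [HB' O'] := HN (k + N)%N (leq_addl _ _).
  by rewrite (le_trans (HC _ _ O' s0))// ler_wpM2r ?expR_ge0// ler_wpM2l.
Qed.

End dominated.

Lemma is_derive_ray p h dh x (v : 'rV[R]_n) (t s : R) :
  is_derive (expR (sg * s) *: (t *: v + x)) v h (dh (expR (sg * s) *: (t *: v + x))) ->
  is_derive t (1 : R) (fun t => ray p h (t *: v + x) s) (ray (p + 1) dh (t *: v + x) s).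
Proof.
move=> H; set c := expR (sg * s).
have E (u : R) : c *: (u *: v + x) = (c * u) *: v + c *: x by rewrite scalerDr scalerA.
have H1 : is_derive (c * t) (1 : R) (fun u => h (u *: v + c *: x)) (dh (c *: (t *: v + x))).
  by apply: is_derive_line; rewrite -E.
have := is_derive_cmul (expR (sg * p * s)) (is_derive1_comp H1 (is_derive_lin c t)).
rewrite (_ : (fun y => _) = (fun u => ray p h (u *: v + x) s)); last first.
  by apply/funext => u /=; rewrite /ray -/c E.
rewrite (_ : _ * _ = ray (p + 1) dh (t *: v + x) s)//.
rewrite /ray -/c mulrA mulrAC -expRD; congr (expR _ * _); ring.
Qed.

Lemma radint_derive lam p w h x j : 0 < lam -> ray_decay lam p w ->
  (forall y, Omega y -> 0 <= w y) -> locally_bounded w -> cls Omega rinv 1 w h -> Omega x ->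
  is_derive x (delta_mx ord0 j) (radint p h) (radint (p + 1) (partial j h) x).
Proof.
move=> lam0 Hw w0 lw Hh x0; set ej : 'rV[R]_n := delta_mx ord0 j.
pose w' := fun y => rinv y * w y.
have Hh0 : cls0 Omega w h := cls_cls0 Hh.
have Hh1 : cls0 Omega w' (partial j h) := cls_partial j Hh.
have Hw' : ray_decay lam (p + 1) w' := ray_decay_rinv Hw.
have [C C0 HC] := ray_bound Hw' Hh1.
have [B HB] := locally_bounded_rinv lw w0 x0.
have [d d0 Hd] : exists2 d : R, 0 < d & forall t : R, `|t| < d ->
    Omega (t *: ej + x) /\ w' (t *: ej + x) <= B.
  have [d d0 Hd] : exists2 d : R, 0 < d & forall y : 'rV[R]_n, `|x - y| < d -> Omega y /\ w' y <= B.
    apply: near_dist; apply: filterI => //; apply: open_nbhs_nbhs; split => //; exact: open_Omega.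
  have e0 : 0 < `|ej| + 1 by rewrite ltr_wpDl.
  exists (d / (`|ej| + 1)); first exact: divr_gt0.
  move=> t td; apply: Hd; rewrite opprD addrCA subrr addr0 normrN normZ.
  move: td; rewrite ltr_pdivlMr// => /(le_lt_trans _); apply.
  by rewrite ler_wpM2l// lerDl.
have B0 : 0 <= B.
  have [|_] := Hd 0; first by rewrite normr0.
  by rewrite scale0r add0r; apply: le_trans; rewrite mulr_ge0 ?rinv_ge0 ?w0.
have Hder t s : `|t| < d ->
    is_derive t (1 : R) (fun t => ray p h (t *: ej + x) s) (ray (p + 1) (partial j h) (t *: ej + x) s).
  move=> /Hd[Ot _]; apply: is_derive_ray.
  by apply: (cls_derive _ Hh); exact: Omega_scale.
have td (t : R) : `]- d, d[%classic t -> `|t| < d by rewrite /= in_itv/= ltr_norml.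
have I0 : `]- d, d[%classic (0 : R) by rewrite /= in_itv/= oppr_lt0 d0.
pose F (t s : R) := ray p h (t *: ej + x) s.
have A1 t : `]- d, d[%classic t -> leb.-integrable half (EFin \o F t).
  by move=> /td/Hd[Ot _]; exact: (integrable_ray lam0 Hw Hh0).
have A2 t s : `]- d, d[%classic t -> half s -> derivable (F^~ s) t 1.
  by move=> /td tdd _; have [] := Hder t s tdd.
pose G (s : R) := C * B * expR (- lam * s).
have G0 s : 0 <= G s by rewrite !mulr_ge0// expR_ge0.
have iG : leb.-integrable half (EFin \o G).
  by apply: integrable_cmul; [exact: measurable_half|apply: integrable_expR; rewrite oppr_lt0].
have PE t s : `|t| < d -> partial1of2 F t s = ray (p + 1) (partial j h) (t *: ej + x) s.
  by move=> tdd; rewrite /partial1of2 derive1E; have [_ ->] := Hder t s tdd.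
have A3 t s : `]- d, d[%classic t -> half s -> `|partial1of2 F t s| <= G s.
  move=> /td tdd; rewrite /= in_itv/= andbT => s0; rewrite PE//.
  have [Ot wB] := Hd t tdd.
  by rewrite (le_trans (HC _ _ Ot s0))// ler_wpM2r ?expR_ge0// ler_wpM2l.
apply/is_derive_lineP; split.
  exact: (derivable_under_integral measurable_half I0 A1 A2 G0 iG A3).
rewrite -derive1E (differentiation_under_integral measurable_half I0 A1 A2 G0 iG A3).
rewrite /radint; apply: eq_Rintegral => s _; rewrite PE ?normr0//.
by rewrite scale0r add0r.
Qed.

(** Derivatives can be taken under the integral, where they replace p by p + 1
    and lower the weight; the decay along the ray persists, and induction
    applies. *)
Lemma radint_cls k lam p w h : 0 < lam -> ray_decay lam p w ->
  (forall y, Omega y -> 0 <= w y) -> locally_bounded w -> cls Omega rinv k w h ->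
  cls Omega rinv k w (radint p h).
Proof.
move=> lam0; elim: k p w h => [|k IH] p w h Hw w0 lw Hh.
  exact: (radint_cls0 lam0 Hw Hh lw).
apply: (clsSI open_Omega); first exact: (radint_cls0 lam0 Hw (cls_cls0 Hh) lw).
move=> j; exists (radint (p + 1) (partial j h)).
  move=> x x0; apply: (radint_derive j lam0 Hw w0 lw _ x0).
  exact: (cls_leq _ Hh).
apply: IH.
- exact: ray_decay_rinv.
- by move=> y y0; rewrite mulr_ge0 ?rinv_ge0 ?w0.
- exact: locally_bounded_rinv.
- exact: cls_partial.
Qed.

Hypothesis sg1 : sg * sg = 1.

(** The Euler field is the derivative along the ray: applied under the integral
    it produces the total derivative of s |-> h (exp (sg s) x), which integrates
    to a boundary term at s = 0. *)
Lemma radint_euler lam w h x : 0 < lam -> ray_decay lam 0 w ->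
  (forall y, Omega y -> 0 <= w y) -> locally_bounded w -> cls Omega rinv 1 w h -> Omega x ->
  \sum_(j < n) x ord0 j * partial j (radint 0 h) x = - sg * h x.
Proof.
move=> lam0 Hw w0 lw Hh x0.
have Hpart j : partial j (radint 0 h) x = radint 1 (partial j h) x.
  have [_ E] := radint_derive j lam0 Hw w0 lw Hh x0.
  by rewrite /partial E add0r.
have ir j : leb.-integrable half (EFin \o (fun s => ray 1 (partial j h) x s)).
  apply: (integrable_ray lam0 _ (cls_partial j Hh) x0).
  by rewrite -[1]add0r; exact: ray_decay_rinv.
have ip j : leb.-integrable half (EFin \o (fun s => x ord0 j * ray 1 (partial j h) x s)).
  by apply: integrable_cmul; first exact: measurable_half.
have [iS ES] := Rintegral_sum measurable_half (index_enum 'I_n) ip.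
have -> : \sum_(j < n) x ord0 j * partial j (radint 0 h) x =
    \int[leb]_(s in half) \sum_(j < n) x ord0 j * ray 1 (partial j h) x s.
  by rewrite ES; apply: eq_bigr => j _; rewrite Hpart /radint (RintegralZl _ measurable_half (ir j)).
pose F s := sg * h (expR (sg * s) *: x).
have dF s : is_derive s (1 : R) F (\sum_(j < n) x ord0 j * ray 1 (partial j h) x s).
  set y := expR (sg * s) *: x; have y0 : Omega y by exact: Omega_scale.
  have Hdir : is_derive y x h (\sum_(j < n) x ord0 j * partial j h y).
    apply: (@is_derive_dir _ _ _ h (fun j => partial j h) y x open_Omega y0); first by move=> j z z0; exact: (cls_derive _ Hh).
    by move=> j; have [cp _] := cls_cls0 (cls_partial j Hh); exact: cp.
  have H1 : is_derive (expR (sg * s)) (1 : R) (fun t => h (t *: x + 0)) (\sum_(j < n) x ord0 j * partial j h y).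
    by apply: is_derive_line; rewrite addr0.
  have := is_derive_cmul sg (@is_derive1_comp _ (fun t => h (t *: x + 0)) (fun s => expR (sg * s)) s _ _
    H1 (is_derive_expR_lin sg s)).
  rewrite (_ : (fun y => _) = F); last by apply/funext => u; rewrite /F/= addr0.
  rewrite (_ : sg * _ = \sum_(j < n) x ord0 j * ray 1 (partial j h) x s)//.
  rewrite [LHS](_ : _ = sg * sg * (expR (sg * s) * \sum_(j < n) x ord0 j * partial j h y)); last by ring.
  rewrite sg1 mul1r mulr_sumr; apply: eq_bigr => j _.
  by rewrite /ray mulr1 -/y; ring.
rewrite (half_line_FTC (F := F) (l := 0) _ dF)//.
- by rewrite /F mulr0 expR0 scale1r sub0r mulNr.
- move=> s; apply: continuous_sum => j; apply: cvgMl_tmp.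
  apply: (ray_continuous x0); by have [cp _] := cls_cls0 (cls_partial j Hh).
- have [C C0 HC] := ray_bound Hw (cls_cls0 Hh).
  rewrite -(mulr0 sg); apply: cvgMl_tmp.
  apply/norm_cvg0P; apply: (@squeeze_cvgr _ _ _ _ (fun=> 0) (fun s => C * w x * expR (- lam * s))).
  + near=> s; rewrite normr_ge0/=.
    have s0 : 0 <= s by near: s; exact: nbhs_pinfty_ge.
    by have := HC x s x0 s0; rewrite /ray mulr0 mul0r expR0 mul1r.
  + exact: cvg_cst.
  + rewrite -(mulr0 (C * w x)); apply: cvgMl_tmp; apply: expR_lin_cvg0.
    by rewrite oppr_lt0.
Unshelve. all: by end_near. Qed.

End radial_integral.

(** * Orders of symbols and the Euler equation *)

Section symbol_orders.
Context {R : realType} {n : nat}.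
Implicit Types (f g h w : 'rV[R]_n -> R) (x : 'rV[R]_n).

(** Symbols of order m at infinity, with a power-like singularity allowed at 0:
    the equation x . grad u = h with h of negative order is solved by
    integration from infinity, and the solution is singular at 0 even when h is
    not. A factor exp (- |x|^-s) absorbs these singularities in the end. *)
Definition sy (m : R) f : Prop := exists2 L : R, - L <= m &
  forall k, symb k (fun x => enorm x `^ m + enorm x `^ (- L)) f.

Lemma powR_sum_le x (m L m' L' : R) : Omega x -> m <= m' -> - L <= m -> L <= L' ->
  enorm x `^ m + enorm x `^ (- L) <= 2 * (enorm x `^ m' + enorm x `^ (- L')).
Proof.
move=> x0 mm' Lm LL'; rewrite mulrDl mul1r; apply: lerD; apply: powR_between => //; lra.
Qed.

Lemma sy_lower m f L0 : sy m f -> exists L, [/\ - L <= m, L0 <= L &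
  forall k, symb k (fun x => enorm x `^ m + enorm x `^ (- L)) f].
Proof.
move=> [L Lm Hf]; exists (Num.max L L0); split.
- by rewrite (le_trans _ Lm)// lerN2 le_max lexx.
- by rewrite le_max lexx orbT.
- move=> k; apply: (cls_weight rinv_ge0 (c := 2)) (Hf k) => // x x0.
  by apply: powR_sum_le => //; rewrite le_max lexx.
Qed.

Lemma sy_weaken m m' f : m <= m' -> sy m f -> sy m' f.
Proof.
move=> mm' [L Lm Hf]; exists L; first exact: le_trans mm'.
move=> k; apply: (cls_weight rinv_ge0 (c := 2)) (Hf k) => // x x0.
exact: powR_sum_le.
Qed.

Lemma sy_ext m f g : (forall x, Omega x -> f x = g x) -> sy m f -> sy m g.
Proof.
by move=> fg [L Lm Hf]; exists L => // k; apply: (cls_ext open_Omega fg).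
Qed.

Lemma sy_add m f g : sy m f -> sy m g -> sy m (fun x => f x + g x).
Proof.
move=> [L Lm Hf] /(@sy_lower _ _ L)[L' [L'm LL' Hg]]; exists L' => // k.
apply: (cls_add (f := f) (g := g) open_Omega) => //.
apply: (cls_weight rinv_ge0 (c := 2)) (Hf k) => // x x0; exact: powR_sum_le.
Qed.

(** The product of the weights contains mixed powers; they lie between the
    extreme ones. *)
Lemma sy_mul m m' f g : sy m f -> sy m' g -> sy (m + m') (fun x => f x * g x).
Proof.
move=> [L Lm Hf] [L' L'm' Hg]; exists (L + L'); first by rewrite opprD lerD.
move=> k; apply: (cls_weight rinv_ge0 (c := 4)) (cls_mul open_Omega rinv_ge0 (Hf k) (Hg k)) => // x x0.
rewrite mulrDl !mulrDr !powR_scale//.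
have B c : - (L + L') <= c <= m + m' -> enorm x `^ c <= enorm x `^ (m + m') + enorm x `^ (- (L + L')).
  exact: powR_between.
have := B (m + m'); have := B (m - L'); have := B (- L + m'); have := B (- L - L').
by move=> /(_ _)H1 /(_ _)H2 /(_ _)H3 /(_ _)H4;
  have := H1 ltac:(lra); have := H2 ltac:(lra); have := H3 ltac:(lra); have := H4 ltac:(lra); lra.
Qed.

Lemma sy_cmul m (c : R) f : sy m f -> sy m (fun x => c * f x).
Proof.
by move=> [L Lm Hf]; exists L => // k; apply: (cls_cmul open_Omega rinv_ge0).
Qed.

Lemma sy_opp m f : sy m f -> sy m (fun x => - f x).
Proof.
by move=> [L Lm Hf]; exists L => // k; apply: (cls_opp open_Omega rinv_ge0).
Qed.

Lemma sy_sub m f g : sy m f -> sy m g -> sy m (fun x => f x - g x).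
Proof. by move=> Hf Hg; apply: (sy_add (g := fun x => - g x) Hf); exact: sy_opp. Qed.

Lemma sy_zero m : sy m (fun=> 0).
Proof.
exists (- m); first by rewrite opprK.
move=> k; apply: (cls_zero open_Omega rinv_ge0) => x x0.
by rewrite addr_ge0 ?powR_ge0.
Qed.

Lemma sy_sum m (I : Type) (r : seq I) (F : I -> 'rV[R]_n -> R) :
  (forall i, sy m (F i)) -> sy m (fun x => \sum_(i <- r) F i x).
Proof.
move=> HF; elim: r => [|i r IH].
  by apply: sy_ext (sy_zero m) => x _; rewrite big_nil.
by apply: sy_ext (sy_add (HF i) IH) => x _; rewrite big_cons.
Qed.

Lemma sy_powR (m : R) : sy m (fun x => dotp x x `^ (m / 2)).
Proof.
exists (- m); first by rewrite opprK.
move=> k; apply: (cls_weight_le rinv_ge0 (w := fun x => enorm x `^ m)); last exact: symb_powR.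
by move=> x _; rewrite lerDl powR_ge0.
Qed.

Lemma sy_const (c : R) : sy 0 (fun=> c).
Proof.
exists 0; first by rewrite oppr0.
move=> k; apply: (cls_weight_le rinv_ge0 (w := fun=> 1)); last exact: (cls_const open_Omega rinv_ge0).
by move=> x _; rewrite oppr0 powRr0; lra.
Qed.

Lemma sy_coord j : sy 1 (fun x => x ord0 j).
Proof.
exists (- 1); first by rewrite opprK.
move=> k; apply: (cls_weight_le rinv_ge0 (w := @enorm R n)); last exact: symb_coord.
by move=> x _; rewrite opprK powRr1 ?enorm_ge0// lerDl enorm_ge0.
Qed.

Lemma sy_weight (m c : R) (w f : 'rV[R]_n -> R) : 0 <= c ->
  (forall x, Omega x -> 0 < w x) ->
  (forall x, Omega x -> enorm x <= w x <= c * (1 + enorm x)) ->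
  (forall k, symb k (fun x => w x `^ m) f) -> sy m f.
Proof.
move=> c0 wpos Hw Hf; have [m0|m0] := leP 0 m; last first.
  exists (- m); first by rewrite opprK.
  move=> k; apply: (cls_weight_le rinv_ge0) (Hf k) => x x0.
  rewrite opprK ler_wpDr ?powR_ge0//.
  have /andP[Hx _] := Hw x x0; have e0 := enorm_Omega x0.
  rewrite -[m]opprK !(powRN _ (- m)) lef_pV2 ?posrE ?powR_gt0 ?wpos//.
  by rewrite ge0_ler_powR ?nnegrE ?oppr_ge0 ?(ltW m0) ?enorm_ge0// ltW// wpos.
exists 0; first by rewrite oppr0.
move=> k; apply: (cls_weight rinv_ge0 (c := (2 * c) `^ m)) (Hf k); first exact: powR_ge0.
move=> x x0; have /andP[_ Hx] := Hw x x0; have e0 := enorm_Omega x0.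
rewrite oppr0 powRr0.
have [x1|x1] := leP 1 (enorm x).
  rewrite (@le_trans _ _ ((2 * c * enorm x) `^ m))//.
    rewrite ge0_ler_powR ?nnegrE ?(ltW (wpos _ _)) ?mulr_ge0 ?enorm_ge0//.
    by rewrite (le_trans Hx)// -mulrA mulrCA ler_wpM2l//; lra.
  by rewrite powRM ?mulr_ge0 ?enorm_ge0// ler_wpM2l ?powR_ge0// lerDl.
rewrite (@le_trans _ _ ((2 * c) `^ m))//.
  rewrite ge0_ler_powR ?nnegrE ?(ltW (wpos _ _)) ?mulr_ge0 ?enorm_ge0//.
  by rewrite (le_trans Hx)// mulrC ler_wpM2r//; lra.
by rewrite ler_peMr ?powR_ge0// lerDr powR_ge0.
Qed.

Lemma jap_le x : jap x <= 1 + enorm x.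
Proof.
rewrite -(@ler_pXn2r _ 2)// ?nnegrE ?(ltW (jap_gt0 x)) ?(ltW (oneDenorm_gt0 x))//.
by rewrite jap_sqr -sqr_enorm; have := enorm_ge0 x; nra.
Qed.

Lemma sy_jap (s : R) : sy s (fun x => jap x `^ s).
Proof.
apply: (@sy_weight _ 1 (@jap R n)) => //.
- by move=> x _; exact: jap_gt0.
- by move=> x _; rewrite enorm_le_jap mul1r jap_le.
- by move=> k; exact: symb_jap.
Qed.

(** The weight (1 + |x|)^m of the coefficients is compared with |x|^m at
    infinity and with a power of |x| near 0; a negative power of 1 + |x| is at
    most the same power of |x|. *)
Lemma sy_smooth (m : R) f : smooth f -> symbol_bound m f -> sy m f.
Proof.
move=> sf bf; apply: (@sy_weight _ 1 (fun x => 1 + enorm x)) => //.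
- by move=> x _; exact: oneDenorm_gt0.
- by move=> x _; rewrite mul1r lexx lerDr ler01.
move=> k.
apply: (cls_weight_le rinv_ge0 (w := fun x => rinv x ^+ 0 * (1 + enorm x) `^ m)).
  by move=> x _; rewrite expr0 mul1r.
apply: (cls_smooth (w := fun i x => rinv x ^+ i * (1 + enorm x) `^ m) _ sf) => //.
- by move=> i x _; rewrite exprS mulrA.
- move=> s; have [C [C0 HC]] := bf (fun j => count_mem j s).
  exists C; first exact: ltW.
  move=> x x0; rewrite foldr_partial_multi// (le_trans (HC x))// ler_wpM2l ?(ltW C0)//.
  rewrite multi_order_count powRD; last by rewrite (gt_eqF (oneDenorm_gt0 x)) implybT.
  rewrite mulrC ler_wpM2r ?powR_ge0// powRN powR_mulrn ?(ltW (oneDenorm_gt0 x))//.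
  rewrite /rinv exprVn lef_pV2 ?posrE ?exprn_gt0 ?oneDenorm_gt0 ?enorm_Omega//.
  by rewrite lerXn2r ?nnegrE ?enorm_ge0 ?(ltW (oneDenorm_gt0 x))// lerDr.
- exact: open_Omega.
- exact: rinv_ge0.
Qed.

Lemma sy_derive m f x j : sy m f -> Omega x ->
  is_derive x (delta_mx ord0 j) f (partial j f x).
Proof. by move=> [L _ Hf]; exact: (cls_derive _ (Hf 1%N)). Qed.

Lemma sy_cont m f x : sy m f -> Omega x -> {for x, continuous f}.
Proof. by move=> [L _ Hf]; exact: (cls_cont (Hf 0%N)). Qed.

Lemma sy_partial m f j : sy m f -> sy (m - 1) (partial j f).
Proof.
move=> [L Lm Hf]; exists (L + 1); first lra.
move=> k; apply: (cls_weight_le rinv_ge0) (cls_partial j (Hf k.+1)) => x x0.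
by rewrite mulrDr !rinv_powR// opprD.
Qed.

Lemma sy_bound m f : sy m f -> exists2 C : R, 0 <= C &
  forall x, 1 <= enorm x -> `|f x| <= C * enorm x `^ m.
Proof.
move=> [L Lm Hf]; have [_ [C C0 HC]] := Hf 0%N.
exists (C * 2); first exact: mulr_ge0.
move=> x x1; have x0 : Omega x by rewrite /Omega/= -enorm_gt0 (lt_le_trans _ x1).
rewrite (le_trans (HC x x0))// -mulrA ler_wpM2l// mulrDl mul1r lerD2l.
by rewrite ler_powR.
Qed.

Lemma sy_bound0 m f : sy m f -> exists2 C : R, 0 <= C & exists L : R,
  forall x, Omega x -> enorm x <= 1 -> `|f x| <= C * enorm x `^ (- L).
Proof.
move=> [L Lm Hf]; have [_ [C C0 HC]] := Hf 0%N.
exists (C * 2); first exact: mulr_ge0.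
exists L => x x0 x1; rewrite (le_trans (HC x x0))// -mulrA ler_wpM2l// mulrDl mul1r lerD2r.
by rewrite ger_powR// enorm_Omega.
Qed.

Lemma locally_bounded_powR (m : R) : locally_bounded (fun x : 'rV[R]_n => enorm x `^ m).
Proof.
move=> x x0; exists (enorm x `^ m + 1).
have cx : {for x, continuous (fun y : 'rV[R]_n => enorm y `^ m)}.
  apply: (continuous_local open_Omega x0 (f := fun y : 'rV[R]_n => dotp y y `^ (m / 2))).
    by move=> y _; rewrite -sqr_enorm sqr_enorm_powR mulrC divfK.
  exact: (cls_cont (symb_powR 0 m)).
by move/cvgr_le: cx; apply; rewrite ltrDl.
Qed.

Lemma ray_powR (sg s m : R) x : Omega x ->
  enorm (expR (sg * s) *: x) `^ m = expR (sg * m * s) * enorm x `^ m.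
Proof.
move=> x0; rewrite enormZ ger0_norm ?expR_ge0// powRM ?expR_ge0 ?enorm_ge0//.
by rewrite -expRM mulrAC.
Qed.

(** For m > 0 the integral from 0 to x converges, provided that the datum is
    O(|x|^m) near the origin as well. *)
Lemma radial_pos m h : 0 < m -> (forall k, symb k (fun x => enorm x `^ m) h) ->
  exists2 u, sy m u & forall x, Omega x -> \sum_(j < n) x ord0 j * partial j u x = h x.
Proof.
move=> m0 Hh.
have rd : ray_decay (-1) m 0 (fun x : 'rV[R]_n => enorm x `^ m).
  move=> x s x0 s0; rewrite mulr0 mul0r expR0 mul1r ray_powR// mulN1r.
  by rewrite lexx.
have lb := @locally_bounded_powR m.
have w0 (y : 'rV[R]_n) : Omega y -> 0 <= enorm y `^ m by move=> _; exact: powR_ge0.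
exists (radint (-1) 0 h).
  exists (- m); first by rewrite opprK.
  move=> k; apply: (cls_weight_le rinv_ge0) (radint_cls m0 rd w0 lb (Hh k)) => x _.
  by rewrite lerDl powR_ge0.
move=> x x0; rewrite (radint_euler _ m0 rd w0 lb (Hh 1%N) x0) ?opprK ?mul1r//.
by rewrite mulrNN mulr1.
Qed.

(** For m < 0 the integral from x to infinity converges, whatever the
    singularity at the origin. *)
Lemma radial_neg m h : m < 0 -> sy m h ->
  exists2 u, sy m u & forall x, Omega x -> \sum_(j < n) x ord0 j * partial j u x = h x.
Proof.
move=> m0 [L Lm Hh].
have rd : ray_decay 1 (- m) 0 (fun x : 'rV[R]_n => enorm x `^ m + enorm x `^ (- L)).
  move=> x s x0 s0; rewrite mulr0 mul0r expR0 mul1r !ray_powR// !mul1r opprK mulrDr lerD2l.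
  by rewrite ler_wpM2r ?powR_ge0// ler_expR ler_wpM2r.
have lb : locally_bounded (fun x : 'rV[R]_n => enorm x `^ m + enorm x `^ (- L)).
  move=> x x0; have [B HB] := locally_bounded_powR m x0.
  have [B' HB'] := locally_bounded_powR (- L) x0; exists (B + B').
  by near=> y; apply: lerD; near: y.
have w0 (y : 'rV[R]_n) : Omega y -> 0 <= enorm y `^ m + enorm y `^ (- L).
  by move=> _; rewrite addr_ge0 ?powR_ge0.
have nm0 : 0 < - m by rewrite oppr_gt0.
exists (fun x => - radint 1 0 h x).
  apply: sy_opp; exists L => // k; exact: (radint_cls nm0 rd w0 lb (Hh k)).
move=> x x0.
have sR : sy m (radint 1 0 h) by exists L => // k; exact: (radint_cls nm0 rd w0 lb (Hh k)).
under eq_bigr => j _.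
  rewrite (_ : partial j _ x = - partial j (radint 1 0 h) x); last first.
    by have [_ E] := is_derive_opp (sy_derive j sR x0); exact: E.
  rewrite mulrN; over.
rewrite sumrN (radint_euler _ nm0 rd w0 lb (Hh 1%N) x0) ?mulr1//.
by rewrite mulN1r opprK.
Unshelve. all: by end_near. Qed.

(** The cutoff removes the singularity at the origin, which makes integration
    from the origin possible. *)
Lemma kappa_pos m L s h : - L <= m -> m + L <= s -> 0 <= s ->
  (forall k, symb k (fun x => enorm x `^ m + enorm x `^ (- L)) h) ->
  forall k, symb k (fun x => enorm x `^ m) (fun x => kappa s x * h x).
Proof.
move=> Lm Ls s0 Hh k; apply: (cls_weight rinv_ge0 (c := 2))
  (cls_mul open_Omega rinv_ge0 (symb_kappa k s) (Hh k)) => // x x0.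
have r0 : 0 < 1 + enorm x `^ s by rewrite ltr_pwDl// powR_ge0.
rewrite powR_inv1 ?(ltW r0)// mulrAC ler_pdivrMr// mulrDr !powR_scale//.
have B := powR_between x0 (_ : m <= s - L <= s + m).
have := B ltac:(lra); rewrite -(powR_scale s m x0).
have := powR_ge0 (enorm x) m; have := powR_ge0 (enorm x) s; nra.
Qed.

(** What the cutoff removes is of very low order at infinity, hence negligible. *)
Lemma kappa_neg m L s h : - L <= m -> 0 <= s ->
  (forall k, symb k (fun x => enorm x `^ m + enorm x `^ (- L)) h) ->
  sy (m - s) (fun x => (1 - kappa s x) * h x).
Proof.
move=> Lm s0 Hh; exists (L + s); first lra.
move=> k; apply: (cls_ext open_Omega (f := fun x => (1 + dotp x x `^ (s / 2)) `^ (- 1) * h x)).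
  by move=> x _; rewrite kappa_compl.
apply: (cls_weight_le rinv_ge0)
  (cls_mul open_Omega rinv_ge0 (symb_kappa_compl k s) (Hh k)) => // x x0.
have r0 : 0 < 1 + enorm x `^ s by rewrite ltr_pwDl// powR_ge0.
rewrite powR_inv1 ?(ltW r0)// mulrC ler_pdivrMr// mulrDr mulr1 opprD.
rewrite mulrDl !powR_scale// !subrK.
by rewrite lerDr addr_ge0 ?powR_ge0.
Qed.

(** The Euler field acts on functions homogeneous of degree m as multiplication
    by m, which is why the order 0 is excluded: there a logarithm would appear. *)
Lemma sy_euler m (N : R) h : m != 0 -> sy m h ->
  exists u e, [/\ sy m u, sy (m - N) e &
    forall x, Omega x -> \sum_(j < n) x ord0 j * partial j u x = h x - e x].
Proof.
move=> m0 Hh; have [mneg|mpos] := ltP m 0.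
  have [u Hu Eu] := radial_neg mneg Hh; exists u, (fun=> 0); split=> //; first exact: sy_zero.
  by move=> x x0; rewrite Eu// subr0.
have {m0}mpos : 0 < m by rewrite lt_neqAle eq_sym m0.
have [L Lm HL] := Hh.
pose s := Num.max 0 (Num.max (m + L) N).
have s0 : 0 <= s by rewrite le_max lexx.
have sL : m + L <= s by rewrite !le_max lexx orbT.
have sN : N <= s by rewrite !le_max lexx !orbT.
have [u Hu Eu] := radial_pos mpos (kappa_pos Lm sL s0 HL).
exists u, (fun x => (1 - kappa s x) * h x); split=> //.
  by apply: sy_weaken (kappa_neg Lm s0 HL); rewrite lerD2l lerN2.
by move=> x x0; rewrite Eu//; ring.
Qed.

End symbol_orders.

(** * The eikonal and transport equations *)

Section wkb.
Context {R : realType} {n : nat}.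
Implicit Types (u v f h : 'rV[R]_n -> R) (x : 'rV[R]_n).

(** Only gradients of the phase and of the amplitude exponent enter the
    equations, and log |x| has a gradient of order -1 without being a symbol of
    order 0. *)
Definition gsy (m : R) u : Prop := forall j,
  (forall x, Omega x -> derivable u x (delta_mx ord0 j)) /\ sy (m - 1) (partial j u).

Lemma sy_gsy m u : sy m u -> gsy m u.
Proof.
move=> Hu j; split; last exact: sy_partial.
by move=> x x0; have [] := sy_derive j Hu x0.
Qed.

Lemma gsy_weaken m m' u : m <= m' -> gsy m u -> gsy m' u.
Proof.
move=> mm' Hu j; have [du su] := Hu j; split=> //.
by apply: sy_weaken su; rewrite lerD2r.
Qed.

Lemma gsy_derive m u x j : gsy m u -> Omega x ->
  is_derive x (delta_mx ord0 j) u (partial j u x).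
Proof. by move=> Hu x0; apply/derivableP; have [du _] := Hu j; exact: du. Qed.

Lemma gsy_sy m u j : gsy m u -> sy (m - 1) (partial j u).
Proof. by move=> Hu; have [] := Hu j. Qed.

Lemma partial_add m m' u v x j : gsy m u -> gsy m' v -> Omega x ->
  partial j (fun y => u y + v y) x = partial j u x + partial j v x.
Proof.
move=> Hu Hv x0.
by have [_ E] := is_derive_add (gsy_derive j Hu x0) (gsy_derive j Hv x0); exact: E.
Qed.

Lemma gsy_add m u v : gsy m u -> gsy m v -> gsy m (fun y => u y + v y).
Proof.
move=> Hu Hv j; split.
  move=> x x0.
  by have [E _] := is_derive_add (gsy_derive j Hu x0) (gsy_derive j Hv x0); exact: E.
apply: sy_ext (sy_add (gsy_sy j Hu) (gsy_sy j Hv)) => x x0.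
by rewrite (partial_add j Hu Hv).
Qed.

Lemma partial2_add m m' u v x j k : gsy m u -> gsy m' v -> Omega x ->
  partial k (partial j (fun y => u y + v y)) x =
  partial k (partial j u) x + partial k (partial j v) x.
Proof.
move=> Hu Hv x0.
have D := is_derive_add (sy_derive k (gsy_sy j Hu) x0) (sy_derive k (gsy_sy j Hv) x0).
have [_ E] := is_derive_local (g := partial j (fun y => u y + v y)) open_Omega x0
  (fun y y0 => esym (partial_add j Hu Hv y0)) D.
exact: E.
Qed.

Variables (alpha mu : R) (a : 'I_n -> 'I_n -> 'rV[R]_n -> R)
  (b : 'I_n -> 'rV[R]_n -> R) (c2 : 'rV[R]_n -> R).

Definition gmat j k x : R := (j == k)%:R + a j k x.

Definition Qform u v x := \sum_(j < n) \sum_(k < n) gmat j k x * (partial j u x * partial k v x).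
(** Qform without the Euclidean part; as the coefficients a_jk are of
    order - mu, it is smaller than Qform by mu orders. *)
Definition Aform u v x := \sum_(j < n) \sum_(k < n) a j k x * (partial j u x * partial k v x).
Definition Mop u x := \sum_(j < n) \sum_(k < n)
  (gmat j k x * partial j (partial k u) x + partial j (a j k) x * partial k u x).
Definition Bop u x := \sum_(j < n) b j x * partial j u x.
Definition divb x := \sum_(j < n) partial j (b j) x.

(** The real and the imaginary part of the factor by which the operator
    multiplies exp (rho + i phi): E1 = 0 is the eikonal equation up to lower
    order terms, E2 = 0 the transport equation. *)
Definition E1 phi rho x :=
  Qform phi phi x - Qform rho rho x - Mop rho x + Bop phi x + c2 x.
Definition E2 phi rho x :=
  - (2 * Qform phi rho x + Mop phi x + Bop rho x + 2^-1 * divb x).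

Hypothesis a_sym : forall j k, a j k = a k j.
Hypothesis sa : forall j k, sy (- mu) (a j k).
Hypothesis sb : forall j, sy (alpha - mu) (b j).

Lemma sy_gmat j k : 0 < mu -> sy 0 (gmat j k).
Proof.
move=> mu0; apply: (sy_add (sy_const _)); apply: sy_weaken (sa j k).
by rewrite oppr_le0 ltW.
Qed.

Hypothesis mu0 : 0 < mu.

Lemma sy_Qform m m' u v : gsy m u -> gsy m' v -> sy (m + m' - 2) (Qform u v).
Proof.
move=> Hu Hv; apply: sy_sum => j; apply: sy_sum => k.
apply: sy_weaken (sy_mul (sy_gmat j k mu0) (sy_mul (gsy_sy j Hu) (gsy_sy k Hv))); lra.
Qed.

Lemma sy_Aform m m' u v : gsy m u -> gsy m' v -> sy (m + m' - 2 - mu) (Aform u v).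
Proof.
move=> Hu Hv; apply: sy_sum => j; apply: sy_sum => k.
apply: sy_weaken (sy_mul (sa j k) (sy_mul (gsy_sy j Hu) (gsy_sy k Hv))); lra.
Qed.

Lemma sy_Mop m u : gsy m u -> sy (m - 2) (Mop u).
Proof.
move=> Hu; apply: sy_sum => j; apply: sy_sum => k; apply: sy_add.
  apply: sy_weaken (sy_mul (sy_gmat j k mu0) (sy_partial j (gsy_sy k Hu))); lra.
apply: sy_weaken (sy_mul (sy_partial j (sa j k)) (gsy_sy k Hu)).
have := mu0; lra.
Qed.

Lemma sy_Bop m u : gsy m u -> sy (alpha - mu + m - 1) (Bop u).
Proof.
move=> Hu; apply: sy_sum => j.
apply: sy_weaken (sy_mul (sb j) (gsy_sy j Hu)); lra.
Qed.

Lemma sy_divb : sy (alpha - mu - 1) divb.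
Proof. by apply: sy_sum => j; exact: sy_partial. Qed.

Lemma QformE u v x :
  Qform u v x = \sum_(j < n) partial j u x * partial j v x + Aform u v x.
Proof.
rewrite /Qform /Aform -big_split/=; apply: eq_bigr => j _.
rewrite (bigD1 j)//= [in RHS](bigD1 j)//= /gmat eqxx mulrDl mul1r -!addrA; congr (_ + (_ + _)).
by apply: eq_bigr => k kj; rewrite eq_sym (negbTE kj) add0r.
Qed.

Lemma QformC u v x : Qform u v x = Qform v u x.
Proof.
rewrite /Qform exchange_big/=; apply: eq_bigr => j _; apply: eq_bigr => k _.
by rewrite /gmat a_sym eq_sym (mulrC (partial k u x)).
Qed.

Lemma Qform_addl m m' u u' v x : gsy m u -> gsy m' u' -> Omega x ->
  Qform (fun y => u y + u' y) v x = Qform u v x + Qform u' v x.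
Proof.
move=> Hu Hu' x0; rewrite /Qform -big_split/=; apply: eq_bigr => j _.
rewrite -big_split/=; apply: eq_bigr => k _.
by rewrite (partial_add j Hu Hu' x0); ring.
Qed.

Lemma Qform_addr m m' u u' v x : gsy m u -> gsy m' u' -> Omega x ->
  Qform v (fun y => u y + u' y) x = Qform v u x + Qform v u' x.
Proof. by move=> Hu Hu' x0; rewrite QformC (Qform_addl _ Hu Hu' x0) !(QformC v). Qed.

Lemma Mop_add m m' u u' x : gsy m u -> gsy m' u' -> Omega x ->
  Mop (fun y => u y + u' y) x = Mop u x + Mop u' x.
Proof.
move=> Hu Hu' x0; rewrite /Mop -big_split/=; apply: eq_bigr => j _.
rewrite -big_split/=; apply: eq_bigr => k _.
by rewrite (partial_add k Hu Hu' x0) (partial2_add k j Hu Hu' x0) !mulrDr addrACA.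
Qed.

Lemma Bop_add m m' u u' x : gsy m u -> gsy m' u' -> Omega x ->
  Bop (fun y => u y + u' y) x = Bop u x + Bop u' x.
Proof.
move=> Hu Hu' x0; rewrite /Bop -big_split/=; apply: eq_bigr => j _.
by rewrite (partial_add j Hu Hu' x0); ring.
Qed.

(** The residuals are quadratic in the phase and the amplitude exponent; among
    the terms linear in the corrections, the one with the large gradient of phi
    leads. *)
Lemma E1_add m m' p p' phi rho u v x : gsy m phi -> gsy m' rho -> gsy p u -> gsy p' v -> Omega x ->
  E1 (fun y => phi y + u y) (fun y => rho y + v y) x = E1 phi rho x +
    (2 * Qform phi u x + (Qform u u x - (2 * Qform rho v x + Qform v v x) - Mop v x + Bop u x)).
Proof.
move=> Hphi Hrho Hu Hv x0; rewrite /E1.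
rewrite !(Qform_addl _ Hphi Hu x0) !(Qform_addr _ Hphi Hu x0).
rewrite !(Qform_addl _ Hrho Hv x0) !(Qform_addr _ Hrho Hv x0).
rewrite (Mop_add Hrho Hv x0) (Bop_add Hphi Hu x0) (QformC u phi) (QformC v rho).
move: (Qform phi phi x) (Qform phi u x) (Qform u u x) (Qform rho rho x) (Qform rho v x).
by move: (Qform v v x) (Mop rho x) (Mop v x) (Bop phi x) (Bop u x) (c2 x) => *; ring.
Qed.

Lemma E2_add m m' p p' phi rho u v x : gsy m phi -> gsy m' rho -> gsy p u -> gsy p' v -> Omega x ->
  E2 (fun y => phi y + u y) (fun y => rho y + v y) x = E2 phi rho x -
    (2 * Qform phi v x + (2 * Qform u rho x + 2 * Qform u v x + Mop u x + Bop v x)).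
Proof.
move=> Hphi Hrho Hu Hv x0; rewrite /E2.
rewrite !(Qform_addl _ Hphi Hu x0) !(Qform_addr _ Hrho Hv x0).
rewrite (Mop_add Hphi Hu x0) (Bop_add Hrho Hv x0).
move: (Qform phi rho x) (Qform phi v x) (Qform u rho x) (Qform u v x) (divb x).
by move: (Mop phi x) (Mop u x) (Bop rho x) (Bop v x) => *; ring.
Qed.

(** Its gradient x <x>^(alpha - 1) has length about <x>^alpha, so that
    |grad phi0|^2 balances the potential - <x>^(2 alpha). *)
Definition phi0 x : R := (1 + alpha)^-1 * jap x `^ (1 + alpha).
(** The amplitude <x>^(- (n - 1 + alpha) / 2) keeps the flux of exp (2 rho) grad
    phi through large spheres constant; the exponent is chosen so that the
    leading term of the transport residual cancels. *)
Definition rho0 x : R := - ((n%:R - 1 + alpha) / 2) * ln (jap x).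

Lemma is_derive_jap x j : is_derive x (delta_mx ord0 j) (@jap R n) (x ord0 j * (jap x)^-1).
Proof.
have E (y : 'rV[R]_n) : jap y = (1 + dotp y y) `^ (2^-1).
  by rewrite -jap_sqr -powR_mulrn ?(ltW (jap_gt0 y))// -powRrM mulfV ?powRr1// ltW// jap_gt0.
have p0 : 0 < 1 + dotp x x by rewrite ltr_pwDl// dotp_ge0.
have D1 : is_derive x (delta_mx ord0 j) (fun y : 'rV[R]_n => 1 + dotp y y) (2 * x ord0 j).
  rewrite -[2 * _]add0r.
  exact: (is_derive_add (is_derive_const 1 x (delta_mx ord0 j)) (is_derive_sqnorm x j)).
have := @is_derive_compo _ _ (fun z => z `^ 2^-1) (fun y : 'rV[R]_n => 1 + dotp y y)
  x (delta_mx ord0 j) _ _ (is_derive1_powR 2^-1 p0) D1.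
rewrite (_ : (fun y => y `^ 2^-1) \o _ = @jap R n); last by apply/funext => y /=; rewrite E.
rewrite (_ : _ * _ = x ord0 j * (jap x)^-1)//.
rewrite (_ : 2^-1 - 1 = - 2^-1 :> R); last by field.
by rewrite powRN -E; field; rewrite gt_eqF ?jap_gt0.
Qed.

Lemma is_derive_phi0 x j : alpha != -1 ->
  is_derive x (delta_mx ord0 j) phi0 (x ord0 j * jap x `^ (alpha - 1)).
Proof.
move=> al.
have := is_derive_cmul (1 + alpha)^-1
  (is_derive_compo (is_derive1_powR (1 + alpha) (jap_gt0 x)) (is_derive_jap x j)).
rewrite (_ : (fun y => _ * _) = phi0)//.
rewrite (_ : _ * _ = x ord0 j * jap x `^ (alpha - 1))//.
rewrite (_ : 1 + alpha - 1 = alpha); last by ring.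
rewrite powRD ?(gt_eqF (jap_gt0 x)) ?implybT// powR_inv1 ?(ltW (jap_gt0 x))//.
by field; rewrite gt_eqF ?jap_gt0// addrC addr_eq0.
Qed.

Lemma is_derive_rho0 x j : is_derive x (delta_mx ord0 j) rho0
  (- ((n%:R - 1 + alpha) / 2) * (x ord0 j * jap x `^ (- 2))).
Proof.
have := is_derive_cmul (- ((n%:R - 1 + alpha) / 2))
  (is_derive_compo (is_derive1_ln (jap_gt0 x)) (is_derive_jap x j)).
rewrite (_ : (fun y => _ * _) = rho0)//.
rewrite (_ : (jap x)^-1 * _ = x ord0 j * jap x `^ (- 2))//.
by rewrite powRN powR_mulrn ?(ltW (jap_gt0 x))//; field; rewrite gt_eqF ?jap_gt0.
Qed.

Hypothesis alpha1 : 1 < alpha.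
Hypothesis mu12 : mu < 1 / 2.
Hypothesis sc2 : sy (2 * alpha - mu) (fun x => c2 x + jap x `^ (2 * alpha)).

Lemma partial_phi0 j : partial j phi0 = fun x => x ord0 j * jap x `^ (alpha - 1).
Proof.
apply/funext => x; have al : alpha != -1 by rewrite gt_eqF//; have := alpha1; lra.
by have [_ E] := is_derive_phi0 x j al; exact: E.
Qed.

Lemma partial_rho0 j : partial j rho0 =
  fun x => - ((n%:R - 1 + alpha) / 2) * (x ord0 j * jap x `^ (- 2)).
Proof. by apply/funext => x; have [_ E] := is_derive_rho0 x j; exact: E. Qed.

Lemma gsy_phi0 : gsy (1 + alpha) phi0.
Proof.
move=> j; split.
  move=> x _; have al : alpha != -1 by rewrite gt_eqF//; have := alpha1; lra.
  by have [E _] := is_derive_phi0 x j al.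
by rewrite partial_phi0; apply: sy_weaken (sy_mul (sy_coord j) (sy_jap _)); lra.
Qed.

Lemma gsy_rho0 : gsy 0 rho0.
Proof.
move=> j; split; first by move=> x _; have [E _] := is_derive_rho0 x j.
by rewrite partial_rho0; apply: sy_cmul; apply: sy_weaken (sy_mul (sy_coord j) (sy_jap _)); lra.
Qed.

Lemma jap_powR_split x (s : R) : jap x `^ (s + 2) = (1 + dotp x x) * jap x `^ s.
Proof.
rewrite powRD ?(gt_eqF (jap_gt0 x)) ?implybT// powR_mulrn ?(ltW (jap_gt0 x))//.
by rewrite jap_sqr mulrC.
Qed.

(** The gradient of phi0 is radial, which makes the leading part of the
    linearized equations a multiple of the Euler field. *)
Lemma gradphi0_dot u x : \sum_(j < n) partial j phi0 x * partial j u x =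
  jap x `^ (alpha - 1) * \sum_(j < n) x ord0 j * partial j u x.
Proof.
rewrite mulr_sumr; apply: eq_bigr => j _; rewrite partial_phi0.
by rewrite mulrA (mulrC (x ord0 j)).
Qed.

(** From |x|^2 = <x>^2 - 1: the error is two orders below <x>^(2 alpha). *)
Lemma eikonal0 x : \sum_(j < n) partial j phi0 x * partial j phi0 x =
  jap x `^ (2 * alpha) - jap x `^ (2 * alpha - 2).
Proof.
rewrite gradphi0_dot.
rewrite (_ : \sum_(j < n) _ = dotp x x * jap x `^ (alpha - 1)); last first.
  by rewrite /dotp mulr_suml; apply: eq_bigr => j _; rewrite partial_phi0 mulrA.
rewrite mulrCA -powRD ?(gt_eqF (jap_gt0 x)) ?implybT//.
rewrite (_ : alpha - 1 + (alpha - 1) = 2 * alpha - 2); last by ring.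
have := jap_powR_split x (2 * alpha - 2); rewrite subrK => ->.
by ring.
Qed.

Lemma is_derive_jap_powR x j (s : R) : is_derive x (delta_mx ord0 j) (fun y : 'rV[R]_n => jap y `^ s)
  (s * (x ord0 j * jap x `^ (s - 2))).
Proof.
have := is_derive_compo (is_derive1_powR s (jap_gt0 x)) (is_derive_jap x j).
rewrite (_ : _ * _ = s * (x ord0 j * jap x `^ (s - 2)))//.
rewrite (_ : s - 1 = (s - 2) + 1); last by ring.
rewrite powRD ?(gt_eqF (jap_gt0 x)) ?implybT// powRr1 ?(ltW (jap_gt0 x))//.
by field; rewrite gt_eqF ?jap_gt0.
Qed.

Lemma partial2_phi0 x j : partial j (partial j phi0) x =
  jap x `^ (alpha - 1) + (alpha - 1) * (x ord0 j * x ord0 j * jap x `^ (alpha - 3)).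
Proof.
rewrite partial_phi0.
have [_ E] := is_derive_mul (is_derive_coord x (delta_mx ord0 j) j) (is_derive_jap_powR x j (alpha - 1)).
rewrite /partial E mxE !eqxx mul1r; congr (_ + _).
rewrite (_ : alpha - 1 - 2 = alpha - 3); [ring|ring].
Qed.

Lemma laplacian_phi0 x : \sum_(j < n) partial j (partial j phi0) x =
  n%:R * jap x `^ (alpha - 1) + (alpha - 1) * (dotp x x * jap x `^ (alpha - 3)).
Proof.
under eq_bigr => j _ do rewrite partial2_phi0.
rewrite big_split/= sumr_const card_ord -[_ *+ n]mulr_natl; congr (_ + _).
by rewrite /dotp mulr_suml mulr_sumr.
Qed.

(** The coefficient of <x>^(alpha - 1) vanishes: 2 grad phi0 . grad rho0
    contributes - (n - 1 + alpha), and the Laplacian of phi0 contributes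
    n + (alpha - 1). *)
Lemma transport0 x : 2 * \sum_(j < n) partial j phi0 x * partial j rho0 x +
  \sum_(j < n) partial j (partial j phi0) x = n%:R * jap x `^ (alpha - 3).
Proof.
rewrite laplacian_phi0 gradphi0_dot.
rewrite (_ : \sum_(j < n) _ = - ((n%:R - 1 + alpha) / 2) * (dotp x x * jap x `^ (- 2))); last first.
  rewrite /dotp mulr_suml mulr_sumr; apply: eq_bigr => j _; rewrite partial_rho0.
  by rewrite mulrCA !mulrA.
have := jap_powR_split x (alpha - 3); rewrite (_ : alpha - 3 + 2 = alpha - 1); last by ring.
move=> E; have E' : jap x `^ (alpha - 1) * jap x `^ (-2) = jap x `^ (alpha - 3).
  by rewrite -powRD ?(gt_eqF (jap_gt0 x)) ?implybT//; congr (_ `^ _); ring.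
rewrite (_ : 2 * _ = - (n%:R - 1 + alpha) * (dotp x x * (jap x `^ (alpha - 1) * jap x `^ (-2)))).
  by rewrite E' E; move: (jap x `^ (alpha - 3)) (dotp x x) => y q; ring.
by move: (jap x `^ (-2)) (jap x `^ (alpha - 1)) => y z; field.
Qed.

Definition MAop u x := \sum_(j < n) \sum_(k < n)
  (a j k x * partial j (partial k u) x + partial j (a j k) x * partial k u x).

Lemma MopE u x : Mop u x = \sum_(j < n) partial j (partial j u) x + MAop u x.
Proof.
rewrite /Mop /MAop -big_split/=; apply: eq_bigr => j _.
rewrite (bigD1 j)//= [in RHS](bigD1 j)//= /gmat eqxx mulrDl mul1r -!addrA; congr (_ + (_ + (_ + _))).
by apply: eq_bigr => k kj; rewrite eq_sym (negbTE kj) add0r.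
Qed.

Lemma sy_MAop m u : gsy m u -> sy (m - 2 - mu) (MAop u).
Proof.
move=> Hu; apply: sy_sum => j; apply: sy_sum => k; apply: sy_add.
  apply: sy_weaken (sy_mul (sa j k) (sy_partial j (gsy_sy k Hu))); lra.
apply: sy_weaken (sy_mul (sy_partial j (sa j k)) (gsy_sy k Hu)); lra.
Qed.

(** The Euclidean part of the eikonal equation is solved by phi0 up to two
    orders; what remains is dominated by the contributions of a_jk, b_j and c,
    mu orders below the principal terms. *)
Lemma E1_start : sy (2 * alpha - mu) (E1 phi0 rho0).
Proof.
have g1 := gsy_phi0; have g0 := gsy_rho0; have mu0' := mu0; have al := alpha1; have m12 := mu12.
have A1 : sy (2 * alpha - mu) (fun x => - jap x `^ (2 * alpha - 2)).
  by apply: sy_opp; apply: sy_weaken (sy_jap _); lra.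
have A2 : sy (2 * alpha - mu) (Aform phi0 phi0) by apply: sy_weaken (sy_Aform g1 g1); lra.
have A3 : sy (2 * alpha - mu) (fun x => - Qform rho0 rho0 x).
  by apply: sy_opp; apply: sy_weaken (sy_Qform g0 g0); lra.
have A4 : sy (2 * alpha - mu) (fun x => - Mop rho0 x).
  by apply: sy_opp; apply: sy_weaken (sy_Mop g0); lra.
have A5 : sy (2 * alpha - mu) (Bop phi0) by apply: sy_weaken (sy_Bop g1); lra.
apply: sy_ext (sy_add (sy_add (sy_add (sy_add (sy_add A1 A2) A3) A4) A5) sc2) => x _.
by rewrite /E1 (QformE phi0) eikonal0; ring.
Qed.

Lemma E2_start : sy (alpha - 1 - mu) (E2 phi0 rho0).
Proof.
have g1 := gsy_phi0; have g0 := gsy_rho0; have mu0' := mu0; have al := alpha1; have m12 := mu12.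
have A1 : sy (alpha - 1 - mu) (fun x => - (n%:R * jap x `^ (alpha - 3))).
  by apply: sy_opp; apply: sy_cmul; apply: sy_weaken (sy_jap _); lra.
have A2 : sy (alpha - 1 - mu) (fun x => - (2 * Aform phi0 rho0 x)).
  by apply: sy_opp; apply: sy_cmul; apply: sy_weaken (sy_Aform g1 g0); lra.
have A3 : sy (alpha - 1 - mu) (fun x => - MAop phi0 x).
  by apply: sy_opp; apply: sy_weaken (sy_MAop g1); lra.
have A4 : sy (alpha - 1 - mu) (fun x => - Bop rho0 x).
  by apply: sy_opp; apply: sy_weaken (sy_Bop g0); lra.
have A5 : sy (alpha - 1 - mu) (fun x => - (2^-1 * divb x)).
  by apply: sy_opp; apply: sy_cmul; apply: sy_weaken sy_divb; lra.
apply: sy_ext (sy_add (sy_add (sy_add (sy_add A1 A2) A3) A4) A5) => x _.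
by rewrite /E2 (QformE phi0) (MopE phi0) -transport0; ring.
Qed.

(** State of the construction after corrections u of the phase and v of the
    amplitude exponent.  As t grows the eikonal residual gains 2 t orders and
    the transport residual t / 2, which at t = alpha is what square
    integrability requires of them. *)
Definition wkb_at t u v := [/\ sy (1 + alpha - mu) u, sy (- (mu / 4)) v,
  sy (2 * alpha - 2 * t) (E1 (fun x => phi0 x + u x) (fun x => rho0 x + v x)) &
  sy (alpha - 1 - t / 2) (E2 (fun x => phi0 x + u x) (fun x => rho0 x + v x))].

(** The leading part of the linearized residuals is 2 <x>^(alpha - 1) times the
    Euler field, which can be inverted within symbols.  Everything else gains a
    power of |x|: the perturbation of the metric, products of two corrections,
    and terms in which the large gradient of phi does not occur. *)
Lemma wkb_step t u v : mu / 2 <= t -> t <= alpha + 1 -> wkb_at t u v ->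
  exists u' v', wkb_at (t + mu / 4) u' v'.
Proof.
move=> tmin tmax [Hu Hv H1 H2].
have g1 := gsy_phi0; have g0 := gsy_rho0; have mu0' := mu0; have al := alpha1; have m12 := mu12.
(* The correction of the phase has order 1 + alpha - 2 t.  When this is the
   forbidden order 0, it is considered as a symbol of order mu / 2: the
   perturbation of the metric gains mu orders, and a step claims half of them. *)
pose m' := if 1 + alpha - 2 * t == 0 then mu / 2 else 1 + alpha - 2 * t.
have m'0 : m' != 0.
  by rewrite /m'; case: ifPn => // _; rewrite gt_eqF// divr_gt0.
have m'P : m' = 1 + alpha - 2 * t \/ (t = (1 + alpha) / 2 /\ m' = mu / 2).
  rewrite /m'; case: eqVneq => [E|_]; [right|by left].
  by split => //; lra.
clearbody m'.
have Hh1 : sy m' (fun x => - 2^-1 * (jap x `^ (1 - alpha) *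
    E1 (fun x => phi0 x + u x) (fun x => rho0 x + v x) x)).
  apply: sy_cmul; apply: sy_weaken (sy_mul (sy_jap _) H1).
  by case: m'P => [E|[E E']]; lra.
have Hh2 : sy (- (t / 2)) (fun x => 2^-1 * (jap x `^ (1 - alpha) *
    E2 (fun x => phi0 x + u x) (fun x => rho0 x + v x) x)).
  by apply: sy_cmul; apply: sy_weaken (sy_mul (sy_jap _) H2); lra.
have [du [e1 [Hdu He1 Edu]]] := sy_euler 1 m'0 Hh1.
have t20 : - (t / 2) != 0 by rewrite lt_eqF//; lra.
have [dv [e2 [Hdv He2 Edv]]] := sy_euler 1 t20 Hh2.
set F1 := E1 _ _ in H1 Hh1 Edu; set F2 := E2 _ _ in H2 Hh2 Edv.
exists (fun x => u x + du x), (fun x => v x + dv x).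
have Gu := sy_gsy Hu; have Gv := sy_gsy Hv; have Gdu := sy_gsy Hdu; have Gdv := sy_gsy Hdv.
have Gphi : gsy (1 + alpha) (fun x => phi0 x + u x).
  by apply: gsy_add => //; apply: gsy_weaken Gu; lra.
have Grho : gsy 0 (fun x => rho0 x + v x).
  by apply: gsy_add => //; apply: gsy_weaken Gv; lra.
have JJ x : jap x `^ (alpha - 1) * jap x `^ (1 - alpha) = 1.
  rewrite -powRD ?(gt_eqF (jap_gt0 x)) ?implybT//.
  by rewrite (_ : alpha - 1 + (1 - alpha) = 0) ?powRr0//; ring.
have Q1 x : Omega x -> 2 * Qform (fun x => phi0 x + u x) du x =
    - F1 x - 2 * (jap x `^ (alpha - 1) * e1 x) + 2 * Aform phi0 du x + 2 * Qform u du x.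
  move=> x0; rewrite (Qform_addl _ g1 Gu x0) (QformE phi0) gradphi0_dot Edu//.
  have := JJ x; move: (jap x `^ (alpha - 1)) (jap x `^ (1 - alpha)) (F1 x) => y z f yz.
  rewrite mulrBr (_ : y * (_ * (z * f)) = - (2^-1 * (y * z) * f)); last by ring.
  by rewrite yz; field.
have Q2 x : Omega x -> 2 * Qform (fun x => phi0 x + u x) dv x =
    F2 x - 2 * (jap x `^ (alpha - 1) * e2 x) + 2 * Aform phi0 dv x + 2 * Qform u dv x.
  move=> x0; rewrite (Qform_addl _ g1 Gu x0) (QformE phi0) gradphi0_dot Edv//.
  have := JJ x; move: (jap x `^ (alpha - 1)) (jap x `^ (1 - alpha)) (F2 x) => y z f yz.
  rewrite mulrBr (_ : y * (_ * (z * f)) =  (2^-1 * (y * z) * f)); last by ring.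
  by rewrite yz; field.
have eqphi : (fun x => phi0 x + (u x + du x)) = (fun x => (phi0 x + u x) + du x).
  by apply/funext => x; rewrite addrA.
have eqrho : (fun x => rho0 x + (v x + dv x)) = (fun x => (rho0 x + v x) + dv x).
  by apply/funext => x; rewrite addrA.
split.
- by apply: sy_add => //; apply: sy_weaken Hdu; case: m'P => [E|[E E']]; lra.
- by apply: sy_add => //; apply: sy_weaken Hdv; lra.
- rewrite eqphi eqrho; set M := 2 * alpha - 2 * (t + mu / 4).
  have B1 : sy M (fun x => - (2 * (jap x `^ (alpha - 1) * e1 x))).
    apply: sy_opp; apply: sy_cmul; apply: sy_weaken (sy_mul (sy_jap _) He1).
    by rewrite /M; case: m'P => [E|[E E']]; lra.
  have B2 : sy M (fun x => 2 * Aform phi0 du x).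
    apply: sy_cmul; apply: sy_weaken (sy_Aform g1 Gdu).
    by rewrite /M; case: m'P => [E|[E E']]; lra.
  have B3 : sy M (fun x => 2 * Qform u du x).
    apply: sy_cmul; apply: sy_weaken (sy_Qform Gu Gdu).
    by rewrite /M; case: m'P => [E|[E E']]; lra.
  have B4 : sy M (Qform du du).
    apply: sy_weaken (sy_Qform Gdu Gdu).
    by rewrite /M; case: m'P => [E|[E E']]; lra.
  have B5 : sy M (fun x => - (2 * Qform (fun x => rho0 x + v x) dv x)).
    by apply: sy_opp; apply: sy_cmul; apply: sy_weaken (sy_Qform Grho Gdv); rewrite /M; lra.
  have B6 : sy M (fun x => - Qform dv dv x).
    by apply: sy_opp; apply: sy_weaken (sy_Qform Gdv Gdv); rewrite /M; lra.
  have B7 : sy M (fun x => - Mop dv x).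
    by apply: sy_opp; apply: sy_weaken (sy_Mop Gdv); rewrite /M; lra.
  have B8 : sy M (Bop du).
    by apply: sy_weaken (sy_Bop Gdu); rewrite /M; case: m'P => [E|[E E']]; lra.
  apply: sy_ext (sy_add (sy_add (sy_add (sy_add (sy_add (sy_add (sy_add B1 B2) B3) B4) B5) B6) B7) B8).
  move=> x x0; rewrite (E1_add Gphi Grho Gdu Gdv x0) Q1// -/F1.
  by move: (F1 x) (Qform du du x) (Mop dv x) (Bop du x) => *; ring.
- rewrite eqphi eqrho; set M := alpha - 1 - (t + mu / 4) / 2.
  have B1 : sy M (fun x => 2 * (jap x `^ (alpha - 1) * e2 x)).
    by apply: sy_cmul; apply: sy_weaken (sy_mul (sy_jap _) He2); rewrite /M; lra.
  have B2 : sy M (fun x => - (2 * Aform phi0 dv x)).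
    by apply: sy_opp; apply: sy_cmul; apply: sy_weaken (sy_Aform g1 Gdv); rewrite /M; lra.
  have B3 : sy M (fun x => - (2 * Qform u dv x)).
    by apply: sy_opp; apply: sy_cmul; apply: sy_weaken (sy_Qform Gu Gdv); rewrite /M; lra.
  have B4 : sy M (fun x => - (2 * Qform du (fun x => rho0 x + v x) x)).
    apply: sy_opp; apply: sy_cmul; apply: sy_weaken (sy_Qform Gdu Grho).
    by rewrite /M; case: m'P => [E|[E E']]; lra.
  have B5 : sy M (fun x => - (2 * Qform du dv x)).
    apply: sy_opp; apply: sy_cmul; apply: sy_weaken (sy_Qform Gdu Gdv).
    by rewrite /M; case: m'P => [E|[E E']]; lra.
  have B6 : sy M (fun x => - Mop du x).
    apply: sy_opp; apply: sy_weaken (sy_Mop Gdu).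
    by rewrite /M; case: m'P => [E|[E E']]; lra.
  have B7 : sy M (fun x => - Bop dv x).
    by apply: sy_opp; apply: sy_weaken (sy_Bop Gdv); rewrite /M; lra.
  apply: sy_ext (sy_add (sy_add (sy_add (sy_add (sy_add (sy_add B1 B2) B3) B4) B5) B6) B7).
  move=> x x0; rewrite (E2_add Gphi Grho Gdu Gdv x0) Q2// -/F2.
  by move: (F2 x) (Qform du _ x) (Mop du x) (Bop dv x) => *; ring.
Qed.

Lemma wkb_iter (k : nat) : mu / 2 + k%:R * (mu / 4) <= alpha + 1 ->
  exists u v, wkb_at (mu / 2 + k%:R * (mu / 4)) u v.
Proof.
have mu0' := mu0; elim: k => [|k IH] H.
  exists (fun=> 0), (fun=> 0); rewrite mul0r addr0; split; try exact: sy_zero.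
    rewrite (_ : (fun x => phi0 x + 0) = phi0); last by apply/funext => x; rewrite addr0.
    rewrite (_ : (fun x => rho0 x + 0) = rho0); last by apply/funext => x; rewrite addr0.
    by apply: sy_weaken E1_start; lra.
  rewrite (_ : (fun x => phi0 x + 0) = phi0); last by apply/funext => x; rewrite addr0.
  rewrite (_ : (fun x => rho0 x + 0) = rho0); last by apply/funext => x; rewrite addr0.
  by apply: sy_weaken E2_start; lra.
move: H; rewrite -[k.+1%:R]natr1 mulrDl mul1r addrA => H.
have k0 : 0 <= k%:R * (mu / 4) by rewrite mulr_ge0// divr_ge0// ltW.
have [u [v Huv]] := IH ltac:(lra).
by apply: (wkb_step _ _ Huv); lra.
Qed.

(** After finitely many steps t reaches alpha; then the eikonal residual is
    bounded and the transport residual has order alpha / 2 - 1, so that both are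
    square integrable after multiplication by the amplitude.  The term - |x|^-s
    added to the amplitude exponent beats every singularity at the origin, and
    does not matter at infinity since s is large. *)
Lemma wkb_exists : exists u v s, [/\ sy (1 + alpha - mu) u, sy (- (mu / 4)) v,
  (exists C L : R, [/\ 0 <= C, L + 1 <= s, 1 <= s &
     forall x, Omega x -> enorm x <= 1 -> `|v x| <= C * enorm x `^ (- L)]),
  sy 0 (E1 (fun x => phi0 x + u x) (fun x => rho0 x + (v x - dotp x x `^ (- s / 2)))) &
  sy (alpha / 2 - 1) (E2 (fun x => phi0 x + u x) (fun x => rho0 x + (v x - dotp x x `^ (- s / 2))))].
Proof.
have g1 := gsy_phi0; have g0 := gsy_rho0; have mu0' := mu0; have al := alpha1; have m12 := mu12.
(* The largest number of steps for which t is at most alpha + 1/2; it is then at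
   least alpha, a step being shorter than 1/2. *)
pose X := (alpha + 1 / 2 - mu / 2) / (mu / 4).
have m4 : 0 < mu / 4 by rewrite divr_gt0.
have X0 : 0 <= X by rewrite divr_ge0// ?(ltW m4)//; lra.
have [k1 k2] : (Num.truncn X)%:R <= X /\ X < (Num.truncn X).+1%:R.
  by have /andP[] := truncn_itv X0.
set k := Num.truncn X in k1 k2.
have k1' : k%:R * (mu / 4) <= alpha + 1 / 2 - mu / 2 by rewrite -ler_pdivlMr.
have k2' : alpha + 1 / 2 - mu / 2 < k%:R * (mu / 4) + mu / 4.
  by move: k2; rewrite /X ltr_pdivrMr// -[k.+1%:R]natr1 => k2; lra.
have [|u [v [Hu Hv H1 H2]]] := @wkb_iter k; first lra.
set t := mu / 2 + k%:R * (mu / 4) in H1 H2.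
have tal : alpha <= t by rewrite /t; lra.
have [C C0 [L HL]] := sy_bound0 Hv.
(* L + 1 beats the singularity of v at the origin; 2 alpha + 4 makes the new
   terms negligible at infinity. *)
pose s := Num.max (L + 1) (2 * alpha + 4).
have s1 : L + 1 <= s by rewrite le_max lexx.
have s2 : 2 * alpha + 4 <= s by rewrite le_max lexx orbT.
pose w x := - dotp x x `^ (- s / 2).
have Hw : sy (- s) w by apply: sy_opp; exact: sy_powR.
have Gw := sy_gsy Hw.
have Gz : gsy (- s) (fun=> 0 : R) by apply: sy_gsy; exact: sy_zero.
have Gu := sy_gsy Hu; have Gv := sy_gsy Hv.
have Gphi : gsy (1 + alpha) (fun x => phi0 x + u x).
  by apply: gsy_add => //; apply: gsy_weaken Gu; lra.
have Grho : gsy 0 (fun x => rho0 x + v x).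
  by apply: gsy_add => //; apply: gsy_weaken Gv; lra.
have eqphi : (fun x => phi0 x + u x) = (fun x => (phi0 x + u x) + 0).
  by apply/funext => x; rewrite addr0.
have eqrho : (fun x => rho0 x + (v x - dotp x x `^ (- s / 2))) = (fun x => (rho0 x + v x) + w x).
  by apply/funext => x; rewrite addrA.
exists u, v, s; split=> //.
- by exists C, L; split => //; lra.
- rewrite eqrho eqphi.
  have B0 : sy 0 (E1 (fun x => phi0 x + u x) (fun x => rho0 x + v x)) by apply: sy_weaken H1; lra.
  have B1 : sy 0 (fun x => 2 * Qform (fun x => phi0 x + u x) (fun=> 0) x).
    by apply: sy_cmul; apply: sy_weaken (sy_Qform Gphi Gz); lra.
  have B2 : sy 0 (Qform (fun=> 0) (fun=> 0)) by apply: sy_weaken (sy_Qform Gz Gz); lra.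
  have B3 : sy 0 (fun x => 2 * Qform (fun x => rho0 x + v x) w x + Qform w w x).
    apply: sy_add; first by apply: sy_cmul; apply: sy_weaken (sy_Qform Grho Gw); lra.
    by apply: sy_weaken (sy_Qform Gw Gw); lra.
  have B4 : sy 0 (Mop w) by apply: sy_weaken (sy_Mop Gw); lra.
  have B5 : sy 0 (Bop (fun=> 0)) by apply: sy_weaken (sy_Bop Gz); lra.
  apply: sy_ext (sy_add B0 (sy_add B1 (sy_add (sy_sub (sy_sub B2 B3) B4) B5))) => x x0.
  by rewrite (E1_add Gphi Grho Gz Gw x0).
- rewrite eqrho eqphi; set M := alpha / 2 - 1.
  have B0 : sy M (E2 (fun x => phi0 x + u x) (fun x => rho0 x + v x)).
    by apply: sy_weaken H2; rewrite /M; lra.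
  have B1 : sy M (fun x => 2 * Qform (fun x => phi0 x + u x) w x).
    by apply: sy_cmul; apply: sy_weaken (sy_Qform Gphi Gw); rewrite /M; lra.
  have B2 : sy M (fun x => 2 * Qform (fun=> 0) (fun x => rho0 x + v x) x).
    by apply: sy_cmul; apply: sy_weaken (sy_Qform Gz Grho); rewrite /M; lra.
  have B3 : sy M (fun x => 2 * Qform (fun=> 0) w x).
    by apply: sy_cmul; apply: sy_weaken (sy_Qform Gz Gw); rewrite /M; lra.
  have B4 : sy M (Mop (fun=> 0)) by apply: sy_weaken (sy_Mop Gz); rewrite /M; lra.
  have B5 : sy M (Bop w) by apply: sy_weaken (sy_Bop Gw); rewrite /M; lra.
  apply: sy_ext (sy_sub B0 (sy_add B1 (sy_add (sy_add (sy_add B2 B3) B4) B5))) => x x0.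
  by rewrite (E2_add Gphi Grho Gz Gw x0).
Qed.

End wkb.

(** * Image measures and the Lebesgue measure of R^n *)

Section image_measures.
Context {R : realType}.

(** The change of variables formula for an image measure up to a constant
    factor; the factor avoids dividing extended real numbers. *)
Lemma ge0_integral_image d d' (X : measurableType d) (Y : measurableType d')
    (mu : {measure set X -> \bar R}) (nu : {measure set Y -> \bar R}) (phi : X -> Y) (c : R)
    (f : Y -> \bar R) :
  0 <= c -> measurable_fun setT phi ->
  (forall A, measurable A -> (c%:E * mu (phi @^-1` A) = nu A)%E) ->
  measurable_fun setT f -> (forall y, (0 <= f y)%E) ->
  (c%:E * \int[mu]_x f (phi x) = \int[nu]_y f y)%E.
Proof.
move=> c0 mphi H mf f0.
have E := @ge0_integral_pushforward _ _ X Y R phi mphi mu setT f measurableT mf (fun y _ => f0 y).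
rewrite preimage_setT in E; rewrite -[(\int[mu]_x f (phi x))%E]E.
have -> : c%:E = ((NngNum c0)%:num)%:E by [].
rewrite -(ge0_integral_mscale _ measurableT (NngNum c0) mf (fun y _ => f0 y)).
apply: eq_measure_integral => A mA _; rewrite -H//.
Qed.

Lemma integral_image d d' (X : measurableType d) (Y : measurableType d')
    (mu : {measure set X -> \bar R}) (nu : {measure set Y -> \bar R}) (phi : X -> Y) (c : R)
    (f : Y -> R) :
  0 < c -> measurable_fun setT phi ->
  (forall A, measurable A -> (c%:E * mu (phi @^-1` A) = nu A)%E) ->
  nu.-integrable setT (EFin \o f) ->
  mu.-integrable setT (EFin \o (f \o phi)) /\
  c * \int[mu]_x f (phi x) = \int[nu]_y f y.
Proof.
move=> c0 mphi H intf; have /integrableP[mf finf] := intf.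
have mf' : measurable_fun setT (EFin \o f) := mf.
have G (g : Y -> \bar R) : measurable_fun setT g -> (forall y, (0 <= g y)%E) ->
  (\int[mu]_x g (phi x) = c^-1%:E * \int[nu]_y g y)%E.
  move=> mg g0; rewrite -(ge0_integral_image (ltW c0) mphi H mg g0) muleA -EFinM mulVf ?mul1e//.
  by rewrite gt_eqF.
have intfphi : mu.-integrable setT (EFin \o (f \o phi)).
  apply/integrableP; split; first exact: (measurableT_comp mf' mphi).
  rewrite (G (fun y => `|(f y)%:E|%E)) //; last exact: measurableT_comp.
  by rewrite lte_mul_pinfty// ?lee_fin ?invr_ge0 ?(ltW c0).
split => //.
rewrite /Rintegral [in LHS]integralE [in RHS]integralE.
have Ep : (\int[mu]_x (EFin \o (f \o phi))^\+ x = \int[mu]_x (EFin \o f)^\+ (phi x))%E.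
  by apply: eq_integral => x _; rewrite !funeposE.
have En : (\int[mu]_x (EFin \o (f \o phi))^\- x = \int[mu]_x (EFin \o f)^\- (phi x))%E.
  by apply: eq_integral => x _; rewrite !funenegE.
rewrite [X in fine (X - _)%E]Ep [X in fine (_ - X)%E]En.
rewrite (G _ (measurable_funepos mf'))// (G _ (measurable_funeneg mf'))//.
have fp : (\int[nu]_y ((EFin \o f)^\+ y))%E \is a fin_num by exact: integrable_pos_fin_num.
have fn : (\int[nu]_y ((EFin \o f)^\- y))%E \is a fin_num by exact: integrable_neg_fin_num.
rewrite -(fineK fp) -(fineK fn) -!EFinM -!EFinB/= -mulrBr mulrA mulfV ?mul1r// gt_eqF//.
Qed.

Lemma lebesgue_affine (c b : R) (A : set (measurableTypeR R)) : 0 < c -> measurable A ->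
  (c%:E * lebesgue_measure ((fun t : measurableTypeR R => (c * t + b)%R : measurableTypeR R) @^-1` A) =
   lebesgue_measure A)%E.
Proof.
move=> c0 mA; set phi := (fun t : measurableTypeR R => _).
have mphi : measurable_fun setT phi.
  apply: continuous_measurable_fun => t; apply: cvgD; last exact: cvg_cst.
  by apply: cvgMl_tmp; exact: cvg_id.
symmetry.
pose m : {measure set (measurableTypeR R) -> \bar R} :=
  mscale (NngNum (ltW c0)) (pushforward lebesgue_measure (phi : measurableTypeR R -> measurableTypeR R)).
have -> : (c%:E * lebesgue_measure (phi @^-1` A) = m mphi A)%E by [].
apply: (@lebesgue_measure_unique R (m mphi) _ A) => // X [[a e]] _ <-.
rewrite /m /= /mscale/= /pushforward.
have -> : phi @^-1` `]a, e]%classic = `](a - b) / c, (e - b) / c]%classic.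
  apply/seteqP; split => t /=; rewrite !in_itv/= ltr_pdivrMr// ler_pdivlMr// ltrBlDr lerBrDr.
    by rewrite /phi (mulrC c).
  by rewrite /phi (mulrC c).
rewrite !lebesgue_measure_itv/= !lte_fin.
rewrite ltr_pM2r ?invr_gt0// ltrD2r; case: ifPn => // _; last by rewrite mule0.
by rewrite -!EFinB -EFinM -mulrBl mulrC divfK ?gt_eqF//; congr EFin; ring.
Qed.

End image_measures.

Section lebesgue_rn.
Context {R : realType} {n : nat}.
Notation mu := (@lebesgue_rV R n).
Implicit Types (x : 'rV[R]_n).

Definition box (A : 'I_n -> set (measurableTypeR R)) : set 'rV[R]_n :=
  [set x | forall i, A i (x ord0 i)].

Lemma measurable_box A : (forall i, measurable (A i)) -> measurable (box A).
Proof.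
move=> mA; rewrite (_ : box A = \bigcap_(i in [set: 'I_n])
    ((fun v : 'rV[R]_n => v ord0 i) @^-1` A i)); last first.
  by apply/seteqP; split => [v H i _|v H i]; exact: H.
apply: fin_bigcap_measurable => // i _.
by rewrite -[X in measurable X]setTI; exact: measurable_rV_coord.
Qed.

Definition boxes : set (set 'rV[R]_n) := [set box A | A in [set A | forall i, measurable (A i)]].

Lemma boxes_generate : (measurable : set (set 'rV[R]_n)) = <<s boxes >>.
Proof.
apply/seteqP; split => A.
  apply: smallest_sub; first exact: smallest_sigma_algebra.
  rewrite -bigcup_seq => B [i _ [C mC <-]]; apply: sub_sigma_algebra.
  exists (fun k => if k == i then C else setT).
    by move=> k /=; case: ifP.
  rewrite setTI; apply/seteqP; split => x /=.
    by move=> /(_ i); rewrite eqxx.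
  by move=> Cx k; case: eqP => [->|].
apply: smallest_sub; first exact: sigma_algebra_measurable.
by move=> _ [B mB <-]; exact: measurable_box.
Qed.

Lemma measure_eq_boxes (m : {measure set 'rV[R]_n -> \bar R}) :
  (forall A, (forall i, measurable (A i)) -> m (box A) = mu (box A)) ->
  forall E, measurable E -> m E = mu E.
Proof.
move=> H.
pose g (k : nat) := box (fun=> `[- k%:R, k%:R]%classic : set (measurableTypeR R)).
have gbox k : boxes (g k) by eexists => //; move=> i; exact: measurable_itv.
have fing k : (mu (g k) < +oo)%E.
  rewrite lebesgue_rV_box; last by move=> i; exact: measurable_itv.
  rewrite lebesgue_measure_itv/=.
  have -> : (if ((- k%:R)%:E < (k%:R : R)%:E)%E then (k%:R%:E + (- - k%:R)%:E)%E else 0%E) = (k%:R + k%:R : R)%:E.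
    rewrite lte_fin opprK; case: ltP => // h.
    have k0 : (0 : R) <= k%:R by [].
    by congr EFin; lra.
  by rewrite prodEFin ltry.
apply: (@measure_unique _ R _ boxes g boxes_generate _ gbox).
- move=> _ _ [A mA <-] [B mB <-]; exists (fun i => A i `&` B i).
    by move=> i; exact: measurableI.
  by apply/seteqP; split => [x H'|x [H1 H2] i]; [split => i; have [] := H' i|split; [exact: H1|exact: H2]].
- apply/seteqP; split => // x _.
  have [N HN] : exists N : nat, enorm x <= N%:R.
    by exists (Num.truncn (enorm x)).+1; rewrite ltW// truncnS_gt.
  exists N => // i /=; rewrite in_itv/= -ler_norml.
  exact: le_trans (coord_le_enorm x i) HN.
- by move=> _ [A mA <-]; exact: H.
- by move=> k; rewrite /g H; [exact: fing|move=> i; exact: measurable_itv].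
Qed.

Lemma measurable_affine (c : R) x : measurable_fun setT (fun z : 'rV[R]_n => c *: z + x).
Proof.
apply: measurable_fun_rVP => i.
under eq_fun do rewrite !mxE.
apply: measurable_funD; last exact: measurable_cst.
by apply: measurable_funM; [exact: measurable_cst|exact: measurable_rV_coord].
Qed.

(** Both sides are measures, and they agree on boxes, where the formula reduces
    to one dimension. *)
Lemma lebesgue_rV_affine (c : R) x (A : set 'rV[R]_n) : 0 < c -> measurable A ->
  ((c ^+ n)%:E * mu ((fun z : 'rV[R]_n => (c *: z + x)%R) @^-1` A) = mu A)%E.
Proof.
move=> c0 mA; set phi := (fun z : 'rV[R]_n => _).
have mphi : measurable_fun setT phi := measurable_affine c x.
have cn0 : 0 <= c ^+ n by rewrite exprn_ge0// ltW.
have -> : ((c ^+ n)%:E * mu (phi @^-1` A) = mscale (NngNum cn0) (pushforward mu phi) A)%E by [].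
apply: measure_eq_boxes => // B mB; rewrite /= /mscale/= /pushforward.
have -> : phi @^-1` box B = box (fun i =>
    (fun t : measurableTypeR R => (c * t + x ord0 i)%R : measurableTypeR R) @^-1` B i).
  by apply/seteqP; split => z /= H i; have := H i; rewrite /phi !mxE.
rewrite !lebesgue_rV_box//; last first.
  move=> i; rewrite -[X in measurable X]setTI.
  have : measurable_fun setT (fun t : measurableTypeR R => (c * t + x ord0 i)%R : measurableTypeR R).
    apply: continuous_measurable_fun => t; apply: cvgD; last exact: cvg_cst.
    by apply: cvgMl_tmp; exact: cvg_id.
  by apply.
have -> : (c ^+ n)%:E = (\prod_(i < n) c%:E)%E.
  by rewrite prodEFin prodr_const card_ord.
by rewrite -big_split/=; apply: eq_bigr => i _; rewrite lebesgue_affine.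
Qed.

Lemma Rintegral_affine (c : R) x (f : 'rV[R]_n -> R) : 0 < c ->
  mu.-integrable setT (EFin \o f) ->
  mu.-integrable setT (EFin \o (fun z => f (c *: z + x))) /\
  c ^+ n * \int[mu]_z f (c *: z + x) = \int[mu]_z f z.
Proof.
move=> c0 intf.
apply: (@integral_image R _ _ _ _ mu mu (fun z => c *: z + x) (c ^+ n) f) => //.
- by rewrite exprn_gt0.
- exact: measurable_affine.
- by move=> A mA; exact: lebesgue_rV_affine.
Qed.

(** A continuous function is the limit of the step functions equal to its value
    at the lower corner of the cell of a finer and finer grid; such a cell is a
    box, hence measurable for the sigma-algebra generated by the coordinates. *)
Lemma continuous_measurable_rV (f : 'rV[R]_n -> R) : (forall x, {for x, continuous f}) ->
  measurable_fun setT f.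
Proof.
move=> cf.
pose fl (k : nat) x : 'rV[int]_n := \row_i Num.floor (k.+1%:R * x ord0 i).
pose gr (k : nat) (z : 'rV[int]_n) : 'rV[R]_n := \row_i ((z ord0 i)%:~R / k.+1%:R).
have mfl k z : measurable (fl k @^-1` [set z]).
  rewrite (_ : _ @^-1` _ = box (fun i => `[(z ord0 i)%:~R / k.+1%:R, ((z ord0 i) + 1)%:~R / k.+1%:R[%classic)).
    by apply: measurable_box => i; exact: measurable_itv.
  have k0 : (0 : R) < k.+1%:R by [].
  apply/seteqP; split => x /=.
    move=> E i; rewrite /= in_itv/= -E mxE ler_pdivrMr// ltr_pdivlMr// (mulrC (x ord0 i)).
    exact: floor_itv.
  move=> H; apply/rowP => i; rewrite mxE; apply: floor_def.
  by have := H i; rewrite /= in_itv/= ler_pdivrMr// ltr_pdivlMr// (mulrC (x ord0 i)).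
have mh k : measurable_fun setT (fun x => f (gr k (fl k x))).
  move=> _ Y mY; rewrite setTI.
  rewrite (_ : _ @^-1` _ = \bigcup_(z in [set z : 'rV[int]_n | Y (f (gr k z))]) (fl k @^-1` [set z])).
    rewrite bigcup_mkcond; apply: countable_bigcupT_measurable; first exact: countableP.
    by move=> z; case: ifP.
  apply/seteqP; split => x /=; first by move=> Yx; exists (fl k x).
  by move=> [z Yz /= ->].
apply: (measurable_fun_cvg (h := fun k x => f (gr k (fl k x)))) => // x _.
apply: (@cvg_comp _ _ _ (fun k => gr k (fl k x)) f); last exact: cf.
apply/cvgrPdist_le => e e0.
near=> k.
have ke : k.+1%:R^-1 <= e.
  by near: k; have := near_infty_natSinv_lt (PosNum e0); apply: filterS => k /ltW.
rewrite /Num.norm/= mx_normrE; apply/bigmax_leP; split; first exact: ltW.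
move=> [i j] _ /=; rewrite (ord1 i) !mxE.
have k0 : (0 : R) < k.+1%:R by [].
have /andP[h1 h2] := floor_itv (k.+1%:R * x ord0 j).
apply: le_trans ke; rewrite ler_norml.
set fx : R := (Num.floor _)%:~R in h1 *.
rewrite intrD -/fx in h2.
have -> : x ord0 j = k.+1%:R * x ord0 j / k.+1%:R by rewrite mulrC mulrA mulVf ?mul1r// gt_eqF.
rewrite mulr1z in h2.
apply/andP; split; rewrite -mulrBl.
  rewrite (_ : - k.+1%:R^-1 = (-1) / k.+1%:R); last by rewrite mulN1r.
  by rewrite ler_pM2r ?invr_gt0//; lra.
by rewrite -[leRHS]mul1r ler_pM2r ?invr_gt0//; lra.
Unshelve. all: by end_near. Qed.

End lebesgue_rn.

(** * Functions of moderate growth and integration by parts *)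

Section fubini_rn.
Context {R : realType}.
Notation leb := (@lebesgue_measure R).

Lemma ge0_integral_rV_cons n (F : 'rV[R]_n.+1 -> \bar R) : measurable_fun setT F ->
  (forall x, (0 <= F x)%E) ->
  (\int[lebesgue_rV n.+1]_x F x =
   \int[leb]_t \int[lebesgue_rV n]_v F (rV_cons (t, v)))%E.
Proof.
move=> mF F0.
have H A : measurable A -> (1%:E * (leb \x lebesgue_rV n)%E (@rV_cons R n @^-1` A) =
    lebesgue_rV n.+1 A)%E by rewrite mul1e.
rewrite -(ge0_integral_image ler01 (@measurable_rV_cons R n) H mF F0) mul1e.
have mFc : measurable_fun setT (F \o @rV_cons R n).
  by apply: measurableT_comp mF _; exact: measurable_rV_cons.
exact: (@fubini_tonelli1 _ _ _ _ R leb (lebesgue_rV n) (F \o @rV_cons R n) mFc (fun x => F0 _)).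
Qed.

Lemma measurable_tail n : measurable_fun setT (fun x : 'rV[R]_n.+1 => (rV_uncons x).2).
Proof. by apply: measurableT_comp; [exact: measurable_snd|exact: measurable_rV_uncons]. Qed.

Lemma integral_rV_prod n (f : R -> R) (g : 'rV[R]_n -> R) :
  leb.-integrable setT (EFin \o f) -> (lebesgue_rV n).-integrable setT (EFin \o g) ->
  (lebesgue_rV n.+1).-integrable setT
    (EFin \o (fun x : 'rV[R]_n.+1 => f (x ord0 ord0) * g (rV_uncons x).2)) /\
  \int[lebesgue_rV n.+1]_x (f (x ord0 ord0) * g (rV_uncons x).2) =
  (\int[leb]_t f t) * \int[lebesgue_rV n]_v g v.
Proof.
move=> intf intg.
have /integrableP[/measurable_EFinP mf finf] := intf.
have /integrableP[/measurable_EFinP mg fing] := intg.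
pose F (x : 'rV[R]_n.+1) := f (x ord0 ord0) * g (rV_uncons x).2.
have mF : measurable_fun setT F.
  apply: measurable_funM.
    exact: (measurableT_comp mf (measurable_rV_coord ord0)).
  exact: (measurableT_comp mg (@measurable_tail n)).
have Fcons t v : F (rV_cons (t, v)) = f t * g v.
  have E := rV_consK (t, v); rewrite /F E; congr (f _ * _).
  by rewrite /rV_cons mxE unlift_none.
have iF : (lebesgue_rV n.+1).-integrable setT (EFin \o F).
  apply/integrableP; split; first exact/measurable_EFinP.
  rewrite ge0_integral_rV_cons//; last by apply: measurableT_comp => //; exact/measurable_EFinP.
  under eq_integral => t _.
    under eq_integral => v _ do rewrite /= Fcons normrM EFinM.
    rewrite ge0_integralZl//; last exact/measurable_EFinP/measurableT_comp.
    over.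
  rewrite ge0_integralZr//; last by apply: integral_ge0.
    by rewrite lte_mul_pinfty// ?integral_ge0// ge0_fin_numE// integral_ge0.
  by apply/measurable_EFinP/measurableT_comp.
split => //.
have H A : measurable A -> (1%:E * (leb \x lebesgue_rV n)%E (@rV_cons R n @^-1` A) =
    lebesgue_rV n.+1 A)%E by rewrite mul1e.
have [iFc E] := integral_image ltr01 (@measurable_rV_cons R n) H iF.
rewrite -[LHS]E mul1r /Rintegral -(integral12_prod_meas1 iFc).
have Ft t : fubini_F (lebesgue_rV n) (EFin \o (F \o (@rV_cons R n))) t =
    (f t * \int[lebesgue_rV n]_v g v)%:E.
  rewrite /fubini_F; under eq_integral => v _ do rewrite /= Fcons EFinM.
  rewrite integralZl// EFinM /Rintegral fineK//; exact: integrable_fin_num.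
transitivity (\int[leb]_t (f t * \int[lebesgue_rV n]_v g v)); last exact: RintegralZr.
by congr fine; apply: eq_integral => t _; exact: Ft.
Qed.

Lemma integrable_powR_half (p : R) : 1 < p ->
  (\int[leb]_(x in `[0%R, +oo[) ((1 + x) `^ (- p))%:E < +oo)%E.
Proof.
move=> p1; pose F (x : R) := - (p - 1)^-1 * (1 + x) `^ (1 - p).
have D (x : R) : -1 < x -> is_derive x (1 : R) F ((1 + x) `^ (- p)).
  move=> x1; have x0 : 0 < 1 + x by rewrite -ltrBlDl sub0r.
  have D1 : is_derive x (1 : R) (fun y => 1 + y) 1.
    rewrite -[X in is_derive _ _ _ X]add0r.
    exact: (is_derive_add (is_derive_const 1 x (1 : R)) (is_derive_id x (1 : R))).
  have := is_derive_cmul (- (p - 1)^-1) (@is_derive1_comp _ (fun y => y `^ (1 - p)) _ x _ _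
    (is_derive1_powR (1 - p) x0) D1).
  rewrite (_ : - (p - 1)^-1 * _ = (1 + x) `^ (- p))//.
  rewrite mulr1 (_ : 1 - p - 1 = - p); last by ring.
  by field; rewrite subr_eq0 gt_eqF.
rewrite (@ge0_continuous_FTC2y _ _ F 0 0).
- by rewrite -EFinB ltry.
- by move=> x _; exact: powR_ge0.
- apply: derivable_within_continuous => x; rewrite in_itv/= andbT => x0.
  have x1 : 0 < 1 + x by rewrite ltr_pwDl.
  have D1 : is_derive x (1 : R) (fun y => 1 + y) 1.
    rewrite -[X in is_derive _ _ _ X]add0r.
    exact: (is_derive_add (is_derive_const 1 x (1 : R)) (is_derive_id x (1 : R))).
  by have [] := @is_derive1_comp _ (fun y => y `^ (- p)) _ x _ _ (is_derive1_powR (- p) x1) D1.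
- rewrite -(mulr0 (- (p - 1)^-1)); apply: cvgMl_tmp.
  apply/cvgrPdist_le => e e0; near=> x.
  have x0 : 0 <= x by near: x; exact: nbhs_pinfty_ge.
  have x1 : 0 < 1 + x by rewrite ltr_pwDl.
  rewrite sub0r normrN ger0_norm ?powR_ge0//.
  have xe : e `^ (1 - p)^-1 <= x by near: x; apply: nbhs_pinfty_ge; exact: num_real.
  have -> : e = (e `^ (1 - p)^-1) `^ (1 - p).
    by rewrite -powRrM mulVf ?powRr1 ?(ltW e0)// lt_eqF//; lra.
  rewrite -[1 - p]opprK !(powRN _ (- (1 - p))) lef_pV2 ?posrE ?powR_gt0 ?(powR_gt0 _ e0)//.
  rewrite ge0_ler_powR ?nnegrE ?powR_ge0 ?(ltW x1)//; last by rewrite opprK (le_trans xe)// lerDr.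
  by lra.
- by move=> x x0; have [] := D x (lt_trans (ltrN10 _) x0).
- apply: cvg_at_right_filter; exact: (derive_continuous (D 0 (ltrN10 _))).
- by move=> x; rewrite in_itv/= andbT derive1E => x0; have [_ ->] := D x (lt_trans (ltrN10 _) x0).
Unshelve. all: by end_near. Qed.

Lemma setT_half : [set x | (0 <= x)%R] = `[0%R, +oo[%classic :> set R.
Proof. by apply/seteqP; split => x /=; rewrite in_itv/= andbT. Qed.

Lemma integrable_powR (p : R) : 1 < p ->
  leb.-integrable setT (EFin \o (fun t => (1 + `|t|) `^ (- p))).
Proof.
move=> p1.
have cf : continuous (fun t : R => (1 + `|t|) `^ (- p)).
  move=> t; have t0 : 0 < 1 + `|t| by rewrite ltr_pwDl.
  apply: (@continuous_comp _ _ _ (fun t : R => 1 + `|t|) (fun y => y `^ (- p))).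
    by apply: cvgD; [exact: cvg_cst|exact: norm_continuous].
  exact: (derive_continuous (is_derive1_powR (- p) t0)).
apply/integrableP; split; first by apply/measurable_EFinP; exact: continuous_measurable_fun.
under eq_integral => t _ do rewrite /= ger0_norm ?powR_ge0//.
rewrite ge0_symfun_integralT//; last by move=> t /=; rewrite normrN.
rewrite setT_half lte_mul_pinfty//.
apply: le_lt_trans (integrable_powR_half p1); rewrite le_eqVlt; apply/orP; left.
apply/eqP; apply: eq_integral.
by move=> x; rewrite inE/= in_itv/= andbT => x0; rewrite ger0_norm.
Qed.

Lemma integrable_prod_powR (p : R) n : 1 < p ->
  (lebesgue_rV n).-integrable setT (EFin \o (fun x : 'rV[R]_n => \prod_(j < n) (1 + `|x ord0 j|) `^ (- p))).
Proof.
move=> p1; elim: n => [|n IH].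
  rewrite (_ : _ \o _ = cst 1%:E); last by apply/funext => x /=; rewrite big_ord0.
  apply/integrableP; split; first exact: measurable_cst.
  by rewrite integral_cst//= normr1 mul1e diracT ltry.
have [H _] := integral_rV_prod (integrable_powR p1) IH.
rewrite (_ : (fun x => _) = (fun x : 'rV[R]_n.+1 => (1 + `|x ord0 ord0|) `^ (- p) *
   \prod_(j < n) (1 + `|(rV_uncons x).2 ord0 j|) `^ (- p)))//.
apply/funext => x; rewrite big_ord_recl; congr (_ * _); apply: eq_bigr => j _.
by rewrite /rV_uncons/= mxE.
Qed.

End fubini_rn.

Section moderate.
Context {R : realType} {n : nat}.
Notation mu := (@lebesgue_rV R n).
Implicit Types (f g : 'rV[R]_n -> R) (x : 'rV[R]_n).

Definition wt (M : R) x : R := (1 + enorm x) `^ M.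

Lemma wt_gt0 M x : 0 < wt M x.
Proof. by rewrite powR_gt0// oneDenorm_gt0. Qed.

Lemma wt_ge0 M x : 0 <= wt M x. Proof. exact: ltW (wt_gt0 M x). Qed.

Lemma wtD M M' x : wt M x * wt M' x = wt (M + M') x.
Proof. by rewrite /wt powRD// (gt_eqF (oneDenorm_gt0 x)) implybT. Qed.

Lemma wt0 x : wt 0 x = 1. Proof. by rewrite /wt powRr0. Qed.

Lemma wt_le M M' x : M <= M' -> wt M x <= wt M' x.
Proof. by move=> MM'; rewrite /wt ler_powR// lerDl enorm_ge0. Qed.

Lemma wt_neg_bound (C r : R) N x : (1 + dotp x x) ^+ N * r <= C -> 0 <= r ->
  r <= 2 ^+ N * C * wt (- N%:R) x.
Proof.
move=> h r0; have e0 := enorm_ge0 x; have w1 := oneDenorm_gt0 x.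
have h1 : 1 + enorm x <= 2 * (1 + dotp x x) by rewrite -sqr_enorm; nra.
have d0 : 0 < 1 + dotp x x by rewrite ltr_pwDl ?dotp_ge0.
rewrite /wt powRN powR_mulrn ?(ltW w1)// ler_pdivlMr ?exprn_gt0//.
apply: (@le_trans _ _ (r * (2 * (1 + dotp x x)) ^+ N)).
  by rewrite ler_wpM2l// lerXn2r ?nnegrE ?mulr_ge0 ?(ltW w1) ?(ltW d0).
by rewrite exprMn mulrCA ler_wpM2l ?exprn_ge0// mulrC.
Qed.

Lemma oneDenorm_continuous x : {for x, continuous (fun y : 'rV[R]_n => 1 + enorm y)}.
Proof.
have H := @enorm_continuous R n x; have H1 := @cst_continuous 'rV[R]_n R 1 x.
exact: (continuousD H1 H).
Qed.

(** Since |x_j| <= |x|, the weight is at most a product of powers of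
    the 1 + |x_j|, and M < - n leaves each of them an exponent below - 1. *)
Lemma integrable_wt (M : R) : M < - n%:R -> mu.-integrable setT (EFin \o wt M).
Proof.
move=> Mn.
have [p p1 pn] : exists2 p : R, 1 < p & n%:R * p <= - M.
  have [n0|n0] := eqVneq n 0%N.
    by exists 2; [lra|rewrite n0 mul0r; move: Mn; rewrite n0; lra].
  have n1 : 0 < n%:R :> R by rewrite ltr0n lt0n.
  exists (- M / n%:R); last by rewrite mulrC divfK ?gt_eqF.
  by rewrite ltr_pdivlMr// mul1r; lra.
apply: (integrable_le measurableT) (@integrable_prod_powR R p n p1) _.
  apply: continuous_measurable_rV => x.
  apply: (@continuous_comp _ _ _ (fun y : 'rV[R]_n => 1 + enorm y) (fun y => y `^ M)).
    exact: oneDenorm_continuous.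
  exact: (derive_continuous (is_derive1_powR M (oneDenorm_gt0 x))).
move=> x _; rewrite ger0_norm ?wt_ge0//.
have -> : \prod_(j < n) (1 + `|x ord0 j|) `^ (- p) = (\prod_(j < n) (1 + `|x ord0 j|) `^ p)^-1.
  by rewrite -prodfV; apply: eq_bigr => j _; rewrite powRN.
rewrite /wt -[M]opprK powRN lef_pV2 ?posrE ?powR_gt0 ?oneDenorm_gt0//; last first.
  by apply: prodr_gt0 => j _; rewrite powR_gt0// ltr_pwDl.
apply: (@le_trans _ _ (\prod_(j < n) (1 + enorm x) `^ p)).
  apply: ler_prod => j _; rewrite powR_ge0/= ge0_ler_powR ?nnegrE ?addr_ge0 ?enorm_ge0 ?(le_trans ler01 (ltW p1))//.
  by rewrite lerD2l coord_le_enorm.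
rewrite prodr_const card_ord -powR_mulrn ?powR_ge0// -powRrM mulrC.
by rewrite ler_powR// lerDl enorm_ge0.
Qed.

Notation tcl := (cls [set: 'rV[R]_n] (fun=> 1)).

Lemma T_ge0 : forall x, [set: 'rV[R]_n] x -> 0 <= (1 : R). Proof. by []. Qed.

Lemma tcl_partial k M f j : tcl k.+1 (wt M) f -> tcl k (wt M) (partial j f).
Proof.
move=> /(cls_partial j); apply: (cls_weight_le T_ge0) => x _.
by rewrite mul1r.
Qed.

Lemma tcl_weaken k M M' f : M <= M' -> tcl k (wt M) f -> tcl k (wt M') f.
Proof. by move=> MM'; apply: (cls_weight_le T_ge0) => x _; exact: wt_le. Qed.

Lemma tcl_mul k M M' f g : tcl k (wt M) f -> tcl k (wt M') g ->
  tcl k (wt (M + M')) (fun x => f x * g x).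
Proof.
move=> Hf Hg; apply: (cls_weight_le T_ge0) (cls_mul openT T_ge0 Hf Hg) => x _.
by rewrite wtD.
Qed.

Lemma tcl_add k M f g : tcl k (wt M) f -> tcl k (wt M) g ->
  tcl k (wt M) (fun x => f x + g x).
Proof. exact: (cls_add openT). Qed.

Lemma tcl_opp k M f : tcl k (wt M) f -> tcl k (wt M) (fun x => - f x).
Proof. exact: (cls_opp openT T_ge0). Qed.

Lemma tcl_cmul k M (c : R) f : tcl k (wt M) f -> tcl k (wt M) (fun x => c * f x).
Proof. exact: (cls_cmul openT T_ge0). Qed.

Lemma tcl_sum k M (I : Type) (r : seq I) (F : I -> 'rV[R]_n -> R) :
  (forall i, tcl k (wt M) (F i)) -> tcl k (wt M) (fun x => \sum_(i <- r) F i x).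
Proof. by apply: (cls_sum openT T_ge0) => y _; exact: wt_ge0. Qed.

Lemma tclSI k M f : cls0 setT (wt M) f ->
  (forall j, exists2 g, (forall x, is_derive x (delta_mx ord0 j) f (g x)) &
    tcl k (wt M) g) -> tcl k.+1 (wt M) f.
Proof.
move=> f0 H; apply: (clsSI openT f0) => j; have [g Dg Hg] := H j.
exists g; first by move=> x _; exact: Dg.
by apply: (cls_weight_le T_ge0) Hg => x _; rewrite mul1r.
Qed.

Lemma tcl_measurable k M f : tcl k (wt M) f -> measurable_fun setT f.
Proof.
by move=> /cls_cls0[cf _]; apply: continuous_measurable_rV => x; exact: cf.
Qed.

Lemma tcl_integrable k M f : M < - n%:R -> tcl k (wt M) f -> mu.-integrable setT (EFin \o f).
Proof.
move=> Mn Hf; have [cf [C C0 fC]] := cls_cls0 Hf.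
apply: (integrable_le measurableT (tcl_measurable Hf)
  (integrable_cmul measurableT C (integrable_wt Mn))).
by move=> x _; exact: fC.
Qed.

Lemma Rintegral_translate x f : mu.-integrable setT (EFin \o f) ->
  \int[mu]_z f (z + x) = \int[mu]_z f z.
Proof.
move=> /(Rintegral_affine x ltr01)[_]; rewrite expr1n mul1r => <-.
by apply: eq_Rintegral => z _; rewrite scale1r.
Qed.

Lemma integrable_translate x f : mu.-integrable setT (EFin \o f) ->
  mu.-integrable setT (EFin \o (fun z => f (z + x))).
Proof.
move=> /(Rintegral_affine x ltr01)[+ _].
by rewrite (_ : (fun z => _) = (fun z => f (z + x)))//; apply/funext => z; rewrite scale1r.
Qed.

Lemma wt_translate M (x z : 'rV[R]_n) : M <= 0 -> enorm x <= 1 ->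
  wt M (x + z) <= 4 `^ (- M) * wt M z.
Proof.
move=> M0 x1; have h := oneDenormD_le (- x) (x + z).
rewrite addKr enormN in h.
have h1 : (1 + enorm z) / 4 <= 1 + enorm (x + z).
  by have := enorm_ge0 (x + z); have := enorm_ge0 x; nra.
have pz := oneDenorm_gt0 z.
have pe := oneDenorm_gt0 (x + z).
rewrite /wt -[M]opprK !(powRN _ (- M)) opprK ler_pdivlMr ?powR_gt0// mulrC.
rewrite ler_pdivrMr ?powR_gt0// -powRM ?(ltW pe)// ge0_ler_powR ?nnegrE ?oppr_ge0 ?mulr_ge0 ?(ltW pe) ?(ltW pz)//.
by rewrite mulrC -ler_pdivrMr.
Qed.

Lemma enorm_delta j : enorm (delta_mx ord0 j : 'rV[R]_n) = 1.
Proof. by rewrite /enorm dotp_delta mxE !eqxx sqrtr1. Qed.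

(** By invariance under translations the integral of f (x + t e_j) does not
    depend on t; its derivative at t = 0 is the integral of the partial
    derivative. *)
Lemma integral_partial_eq0 M f j : M < - n%:R -> tcl 1 (wt M) f ->
  \int[mu]_x partial j f x = 0.
Proof.
move=> Mn Hf; have M0 : M <= 0 by rewrite ltW// (lt_le_trans Mn)// oppr_le0.
set ej : 'rV[R]_n := delta_mx ord0 j.
have intf := tcl_integrable Mn Hf.
have Hf1 := tcl_partial j Hf.
have [cf1 [C C0 f1C]] := cls_cls0 Hf1.
pose F (t : R) x := f (x + t *: ej).
have I0 : `]-1, 1[%classic (0 : R) by rewrite /= in_itv/= ltrN10 ltr01.
have D (t : R) x : is_derive t (1 : R) (F^~ x) (partial j f (x + t *: ej)).
  have := is_derive_line (cls_derive j Hf (I : [set: 'rV[R]_n] (t *: ej + x))).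
  rewrite (_ : (fun h => _) = F^~ x); last by apply/funext => h; rewrite /F addrC.
  by rewrite addrC.
have A1 t : `]-1, 1[%classic t -> mu.-integrable setT (EFin \o F t).
  by move=> _; exact: integrable_translate.
have A2 t x : `]-1, 1[%classic t -> setT x -> derivable (F^~ x) t 1.
  by move=> _ _; have [] := D t x.
pose G x := C * (4 `^ (- M) * wt M x).
have G0 x : 0 <= G x by rewrite !mulr_ge0 ?powR_ge0 ?wt_ge0.
have iG : mu.-integrable setT (EFin \o G).
  by do 2 apply: integrable_cmul measurableT _ _ _; exact: integrable_wt.
have PE t x : partial1of2 F t x = partial j f (x + t *: ej).
  by rewrite /partial1of2 derive1E; have [_ ->] := D t x.
have A3 t x : `]-1, 1[%classic t -> setT x -> `|partial1of2 F t x| <= G x.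
  rewrite /= in_itv/= -ltr_norml => t1 _; rewrite PE (le_trans (f1C _ I))// ler_wpM2l//.
  by rewrite addrC; apply: wt_translate => //; rewrite enormZ enorm_delta mulr1 ltW.
have E := differentiation_under_integral measurableT I0 A1 A2 G0 iG A3.
have -> : \int[mu]_x partial j f x = \int[mu]_x partial1of2 F 0 x.
  by apply: eq_Rintegral => x _; rewrite PE scale0r addr0.
rewrite -E (_ : (fun t => _) = cst (\int[mu]_x f x)).
  by rewrite derive1_cst.
by apply/funext => t; rewrite -[RHS](Rintegral_translate (t *: ej) intf).
Qed.

End moderate.
Notation tcl := (cls [set: 'rV[_]_ _] (fun=> 1)).

(** * Poisson kernels *)

Section poisson.
Context {R : realType}.
Notation leb := (@lebesgue_measure R).
Notation half := (`[0, +oo[%classic : set R).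

Lemma Rintegral_reflect (f : R -> R) : leb.-integrable setT (EFin \o f) ->
  \int[leb]_t f (- t) = \int[leb]_t f t.
Proof.
move=> intf.
have mN : measurable_fun setT (-%R : measurableTypeR R -> measurableTypeR R).
  exact: oppr_measurable.
have H (A : set (measurableTypeR R)) : measurable A ->
    (1%:E * leb ((-%R : measurableTypeR R -> measurableTypeR R) @^-1` A) = leb A)%E.
  by move=> mA; rewrite mul1e -[RHS]lebesgue_measureN.
by have [_] := integral_image ltr01 mN H intf; rewrite mul1r.
Qed.

Lemma Rintegral_even (f : R -> R) : continuous f -> (forall t, 0 <= f t) ->
  (forall t, f (- t) = f t) -> leb.-integrable half (EFin \o f) ->
  leb.-integrable setT (EFin \o f) /\ \int[leb]_t f t = 2 * \int[leb]_(t in half) f t.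
Proof.
move=> cf f0 fe /integrableP[mf intf].
have E : (\int[leb]_t (f t)%:E = 2%:E * \int[leb]_(t in half) (f t)%:E)%E.
  rewrite ge0_symfun_integralT ?setT_half//.
  by move=> t /=; rewrite fe.
have fin : (\int[leb]_(t in half) (f t)%:E < +oo)%E.
  apply: le_lt_trans intf; rewrite le_eqVlt; apply/orP; left; apply/eqP.
  by apply: eq_integral => t _; rewrite /= ger0_norm.
split.
  apply/integrableP; split; first by apply/measurable_EFinP; exact: continuous_measurable_fun.
  under eq_integral => t _ do rewrite /= ger0_norm//.
  by rewrite E lte_mul_pinfty.
rewrite /Rintegral E fineM// ge0_fin_numE//; apply: integral_ge0 => t _.
by rewrite lee_fin.
Qed.

(** The cutoff of the Fourier integrals is exp (- e |t|), whose transform is an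
    explicit rational function: unlike the Gaussian it requires no more than an
    elementary primitive. *)
Definition pois (e t : R) : R := expR (- e * `|t|).

Lemma pois_continuous e : continuous (pois e).
Proof.
move=> t; apply: (@continuous_comp _ _ _ (fun t : R => `|t|) (fun s => expR (- e * s))).
  exact: norm_continuous.
exact: expR_lin_continuous.
Qed.

Lemma pois_gt0 e t : 0 < pois e t. Proof. exact: expR_gt0. Qed.

Lemma trig_lin_continuous (y : R) :
  continuous (fun t : R => cos (y * t)) /\ continuous (fun t : R => sin (y * t)).
Proof.
have H t : {for t, continuous (fun s : R => y * s)}.
  exact: (derive_continuous (is_derive_lin y t)).
split=> t; (apply: (@continuous_comp _ _ _ (fun s => y * s)); first exact: H).
  exact: continuous_cos.
exact: continuous_sin.
Qed.

(** The primitive is exp (- e t) (y sin (y t) - e cos (y t)) / (e^2 + y^2). *)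
Lemma pois_half (e y : R) : 0 < e ->
  leb.-integrable half (EFin \o (fun t => pois e t * cos (y * t))) /\
  \int[leb]_(t in half) (pois e t * cos (y * t)) = e / (e ^+ 2 + y ^+ 2).
Proof.
move=> e0; have d0 : 0 < e ^+ 2 + y ^+ 2 by rewrite ltr_pwDl ?exprn_gt0 ?sqr_ge0.
have ne0 : - e < 0 by rewrite oppr_lt0.
have [cc cs] := trig_lin_continuous y.
have cf : continuous (fun t : R => expR (- e * t) * cos (y * t)).
  move=> t; apply: (@continuousM _ _ (fun t : R => expR (- e * t)) (fun t => cos (y * t))).
    exact: expR_lin_continuous.
  exact: cc.
set f := (fun t : R => _) in cf.
have intf : leb.-integrable half (EFin \o f).
  apply: (integrable_le measurable_half) (integrable_expR ne0) _.
    by apply: continuous_measurable_on => //; exact: measurable_half.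
  by move=> t _; rewrite normrM gtr0_norm ?expR_gt0// ler_piMr ?expR_ge0 ?cos_max.
have Ef t : half t -> f t = pois e t * cos (y * t).
  by rewrite /= in_itv/= andbT /f /pois => t0; rewrite ger0_norm.
split.
  apply: eq_integrable intf => //.
  by move=> t /set_mem/Ef/= ->.
transitivity (\int[leb]_(t in half) f t).
  by apply: eq_Rintegral => t /set_mem/Ef.
pose F t := (e ^+ 2 + y ^+ 2)^-1 * (expR (- e * t) * (y * sin (y * t) + - e * cos (y * t))).
have DF t : is_derive t (1 : R) F (f t).
  have L := is_derive_lin y t.
  have Ds : is_derive t (1 : R) (fun s => sin (y * s)) (cos (y * t) * y).
    exact: (is_derive_compo (F := sin) (f := fun s => y * s) (is_derive_sin (y * t)) L).
  have Dc : is_derive t (1 : R) (fun s => cos (y * s)) (- sin (y * t) * y).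
    exact: (is_derive_compo (F := cos) (f := fun s => y * s) (is_derive_cos (y * t)) L).
  have := is_derive_cmul (e ^+ 2 + y ^+ 2)^-1 (is_derive_mul (is_derive_expR_lin (- e) t)
    (is_derive_add (is_derive_cmul y Ds) (is_derive_cmul (- e) Dc))).
  rewrite (_ : _ * (_ + _) = f t)// /f; field; exact: lt0r_neq0.
have F0 : F t @[t --> +oo] --> 0.
  pose C := (e ^+ 2 + y ^+ 2)^-1 * (`|y| + e).
  have C0 : 0 <= C by rewrite mulr_ge0 ?invr_ge0 ?(ltW d0)// addr_ge0 ?(ltW e0).
  have H : C * expR (- e * t) @[t --> +oo] --> 0.
    by rewrite -(mulr0 C); apply: cvgMl_tmp; exact: expR_lin_cvg0.
  have FC t : `|F t| <= C * expR (- e * t).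
    rewrite /F /C normrM gtr0_norm ?invr_gt0// -mulrA ler_wpM2l ?invr_ge0 ?(ltW d0)//.
    rewrite normrM gtr0_norm ?expR_gt0// mulrC ler_wpM2r ?expR_ge0//.
    apply: (le_trans (ler_normD _ _)); rewrite !normrM normrN (gtr0_norm e0).
    by apply: lerD; [rewrite ler_piMr ?sin_max|rewrite ler_piMr ?cos_max ?(ltW e0)].
  apply/cvgrPdist_le => d dd0; move/cvgrPdist_le : H => /(_ d dd0).
  apply: filterS => t; rewrite !sub0r !normrN => h.
  exact: le_trans (FC t) (le_trans (ler_norm _) h).
rewrite (half_line_FTC cf DF F0 intf) /F !mulr0 expR0 sin0 cos0.
by field; exact: lt0r_neq0.
Qed.

Lemma pois_integrable (e : R) : 0 < e -> leb.-integrable setT (EFin \o pois e).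
Proof.
move=> e0; have [H _] := pois_half 0 e0.
rewrite (_ : (fun t => _) = pois e) in H; last by apply/funext => t; rewrite mul0r cos0 mulr1.
have [|||//|] := @Rintegral_even (pois e).
- exact: pois_continuous.
- by move=> t; exact: ltW (pois_gt0 e t).
- by move=> t; rewrite /pois normrN.
- by [].
Qed.

Lemma pois_trig_integrable (e y : R) : 0 < e ->
  leb.-integrable setT (EFin \o (fun t => pois e t * cos (y * t))) /\
  leb.-integrable setT (EFin \o (fun t => pois e t * sin (y * t))).
Proof.
move=> e0; have [cc cs] := trig_lin_continuous y; split.
  apply: (integrable_le measurableT) (pois_integrable e0) _.
    by apply: continuous_measurable_fun => t; apply: continuousM; [exact: pois_continuous|exact: cc].
  by move=> t _; rewrite normrM gtr0_norm ?pois_gt0// ler_piMr ?(ltW (pois_gt0 _ _)) ?cos_max.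
apply: (integrable_le measurableT) (pois_integrable e0) _.
  by apply: continuous_measurable_fun => t; apply: continuousM; [exact: pois_continuous|exact: cs].
by move=> t _; rewrite normrM gtr0_norm ?pois_gt0// ler_piMr ?(ltW (pois_gt0 _ _)) ?sin_max.
Qed.

Lemma Rintegral_pois_sin (e y : R) : 0 < e -> \int[leb]_t (pois e t * sin (y * t)) = 0.
Proof.
move=> e0; have [_ H] := pois_trig_integrable y e0.
have := Rintegral_reflect H.
under eq_Rintegral => t _ do rewrite /pois normrN mulrN sinN mulrN -mulN1r.
rewrite RintegralZl// mulN1r => /eqP; rewrite -subr_eq0 -opprD oppr_eq0 -mulr2n mulrn_eq0/=.
by move/eqP.
Qed.

Lemma Rintegral_pois_cos (e y : R) : 0 < e ->
  \int[leb]_t (pois e t * cos (y * t)) = 2 * e / (e ^+ 2 + y ^+ 2).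
Proof.
move=> e0; have [cc _] := trig_lin_continuous y.
have [H HE] := pois_half y e0.
have [H0 H0E] := pois_half 0 e0.
have E0 : (fun t => pois e t * cos (0 * t)) = pois e by apply/funext => t; rewrite mul0r cos0 mulr1.
rewrite E0 in H0 H0E.
(* The symmetry principle for integrals asks for a nonnegative function, whence
   the factor 1 + cos. *)
pose g t := pois e t + pois e t * cos (y * t).
have gE t : g t = pois e t * (1 + cos (y * t)) by rewrite /g mulrDr mulr1.
have [||||G1 G2] := @Rintegral_even g.
- move=> t; apply: continuousD; first exact: pois_continuous.
  by apply: continuousM; [exact: pois_continuous|exact: cc].
- move=> t; rewrite gE mulr_ge0 ?(ltW (pois_gt0 _ _))//.
- by move=> t; rewrite /g /pois normrN mulrN cosN.
- apply: eq_integrable (integrableD measurable_half H0 H) => //; exact: measurable_half.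
have [|||//|_ P2] := @Rintegral_even (pois e).
- exact: pois_continuous.
- by move=> t; exact: ltW (pois_gt0 e t).
- by move=> t; rewrite /pois normrN.
move: G2; rewrite /g RintegralD//; first last.
- by have [] := pois_trig_integrable y e0.
- exact: pois_integrable.
have -> := RintegralD measurable_half H0 H.
by rewrite P2 HE; lra.
Qed.

Lemma Rintegral_oneDsqr : leb.-integrable setT (EFin \o (fun t : R => 2 / (1 + t ^+ 2))) /\
  \int[leb]_t (2 / (1 + t ^+ 2)) = 2 * pi.
Proof.
have E (t : R) : (oneDsqr t)^-1 = (1 + t ^+ 2)^-1 by [].
have d0 (t : R) : 0 < 1 + t ^+ 2 by rewrite ltr_pwDl ?sqr_ge0.
have c : continuous (fun t : R => (1 + t ^+ 2)^-1) by exact: continuous_oneDsqrV.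
have I : (\int[leb]_(t in half) `|((1 + t ^+ 2)^-1)%:E| = (pi / 2)%:E)%E.
  rewrite -integral0y_oneDsqr; apply: eq_integral => t _ /=.
  by rewrite ger0_norm ?invr_ge0 ?(ltW (d0 _)).
have Hh : leb.-integrable half (EFin \o (fun t : R => (1 + t ^+ 2)^-1)).
  apply/integrableP; split; last by rewrite I ltry.
  apply/measurable_EFinP.
  exact: (continuous_measurable_on c measurable_half).
have [|||//|H1 H2] := @Rintegral_even (fun t : R => (1 + t ^+ 2)^-1).
- exact: c.
- by move=> t; rewrite invr_ge0 (ltW (d0 _)).
- by move=> t; rewrite sqrrN.
split; first exact: integrable_cmul.
rewrite RintegralZl// H2 /Rintegral integral0y_oneDsqr/=; by field.
Qed.

End poisson.

Section poisson_rn.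
Context {R : realType}.
Notation leb := (@lebesgue_measure R).

Definition pker (e : R) n (x : 'rV[R]_n) : R := \prod_(j < n) pois e (x ord0 j).

Lemma dotp_lin_continuous n (u x : 'rV[R]_n) : {for x, continuous (fun y : 'rV[R]_n => dotp u y)}.
Proof.
apply: continuous_sum => i; apply: continuousM; first exact: cst_continuous.
exact: coord_continuous.
Qed.

Lemma dotp_trig_continuous n (u x : 'rV[R]_n) :
  {for x, continuous (fun y : 'rV[R]_n => cos (dotp u y))} /\
  {for x, continuous (fun y : 'rV[R]_n => sin (dotp u y))}.
Proof.
split.
  apply: (@continuous_comp _ _ _ (fun y : 'rV[R]_n => dotp u y) (@cos R)).
    exact: dotp_lin_continuous.
  exact: continuous_cos.
apply: (@continuous_comp _ _ _ (fun y : 'rV[R]_n => dotp u y) (@sin R)).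
  exact: dotp_lin_continuous.
exact: continuous_sin.
Qed.

Lemma pker_gt0 e n (x : 'rV[R]_n) : 0 < pker e x.
Proof. by apply: prodr_gt0 => j _; exact: pois_gt0. Qed.

Lemma pkerS e n (x : 'rV[R]_n.+1) : pker e x = pois e (x ord0 ord0) * pker e (rV_uncons x).2.
Proof.
rewrite /pker big_ord_recl; congr (_ * _); apply: eq_bigr => j _.
by rewrite /rV_uncons/= mxE.
Qed.

Lemma dotpS n (u x : 'rV[R]_n.+1) :
  dotp u x = u ord0 ord0 * x ord0 ord0 + dotp (rV_uncons u).2 (rV_uncons x).2.
Proof.
rewrite /dotp big_ord_recl; congr (_ + _); apply: eq_bigr => j _.
by rewrite /rV_uncons/= !mxE.
Qed.

Lemma pker_integrable e n : 0 < e ->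
  (lebesgue_rV n).-integrable setT (EFin \o (fun x : 'rV[R]_n => pker e x)).
Proof.
move=> e0; elim: n => [|n IH].
  rewrite (_ : _ \o _ = cst 1%:E); last by apply/funext => x /=; rewrite /pker big_ord0.
  apply/integrableP; split; first exact: measurable_cst.
  by rewrite integral_cst//= normr1 mul1e diracT ltry.
have [H _] := integral_rV_prod (pois_integrable e0) IH.
by rewrite (_ : (fun x => _) = (fun x : 'rV[R]_n.+1 => pois e (x ord0 ord0) * pker e (rV_uncons x).2))//;
  apply/funext => x; rewrite pkerS.
Qed.

Lemma pker_measurable e n : measurable_fun setT (fun x : 'rV[R]_n => pker e x).
Proof.
apply: measurable_prod => j _.
apply: (measurableT_comp _ (measurable_rV_coord j)).
exact: (continuous_measurable_fun (@pois_continuous R e)).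
Qed.

Lemma pker_trig_integrable e n (u : 'rV[R]_n) : 0 < e ->
  (lebesgue_rV n).-integrable setT (EFin \o (fun x : 'rV[R]_n => pker e x * cos (dotp u x))) /\
  (lebesgue_rV n).-integrable setT (EFin \o (fun x : 'rV[R]_n => pker e x * sin (dotp u x))).
Proof.
move=> e0; split; apply: (integrable_le measurableT) (pker_integrable n e0) _.
- apply: measurable_funM; first exact: pker_measurable.
  by apply: continuous_measurable_rV => x; have [] := dotp_trig_continuous u x.
- by move=> x _; rewrite normrM gtr0_norm ?pker_gt0// ler_piMr ?cos_max// ltW ?pker_gt0.
- apply: measurable_funM; first exact: pker_measurable.
  by apply: continuous_measurable_rV => x; have [] := dotp_trig_continuous u x.
- by move=> x _; rewrite normrM gtr0_norm ?pker_gt0// ler_piMr ?sin_max// ltW ?pker_gt0.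
Qed.

Lemma Rintegral_rV0 (f : 'rV[R]_0 -> R) : \int[lebesgue_rV 0]_x f x = f 0.
Proof.
have -> : f = cst (f 0) by apply/funext => x; congr f; apply/rowP; case.
have E : @lebesgue_rV R 0 [set: 'rV[R]_0] = 1%E by exact: diracT.
rewrite Rintegral_cst//; transitivity (f 0 * fine (1%E : \bar R)); last by rewrite mulr1.
by congr (_ * fine _); exact: E.
Qed.

(** The addition formulas separate the first coordinate from the others, and the
    sine integrals vanish by symmetry. *)
Lemma Rintegral_pker e n (u : 'rV[R]_n) : 0 < e ->
  \int[lebesgue_rV n]_x (pker e x * cos (dotp u x)) =
    \prod_(j < n) (2 * e / (e ^+ 2 + u ord0 j ^+ 2)) /\
  \int[lebesgue_rV n]_x (pker e x * sin (dotp u x)) = 0.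
Proof.
move=> e0; elim: n u => [|n IH] u.
  by rewrite !Rintegral_rV0 /pker /dotp !big_ord0 cos0 sin0 mulr1 mulr0.
have [IHc IHs] := IH (rV_uncons u).2.
have [ic is_] := pker_trig_integrable (rV_uncons u).2 e0.
have [jc js] := pois_trig_integrable (u ord0 ord0) e0.
have [i1 E1] := integral_rV_prod jc ic.
have [i2 E2] := integral_rV_prod js is_.
have [i3 E3] := integral_rV_prod js ic.
have [i4 E4] := integral_rV_prod jc is_.
split.
  under eq_Rintegral => x _.
    rewrite pkerS dotpS cosD (_ : _ * (_ - _) =
      pois e (x ord0 ord0) * cos (u ord0 ord0 * x ord0 ord0) *
        (pker e (rV_uncons x).2 * cos (dotp (rV_uncons u).2 (rV_uncons x).2)) -
      pois e (x ord0 ord0) * sin (u ord0 ord0 * x ord0 ord0) *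
        (pker e (rV_uncons x).2 * sin (dotp (rV_uncons u).2 (rV_uncons x).2))); last by ring.
  over.
  rewrite RintegralB// E1 E2 IHc IHs mulr0 subr0 Rintegral_pois_cos// big_ord_recl.
  by congr (_ * _); apply: eq_bigr => j _; rewrite /rV_uncons/= mxE.
under eq_Rintegral => x _.
  rewrite pkerS dotpS sinD (_ : _ * (_ + _) =
    pois e (x ord0 ord0) * sin (u ord0 ord0 * x ord0 ord0) *
      (pker e (rV_uncons x).2 * cos (dotp (rV_uncons u).2 (rV_uncons x).2)) +
    pois e (x ord0 ord0) * cos (u ord0 ord0 * x ord0 ord0) *
      (pker e (rV_uncons x).2 * sin (dotp (rV_uncons u).2 (rV_uncons x).2))); last by ring.
over.
by rewrite RintegralD// E3 E4 IHs Rintegral_pois_sin// mul0r mulr0 addr0.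
Qed.

(** The transform of the product of Laplace densities at e = 1: an approximate
    identity in x after scaling by e. *)
Definition cauchy n (z : 'rV[R]_n) : R := \prod_(j < n) (2 / (1 + z ord0 j ^+ 2)).

Lemma cauchy_integral n : (lebesgue_rV n).-integrable setT (EFin \o @cauchy n) /\
  \int[lebesgue_rV n]_z cauchy z = (2 * pi) ^+ n.
Proof.
elim: n => [|n [IH IHE]].
  split; last by rewrite Rintegral_rV0 /cauchy big_ord0.
  rewrite (_ : _ \o _ = cst 1%:E); last by apply/funext => x /=; rewrite /cauchy big_ord0.
  apply/integrableP; split; first exact: measurable_cst.
  by rewrite integral_cst//= normr1 mul1e diracT ltry.
have [H HE] := @Rintegral_oneDsqr R.
have E : @cauchy n.+1 = (fun x : 'rV[R]_n.+1 => 2 / (1 + x ord0 ord0 ^+ 2) * cauchy (rV_uncons x).2).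
  apply/funext => x; rewrite /cauchy big_ord_recl; congr (_ * _); apply: eq_bigr => j _.
  by rewrite /rV_uncons/= mxE.
have [K KE] := integral_rV_prod H IH.
by rewrite E; split=> //; rewrite KE HE IHE exprS.
Qed.

Lemma cauchy_ge0 n (z : 'rV[R]_n) : 0 <= cauchy z.
Proof. by apply: prodr_ge0 => j _; rewrite divr_ge0// addr_ge0 ?sqr_ge0. Qed.

End poisson_rn.

Section product_integrable.
Context {R : realType} {n : nat}.
Notation mu := (@lebesgue_rV R n).

Lemma integrable_prod2 (f g : 'rV[R]_n -> R) :
  mu.-integrable setT (EFin \o f) -> mu.-integrable setT (EFin \o g) ->
  (mu \x mu)%E.-integrable setT (EFin \o (fun z : 'rV[R]_n * 'rV[R]_n => f z.1 * g z.2)).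
Proof.
move=> /integrableP[/measurable_EFinP mf finf] /integrableP[/measurable_EFinP mg fing].
have mfg : measurable_fun setT (EFin \o (fun z : 'rV[R]_n * 'rV[R]_n => f z.1 * g z.2)).
  apply/measurable_EFinP; apply: measurable_funM.
    exact: (measurableT_comp mf measurable_fst).
  exact: (measurableT_comp mg measurable_snd).
apply/(integrable12ltyP mu mu mfg).
under eq_integral => t _.
  under eq_integral => v _ do rewrite /= normrM EFinM.
  rewrite ge0_integralZl//; last exact/measurable_EFinP/measurableT_comp.
  over.
rewrite ge0_integralZr//; last by apply: integral_ge0.
  by rewrite lte_mul_pinfty// ?integral_ge0// ge0_fin_numE// integral_ge0.
by apply/measurable_EFinP/measurableT_comp.
Qed.

End product_integrable.

(** * Fourier integrals and their inversion *)

Section fourier.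
Context {R : realType} {n : nat}.
Notation mu := (@lebesgue_rV R n).
Implicit Types (f g W : 'rV[R]_n -> R) (x y xi : 'rV[R]_n).

Lemma dotpBl x y xi : dotp (x - y) xi = dotp x xi - dotp y xi.
Proof. by rewrite dotpDl -scaleN1r dotpZl mulN1r. Qed.

Section fixed_x.
Variable x : 'rV[R]_n.

(** The inner integral of the Weyl quantization, with the phase (x - y) . xi
    rather than y . xi; its real and imaginary parts are kept apart, the
    densities being real. *)
Definition fcos W xi : R := \int[mu]_y (cos (dotp (x - y) xi) * W y).
Definition fsin W xi : R := \int[mu]_y (sin (dotp (x - y) xi) * W y).

Lemma phase_continuous xi y : {for y, continuous (fun y : 'rV[R]_n => dotp (x - y) xi)}.
Proof.
rewrite (_ : (fun y => _) = (fun y => dotp x xi - dotp xi y)); last first.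
  by apply/funext => z; rewrite dotpBl (dotpC z).
apply: (@continuousB _ _ _ (fun=> dotp x xi) (fun y : 'rV[R]_n => dotp xi y)).
  exact: cst_continuous.
exact: dotp_lin_continuous.
Qed.

Lemma phase_derive xi y j :
  is_derive y (delta_mx ord0 j) (fun y : 'rV[R]_n => dotp (x - y) xi) (- xi ord0 j).
Proof.
rewrite (_ : (fun y => _) = (fun y => dotp x xi + - (\sum_(k < n) xi ord0 k * y ord0 k))); last first.
  by apply/funext => z; rewrite dotpBl (dotpC z).
rewrite -[X in is_derive _ _ _ X]add0r.
apply: is_derive_add.
apply: is_derive_opp.
have -> : xi ord0 j = \sum_(k < n) xi ord0 k * (delta_mx ord0 j : 'rV[R]_n) ord0 k.
  by rewrite -[RHS]/(dotp xi (delta_mx ord0 j)) dotp_delta.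
by apply: is_derive_bigsum => k; apply: is_derive_cmul; exact: is_derive_coord.
Qed.

Lemma phase_trig_derive xi y j :
  is_derive y (delta_mx ord0 j) (fun y : 'rV[R]_n => cos (dotp (x - y) xi))
    (xi ord0 j * sin (dotp (x - y) xi)) /\
  is_derive y (delta_mx ord0 j) (fun y : 'rV[R]_n => sin (dotp (x - y) xi))
    (- xi ord0 j * cos (dotp (x - y) xi)).
Proof.
have P := phase_derive xi y j; split.
  rewrite (_ : xi ord0 j * _ = - sin (dotp (x - y) xi) * - xi ord0 j); last by ring.
  exact: (is_derive_compo (F := cos) (f := fun y : 'rV[R]_n => dotp (x - y) xi) (is_derive_cos _) P).
rewrite (_ : - xi ord0 j * _ = cos (dotp (x - y) xi) * - xi ord0 j); last by ring.
exact: (is_derive_compo (F := sin) (f := fun y : 'rV[R]_n => dotp (x - y) xi) (is_derive_sin _) P).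
Qed.

Lemma phase_trig_cls0 xi :
  cls0 [set: 'rV[R]_n] (wt 0) (fun y : 'rV[R]_n => cos (dotp (x - y) xi)) /\
  cls0 [set: 'rV[R]_n] (wt 0) (fun y : 'rV[R]_n => sin (dotp (x - y) xi)).
Proof.
split; split.
- move=> y _; apply: (@continuous_comp _ _ _ (fun y : 'rV[R]_n => dotp (x - y) xi) (@cos R)).
    exact: phase_continuous.
  exact: continuous_cos.
- by exists 1 => // y _; rewrite wt0 mulr1 cos_max.
- move=> y _; apply: (@continuous_comp _ _ _ (fun y : 'rV[R]_n => dotp (x - y) xi) (@sin R)).
    exact: phase_continuous.
  exact: continuous_sin.
- by exists 1 => // y _; rewrite wt0 mulr1 sin_max.
Qed.

Lemma phase_trig_tcl xi :
  tcl 1 (wt 0) (fun y : 'rV[R]_n => cos (dotp (x - y) xi)) /\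
  tcl 1 (wt 0) (fun y : 'rV[R]_n => sin (dotp (x - y) xi)).
Proof.
have [Hc Hs] := phase_trig_cls0 xi.
split; apply: tclSI => // j.
- exists (fun y => xi ord0 j * sin (dotp (x - y) xi)).
    by move=> y; have [] := phase_trig_derive xi y j.
  exact: (tcl_cmul (k := 0)).
- exists (fun y => - xi ord0 j * cos (dotp (x - y) xi)).
    by move=> y; have [] := phase_trig_derive xi y j.
  exact: (tcl_cmul (k := 0)).
Qed.

Section rapid.
Variables (M : R).
Hypothesis Mn : M < - n%:R.

Lemma fourier_integrable W xi : tcl 0 (wt M) W ->
  mu.-integrable setT (EFin \o (fun y => cos (dotp (x - y) xi) * W y)) /\
  mu.-integrable setT (EFin \o (fun y => sin (dotp (x - y) xi) * W y)).
Proof.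
move=> HW; have [Hc Hs] := phase_trig_cls0 xi.
split; apply: (tcl_integrable (k := 0) Mn); rewrite -[M]add0r; exact: (tcl_mul (k := 0)).
Qed.

(** The integral over y of the derivative of a product vanishes. *)
Lemma fourier_partial W xi j : tcl 1 (wt M) W ->
  xi ord0 j * fsin W xi = - fcos (partial j W) xi /\
  xi ord0 j * fcos W xi = fsin (partial j W) xi.
Proof.
move=> HW; have [Hc Hs] := phase_trig_tcl xi.
have HW0 : tcl 0 (wt M) W := clsS HW.
have HdW : tcl 0 (wt M) (partial j W) := tcl_partial j HW.
have [ic is_] := fourier_integrable xi HW0.
have [dc ds] := fourier_integrable xi HdW.
have Pc := tcl_mul Hc HW; have Ps := tcl_mul Hs HW.
rewrite add0r in Pc Ps.
have Ic := integral_partial_eq0 j Mn Pc; have Is := integral_partial_eq0 j Mn Ps.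
split.
  apply/eqP; rewrite -addr_eq0; apply/eqP; rewrite -[RHS]Ic /fsin /fcos.
  rewrite -RintegralZl// -RintegralD//; last exact: integrable_cmul.
  apply: eq_Rintegral => y _; have [D _] := phase_trig_derive xi y j.
  have [_ E] := is_derive_mul D (cls_derive j HW (I : [set: 'rV[R]_n] y)).
  by rewrite [RHS]E mulrA.
apply/eqP; rewrite eq_sym -subr_eq0; apply/eqP; rewrite -[RHS]Is /fsin /fcos.
rewrite -RintegralZl// -RintegralB//; last exact: integrable_cmul.
apply: eq_Rintegral => y _; have [_ D] := phase_trig_derive xi y j.
have [_ E] := is_derive_mul D (cls_derive j HW (I : [set: 'rV[R]_n] y)).
by rewrite [RHS]E; ring.
Qed.

Lemma fourier_partial2 W xi j k : tcl 2 (wt M) W ->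
  xi ord0 j * xi ord0 k * fcos W xi = - fcos (partial j (partial k W)) xi /\
  xi ord0 j * xi ord0 k * fsin W xi = - fsin (partial j (partial k W)) xi.
Proof.
move=> HW; have HW1 : tcl 1 (wt M) W := clsS HW.
have [A1 A2] := fourier_partial xi k HW1.
have [B1 B2] := fourier_partial xi j (tcl_partial k HW).
move: (fcos W xi) (fsin W xi) (fcos (partial k W) xi) (fsin (partial k W) xi) A1 A2 B1 B2.
move=> F G F1 G1 A1 A2 B1 B2; split; first by rewrite -mulrA A2.
by rewrite -mulrA A1 mulrN B2.
Qed.

Lemma fourier_bounded W : tcl 0 (wt M) W -> exists2 C : R, 0 <= C &
  forall xi, `|fcos W xi| <= C /\ `|fsin W xi| <= C.
Proof.
move=> HW; have [cW [C C0 WC]] := cls_cls0 HW.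
have iC := integrable_cmul measurableT C (integrable_wt Mn).
have bd (tr : R -> R) xi : (forall t, `|tr t| <= 1) ->
    mu.-integrable setT (EFin \o (fun y => tr (dotp (x - y) xi) * W y)) ->
    `|\int[mu]_y (tr (dotp (x - y) xi) * W y)| <= \int[mu]_y (C * wt M y).
  move=> tr1 /integrableP[/measurable_EFinP mf _].
  apply: (Rintegral_le_bound measurableT mf iC) => y _.
  by rewrite normrM (le_trans _ (WC y I))// ler_piMl.
exists (\int[mu]_y (C * wt M y)).
  by apply: Rintegral_ge0 => y _; rewrite mulr_ge0 ?wt_ge0.
move=> xi; have [ic is_] := fourier_integrable xi HW.
by split; apply: bd => //; [exact: cos_max|exact: sin_max].
Qed.

Lemma fourier_continuous W : tcl 0 (wt M) W ->
  (forall xi, {for xi, continuous (fcos W)}) /\ (forall xi, {for xi, continuous (fsin W)}).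
Proof.
move=> HW; have [cW [C C0 WC]] := cls_cls0 HW.
have iC := integrable_cmul measurableT C (integrable_wt Mn).
have ct (tr : R -> R) : (forall t, `|tr t| <= 1) -> continuous tr ->
    (forall xi, mu.-integrable setT (EFin \o (fun y => tr (dotp (x - y) xi) * W y))) ->
    forall xi, {for xi, continuous (fun xi => \int[mu]_y (tr (dotp (x - y) xi) * W y))}.
  move=> tr1 ctr itr xi; apply: sequential_continuous => u uxi.
  apply: (Rintegral_dominated measurableT _ _ iC) => [k|y _|k y _].
  - by have /integrableP[/measurable_EFinP] := itr (u k).
  - apply: cvgM; last exact: cvg_cst.
    apply: (cvg_comp (fun k => dotp (x - y) (u k)) tr); last exact: ctr.
    exact: (cvg_comp u (fun z : 'rV[R]_n => dotp (x - y) z) uxi (@dotp_lin_continuous R n (x - y) xi)).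
  - by rewrite normrM (le_trans _ (WC y I))// ler_piMl.
split; apply: ct.
- exact: cos_max.
- exact: continuous_cos.
- by move=> xi; have [] := fourier_integrable xi HW.
- exact: sin_max.
- exact: continuous_sin.
- by move=> xi; have [] := fourier_integrable xi HW.
Qed.

(** The operator 1 - Laplacian, moved to the phase by parts, multiplies it
    by 1 + |xi|^2. *)
Lemma fourier_laplace W xi : tcl 2 (wt M) W ->
  let V := fun y => W y + - (\sum_(j < n) partial j (partial j W) y) in
  tcl 0 (wt M) V /\
  (1 + dotp xi xi) * fcos W xi = fcos V xi /\ (1 + dotp xi xi) * fsin W xi = fsin V xi.
Proof.
move=> HW V; have HW0 : tcl 0 (wt M) W := cls_leq (leq0n 2) HW.
have HD j : tcl 0 (wt M) (partial j (partial j W)) by do 2 apply: tcl_partial.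
have HS : tcl 0 (wt M) (fun y => \sum_(j < n) partial j (partial j W) y).
  exact: (tcl_sum (k := 0)).
split; first by apply: (tcl_add (k := 0)) => //; exact: (tcl_opp (k := 0)).
have [ic is_] := fourier_integrable xi HW0.
have [sc ss] := fourier_integrable xi HS.
have [S1 S2] := Rintegral_sum measurableT (index_enum 'I_n) (fun j => (fourier_integrable xi (HD j)).1).
have [T1 T2] := Rintegral_sum measurableT (index_enum 'I_n) (fun j => (fourier_integrable xi (HD j)).2).
split.
  rewrite /fcos (_ : \int[mu]_y (_ * V y) = \int[mu]_y (cos (dotp (x - y) xi) * W y -
     cos (dotp (x - y) xi) * (\sum_(j < n) partial j (partial j W) y))); last first.
    by apply: eq_Rintegral => y _; rewrite /V mulrDr mulrN.
  rewrite RintegralB// mulrDl mul1r; congr (_ + _).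
  rewrite (_ : \int[mu]_y (_ * \sum_(j < n) _) = \int[mu]_y (\sum_(j < n)
     cos (dotp (x - y) xi) * partial j (partial j W) y)); last first.
    by apply: eq_Rintegral => y _; rewrite mulr_sumr.
  rewrite S2 -sumrN /dotp mulr_suml; apply: eq_bigr => j _.
  by have [] := fourier_partial2 xi j j HW.
rewrite /fsin (_ : \int[mu]_y (_ * V y) = \int[mu]_y (sin (dotp (x - y) xi) * W y -
   sin (dotp (x - y) xi) * (\sum_(j < n) partial j (partial j W) y))); last first.
  by apply: eq_Rintegral => y _; rewrite /V mulrDr mulrN.
rewrite RintegralB// mulrDl mul1r; congr (_ + _).
rewrite (_ : \int[mu]_y (_ * \sum_(j < n) _) = \int[mu]_y (\sum_(j < n)
   sin (dotp (x - y) xi) * partial j (partial j W) y)); last first.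
  by apply: eq_Rintegral => y _; rewrite mulr_sumr.
rewrite T2 -sumrN /dotp mulr_suml; apply: eq_bigr => j _.
by have [] := fourier_partial2 xi j j HW.
Qed.

Lemma fourier_decay k W : tcl k.*2 (wt M) W -> exists2 C : R, 0 <= C &
  forall xi, (1 + dotp xi xi) ^+ k * `|fcos W xi| <= C /\ (1 + dotp xi xi) ^+ k * `|fsin W xi| <= C.
Proof.
elim: k W => [|k IH] W HW.
  by have [C C0 H] := fourier_bounded HW; exists C => // xi; rewrite !mul1r.
have HW2 : tcl 2 (wt M) W by apply: cls_leq HW; rewrite doubleS.
have HV : tcl k.*2 (wt M) (fun y => W y + - (\sum_(j < n) partial j (partial j W) y)).
  rewrite doubleS in HW; apply: tcl_add.
    by apply: cls_leq HW; rewrite -addn2 leq_addr.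
  apply: tcl_opp; apply: tcl_sum => j.
  by do 2 apply: tcl_partial.
have [C C0 H] := IH _ HV; exists C => // xi.
have [_ [E1 E2]] := fourier_laplace xi HW2.
have d0 : 0 <= 1 + dotp xi xi by rewrite addr_ge0 ?dotp_ge0.
by rewrite exprSr -!mulrA -{2 4}(ger0_norm d0) -!normrM E1 E2.
Qed.

(** n + 1 applications of 1 - Laplacian give a decay of order 2 n + 2, more than
    enough to integrate in xi. *)
Lemma fourier_L1 W : tcl n.+1.*2 (wt M) W ->
  mu.-integrable setT (EFin \o fcos W) /\ mu.-integrable setT (EFin \o fsin W).
Proof.
move=> HW; have [C C0 H] := fourier_decay HW.
have HW0 : tcl 0 (wt M) W := cls_leq (leq0n _) HW.
have [cc cs] := fourier_continuous HW0.
have w : - n.+1%:R < - n%:R :> R by rewrite ltrN2 ltr_nat.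
have iw := integrable_cmul measurableT (2 ^+ n.+1 * C) (integrable_wt w).
split; apply: (integrable_le measurableT _ iw).
- exact: continuous_measurable_rV.
- by move=> z _; exact: wt_neg_bound (H z).1 _.
- exact: continuous_measurable_rV.
- by move=> z _; exact: wt_neg_bound (H z).2 _.
Qed.

End rapid.

End fixed_x.

End fourier.

Section inversion.
Context {R : realType} {n : nat}.
Notation mu := (@lebesgue_rV R n).
Implicit Types (f g W : 'rV[R]_n -> R) (x y xi : 'rV[R]_n).

Lemma Rintegral_swap (F : 'rV[R]_n * 'rV[R]_n -> R) :
  (mu \x mu)%E.-integrable setT (EFin \o F) ->
  (forall y, mu.-integrable setT (EFin \o (fun xi => F (y, xi)))) ->
  (forall xi, mu.-integrable setT (EFin \o (fun y => F (y, xi)))) ->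
  mu.-integrable setT (EFin \o (fun y => \int[mu]_xi F (y, xi))) /\
  \int[mu]_y \int[mu]_xi F (y, xi) = \int[mu]_xi \int[mu]_y F (y, xi).
Proof.
move=> iF i1 i2.
have E1 : (EFin \o (fun y => \int[mu]_xi F (y, xi))) =
    (fun y => \int[mu]_xi (EFin \o F) (y, xi))%E.
  by apply/funext => y /=; rewrite /Rintegral fineK//; exact: integrable_fin_num (i1 y).
have E2 : (EFin \o (fun xi => \int[mu]_y F (y, xi))) =
    (fun xi => \int[mu]_y (EFin \o F) (y, xi))%E.
  by apply/funext => xi /=; rewrite /Rintegral fineK//; exact: integrable_fin_num (i2 xi).
split; first by rewrite E1; exact: (integrable_fubini_F iF).
rewrite /Rintegral; congr fine.
transitivity (\int[mu]_y \int[mu]_xi (EFin \o F) (y, xi))%E; first by rewrite -E1.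
by rewrite (Fubini iF) -E2.
Qed.

Lemma phase_measurable x :
  measurable_fun setT (fun z : 'rV[R]_n * 'rV[R]_n => dotp (x - z.1) z.2).
Proof.
apply: measurable_sum => j; apply: measurable_funM.
  rewrite (_ : (fun z => _) = (fun z : 'rV[R]_n * 'rV[R]_n => x ord0 j - z.1 ord0 j)); last first.
    by apply/funext => z; rewrite !mxE.
  apply: measurable_funB; first exact: measurable_cst.
  exact: (measurableT_comp (measurable_rV_coord j) measurable_fst).
exact: (measurableT_comp (measurable_rV_coord j) measurable_snd).
Qed.

Lemma pkerE e x : pker e x = expR (- e * \sum_(j < n) `|x ord0 j|).
Proof. by rewrite mulr_sumr expR_sum. Qed.

Section regularized.
Variables (M : R) (W : 'rV[R]_n -> R) (x : 'rV[R]_n) (e : R).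
Hypotheses (Mn : M < - n%:R) (HW : tcl 0 (wt M) W) (e0 : 0 < e).

Lemma phase_product_integrable (tr : R -> R) : (forall t, `|tr t| <= 1) -> continuous tr ->
  (mu \x mu)%E.-integrable setT (EFin \o (fun z : 'rV[R]_n * 'rV[R]_n =>
    pker e z.2 * (tr (dotp (x - z.1) z.2) * W z.1))).
Proof.
move=> tr1 ctr; have [cW [C C0 WC]] := cls_cls0 HW.
have H := integrable_prod2 (integrable_cmul measurableT C (integrable_wt Mn)) (pker_integrable n e0).
apply: (integrable_le measurableT _ H).
  apply: measurable_funM.
    exact: (measurableT_comp (@pker_measurable R e n) measurable_snd).
  apply: measurable_funM.
    exact: (measurableT_comp (continuous_measurable_fun ctr) (phase_measurable x)).
  exact: (measurableT_comp (tcl_measurable HW) measurable_fst).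
move=> [y xi] _ /=; rewrite !normrM gtr0_norm ?pker_gt0// mulrC ler_wpM2r ?(ltW (pker_gt0 _ _))//.
by rewrite (le_trans _ (WC y I))// ler_piMl.
Qed.

(** With the factor exp (- e |xi_j|) the double integral converges absolutely,
    so that the order of integration can be exchanged; the inner integral is a
    product of Cauchy densities of width e around x, and the substitution
    y = x + e z makes the width 1. *)
Lemma regularized_inversion :
  \int[mu]_xi (pker e xi * fcos x W xi) = \int[mu]_z (W (e *: z + x) * cauchy z) /\
  \int[mu]_xi (pker e xi * fsin x W xi) = 0.
Proof.
have Pc := phase_product_integrable (@cos_max R) (@continuous_cos R).
have Ps := phase_product_integrable (@sin_max R) (@continuous_sin R).
have i1 y : mu.-integrable setT (EFin \o (fun xi => pker e xi * (cos (dotp (x - y) xi) * W y))) /\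
    \int[mu]_xi (pker e xi * (cos (dotp (x - y) xi) * W y)) =
      W y * \prod_(j < n) (2 * e / (e ^+ 2 + (x - y) ord0 j ^+ 2)).
  have [H _] := pker_trig_integrable (x - y) e0; have [K _] := Rintegral_pker (x - y) e0.
  rewrite (_ : (fun xi => _) = (fun xi => W y * (pker e xi * cos (dotp (x - y) xi)))); last first.
    by apply/funext => xi; ring.
  by split; [exact: integrable_cmul|rewrite RintegralZl// K].
have i2 y : mu.-integrable setT (EFin \o (fun xi => pker e xi * (sin (dotp (x - y) xi) * W y))) /\
    \int[mu]_xi (pker e xi * (sin (dotp (x - y) xi) * W y)) = 0.
  have [_ H] := pker_trig_integrable (x - y) e0; have [_ K] := Rintegral_pker (x - y) e0.
  rewrite (_ : (fun xi => _) = (fun xi => W y * (pker e xi * sin (dotp (x - y) xi)))); last first.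
    by apply/funext => xi; ring.
  by split; [exact: integrable_cmul|rewrite RintegralZl// K mulr0].
have j1 xi : mu.-integrable setT (EFin \o (fun y => pker e xi * (cos (dotp (x - y) xi) * W y))).
  by apply: integrable_cmul => //; have [] := fourier_integrable x Mn xi HW.
have j2 xi : mu.-integrable setT (EFin \o (fun y => pker e xi * (sin (dotp (x - y) xi) * W y))).
  by apply: integrable_cmul => //; have [] := fourier_integrable x Mn xi HW.
have [Fc Ec] := Rintegral_swap Pc (fun y => (i1 y).1) j1.
have [Fs Es] := Rintegral_swap Ps (fun y => (i2 y).1) j2.
have Dc xi : \int[mu]_y (pker e xi * (cos (dotp (x - y) xi) * W y)) = pker e xi * fcos x W xi.
  by rewrite RintegralZl//; have [] := fourier_integrable x Mn xi HW.
have Ds xi : \int[mu]_y (pker e xi * (sin (dotp (x - y) xi) * W y)) = pker e xi * fsin x W xi.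
  by rewrite RintegralZl//; have [] := fourier_integrable x Mn xi HW.
split; last first.
  rewrite -(eq_Rintegral _ (fun xi _ => Ds xi)) -Es.
  by rewrite [LHS]/Rintegral integral0_eq// => y _; congr EFin; exact: (i2 y).2.
rewrite -(eq_Rintegral _ (fun xi _ => Dc xi)) -Ec.
have [_ <-] := Rintegral_affine x e0 Fc.
rewrite -RintegralZl//; last by have [] := Rintegral_affine x e0 Fc.
apply: eq_Rintegral => z _; rewrite (i1 _).2 mulrCA; congr (_ * _).
rewrite -[n in e ^+ n]card_ord -prodr_const -big_split/=; apply: eq_bigr => j _.
rewrite !mxE opprD addrCA subrr addr0 sqrrN.
field.
have d0 : 0 < 1 + z ord0 j ^+ 2 by rewrite ltr_pwDl ?sqr_ge0.
rewrite (lt0r_neq0 d0) /= -[X in X + _]mulr1 exprMn -mulrDr mulf_neq0 ?lt0r_neq0//.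
by rewrite exprn_gt0.
Qed.

End regularized.

(** As e tends to 0, dominated convergence applies to both sides of the
    regularized formula: on the left because the transform is integrable, on the
    right because W is bounded and continuous. *)
Lemma fourier_inversion M W x : M < - n%:R -> tcl n.+1.*2 (wt M) W ->
  \int[mu]_xi fcos x W xi = (2 * pi) ^+ n * W x /\ \int[mu]_xi fsin x W xi = 0.
Proof.
move=> Mn HW; have HW0 : tcl 0 (wt M) W := cls_leq (leq0n _) HW.
have [ic is_] := fourier_L1 x Mn HW.
have [cc cs] := fourier_continuous x Mn HW0.
have [cW [C C0 WC]] := cls_cls0 HW0.
pose e k : R := k.+1%:R^-1.
have e0 k : 0 < e k by rewrite invr_gt0 ltr0n.
have ecvg : e k @[k --> \oo] --> 0 by exact: cvg_harmonic.
have pk1 xi : pker (e k) xi @[k --> \oo] --> (1 : R).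
  set S := \sum_(j < n) `|xi ord0 j|.
  have -> : (fun k => pker (e k) xi) = (fun k => expR (- e k * S)) by apply/funext => k; exact: pkerE.
  have H : - e k * S @[k --> \oo] --> (0 : R).
    by rewrite -(mul0r S) -oppr0; apply: cvgMr_tmp; exact: cvgN.
  by rewrite -expR0; apply: (cvg_comp (fun k => - e k * S) expR H); exact: continuous_expR.
have pkle k xi : pker (e k) xi <= 1.
  rewrite pkerE -expR0 ler_expR mulNr oppr_le0 mulr_ge0 ?(ltW (e0 _))//.
  by apply: sumr_ge0.
have L (r : 'rV[R]_n -> R) : (forall xi, {for xi, continuous r}) -> mu.-integrable setT (EFin \o r) ->
    \int[mu]_xi (pker (e k) xi * r xi) @[k --> \oo] --> \int[mu]_xi r xi.
  move=> cr ir.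
  apply: (Rintegral_dominated measurableT (g := fun xi => `|r xi|)) => [k|xi _||k xi _].
  - by apply: measurable_funM; [exact: pker_measurable|exact: continuous_measurable_rV].
  - by rewrite -[r xi in X in _ --> X]mul1r; apply: cvgMr_tmp; exact: pk1.
  - exact: (integrable_norm ir).
  - by rewrite normrM gtr0_norm ?pker_gt0// ler_piMl// pkle.
have Lc := L _ cc ic; have Ls := L _ cs is_.
have Rg k := regularized_inversion x Mn HW0 (e0 k).
split; last first.
  rewrite (_ : (fun k : nat => _) = cst (0 : R)) in Ls.
    exact: (cvg_unique _ Ls (@cvg_cst _ _ _ _ _)).
  by apply/funext => k; exact: (Rg k).2.
rewrite (_ : (fun k : nat => _) = (fun k => \int[mu]_z (W (e k *: z + x) * cauchy z))) in Lc; last first.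
  by apply/funext => k; exact: (Rg k).1.
apply: (cvg_unique _ Lc); rewrite //=.
have [ci cE] := @cauchy_integral R n.
rewrite -cE mulrC -RintegralZl//.
have WC1 y : `|W y| <= C.
  apply: (le_trans (WC y I)); rewrite ler_piMr//.
  have M0 : M <= 0 by rewrite ltW// (lt_le_trans Mn)// oppr_le0.
  by rewrite -(wt0 y); exact: wt_le.
apply: (Rintegral_dominated measurableT (g := fun z => C * cauchy z)) => [k|z _||k z _].
- apply: measurable_funM; last by have /integrableP[/measurable_EFinP] := ci.
  exact: (measurableT_comp (tcl_measurable HW0) (measurable_affine (e k) x)).
- apply: cvgM; last exact: cvg_cst.
  apply: (cvg_comp (fun k => e k *: z + x) W); last exact: (cW x I).
  have H : e k *: z + x @[k --> \oo] --> 0 *: z + x.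
    by apply: cvgD; [exact: cvgZr_tmp|exact: cvg_cst].
  by rewrite scale0r add0r in H.
- exact: integrable_cmul.
- by rewrite normrM (ger0_norm (cauchy_ge0 z)) ler_wpM2r ?cauchy_ge0.
Qed.

End inversion.

(** * Rapidly decreasing functions *)

Section rapid_decay.
Context {R : realType} {n : nat}.
Implicit Types (f g : 'rV[R]_n -> R) (x y : 'rV[R]_n).

Definition rapid f : Prop := forall k M, tcl k (wt M) f.

Lemma rapid_partial f j : rapid f -> rapid (partial j f).
Proof. by move=> Hf k M; apply: tcl_partial; exact: Hf. Qed.

Lemma rapid_derive f x j : rapid f -> is_derive x (delta_mx ord0 j) f (partial j f x).
Proof. by move=> Hf; exact: (cls_derive j (Hf 1%N 0) (I : [set: 'rV[R]_n] x)). Qed.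

Lemma rapid_mul k M M' f g : tcl k (wt M) f -> rapid g -> tcl k (wt M') (fun x => f x * g x).
Proof.
move=> Hf Hg; rewrite (_ : M' = M + (M' - M)); last by ring.
by apply: tcl_mul => //; exact: Hg.
Qed.

(** The form in which the Schwartz space expresses decay.  Bounds by
    powers of 1 + |x| follow since 1 + |x|^2 is a sum of monomials. *)
Definition monomially_bounded f : Prop := forall gamma : 'I_n -> nat,
  exists C : R, forall x, `|\prod_(j < n) x ord0 j ^+ gamma j| * `|f x| <= C.

Lemma monomially_bounded_mul f : monomially_bounded f ->
  monomially_bounded (fun x => (1 + dotp x x) * f x).
Proof.
move=> Hf gamma.
pose gam (i j : 'I_n) := (gamma j + (i == j).*2)%N.
have [C HC] := Hf gamma.
have /choice[D HD] : forall i, exists D : R, forall x,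
    `|\prod_(j < n) x ord0 j ^+ gam i j| * `|f x| <= D by move=> i; exact: Hf.
exists (C + \sum_(i < n) D i) => x.
have -> : `|\prod_(j < n) x ord0 j ^+ gamma j| * `|(1 + dotp x x) * f x| =
    `|\prod_(j < n) x ord0 j ^+ gamma j| * `|f x| +
    \sum_(i < n) `|\prod_(j < n) x ord0 j ^+ gam i j| * `|f x|.
  rewrite normrM ger0_norm ?addr_ge0 ?dotp_ge0// mulrDl mul1r mulrDr; congr (_ + _).
  rewrite /dotp mulr_suml mulr_sumr; apply: eq_bigr => i _.
  rewrite mulrA; congr (_ * _).
  have -> : \prod_(j < n) x ord0 j ^+ gam i j =
      (\prod_(j < n) x ord0 j ^+ gamma j) * (x ord0 i * x ord0 i).
    rewrite /gam; under eq_bigr => j _ do rewrite exprD.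
    rewrite big_split/=; congr (_ * _).
    rewrite (bigD1 i)//= eqxx big1 ?mulr1 ?expr2// => j ji.
    by rewrite eq_sym (negbTE ji).
  by rewrite normrM (ger0_norm (sqr_ge0 (x ord0 i))).
by apply: lerD => //; apply: ler_sum => i _; exact: HD.
Qed.

Lemma monomially_bounded_wt f M : monomially_bounded f ->
  exists2 C : R, 0 <= C & forall x, `|f x| <= C * wt M x.
Proof.
have H N g : monomially_bounded g -> exists C : R, forall x, (1 + dotp x x) ^+ N * `|g x| <= C.
  elim: N g => [|N IH] g Hg.
    have [C HC] := Hg (fun=> 0%N); exists C => x; apply: le_trans (HC x).
    by rewrite expr0 big1// normr1.
  have [C HC] := IH _ (monomially_bounded_mul Hg); exists C => x; apply: le_trans (HC x).
  by rewrite exprSr -mulrA normrM (@ger0_norm _ (1 + _)) ?addr_ge0 ?dotp_ge0.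
move=> Hf; pose N := Num.bound `|M|.
have MN : - M <= N%:R.
  by rewrite (le_trans (ler_norm _))// normrN ltW// archi_boundP.
have [C HC] := H N f Hf.
have C0 : 0 <= C by apply: le_trans (HC 0); rewrite mulr_ge0 ?exprn_ge0 ?addr_ge0 ?dotp_ge0.
exists (2 ^+ N * C); first by rewrite mulr_ge0 ?exprn_ge0.
move=> x; apply: (le_trans (wt_neg_bound (HC x) (normr_ge0 _))).
rewrite ler_wpM2l ?mulr_ge0 ?exprn_ge0//; apply: wt_le; lra.
Qed.

Lemma tcl_smooth k M f : smooth f ->
  (forall s, exists2 C : R, 0 <= C & forall x, `|foldr partial f s x| <= C * wt M x) ->
  tcl k (wt M) f.
Proof.
move=> sf Hf; apply: (@cls_smooth _ _ _ _ k (fun=> wt M) f sf) => //.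
- by move=> i x _; rewrite mul1r.
- by move=> s; have [C C0 HC] := Hf s; exists C => // x _; exact: HC.
- exact: openT.
Qed.

Lemma tcl_symbol k m f : smooth f -> symbol_bound m f -> tcl k (wt m) f.
Proof.
move=> sf Hf; apply: tcl_smooth => // s; rewrite foldr_partial_multi//.
have [C [C0 HC]] := Hf (fun j => count_mem j s); exists C; first exact: ltW.
move=> x; apply: (le_trans (HC x)); rewrite ler_wpM2l ?(ltW C0)//.
by apply: wt_le; rewrite gerBl.
Qed.

Lemma normc_ge_parts (z : R[i]) :
  `|complex.Re z| <= ComplexField.Normc.normc z /\ `|complex.Im z| <= ComplexField.Normc.normc z.
Proof.
case: z => p q /=; rewrite -!sqrtr_sqr; split; apply: ler_wsqrtr.
  by rewrite lerDl sqr_ge0.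
by rewrite lerDr sqr_ge0.
Qed.

Lemma schwartz_rapid (u : 'rV[R]_n -> R[i]) : schwartz u ->
  rapid (fun x => complex.Re (u x)) /\ rapid (fun x => complex.Im (u x)).
Proof.
move=> [[s1 s2] H]; split=> k M; apply: tcl_smooth => // s;
  apply: monomially_bounded_wt => gamma; have [C HC] := H (fun j => count_mem j s) gamma;
  exists C => x; apply: le_trans (HC x); rewrite ler_wpM2l// foldr_partial_multi//.
- by have [+ _] := normc_ge_parts (cmulti_partial (fun j => count_mem j s) u x).
- by have [_ +] := normc_ge_parts (cmulti_partial (fun j => count_mem j s) u x).
Qed.

End rapid_decay.

Section midpoint.
Context {R : realType} {n : nat}.
Implicit Types (f g : 'rV[R]_n -> R) (x y : 'rV[R]_n).

(** The argument (x + y) / 2 of the coefficients in the Weyl quantization; it is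
    differentiated in y, at fixed x. *)
Definition midpt x f y := f (2^-1 *: (x + y)).

Lemma is_derive_midpt x f df y j :
  is_derive (2^-1 *: (x + y)) (delta_mx ord0 j) f df ->
  is_derive y (delta_mx ord0 j) (midpt x f) (2^-1 * df).
Proof.
move/is_derive_lineP => D; apply/is_derive_lineP.
have L := is_derive_lin 2^-1 (0 : R).
rewrite (_ : (fun h => _) = (fun k => f (k *: delta_mx ord0 j + 2^-1 *: (x + y))) \o (fun h : R => 2^-1 * h)); last first.
  apply/funext => h; rewrite /midpt /=; congr f.
  by rewrite addrCA scalerDr scalerA addrC.
rewrite mulrC; apply: is_derive_compo L; by rewrite mulr0.
Qed.

Lemma midpt_diag x f : midpt x f x = f x.
Proof. by rewrite /midpt scalerDr -scalerDl (_ : 2^-1 + 2^-1 = 1 :> R) ?scale1r//; lra. Qed.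

Lemma tcl_midpt k M x f : 0 <= M -> tcl k (wt M) f -> tcl k (wt M) (midpt x f).
Proof.
move=> M0.
have W y : wt M (2^-1 *: (x + y)) <= (2 * (1 + enorm x)) `^ M * wt M y.
  have e0 := oneDenorm_gt0 x; have e1 := oneDenorm_gt0 y; have e2 := oneDenorm_gt0 (2^-1 *: (x + y)).
  rewrite /wt -powRM ?mulr_ge0 ?(ltW e0) ?(ltW e1)// ge0_ler_powR ?nnegrE ?(ltW e2) ?mulr_ge0 ?(ltW e0) ?(ltW e1)//.
  apply: le_trans (oneDenormD_le x y); rewrite lerD2l enormZ ger0_norm ?invr_ge0//.
  by rewrite ler_piMl ?enorm_ge0//; lra.
elim: k f => [|k IH] f Hf.
  have [cf [C C0 fC]] := cls_cls0 Hf; split.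
    move=> y _; apply: (@continuous_comp _ _ _ (fun y : 'rV[R]_n => 2^-1 *: (x + y)) f); last exact: cf.
    have h1 := @cst_continuous 'rV[R]_n 'rV[R]_n x y.
    have h2 : z @[z --> y] --> y by exact: cvg_id.
    have h : x + z @[z --> y] --> x + y by exact: (cvgD h1 h2).
    exact: (cvgZl_tmp h).
  exists (C * (2 * (1 + enorm x)) `^ M); first by rewrite mulr_ge0 ?powR_ge0.
  by move=> y _; rewrite -mulrA; apply: (le_trans (fC _ I)); rewrite ler_wpM2l.
apply: tclSI; first exact: cls_cls0 (IH _ (clsS Hf)).
move=> j; exists (fun y => 2^-1 * midpt x (partial j f) y).
  by move=> y; apply: is_derive_midpt; exact: (cls_derive j Hf).
by apply: tcl_cmul; apply: IH; exact: tcl_partial.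
Qed.

End midpoint.

(** * Weyl quantization of quadratic polynomials in the frequency *)

Lemma realC_mul {R : rcfType} (r p q : R) : (r%:C * (p +i* q) = (r * p) +i* (r * q))%C.
Proof.
transitivity ((r * p - 0 * q) +i* (r * q + 0 * p))%C; first by [].
by rewrite !mul0r subr0 addr0.
Qed.

Section rapid_algebra.
Context {R : realType} {n : nat}.
Notation mu := (@lebesgue_rV R n).
Implicit Types (f g W : 'rV[R]_n -> R) (x y xi : 'rV[R]_n).

Lemma rapid_add f g : rapid f -> rapid g -> rapid (fun x => f x + g x).
Proof. by move=> Hf Hg k M; apply: tcl_add; [exact: Hf|exact: Hg]. Qed.

Lemma rapid_opp f : rapid f -> rapid (fun x => - f x).
Proof. by move=> Hf k M; apply: tcl_opp; exact: Hf. Qed.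

Lemma rapid_cmul c f : rapid f -> rapid (fun x => c * f x).
Proof. by move=> Hf k M; apply: tcl_cmul; exact: Hf. Qed.

Lemma rapid_sum (I : Type) (r : seq I) (F : I -> 'rV[R]_n -> R) :
  (forall i, rapid (F i)) -> rapid (fun x => \sum_(i <- r) F i x).
Proof. by move=> HF k M; apply: tcl_sum => i; exact: HF. Qed.

Lemma wt_Sn : - n.+1%:R < - n%:R :> R.
Proof. by rewrite ltrN2 ltr_nat. Qed.

Section transform.
Variables (tr : R -> R) (x : 'rV[R]_n).
Hypotheses (tr1 : forall t, `|tr t| <= 1) (ctr : continuous tr).

Definition ftr W xi : R := \int[mu]_y (tr (dotp (x - y) xi) * W y).

Lemma ftr_integrable W xi : rapid W ->
  mu.-integrable setT (EFin \o (fun y => tr (dotp (x - y) xi) * W y)).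
Proof.
move=> HW; apply: (integrable_le measurableT _ (integrable_norm (tcl_integrable wt_Sn (HW 0%N _)))).
  apply: measurable_funM; last exact: tcl_measurable (HW 0%N 0).
  apply: continuous_measurable_rV => y.
  apply: (@continuous_comp _ _ _ (fun y : 'rV[R]_n => dotp (x - y) xi) tr).
    exact: phase_continuous.
  exact: ctr.
by move=> y _; rewrite normrM /= ler_piMl.
Qed.

Lemma ftr_add f g xi : rapid f -> rapid g ->
  ftr (fun y => f y + g y) xi = ftr f xi + ftr g xi.
Proof.
move=> Hf Hg; rewrite /ftr -RintegralD//; [|exact: ftr_integrable..].
by apply: eq_Rintegral => y _; rewrite mulrDr.
Qed.

Lemma ftr_cmul c f xi : rapid f -> ftr (fun y => c * f y) xi = c * ftr f xi.
Proof.
move=> Hf; rewrite /ftr -RintegralZl//; last exact: ftr_integrable.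
by apply: eq_Rintegral => y _; rewrite mulrCA.
Qed.

Lemma ftr_opp f xi : rapid f -> ftr (fun y => - f y) xi = - ftr f xi.
Proof.
move=> Hf; rewrite -mulN1r -ftr_cmul//; congr (ftr _ xi).
by apply/funext => y; rewrite mulN1r.
Qed.

Lemma ftr_sum (I : Type) (r : seq I) (F : I -> 'rV[R]_n -> R) xi : (forall i, rapid (F i)) ->
  ftr (fun y => \sum_(i <- r) F i y) xi = \sum_(i <- r) ftr (F i) xi.
Proof.
move=> HF; rewrite /ftr.
have [_ <-] := Rintegral_sum measurableT r (fun i => ftr_integrable xi (HF i)).
by apply: eq_Rintegral => y _; rewrite mulr_sumr.
Qed.

End transform.

Lemma inversion_rapid x W : rapid W ->
  [/\ mu.-integrable setT (EFin \o ftr cos x W), mu.-integrable setT (EFin \o ftr sin x W),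
   \int[mu]_xi ftr cos x W xi = (2 * pi) ^+ n * W x & \int[mu]_xi ftr sin x W xi = 0].
Proof.
move=> HW; have [I1 I2] := fourier_L1 x wt_Sn (HW _ _).
by have [E1 E2] := fourier_inversion x wt_Sn (HW _ _).
Qed.

Lemma phase_partial x W xi j : rapid W ->
  xi ord0 j * ftr sin x W xi = - ftr cos x (partial j W) xi /\
  xi ord0 j * ftr cos x W xi = ftr sin x (partial j W) xi.
Proof. by move=> HW; exact: (fourier_partial x wt_Sn xi j (HW _ _)). Qed.

Lemma phase_partial2 x W xi j k : rapid W ->
  xi ord0 j * xi ord0 k * ftr cos x W xi = - ftr cos x (partial j (partial k W)) xi /\
  xi ord0 j * xi ord0 k * ftr sin x W xi = - ftr sin x (partial j (partial k W)) xi.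
Proof. by move=> HW; exact: (fourier_partial2 x wt_Sn xi j k (HW _ _)). Qed.

End rapid_algebra.

Section weyl_formula.
Context {R : realType} {n : nat}.
Notation mu := (@lebesgue_rV R n).
Implicit Types (f g : 'rV[R]_n -> R) (x y xi : 'rV[R]_n).
Variables (a : 'I_n -> 'I_n -> 'rV[R]_n -> R) (b : 'I_n -> 'rV[R]_n -> R) (c : 'rV[R]_n -> R).
Variable (M0 : R).
Hypotheses (M00 : 0 <= M0) (Ta : forall j k l, tcl l (wt M0) (a j k))
  (Tb : forall j l, tcl l (wt M0) (b j)) (Tc : forall l, tcl l (wt M0) c).

Section at_x.
Variable x : 'rV[R]_n.

Definition Wa f j k y := midpt x (a j k) y * f y.
Definition Wb f j y := midpt x (b j) y * f y.
Definition Wc f y := midpt x c y * f y.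

Lemma rapid_W f : rapid f -> [/\ forall j k, rapid (Wa f j k), forall j, rapid (Wb f j) & rapid (Wc f)].
Proof.
move=> Hf; split=> [j k l M|j l M|l M].
- exact: (rapid_mul M (tcl_midpt x M00 (Ta j k l)) Hf).
- exact: (rapid_mul M (tcl_midpt x M00 (Tb j l)) Hf).
- exact: (rapid_mul M (tcl_midpt x M00 (Tc l)) Hf).
Qed.

(** The differential operators in y that the even and the odd part of the symbol
    in xi become after integration by parts, applied to the coefficients at the
    midpoint times the function.  They are used at y = x. *)
Definition wA f y := - (\sum_(j < n) \sum_(k < n) partial j (partial k (Wa f j k)) y) + Wc f y.
Definition wB f y := \sum_(j < n) partial j (Wb f j) y.

Lemma rapid_wA_wB f : rapid f -> rapid (wA f) /\ rapid (wB f).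
Proof.
move=> /rapid_W[Ha Hb Hc]; split.
  apply: rapid_add => //; apply: rapid_opp; do 2 apply: rapid_sum => ?.
  by do 2 apply: rapid_partial.
by apply: rapid_sum => j; exact: rapid_partial.
Qed.

Definition pot_mid f xi y := potential a b c (2^-1 *: (x + y)) xi * f y.

Lemma pot_midE f xi : pot_mid f xi = (fun y =>
  \sum_(j < n) \sum_(k < n) xi ord0 j * xi ord0 k * Wa f j k y
  + \sum_(j < n) xi ord0 j * Wb f j y + Wc f y).
Proof.
apply/funext => y; rewrite /pot_mid /potential !mulrDl !mulr_suml; congr (_ + _ + _).
  apply: eq_bigr => j _; rewrite mulr_suml; apply: eq_bigr => k _.
  by rewrite /Wa /midpt; ring.
by apply: eq_bigr => j _; rewrite /Wb /midpt; ring.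
Qed.

Lemma rapid_pot_mid f xi : rapid f -> rapid (pot_mid f xi).
Proof.
move=> /rapid_W[Ha Hb Hc]; rewrite pot_midE; apply: rapid_add => //; apply: rapid_add.
  by do 2 apply: rapid_sum => ?; apply: rapid_cmul.
by apply: rapid_sum => ?; apply: rapid_cmul.
Qed.

Lemma ftr_pot_mid tr f xi : (forall t, `|tr t| <= 1) -> continuous tr -> rapid f ->
  ftr tr x (pot_mid f xi) xi =
  \sum_(j < n) \sum_(k < n) xi ord0 j * xi ord0 k * ftr tr x (Wa f j k) xi
  + \sum_(j < n) xi ord0 j * ftr tr x (Wb f j) xi + ftr tr x (Wc f) xi.
Proof.
move=> tr1 ctr /rapid_W[Ha Hb Hc].
have H1 j : rapid (fun y => \sum_(k < n) xi ord0 j * xi ord0 k * Wa f j k y).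
  by apply: rapid_sum => k; exact: rapid_cmul.
have H2 j : rapid (fun y => xi ord0 j * Wb f j y) by exact: rapid_cmul.
rewrite pot_midE ftr_add//; last first.
  by apply: rapid_add; exact: rapid_sum.
rewrite ftr_add//; [|exact: rapid_sum..].
congr (_ + _ + _).
  rewrite ftr_sum//; apply: eq_bigr => j _.
  rewrite ftr_sum//; last by move=> k; exact: rapid_cmul.
  by apply: eq_bigr => k _; rewrite ftr_cmul.
by rewrite ftr_sum//; apply: eq_bigr => j _; rewrite ftr_cmul.
Qed.

Lemma ftr_wA tr f xi : (forall t, `|tr t| <= 1) -> continuous tr -> rapid f ->
  ftr tr x (wA f) xi =
  - (\sum_(j < n) \sum_(k < n) ftr tr x (partial j (partial k (Wa f j k))) xi) + ftr tr x (Wc f) xi.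
Proof.
move=> tr1 ctr /rapid_W[Ha Hb Hc].
have H1 j : rapid (fun y => \sum_(k < n) partial j (partial k (Wa f j k)) y).
  by apply: rapid_sum => k; do 2 apply: rapid_partial.
rewrite /wA ftr_add//; last by apply: rapid_opp; exact: rapid_sum.
rewrite ftr_opp//; last exact: rapid_sum.
congr (- _ + _); rewrite ftr_sum//; apply: eq_bigr => j _.
by rewrite ftr_sum// => k; do 2 apply: rapid_partial.
Qed.

Lemma ftr_wB tr f xi : (forall t, `|tr t| <= 1) -> continuous tr -> rapid f ->
  ftr tr x (wB f) xi = \sum_(j < n) ftr tr x (partial j (Wb f j)) xi.
Proof.
move=> tr1 ctr /rapid_W[Ha Hb Hc].
by rewrite /wB ftr_sum// => j; exact: rapid_partial.
Qed.

(** A factor xi_j under the transform becomes a derivative of the density; an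
    odd number of factors exchanges sine and cosine. *)
Lemma phase_potential f xi : rapid f ->
  ftr cos x (pot_mid f xi) xi = ftr cos x (wA f) xi + ftr sin x (wB f) xi /\
  ftr sin x (pot_mid f xi) xi = ftr sin x (wA f) xi - ftr cos x (wB f) xi.
Proof.
move=> Hf; have [Ha Hb Hc] := rapid_W Hf.
have cc := @continuous_cos R; have cs := @continuous_sin R.
split.
  rewrite (ftr_pot_mid _ (@cos_max R) cc Hf) (ftr_wA _ (@cos_max R) cc Hf) (ftr_wB _ (@sin_max R) cs Hf).
  rewrite addrAC; congr (_ + _ + _).
    rewrite -sumrN; apply: eq_bigr => j _; rewrite -sumrN; apply: eq_bigr => k _.
    exact: (phase_partial2 x xi j k (Ha j k)).1.
  by apply: eq_bigr => j _; exact: (phase_partial x xi j (Hb j)).2.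
rewrite (ftr_pot_mid _ (@sin_max R) cs Hf) (ftr_wA _ (@sin_max R) cs Hf) (ftr_wB _ (@cos_max R) cc Hf).
rewrite addrAC; congr (_ + _ + _).
  rewrite -sumrN; apply: eq_bigr => j _; rewrite -sumrN; apply: eq_bigr => k _.
  exact: (phase_partial2 x xi j k (Ha j k)).2.
by rewrite -sumrN; apply: eq_bigr => j _; exact: (phase_partial x xi j (Hb j)).1.
Qed.

(** The integral over xi inverts the Fourier integral over y, and leaves the
    value of the differentiated density at y = x. *)
Lemma weyl_parts (u : 'rV[R]_n -> R[i]) :
  rapid (fun y => complex.Re (u y)) -> rapid (fun y => complex.Im (u y)) ->
  weyl (potential a b c) u x =
  ((wA (fun y => complex.Re (u y)) x + wB (fun y => complex.Im (u y)) x)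
   +i* (wA (fun y => complex.Im (u y)) x - wB (fun y => complex.Re (u y)) x))%C.
Proof.
set u1 := fun y => complex.Re (u y); set u2 := fun y => complex.Im (u y) => H1 H2.
have cc := @continuous_cos R; have cs := @continuous_sin R.
have inner xi : cintegral (fun y => expi (dotp (x - y) xi) *
      (potential a b c (2^-1 *: (x + y)) xi)%:C%C * u y) =
    ((ftr cos x (wA u1) xi + ftr sin x (wB u1) xi - (ftr sin x (wA u2) xi - ftr cos x (wB u2) xi)) +i*
     (ftr sin x (wA u1) xi - ftr cos x (wB u1) xi + (ftr cos x (wA u2) xi + ftr sin x (wB u2) xi)))%C.
  have [<- <-] := phase_potential xi H1; have [<- <-] := phase_potential xi H2.
  rewrite /cintegral; congr (_ +i* _)%C; rewrite /ftr.
    rewrite -RintegralB//; [|apply: ftr_integrable => //; [exact: cos_max|exact: rapid_pot_mid]|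
      apply: ftr_integrable => //; [exact: sin_max|exact: rapid_pot_mid]].
    apply: eq_Rintegral => y _; rewrite /expi /pot_mid /u1 /u2; case: (u y) => p q /=; ring.
  rewrite -RintegralD//; [|apply: ftr_integrable => //; [exact: sin_max|exact: rapid_pot_mid]|
    apply: ftr_integrable => //; [exact: cos_max|exact: rapid_pot_mid]].
  apply: eq_Rintegral => y _; rewrite /expi /pot_mid /u1 /u2; case: (u y) => p q /=; ring.
have [A1 B1] := rapid_wA_wB H1; have [A2 B2] := rapid_wA_wB H2.
have [A1c A1s EA1 ZA1] := inversion_rapid x A1; have [A2c A2s EA2 ZA2] := inversion_rapid x A2.
have [B1c B1s EB1 ZB1] := inversion_rapid x B1; have [B2c B2s EB2 ZB2] := inversion_rapid x B2.
rewrite /weyl; have /funext -> := inner.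
rewrite /cintegral /=.
have iD f g : mu.-integrable setT (EFin \o f) -> mu.-integrable setT (EFin \o g) ->
    mu.-integrable setT (EFin \o (fun y => f y + g y)).
  by move=> Hf Hg; apply: eq_integrable (integrableD measurableT Hf Hg).
have iB f g : mu.-integrable setT (EFin \o f) -> mu.-integrable setT (EFin \o g) ->
    mu.-integrable setT (EFin \o (fun y => f y - g y)).
  by move=> Hf Hg; apply: eq_integrable (integrableB measurableT Hf Hg).
rewrite RintegralB//; [|exact: iD|exact: iB].
rewrite (RintegralD measurableT A1c B1s) (RintegralB measurableT A2s B2c).
rewrite RintegralD//; [|exact: iB|exact: iD].
rewrite (RintegralB measurableT A1s B1c) (RintegralD measurableT A2c B2s).
have p0 : (2 * pi : R) ^+ n != 0 by rewrite expf_neq0// mulf_neq0// gt_eqF// pi_gt0.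
have S1 := congr2 (fun p q : R => p - q) (congr2 +%R EA1 ZB1) (congr2 (fun p q : R => p - q) ZA2 EB2).
have S2 := congr2 +%R (congr2 (fun p q : R => p - q) ZA1 EB1) (congr2 +%R EA2 ZB2).
move: S1 S2 => /= S1 S2; apply: (etrans (congr2 (fun p q => _ * (p +i* q)%C) S1 S2)).
move: (wA u1 x) (wA u2 x) (wB u1 x) (wB u2 x) => p q r s.
by rewrite realC_mul; congr (_ +i* _)%C; move: ((2 * pi) ^+ n) p0 => K p0; field.
Qed.

End at_x.

Lemma tcl_derive k M f x j : tcl k.+1 (wt M) f -> is_derive x (delta_mx ord0 j) f (partial j f x).
Proof. by move=> Hf; exact: (cls_derive j Hf (I : [set: 'rV[R]_n] x)). Qed.

Lemma partial_midpt_mul M x h f y j : tcl 1 (wt M) h -> rapid f ->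
  partial j (fun y => midpt x h y * f y) y =
  2^-1 * (midpt x (partial j h) y * f y) + midpt x h y * partial j f y.
Proof.
move=> Hh Hf.
have [_ E] := is_derive_mul (is_derive_midpt (tcl_derive (2^-1 *: (x + y)) j Hh)) (rapid_derive y j Hf).
by rewrite [LHS]E; congr (_ + _); rewrite -mulrA.
Qed.

(** At y = x each derivative of the coefficient at the midpoint brings a factor
    1/2: this produces the symmetrized operator, with half of the divergence of
    b. *)
Lemma wB_diag f x : rapid f ->
  wB x f x = \sum_(j < n) (b j x * partial j f x + 2^-1 * partial j (b j) x * f x).
Proof.
move=> Hf; apply: eq_bigr => j _; rewrite /Wb (partial_midpt_mul x x j (Tb j 1) Hf) !midpt_diag.
by ring.
Qed.

Lemma wA_diag f x : rapid f ->
  wA x f x = - (\sum_(j < n) \sum_(k < n) (a j k x * partial j (partial k f) x +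
     2^-1 * (partial j (a j k) x * partial k f x) + 2^-1 * (partial k (a j k) x * partial j f x) +
     4^-1 * partial j (partial k (a j k)) x * f x)) + c x * f x.
Proof.
move=> Hf; rewrite /wA /Wc midpt_diag; congr (- _ + _).
apply: eq_bigr => j _; apply: eq_bigr => k _.
have -> : partial k (Wa x f j k) = (fun y => 2^-1 * (midpt x (partial k (a j k)) y * f y) +
    midpt x (a j k) y * partial k f y).
  by apply/funext => y; exact: partial_midpt_mul (Ta j k 1) Hf.
have Da := is_derive_midpt (tcl_derive (2^-1 *: (x + x)) j (Ta j k 1)).
have Dda := is_derive_midpt (tcl_derive (2^-1 *: (x + x)) j (tcl_partial k (Ta j k 2))).
have [_ E] := is_derive_add
  (is_derive_cmul 2^-1 (is_derive_mul Dda (rapid_derive x j Hf)))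
  (is_derive_mul Da (rapid_derive x j (rapid_partial k Hf))).
rewrite [LHS]E -/(midpt x _ x) -/(midpt x (partial j (a j k)) x) !midpt_diag.
move: (a j k x) (partial j (a j k) x) (partial k (a j k) x) (partial j (partial k (a j k)) x)
  (f x) (partial j f x) (partial k f x) (partial j (partial k f) x) => p0 p1 p2 p3 q0 q1 q2 q3.
by field.
Qed.

End weyl_formula.

(** * The differential operator and its Green formulas *)

Section hamiltonian_formula.
Context {R : realType} {n : nat}.
Notation mu := (@lebesgue_rV R n).
Implicit Types (f g w : 'rV[R]_n -> R) (x : 'rV[R]_n).
Variables (alpha : R) (a : 'I_n -> 'I_n -> 'rV[R]_n -> R)
  (b : 'I_n -> 'rV[R]_n -> R) (c : 'rV[R]_n -> R).

(** The Weyl quantization of a_jk xi_j xi_k differs from the divergence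
    form - d_j a_jk d_k by the function - (d_j d_k a_jk) / 4, which joins the
    potential. *)
Definition divpot x : R :=
  c x - jap x `^ (2 * alpha) - 4^-1 * \sum_(j < n) \sum_(k < n) partial j (partial k (a j k)) x.

(** The operator is Lop - i Kop, where Lop is symmetric and Kop antisymmetric,
    both with real coefficients. *)
Definition Lop f x : R := - Mop a f x + divpot x * f x.
Definition Kop f x : R := Bop b f x + 2^-1 * divb b x * f x.

Variable M0 : R.
Hypotheses (a_sym : forall j k, a j k = a k j) (M00 : 0 <= M0)
  (Ta : forall j k l, tcl l (wt M0) (a j k))
  (Tb : forall j l, tcl l (wt M0) (b j)) (Tc : forall l, tcl l (wt M0) c).

Lemma Lop_weyl f x : rapid f ->
  - laplacian f x - jap x `^ (2 * alpha) * f x + wA a c x f x = Lop f x.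
Proof.
move=> Hf; rewrite (wA_diag c Ta)// /Lop /Mop /divpot /laplacian.
have E1 : \sum_(j < n) \sum_(k < n) 2^-1 * (partial k (a j k) x * partial j f x) =
    \sum_(j < n) \sum_(k < n) 2^-1 * (partial j (a j k) x * partial k f x).
  by rewrite exchange_big/=; apply: eq_bigr => j _; apply: eq_bigr => k _; rewrite a_sym.
have E2 : \sum_(j < n) \sum_(k < n) gmat a j k x * partial j (partial k f) x =
    \sum_(j < n) partial j (partial j f) x + \sum_(j < n) \sum_(k < n) a j k x * partial j (partial k f) x.
  rewrite -big_split/=; apply: eq_bigr => j _.
  under eq_bigr => k _ do rewrite /gmat mulrDl.
  rewrite big_split/=; congr (_ + _); rewrite (bigD1 j)//= eqxx mul1r big1 ?addr0// => k kj.
  by rewrite eq_sym (negbTE kj) mul0r.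
have S4 : \sum_(j < n) \sum_(k < n) (a j k x * partial j (partial k f) x +
     2^-1 * (partial j (a j k) x * partial k f x) + 2^-1 * (partial k (a j k) x * partial j f x) +
     4^-1 * partial j (partial k (a j k)) x * f x) =
   \sum_(j < n) \sum_(k < n) a j k x * partial j (partial k f) x +
   \sum_(j < n) \sum_(k < n) 2^-1 * (partial j (a j k) x * partial k f x) +
   \sum_(j < n) \sum_(k < n) 2^-1 * (partial k (a j k) x * partial j f x) +
   \sum_(j < n) \sum_(k < n) 4^-1 * partial j (partial k (a j k)) x * f x.
  rewrite -!big_split/=; apply: eq_bigr => j _; rewrite -!big_split/=.
  by apply: eq_bigr => k _.
have S2 : \sum_(j < n) \sum_(k < n) (gmat a j k x * partial j (partial k f) x +
      partial j (a j k) x * partial k f x) =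
    \sum_(j < n) \sum_(k < n) gmat a j k x * partial j (partial k f) x +
    \sum_(j < n) \sum_(k < n) partial j (a j k) x * partial k f x.
  by rewrite -!big_split/=; apply: eq_bigr => j _; rewrite -!big_split/=.
have S3 : \sum_(j < n) \sum_(k < n) 4^-1 * partial j (partial k (a j k)) x * f x =
    4^-1 * (\sum_(j < n) \sum_(k < n) partial j (partial k (a j k)) x) * f x.
  rewrite mulr_sumr mulr_suml; apply: eq_bigr => j _.
  by rewrite mulr_sumr mulr_suml; apply: eq_bigr => k _.
have S1 : \sum_(j < n) \sum_(k < n) 2^-1 * (partial j (a j k) x * partial k f x) =
    2^-1 * \sum_(j < n) \sum_(k < n) partial j (a j k) x * partial k f x.
  by rewrite mulr_sumr; apply: eq_bigr => j _; rewrite mulr_sumr.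
by rewrite S4 S2 E1 E2 S3 S1; field.
Qed.

Lemma Kop_weyl f x : rapid f -> wB b x f x = Kop f x.
Proof.
move=> Hf; rewrite (wB_diag Tb)// /Kop /Bop /divb mulr_sumr mulr_suml -big_split/=.
by apply: eq_bigr.
Qed.

Lemma hamiltonianE (u : 'rV[R]_n -> R[i]) x : schwartz u ->
  hamiltonian alpha a b c u x =
  ((Lop (fun y => complex.Re (u y)) x + Kop (fun y => complex.Im (u y)) x) +i*
   (Lop (fun y => complex.Im (u y)) x - Kop (fun y => complex.Re (u y)) x))%C.
Proof.
move=> /schwartz_rapid[H1 H2]; rewrite /hamiltonian (weyl_parts M00 Ta Tb Tc x H1 H2).
rewrite -!Lop_weyl// -!Kop_weyl// /claplacian.
set A1 := wA _ _ _ _ _; set A2 := wA _ _ _ _ _; set B1 := wB _ _ _ _; set B2 := wB _ _ _ _.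
have -> : ((jap x `^ (2 * alpha))%:C * u x =
    (jap x `^ (2 * alpha) * complex.Re (u x)) +i* (jap x `^ (2 * alpha) * complex.Im (u x)))%C.
  by case: (u x) => p q; rewrite realC_mul.
have E (p q r s t v : R) : (- (p +i* q) - (r +i* s) + (t +i* v) = (- p - r + t) +i* (- q - s + v))%C by [].
by rewrite E; congr (_ +i* _)%C; rewrite addrA.
Qed.

Section adjoint.
Variables (M : R) (f w : 'rV[R]_n -> R).
Hypotheses (Hf : rapid f) (Hw : tcl 2 (wt M) w).

Lemma gmat_tcl j k l : tcl l (wt M0) (gmat a j k).
Proof.
apply: tcl_add => //.
by apply: (tcl_weaken M00); apply: (cls_weight_le T_ge0) (cls_const openT T_ge0 l _) => x _; rewrite wt0.
Qed.

Lemma gmat_sym j k : gmat a j k = gmat a k j.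
Proof. by apply/funext => x; rewrite /gmat a_sym eq_sym. Qed.

Let Hwd l x : is_derive x (delta_mx ord0 l) w (partial l w x) := tcl_derive x l (clsS Hw).

(** Lagrange identity: by the symmetry of a_jk the terms with one derivative on
    each factor cancel. *)
Lemma green_L x : Lop f x * w x - f x * Lop w x =
  - \sum_(j < n) \sum_(k < n)
    partial j (fun y => gmat a j k y * (partial k f y * w y + - (f y * partial k w y))) x.
Proof.
have D j k : partial j (fun y => gmat a j k y * (partial k f y * w y + - (f y * partial k w y))) x =
    partial j (a j k) x * (partial k f x * w x + - (f x * partial k w x)) +
    gmat a j k x * (partial j (partial k f) x * w x + partial k f x * partial j w x +
      - (partial j f x * partial k w x + f x * partial j (partial k w) x)).
  have Dg := is_derive_add (is_derive_const (j == k)%:R x (delta_mx ord0 j)) (tcl_derive x j (Ta j k 1)).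
  have [_ E] := is_derive_mul Dg (is_derive_add
    (is_derive_mul (rapid_derive x j (rapid_partial k Hf)) (Hwd j x))
    (is_derive_opp (is_derive_mul (rapid_derive x j Hf) (tcl_derive x j (tcl_partial k Hw))))).
  by rewrite [LHS]E add0r.
have S : \sum_(j < n) \sum_(k < n) gmat a j k x * (partial k f x * partial j w x) =
    \sum_(j < n) \sum_(k < n) gmat a j k x * (partial j f x * partial k w x).
  by rewrite exchange_big/=; apply: eq_bigr => j _; apply: eq_bigr => k _; rewrite gmat_sym.
transitivity (- (\sum_(j < n) \sum_(k < n) (gmat a j k x * partial j (partial k f) x +
      partial j (a j k) x * partial k f x)) * w x +
   f x * \sum_(j < n) \sum_(k < n) (gmat a j k x * partial j (partial k w) x +
      partial j (a j k) x * partial k w x)).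
  by rewrite /Lop /Mop; ring.
transitivity (- (\sum_(j < n) \sum_(k < n) ((gmat a j k x * partial j (partial k f) x +
      partial j (a j k) x * partial k f x) * w x -
      f x * (gmat a j k x * partial j (partial k w) x + partial j (a j k) x * partial k w x))
    + (\sum_(j < n) \sum_(k < n) gmat a j k x * (partial k f x * partial j w x) -
       \sum_(j < n) \sum_(k < n) gmat a j k x * (partial j f x * partial k w x)))).
  rewrite S subrr addr0 mulNr mulr_suml mulr_sumr -!sumrN -big_split/=; apply: eq_bigr => j _.
  rewrite mulr_suml mulr_sumr -!sumrN -big_split/=; apply: eq_bigr => k _.
  move: (gmat a j k x) (partial j (partial k f) x) (partial j (a j k) x) (partial k f x) (w x) (f x)
    (partial j (partial k w) x) (partial k w x) => *; ring.
congr (- _); rewrite -sumrB -big_split/=; apply: eq_bigr => j _.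
rewrite -sumrB -big_split/=; apply: eq_bigr => k _; rewrite D.
move: (gmat a j k x) (partial j (partial k f) x) (partial j (a j k) x) (partial k f x) (w x) (f x)
  (partial j (partial k w) x) (partial k w x) (partial j w x) (partial j f x) => *; ring.
Qed.

Lemma green_K x : Kop f x * w x + f x * Kop w x =
  \sum_(j < n) partial j (fun y => b j y * (f y * w y)) x.
Proof.
have D j : partial j (fun y => b j y * (f y * w y)) x =
    partial j (b j) x * (f x * w x) + b j x * (partial j f x * w x + f x * partial j w x).
  by have [_ E] := is_derive_mul (tcl_derive x j (Tb j 1))
    (is_derive_mul (rapid_derive x j Hf) (Hwd j x)); rewrite [LHS]E.
transitivity ((\sum_(j < n) b j x * partial j f x) * w x + f x * (\sum_(j < n) b j x * partial j w x) +
    (\sum_(j < n) partial j (b j) x) * (f x * w x)).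
  by rewrite /Kop /Bop /divb; field.
rewrite !mulr_suml mulr_sumr -!big_split/=; apply: eq_bigr => j _; rewrite D; ring.
Qed.

Let ML := - n.+1%:R - M0.

(** Rapidly decreasing functions absorb the growth of the coefficients and of w,
    so that there is no contribution from infinity. *)
Lemma green_integrals :
  [/\ mu.-integrable setT (EFin \o (fun x => Lop f x * w x - f x * Lop w x)),
   mu.-integrable setT (EFin \o (fun x => Kop f x * w x + f x * Kop w x)),
   \int[mu]_x (Lop f x * w x - f x * Lop w x) = 0 &
   \int[mu]_x (Kop f x * w x + f x * Kop w x) = 0].
Proof.
have F0 l g : tcl l (wt M) g -> forall k, (k <= l)%N -> forall N h, rapid h -> tcl k (wt N) (fun y => h y * g y).
  move=> Hg k kl N h Hh.
  have := rapid_mul N (cls_leq kl Hg) Hh; apply: cls_ext => // [|y _]; first exact: openT.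
  by rewrite mulrC.
have T1 j k : tcl 1 (wt (- n.+1%:R)) (fun y => gmat a j k y * (partial k f y * w y + - (f y * partial k w y))).
  rewrite (_ : - n.+1%:R = M0 + ML); last by rewrite /ML; ring.
  apply: tcl_mul; first exact: gmat_tcl.
  apply: tcl_add; first by apply: (F0 _ _ Hw) => //; exact: rapid_partial.
  by apply: tcl_opp; apply: (F0 _ _ (tcl_partial k Hw)).
have T2 j : tcl 1 (wt (- n.+1%:R)) (fun y => b j y * (f y * w y)).
  rewrite (_ : - n.+1%:R = M0 + ML); last by rewrite /ML; ring.
  by apply: tcl_mul => //; apply: (F0 _ _ Hw).
have I1 j k := tcl_integrable (@wt_Sn R n) (tcl_partial j (T1 j k)).
have I2 j := tcl_integrable (@wt_Sn R n) (tcl_partial j (T2 j)).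
have [J1 E1] : mu.-integrable setT (EFin \o (fun x => \sum_(j < n) \sum_(k < n)
     partial j (fun y => gmat a j k y * (partial k f y * w y + - (f y * partial k w y))) x)) /\
   \int[mu]_x (\sum_(j < n) \sum_(k < n)
     partial j (fun y => gmat a j k y * (partial k f y * w y + - (f y * partial k w y))) x) = 0.
  have [A B] := Rintegral_sum measurableT (index_enum 'I_n) (fun j =>
    (Rintegral_sum measurableT (index_enum 'I_n) (fun k => I1 j k)).1).
  split=> //; rewrite B big1// => j _.
  have [_ ->] := Rintegral_sum measurableT (index_enum 'I_n) (fun k => I1 j k).
  by rewrite big1// => k _; apply: (integral_partial_eq0 _ (@wt_Sn R n)).
have [J2 E2] : mu.-integrable setT (EFin \o (fun x => \sum_(j < n) partial j (fun y => b j y * (f y * w y)) x)) /\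
   \int[mu]_x (\sum_(j < n) partial j (fun y => b j y * (f y * w y)) x) = 0.
  have [A B] := Rintegral_sum measurableT (index_enum 'I_n) I2.
  by split=> //; rewrite B big1// => j _; apply: (integral_partial_eq0 _ (@wt_Sn R n)).
have /funext-> := green_L; have /funext-> := green_K.
have J1' := integrable_cmul measurableT (-1) J1.
have X : (fun x => - \sum_(j < n) \sum_(k < n)
     partial j (fun y => gmat a j k y * (partial k f y * w y + - (f y * partial k w y))) x) =
  (fun x => -1 * \sum_(j < n) \sum_(k < n)
     partial j (fun y => gmat a j k y * (partial k f y * w y + - (f y * partial k w y))) x).
  by apply/funext => x; rewrite mulN1r.
by split=> //; rewrite X// RintegralZl// E1 mulr0.
Qed.

End adjoint.

End hamiltonian_formula.

(** * Oscillating functions that are flat at the origin *)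

Section oscillating.
Context {R : realType} {n : nat}.
Implicit Types (f q : 'rV[R]_n -> R) (x : 'rV[R]_n).
Variables (rho phi : 'rV[R]_n -> R) (m1 : R).
Hypotheses (Grho : gsy m1 rho) (Gphi : gsy m1 phi)
  (crho : forall x, Omega x -> {for x, continuous rho})
  (cphi : forall x, Omega x -> {for x, continuous phi})
  (flat : forall N : R, exists2 C : R, 0 <= C & forall x, Omega x -> enorm x <= 1 ->
     expR (rho x) <= C * enorm x `^ N)
  (grow : exists2 C : R, 0 <= C & forall x, 1 <= enorm x -> expR (rho x) <= C).

(** Real and imaginary parts of a symbol times exp (rho + i phi) have this form.
    The value 0 at the origin is the continuous extension, exp rho being flat
    there; coefficients that are singular at the origin are therefore allowed. *)
Definition osc q1 q2 x : R :=
  if x == 0 then 0 else expR (rho x) * (q1 x * cos (phi x) + q2 x * sin (phi x)).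

Lemma osc0 q1 q2 : osc q1 q2 0 = 0. Proof. by rewrite /osc eqxx. Qed.

Lemma oscE q1 q2 x : Omega x ->
  osc q1 q2 x = expR (rho x) * (q1 x * cos (phi x) + q2 x * sin (phi x)).
Proof. by rewrite /osc /Omega /= => /negbTE ->. Qed.

Lemma osc_ext q1 q2 q1' q2' : (forall x, Omega x -> q1 x = q1' x) ->
  (forall x, Omega x -> q2 x = q2' x) -> osc q1 q2 = osc q1' q2'.
Proof.
move=> E1 E2; apply/funext => x; have [->|x0] := eqVneq x 0; first by rewrite !osc0.
by rewrite !oscE// E1// E2.
Qed.

Lemma osc_le q1 q2 x : Omega x -> `|osc q1 q2 x| <= expR (rho x) * (`|q1 x| + `|q2 x|).
Proof.
move=> x0; rewrite oscE// normrM ger0_norm ?expR_ge0// ler_wpM2l ?expR_ge0//.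
rewrite (le_trans (ler_normD _ _))// !normrM.
by apply: lerD; rewrite ler_piMr ?cos_max ?sin_max.
Qed.

Section bounds.
Variables (m : R) (q1 q2 : 'rV[R]_n -> R).
Hypotheses (S1 : sy m q1) (S2 : sy m q2).

(** The flatness of exp rho exceeds the singularities of the coefficients by two
    orders, which makes the function differentiable at the origin with
    derivative 0. *)
Lemma osc_flat : exists2 C : R, 0 <= C & forall x, enorm x <= 1 ->
  `|osc q1 q2 x| <= C * enorm x ^+ 2.
Proof.
have [C1 C10 [L1 H1]] := sy_bound0 S1; have [C2 C20 [L2 H2]] := sy_bound0 S2.
have [C C0 HC] := flat (2 + `|L1| + `|L2|).
exists (C * (C1 + C2)); first by rewrite mulr_ge0// addr_ge0.
move=> x x1; have [->|x0] := eqVneq x 0.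
  by rewrite osc0 normr0 !mulr_ge0 ?addr_ge0 ?exprn_ge0 ?enorm_ge0.
have r0 := enorm_Omega x0.
have r01 : 0 < enorm x <= 1 by rewrite r0.
have H (L : R) : `|L| <= `|L1| + `|L2| -> enorm x `^ (- L) <= enorm x `^ (- (`|L1| + `|L2|)).
  by move=> h; apply: ger_powR => //; rewrite lerN2 (le_trans (ler_norm _)).
have B1 : `|q1 x| <= C1 * enorm x `^ (- (`|L1| + `|L2|)).
  by apply: (le_trans (H1 x x0 x1)); rewrite ler_wpM2l// H// lerDl.
have B2 : `|q2 x| <= C2 * enorm x `^ (- (`|L1| + `|L2|)).
  by apply: (le_trans (H2 x x0 x1)); rewrite ler_wpM2l// H// lerDr.
apply: (le_trans (osc_le _ _ x0)).
apply: (@le_trans _ _ (C * enorm x `^ (2 + `|L1| + `|L2|) *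
    ((C1 + C2) * enorm x `^ (- (`|L1| + `|L2|))))).
  apply: ler_pM => //; first exact: HC.
  by rewrite mulrDl lerD.
rewrite mulrACA -powRD; last by rewrite (gt_eqF r0) implybT.
rewrite (_ : 2 + `|L1| + `|L2| - (`|L1| + `|L2|) = 2%:R); last by ring.
by rewrite powR_mulrn// ltW.
Qed.

Lemma osc_grow : exists2 C : R, 0 <= C & forall x, 1 <= enorm x ->
  `|osc q1 q2 x| <= C * enorm x `^ m.
Proof.
have [C1 C10 H1] := sy_bound S1; have [C2 C20 H2] := sy_bound S2.
have [C C0 HC] := grow.
exists (C * (C1 + C2)); first by rewrite mulr_ge0// addr_ge0.
move=> x x1; have x0 : Omega x by rewrite /Omega /= -enorm_gt0 (lt_le_trans ltr01).
apply: (le_trans (osc_le _ _ x0)); rewrite -mulrA; apply: ler_pM => //; first exact: HC.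
by rewrite mulrDl lerD ?H1 ?H2.
Qed.

Lemma osc_continuous0 : {for 0, continuous (osc q1 q2)}.
Proof.
have [C C0 HC] := osc_flat.
have E0 := @enorm_continuous R n 0.
apply: sequential_continuous => z z0; rewrite osc0.
have E : enorm (z k) @[k --> \oo] --> enorm (0 : 'rV[R]_n) := cvg_comp z (@enorm R n) z0 E0.
apply/cvgrPdist_le => e e0.
have : 0 < Num.min 1 (e / (C + 1)) by rewrite lt_min ltr01 divr_gt0// ltr_pwDr.
move/cvgrPdist_le : E => /[apply]; apply: filterS => k.
rewrite enorm0 !sub0r !normrN (ger0_norm (enorm_ge0 _)) le_min => /andP[x1 xe].
apply: (le_trans (HC _ x1)); apply: (@le_trans _ _ (C * enorm (z k))).
  by rewrite ler_wpM2l// expr2 ler_piMr ?enorm_ge0.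
apply: (@le_trans _ _ (C * (e / (C + 1)))); first by rewrite ler_wpM2l.
by rewrite mulr_div_succ_le// ltW.
Qed.

Lemma osc_derive0 j : is_derive (0 : 'rV[R]_n) (delta_mx ord0 j) (osc q1 q2) 0.
Proof.
have [C C0 HC] := osc_flat.
apply/is_derive_epsP => e e0.
have H : \forall h \near (0 : R), `|h| <= Num.min 1 (e / (C + 1)).
  have : 0 < Num.min 1 (e / (C + 1)) by rewrite lt_min ltr01 divr_gt0// ltr_pwDr.
  have E0 : {for (0 : R), continuous (fun h : R => h)} by exact: cvg_id.
  move/cvgrPdist_le : E0 => /[apply]; apply: filterS => x.
  by rewrite sub0r normrN.
near=> h.
have : `|h| <= Num.min 1 (e / (C + 1)) by near: h.
rewrite le_min => /andP[h1 he]; rewrite addr0 osc0 subr0 mulr0 subr0.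
have Eh : enorm (h *: delta_mx ord0 j : 'rV[R]_n) = `|h| by rewrite enormZ enorm_delta mulr1.
apply: (le_trans (HC _ _)); rewrite Eh//.
rewrite expr2 mulrA ler_wpM2r//.
apply: (@le_trans _ _ (C * (e / (C + 1)))); first by rewrite ler_wpM2l.
by rewrite mulr_div_succ_le// ltW.
Unshelve. all: by end_near. Qed.

Lemma osc_derive x j : Omega x -> is_derive x (delta_mx ord0 j) (osc q1 q2)
  (osc (fun y => partial j q1 y + partial j rho y * q1 y + partial j phi y * q2 y)
       (fun y => partial j q2 y + partial j rho y * q2 y - partial j phi y * q1 y) x).
Proof.
move=> x0.
apply: (is_derive_local open_Omega x0 (fun y y0 => esym (oscE q1 q2 y0))).
rewrite oscE//.
have Dr := gsy_derive j Grho x0; have Dp := gsy_derive j Gphi x0.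
have D1 := sy_derive j S1 x0; have D2 := sy_derive j S2 x0.
have De := is_derive_compo (is_derive_expR (rho x)) Dr.
have Dc := is_derive_compo (is_derive_cos (phi x)) Dp.
have Ds := is_derive_compo (is_derive_sin (phi x)) Dp.
have := is_derive_mul De (is_derive_add (is_derive_mul D1 Dc) (is_derive_mul D2 Ds)).
rewrite (_ : _ + _ = expR (rho x) *
  ((partial j q1 x + partial j rho x * q1 x + partial j phi x * q2 x) * cos (phi x) +
   (partial j q2 x + partial j rho x * q2 x - partial j phi x * q1 x) * sin (phi x)))//=.
move: (expR _) (cos _) (sin _) (partial j q1 x) (partial j q2 x) (partial j rho x) (partial j phi x) (q1 x) (q2 x) => *.
ring.
Qed.

(** Derivatives stay in the class, and hence are again flat at the origin: this
    gives smoothness of all orders there from a bound of order 2. *)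
Lemma partial_osc j : partial j (osc q1 q2) =
  osc (fun y => partial j q1 y + partial j rho y * q1 y + partial j phi y * q2 y)
      (fun y => partial j q2 y + partial j rho y * q2 y - partial j phi y * q1 y).
Proof.
apply/funext => x; have [->|x0] := eqVneq x 0.
  by rewrite osc0; have [_ E] := osc_derive0 j; exact: E.
by have [_ E] := osc_derive j x0; exact: E.
Qed.

Lemma osc_is_derive x j : is_derive x (delta_mx ord0 j) (osc q1 q2) (partial j (osc q1 q2) x).
Proof.
rewrite partial_osc; have [->|x0] := eqVneq x 0; last exact: osc_derive.
by rewrite osc0; exact: osc_derive0.
Qed.

Lemma sy_osc_coef j : sy (m + `|m1|) (fun y => partial j q1 y + partial j rho y * q1 y + partial j phi y * q2 y) /\
  sy (m + `|m1|) (fun y => partial j q2 y + partial j rho y * q2 y - partial j phi y * q1 y).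
Proof.
have m1n := ler_norm m1; have m1p := normr_ge0 m1.
have W q q' : sy m q -> sy m q' ->
    sy (m + `|m1|) (fun y => partial j q y + partial j rho y * q y + partial j phi y * q' y).
  move=> Sq Sq'; apply: sy_add; first apply: sy_add.
  - by apply: sy_weaken (sy_partial j Sq); lra.
  - by apply: sy_weaken (sy_mul (gsy_sy j Grho) Sq); lra.
  - by apply: sy_weaken (sy_mul (gsy_sy j Gphi) Sq'); lra.
split; first exact: W.
apply: sy_ext (W _ _ S2 (sy_opp S1)) => x _.
by rewrite mulrN.
Qed.

Lemma osc_tcl0 : cls0 setT (wt `|m|) (osc q1 q2).
Proof.
split=> [x _|].
  have [->|x0] := eqVneq x 0; first exact: osc_continuous0.
  apply: (continuous_local open_Omega x0 (fun y y0 => esym (oscE q1 q2 y0))).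
  have cr := crho x0; have cp := cphi x0.
  apply: (@continuousM _ _ (fun y => expR (rho y)) (fun y => q1 y * cos (phi y) + q2 y * sin (phi y))).
    by apply: (@continuous_comp _ _ _ rho (@expR R)) => //; exact: continuous_expR.
  apply: (@continuousD _ _ _ (fun y => q1 y * cos (phi y)) (fun y => q2 y * sin (phi y))).
    apply: (@continuousM _ _ q1 (fun y => cos (phi y))); first exact: sy_cont S1 x0.
    by apply: (@continuous_comp _ _ _ phi (@cos R)) => //; exact: continuous_cos.
  apply: (@continuousM _ _ q2 (fun y => sin (phi y))); first exact: sy_cont S2 x0.
  by apply: (@continuous_comp _ _ _ phi (@sin R)) => //; exact: continuous_sin.
have [C C0 HC] := osc_flat; have [C' C'0 HC'] := osc_grow.
exists (C + C'); first exact: addr_ge0.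
move=> x _; have e0 := enorm_ge0 x.
have w1 : 1 <= wt `|m| x by rewrite -(wt0 x); apply: wt_le.
have [x1|x1] := leP (enorm x) 1.
  apply: (le_trans (HC x x1)); rewrite mulrDl; apply: (@le_trans _ _ (C * wt `|m| x)).
    by rewrite ler_wpM2l// (le_trans _ w1)// expr_le1.
  by rewrite lerDl mulr_ge0// wt_ge0.
apply: (le_trans (HC' x (ltW x1))); rewrite mulrDl; apply: (@le_trans _ _ (C' * wt `|m| x)).
  rewrite ler_wpM2l// /wt (le_trans (ler_powR (ltW x1) (ler_norm m)))//.
  by rewrite ge0_ler_powR ?nnegrE ?addr_ge0// lerDr.
by rewrite lerDr mulr_ge0// wt_ge0.
Qed.

End bounds.

(** Each derivative raises the order of the coefficients by at most |m1|. *)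
Lemma osc_tcl k m q1 q2 : sy m q1 -> sy m q2 ->
  exists2 M : R, 0 <= M & tcl k (wt M) (osc q1 q2).
Proof.
elim: k m q1 q2 => [|k IH] m q1 q2 S1 S2; first by exists `|m| => //; exact: osc_tcl0.
have /choice[M HM] : forall j, exists M : R, 0 <= M /\ tcl k (wt M) (partial j (osc q1 q2)).
  move=> j; have [T1 T2] := sy_osc_coef S1 S2 j.
  by have [M M0 HM] := IH _ _ _ T1 T2; exists M; rewrite (partial_osc S1 S2).
pose MM := `|m| + \sum_(j < n) M j.
have S0 : 0 <= \sum_(j < n) M j by apply: sumr_ge0 => j _; have [] := HM j.
exists MM; first by rewrite addr_ge0.
apply: tclSI.
  have [c0 [C C0 HC]] := osc_tcl0 S1 S2; split=> //; exists C => // x _.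
  by apply: (le_trans (HC x I)); rewrite ler_wpM2l//; apply: wt_le; rewrite lerDl.
move=> j; exists (partial j (osc q1 q2)); first by move=> x; exact: osc_is_derive S1 S2 x j.
apply: tcl_weaken (HM j).2; rewrite /MM (bigD1 j)//= addrCA lerDl addr_ge0//.
by apply: sumr_ge0 => i _; have [] := HM i.
Qed.

End oscillating.

(** * The profile of the quasimode *)

Section flatness.
Context {R : realType}.

Lemma expR_beats_power (N : nat) (t : R) : 0 < t -> expR (- t) <= N.+1%:R ^+ N.+1 * t ^- N.+1.
Proof.
move=> t0; have p0 : 0 < N.+1%:R :> R by rewrite ltr0n.
have h : t / N.+1%:R <= expR (t / N.+1%:R).
  by apply: le_trans (expR_ge1Dx _); rewrite lerDr.
have h2 : (t / N.+1%:R) ^+ N.+1 <= expR t.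
  rewrite (_ : t = N.+1%:R * (t / N.+1%:R)); last by field; rewrite lt0r_neq0.
  rewrite expRM_natl; rewrite -{1}(_ : t = N.+1%:R * (t / N.+1%:R)); last by field; rewrite lt0r_neq0.
  by rewrite lerXn2r ?nnegrE ?expR_ge0 ?divr_ge0 ?(ltW t0).
rewrite expRN -[X in _ <= X]invrK lef_pV2 ?posrE ?expR_gt0 ?invr_gt0 ?mulr_gt0 ?exprn_gt0 ?invr_gt0 ?exprn_gt0//.
by rewrite invfM invrK mulrC -exprVn -exprMn.
Qed.

Lemma powR_ge1 (t p : R) : 1 <= t -> 0 <= p -> 1 <= t `^ p.
Proof. by move=> t1 p0; rewrite -[leLHS](powRr0 t); exact: ler_powR. Qed.

Lemma powR_le1 (t p : R) : 1 <= t -> p <= 0 -> t `^ p <= 1.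
Proof. by move=> t1 p0; rewrite -[leRHS](powRr0 t); exact: ler_powR. Qed.

(** If t is at most 2 C + 1 then t^s - t/2 is nonnegative and C t^L is bounded;
    otherwise half of t^s dominates C t^L. *)
Lemma power_gap (C L s t : R) : 0 <= C -> L + 1 <= s -> 1 <= s -> 1 <= t ->
  C * t `^ L - t `^ s <= C * (2 * C + 1) `^ (s - 1) - t / 2.
Proof.
move=> C0 Ls s1 t1; have t0 : 0 < t by rewrite (lt_le_trans ltr01).
have tL : t `^ L <= t `^ (s - 1) by apply: ler_powR => //; lra.
have ts : t `^ s = t * t `^ (s - 1).
  by rewrite -{2}(powRr1 (ltW t0)) -powRD ?(gt_eqF t0) ?implybT//; congr (_ `^ _); lra.
have p1 : 1 <= t `^ (s - 1) by apply: powR_ge1 => //; lra.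
have C1 : 0 <= (2 * C + 1) `^ (s - 1) by exact: powR_ge0.
have [tC|tC] := leP t (2 * C + 1).
  have h : t `^ (s - 1) <= (2 * C + 1) `^ (s - 1).
    by apply: ge0_ler_powR; rewrite ?nnegrE ?(ltW t0)//; lra.
  apply: lerB.
    by rewrite ler_wpM2l// (le_trans tL).
  by rewrite ts; nra.
apply: (@le_trans _ _ (C * t `^ (s - 1) - t * t `^ (s - 1))).
  by rewrite ts lerB// ler_wpM2l.
apply: (@le_trans _ _ (- t / 2)); last by rewrite mulNr lerDr mulr_ge0.
by nra.
Qed.

End flatness.

Section profile.
Context {R : realType} {n : nat}.
Implicit Types (u v f h : 'rV[R]_n -> R) (x : 'rV[R]_n).
Variables (alpha mu : R) (a : 'I_n -> 'I_n -> 'rV[R]_n -> R)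
  (b : 'I_n -> 'rV[R]_n -> R) (c2 : 'rV[R]_n -> R).
Hypotheses (n1 : (1 <= n)%N) (a_sym : forall j k, a j k = a k j)
  (sa : forall j k, sy (- mu) (a j k)) (sb : forall j, sy (alpha - mu) (b j))
  (mu0 : 0 < mu) (alpha1 : 1 < alpha) (mu12 : mu < 1 / 2)
  (sc2 : sy (2 * alpha - mu) (fun x => c2 x + jap x `^ (2 * alpha))).

(** The vector field whose product with exp (2 rho) is the current of exp
    (rho + i phi). *)
Definition flux phi j x : R := \sum_(k < n) gmat a j k x * partial k phi x + 2^-1 * b j x.

Definition ampl : R := (n%:R - 1 + alpha) / 2.

(** What the rest of the argument uses of the phase and of the amplitude
    exponent: flatness of the amplitude at the origin, its exact size at
    infinity, small residuals and a current that points outwards. *)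
Record wkb_profile_spec (m1 : R) (phi rho : 'rV[R]_n -> R) : Prop := {
  prof_rho : gsy m1 rho; prof_phi : gsy m1 phi;
  prof_crho : forall x, Omega x -> {for x, continuous rho};
  prof_cphi : forall x, Omega x -> {for x, continuous phi};
  prof_flat : forall N : R, exists2 C : R, 0 <= C & forall x, Omega x -> enorm x <= 1 ->
     expR (rho x) <= C * enorm x `^ N;
  prof_size : exists2 C : R, 0 < C & forall x, 1 <= enorm x ->
     C^-1 * enorm x `^ (- ampl) <= expR (rho x) <= C * enorm x `^ (- ampl);
  prof_E1 : sy 0 (E1 a b c2 phi rho);
  prof_E2 : sy (alpha / 2 - 1) (E2 a b phi rho);
  prof_flux : exists2 R0 : R, 1 <= R0 & forall x, R0 <= enorm x ->
     2^-1 * enorm x `^ (1 + alpha) <= \sum_(j < n) x ord0 j * flux phi j x }.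

Lemma ampl_gt0 : 0 < ampl.
Proof.
have n0 : 1 <= n%:R :> R by rewrite ler1n.
by have al := alpha1; rewrite divr_gt0//; lra.
Qed.

Lemma expR_rho0 x : expR (rho0 alpha x) = jap x `^ (- ampl).
Proof. by rewrite /rho0 /powR (gt_eqF (jap_gt0 x)). Qed.

Lemma rho0_continuous x : {for x, continuous (@rho0 R n alpha)}.
Proof.
rewrite (_ : rho0 alpha = (fun y : 'rV[R]_n => ln (jap y `^ (- ampl)))); last first.
  by apply/funext => y; rewrite -expR_rho0 expRK.
have cj : {for x, continuous (fun y : 'rV[R]_n => jap y `^ (- ampl))}.
  rewrite (_ : (fun y => _) = (fun y : 'rV[R]_n => (1 + dotp y y) `^ (- ampl / 2))); last first.
    by apply/funext => y; rewrite jap_powR.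
  apply: (@continuous_comp _ _ _ (fun y : 'rV[R]_n => 1 + dotp y y) (fun t => t `^ (- ampl / 2))).
    apply: (@continuousD _ _ _ (fun=> 1 : R) (fun y : 'rV[R]_n => dotp y y)).
      exact: cst_continuous.
    exact: dotp_continuous.
  apply: (derive_continuous (is_derive1_powR _ _)).
  by rewrite ltr_pwDl// dotp_ge0.
apply: (@continuous_comp _ _ _ (fun y : 'rV[R]_n => jap y `^ (- ampl)) (@ln R)) => //.
by apply: continuous_ln; rewrite powR_gt0// jap_gt0.
Qed.

Lemma phi0_cont x : Omega x -> {for x, continuous (@phi0 R n alpha)}.
Proof. by move=> x0; apply: sy_cont (sy_cmul (1 + alpha)^-1 (sy_jap (1 + alpha))) x0. Qed.

(** The radial component of grad phi0 is about |x|^alpha; everything else in the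
    current is smaller by mu orders. *)
Lemma flux_lower u phi : sy (1 + alpha - mu) u -> phi = (fun x => phi0 alpha x + u x) ->
  exists2 R0 : R, 1 <= R0 & forall x, R0 <= enorm x ->
     2^-1 * enorm x `^ (1 + alpha) <= \sum_(j < n) x ord0 j * flux phi j x.
Proof.
move=> Su Ephi; have al := alpha1; have m0 := mu0; have g1 : gsy (1 + alpha) (@phi0 R n alpha) := gsy_phi0 alpha1.
have gu := sy_gsy Su.
have gphi : gsy (1 + alpha) phi.
  by rewrite Ephi; apply: (gsy_add g1); apply: gsy_weaken gu; lra.
pose T x := \sum_(j < n) x ord0 j * partial j u x +
  (\sum_(j < n) \sum_(k < n) x ord0 j * (a j k x * partial k phi x) +
   \sum_(j < n) x ord0 j * (2^-1 * b j x)).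
have ST : sy (1 + alpha - mu) T.
  apply: sy_add; first by apply: sy_sum => j; apply: sy_weaken (sy_mul (sy_coord j) (gsy_sy j gu)); lra.
  apply: sy_add.
    apply: sy_sum => j; apply: sy_sum => k.
    by apply: sy_weaken (sy_mul (sy_coord j) (sy_mul (sa j k) (gsy_sy k gphi))); lra.
  by apply: sy_sum => j; apply: sy_weaken (sy_mul (sy_coord j) (sy_cmul 2^-1 (sb j))); lra.
have [C C0 HC] := sy_bound ST.
exists (1 + (2 * C + 1) `^ mu^-1); first by rewrite lerDl powR_ge0.
move=> x xR.
have p0 := powR_ge0 (2 * C + 1) mu^-1.
have x1 : 1 <= enorm x by lra.
have r0 : 0 < enorm x by lra.
have x0 : Omega x by rewrite /Omega /= -enorm_gt0.
have -> : \sum_(j < n) x ord0 j * flux phi j x = dotp x x * jap x `^ (alpha - 1) + T x.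
  have E0 : dotp x x * jap x `^ (alpha - 1) = \sum_(j < n) x ord0 j * partial j (phi0 alpha) x.
    by rewrite /dotp mulr_suml; apply: eq_bigr => j _; rewrite partial_phi0// mulrA.
  rewrite E0 /T -!big_split/=; apply: eq_bigr => j _.
  rewrite -mulr_sumr -!mulrDr; congr (_ * _); rewrite /flux !addrA; congr (_ + _).
  transitivity (partial j phi x + \sum_(k < n) a j k x * partial k phi x).
    under eq_bigr => k _ do rewrite /gmat mulrDl.
    rewrite big_split/=; congr (_ + _); rewrite (bigD1 j)//= eqxx mul1r big1 ?addr0// => k kj.
    by rewrite eq_sym (negbTE kj) mul0r.
  by congr (_ + _); rewrite Ephi (partial_add j g1 gu x0).
have h1 : enorm x `^ (1 + alpha) <= dotp x x * jap x `^ (alpha - 1).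
  have -> : enorm x `^ (1 + alpha) = dotp x x * enorm x `^ (alpha - 1).
    rewrite -sqr_enorm -(powR_mulrn 2 (ltW r0)) -powRD ?(gt_eqF r0) ?implybT//.
    by congr (_ `^ _); ring.
  rewrite ler_wpM2l ?dotp_ge0//.
  by apply: ge0_ler_powR; rewrite ?nnegrE ?enorm_ge0 ?(ltW (jap_gt0 x)) ?enorm_le_jap//; lra.
have h2 : `|T x| <= 2^-1 * enorm x `^ (1 + alpha).
  apply: (le_trans (HC x x1)).
  have -> : enorm x `^ (1 + alpha - mu) = enorm x `^ (1 + alpha) / enorm x `^ mu.
    by rewrite -powRN -powRD// (gt_eqF r0) implybT.
  rewrite mulrA ler_pdivrMr ?powR_gt0//.
  have h : 2 * C <= enorm x `^ mu.
    have -> : 2 * C = (2 * C) `^ mu^-1 `^ mu.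
      by rewrite -powRrM mulVf ?lt0r_neq0// powRr1// mulr_ge0.
    apply: ge0_ler_powR; rewrite ?nnegrE ?powR_ge0 ?enorm_ge0 ?(ltW mu0)//.
    apply: le_trans xR; apply: (@le_trans _ _ ((2 * C + 1) `^ mu^-1)); last by rewrite lerDr.
    by apply: ge0_ler_powR; rewrite ?nnegrE ?invr_ge0 ?(ltW mu0)//; lra.
  by have := powR_ge0 (enorm x) (1 + alpha); nra.
by have := ler_norm (- T x); rewrite normrN; lra.
Qed.

(** Near the origin the exponent is at most C |x|^-L - |x|^-s, which tends
    to - infinity; at infinity the corrections of the amplitude exponent are
    bounded, so that its size is that of exp rho0. *)
Lemma profile_exists : exists m1 phi rho, wkb_profile_spec m1 phi rho.
Proof.
have al := alpha1; have m0 := mu0.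
have [u [w [s [Su Sw [C [L [C0 Ls s1 HL]]] H1 H2]]]] := wkb_exists a_sym sa sb mu0 alpha1 mu12 sc2.
set phi := (fun x => phi0 alpha x + u x) in H1 H2.
set rho := (fun x => rho0 alpha x + (w x - dotp x x `^ (- s / 2))) in H1 H2.
have Sp : sy (- s) (fun x : 'rV[R]_n => dotp x x `^ (- s / 2)) := sy_powR (- s).
have dE x : dotp x x `^ (- s / 2) = enorm x `^ (- s).
  by rewrite -sqr_enorm sqr_enorm_powR; congr (_ `^ _); field.
exists (1 + alpha), phi, rho; split => //.
- rewrite /rho; apply: gsy_add.
    have g0 : gsy 0 (@rho0 R n alpha) by exact: gsy_rho0.
    by apply: gsy_weaken g0; lra.
  apply: (@gsy_weaken _ _ 0); first by lra.
  apply: sy_gsy; apply: sy_sub; first by apply: sy_weaken Sw; lra.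
  by apply: sy_weaken Sp; lra.
- apply: (gsy_add (gsy_phi0 alpha1)); apply: gsy_weaken (sy_gsy Su); lra.
- move=> x x0; apply: (@continuousD _ _ _ (rho0 alpha) (fun x => w x - dotp x x `^ (- s / 2))).
    exact: rho0_continuous.
  apply: (@continuousB _ _ _ w (fun x : 'rV[R]_n => dotp x x `^ (- s / 2))).
    exact: sy_cont Sw x0.
  exact: sy_cont Sp x0.
- move=> x x0; apply: (@continuousD _ _ _ (phi0 alpha) u); first exact: phi0_cont.
  exact: sy_cont Su x0.
- move=> N.
  pose K := Num.bound `|N|.
  have NK : N <= K.+1%:R.
    by rewrite (le_trans (ler_norm _))// (le_trans (ltW (archi_boundP (normr_ge0 N))))// ler_nat.
  pose D := expR (C * (2 * C + 1) `^ (s - 1)).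
  have D0 : 0 <= D by exact: expR_ge0.
  exists (D * (K.+1%:R ^+ K.+1 * 2 ^+ K.+1)); first by apply: mulr_ge0 => //; apply: mulr_ge0; apply: exprn_ge0; rewrite ?ler0n.
  move=> x x0 x1; have r0 := enorm_Omega x0.
  have t1 : 1 <= (enorm x)^-1 by rewrite invf_ge1.
  have j1 : jap x `^ (- ampl) <= 1.
    by apply: powR_le1; rewrite ?jap_ge1// oppr_le0 ltW// ampl_gt0.
  rewrite expRD expR_rho0; apply: (@le_trans _ _ (expR (w x - dotp x x `^ (- s / 2)))).
    by rewrite ler_piMl ?expR_ge0.
  have iE (p : R) : enorm x `^ (- p) = (enorm x)^-1 `^ p.
    by rewrite -(powR_inv1 (ltW r0)) -powRrM mulN1r.
  have h : w x - dotp x x `^ (- s / 2) <= C * (2 * C + 1) `^ (s - 1) - (enorm x)^-1 / 2.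
    apply: le_trans (power_gap C0 Ls s1 t1); rewrite dE -!iE lerB//.
    by rewrite (le_trans (ler_norm _))// HL.
  apply: (@le_trans _ _ (D * expR (- ((enorm x)^-1 / 2)))); first by rewrite -expRD ler_expR.
  rewrite -mulrA ler_wpM2l//.
  have t2 : 0 < (enorm x)^-1 / 2 by rewrite divr_gt0// invr_gt0.
  apply: (le_trans (expR_beats_power K t2)).
  rewrite -mulrA ler_wpM2l ?exprn_ge0//.
  rewrite exprMn invfM exprVn invrK exprVn invrK mulrC ler_wpM2l ?exprn_ge0//.
  by rewrite -powR_mulrn ?(ltW r0)//; apply: ger_powR => //; rewrite r0.
- have [Cw Cw0 HCw] := sy_bound Sw.
  exists (expR (Cw + 1) * 2 `^ ampl); first by rewrite mulr_gt0 ?expR_gt0 ?powR_gt0.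
  move=> x x1; have r0 : 0 < enorm x by rewrite (lt_le_trans ltr01).
  have h : `|w x - dotp x x `^ (- s / 2)| <= Cw + 1.
    rewrite (le_trans (ler_normB _ _))// lerD//.
      by rewrite (le_trans (HCw x x1))// ler_piMr// powR_le1//; lra.
    by rewrite dE ger0_norm ?powR_ge0// powR_le1//; lra.
  have j1 := jap_ge1 x; have j2 := enorm_le_jap x; have j3 := jap_le x; have a0 := ampl_gt0.
  have ja : jap x <= 2 * enorm x by lra.
  have p1 : jap x `^ (- ampl) <= enorm x `^ (- ampl).
    rewrite !powRN lef_pV2 ?posrE ?powR_gt0 ?jap_gt0//.
    by apply: ge0_ler_powR; rewrite ?nnegrE ?(ltW a0) ?(ltW r0) ?(ltW (jap_gt0 x)).
  have p2 : (2 `^ ampl)^-1 * enorm x `^ (- ampl) <= jap x `^ (- ampl).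
    rewrite !powRN -invfM -powRM ?(ltW r0)// lef_pV2 ?posrE ?powR_gt0 ?jap_gt0 ?mulr_gt0//.
    by apply: ge0_ler_powR; rewrite ?nnegrE ?(ltW a0) ?mulr_ge0 ?(ltW r0) ?(ltW (jap_gt0 x)).
  have /andP[h1 h2] : - (Cw + 1) <= w x - dotp x x `^ (- s / 2) <= Cw + 1 by rewrite -ler_norml.
  have q1 : expR (- (Cw + 1)) <= expR (w x - dotp x x `^ (- s / 2)) by rewrite ler_expR.
  have q2 : expR (w x - dotp x x `^ (- s / 2)) <= expR (Cw + 1) by rewrite ler_expR.
  have -> : expR (rho x) = jap x `^ (- ampl) * expR (w x - dotp x x `^ (- s / 2)).
    by rewrite -expR_rho0 -expRD.
  rewrite invfM -expRN; apply/andP; split.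
    by rewrite -mulrA mulrC; apply: ler_pM => //; rewrite ?expR_ge0 ?mulr_ge0 ?invr_ge0 ?powR_ge0.
  apply: (@le_trans _ _ (enorm x `^ (- ampl) * expR (Cw + 1))).
    by apply: ler_pM => //; rewrite ?expR_ge0 ?powR_ge0.
  rewrite mulrC ler_wpM2r ?powR_ge0// ler_peMr ?expR_ge0//.
  by apply: powR_ge1; lra.
- exact: flux_lower Su _.
Qed.

End profile.

(** * The quasimode and its image *)

Section quasimode.
Context {R : realType} {n : nat}.
Notation mu := (@lebesgue_rV R n).
Implicit Types (u v f h q : 'rV[R]_n -> R) (x : 'rV[R]_n).
Variables (alpha : R) (a : 'I_n -> 'I_n -> 'rV[R]_n -> R)
  (b : 'I_n -> 'rV[R]_n -> R) (c : 'rV[R]_n -> R) (m1 : R) (phi rho : 'rV[R]_n -> R).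
Hypotheses (a_sym : forall j k, a j k = a k j)
  (P : wkb_profile_spec alpha a b (divpot alpha a c) m1 phi rho).

Let Grho := prof_rho P.
Let Gphi := prof_phi P.
Let flat := prof_flat P.
Notation osc := (osc rho phi).
Notation c2 := (divpot alpha a c).

Let s1 : sy 0 (fun _ : 'rV[R]_n => 1) := sy_const 1.
Let s0 : sy 0 (fun _ : 'rV[R]_n => 0) := sy_const 0.

Definition mode1 := osc (fun=> 1) (fun=> 0).
Definition mode2 := osc (fun=> 0) (fun=> 1).

Lemma partial_cst (k : R) j x : partial j (fun _ : 'rV[R]_n => k) x = 0.
Proof. by have [_ E] := is_derive_const k x (delta_mx ord0 j : 'rV[R]_n); exact: E. Qed.

Lemma partial_mode1 j : partial j mode1 = osc (partial j rho) (fun x => - partial j phi x).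
Proof.
rewrite /mode1 (partial_osc Grho Gphi flat s1 s0); apply: osc_ext => x _; rewrite partial_cst; ring.
Qed.

Lemma partial_mode2 j : partial j mode2 = osc (partial j phi) (partial j rho).
Proof.
rewrite /mode2 (partial_osc Grho Gphi flat s0 s1); apply: osc_ext => x _; rewrite partial_cst; ring.
Qed.

Let sr j : sy (m1 - 1) (partial j rho) := gsy_sy j Grho.
Let sp j : sy (m1 - 1) (partial j phi) := gsy_sy j Gphi.

Lemma partial_neg_phi j k x : Omega x ->
  partial j (fun y => - partial k phi y) x = - partial j (partial k phi) x.
Proof. by move=> x0; have [_ E] := is_derive_opp (sy_derive j (sp k) x0); exact: E. Qed.

Lemma partial2_mode1 j k : partial j (partial k mode1) =
  osc (fun x => partial j (partial k rho) x + partial j rho x * partial k rho x - partial j phi x * partial k phi x)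
      (fun x => - (partial j (partial k phi) x + partial j rho x * partial k phi x + partial j phi x * partial k rho x)).
Proof.
rewrite partial_mode1 (partial_osc Grho Gphi flat (sr k) (sy_opp (sp k))).
by apply: osc_ext => x x0; rewrite ?partial_neg_phi//;
  move: (partial j (partial k rho) x) (partial j (partial k phi) x) (partial j rho x) (partial k rho x)
    (partial j phi x) (partial k phi x) => *; ring.
Qed.

Lemma partial2_mode2 j k : partial j (partial k mode2) =
  osc (fun x => partial j (partial k phi) x + partial j rho x * partial k phi x + partial j phi x * partial k rho x)
      (fun x => partial j (partial k rho) x + partial j rho x * partial k rho x - partial j phi x * partial k phi x).
Proof.
rewrite partial_mode2 (partial_osc Grho Gphi flat (sp k) (sr k)).
by apply: osc_ext => x x0;
  move: (partial j (partial k rho) x) (partial j (partial k phi) x) (partial j rho x) (partial k rho x)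
    (partial j phi x) (partial k phi x) => *; ring.
Qed.

Lemma Mop_Qform x :
  \sum_(j < n) \sum_(k < n) (gmat a j k x * (partial j (partial k rho) x + partial j rho x * partial k rho x
     - partial j phi x * partial k phi x) + partial j (a j k) x * partial k rho x) =
    Mop a rho x + Qform a rho rho x - Qform a phi phi x /\
  \sum_(j < n) \sum_(k < n) (gmat a j k x * (partial j (partial k phi) x + partial j rho x * partial k phi x
     + partial j phi x * partial k rho x) + partial j (a j k) x * partial k phi x) =
    Mop a phi x + 2 * Qform a phi rho x.
Proof.
split.
  rewrite /Mop /Qform -sumrN -!big_split/=; apply: eq_bigr => j _.
  rewrite -sumrN -!big_split/=; apply: eq_bigr => k _.
  move: (gmat a j k x) (partial j (partial k rho) x) (partial j rho x) (partial k rho x)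
    (partial j phi x) (partial k phi x) (partial j (a j k) x) => *; ring.
rewrite mulr_natl mulr2n {1}(QformC a_sym) /Mop /Qform -!big_split/=; apply: eq_bigr => j _.
rewrite -!big_split/=; apply: eq_bigr => k _.
move: (gmat a j k x) (partial j (partial k phi) x) (partial j rho x) (partial k rho x)
  (partial j phi x) (partial k phi x) (partial j (a j k) x) => *; ring.
Qed.

Lemma mode_Mop x : Omega x ->
  Mop a mode1 x = (Mop a rho x + Qform a rho rho x - Qform a phi phi x) * mode1 x
    - (Mop a phi x + 2 * Qform a phi rho x) * mode2 x /\
  Mop a mode2 x = (Mop a rho x + Qform a rho rho x - Qform a phi phi x) * mode2 x
    + (Mop a phi x + 2 * Qform a phi rho x) * mode1 x.
Proof.
move=> x0; have [<- <-] := Mop_Qform x.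
split.
  rewrite /Mop !mulr_suml -sumrN -big_split/=; apply: eq_bigr => j _.
  rewrite !mulr_suml -sumrN -big_split/=; apply: eq_bigr => k _.
  rewrite partial2_mode1 partial_mode1 /mode1 /mode2 !oscE//.
  move: (expR _) (cos _) (sin _) (gmat a j k x) (partial j (partial k rho) x) (partial j (partial k phi) x)
    (partial j rho x) (partial k rho x) (partial j phi x) (partial k phi x) (partial j (a j k) x) => *; ring.
rewrite /Mop !mulr_suml -big_split/=; apply: eq_bigr => j _.
rewrite !mulr_suml -big_split/=; apply: eq_bigr => k _.
rewrite partial2_mode2 partial_mode2 /mode1 /mode2 !oscE//.
move: (expR _) (cos _) (sin _) (gmat a j k x) (partial j (partial k rho) x) (partial j (partial k phi) x)
  (partial j rho x) (partial k rho x) (partial j phi x) (partial k phi x) (partial j (a j k) x) => *; ring.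
Qed.

Lemma mode_Bop x : Omega x ->
  Bop b mode1 x = Bop b rho x * mode1 x - Bop b phi x * mode2 x /\
  Bop b mode2 x = Bop b rho x * mode2 x + Bop b phi x * mode1 x.
Proof.
move=> x0; split.
  rewrite /Bop !mulr_suml -sumrN -big_split/=; apply: eq_bigr => j _.
  rewrite partial_mode1 /mode1 /mode2 !oscE//.
  move: (expR _) (cos _) (sin _) (b j x) (partial j rho x) (partial j phi x) => *; ring.
rewrite /Bop !mulr_suml -big_split/=; apply: eq_bigr => j _.
rewrite partial_mode2 /mode1 /mode2 !oscE//.
move: (expR _) (cos _) (sin _) (b j x) (partial j rho x) (partial j phi x) => *; ring.
Qed.

Notation F1 := (E1 a b c2 phi rho).
Notation F2 := (E2 a b phi rho).

Definition image1 := osc F1 (fun x => - F2 x).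
Definition image2 := osc F2 F1.

(** On exp (rho + i phi) a derivative acts as multiplication by the gradient of
    rho + i phi; collecting real and imaginary parts gives the factor E1 + i E2.
    At the origin both sides vanish by flatness. *)
Lemma mode_image x :
  Lop alpha a c mode1 x + Kop b mode2 x = image1 x /\
  Lop alpha a c mode2 x - Kop b mode1 x = image2 x.
Proof.
have [->|x0] := eqVneq x 0.
  rewrite /Lop /Kop /Mop /Bop /image1 /image2 !osc0.
  have Z1 : mode1 0 = 0 := osc0 _ _ _ _. have Z2 : mode2 0 = 0 := osc0 _ _ _ _.
  rewrite Z1 Z2 !mulr0 !addr0.
  have S w : (forall j, partial j w 0 = 0) -> (forall j k, partial j (partial k w) 0 = 0) ->
      \sum_(j < n) \sum_(k < n) (gmat a j k 0 * partial j (partial k w) 0 + partial j (a j k) 0 * partial k w 0) = 0 /\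
      \sum_(j < n) b j 0 * partial j w 0 = 0.
    move=> h1 h2; split; rewrite big1// => j _; last by rewrite h1 mulr0.
    by rewrite big1// => k _; rewrite h1 h2 !mulr0 addr0.
  have [||-> ->] := S mode1.
  - by move=> j; rewrite partial_mode1 osc0.
  - by move=> j k; rewrite partial2_mode1 osc0.
  have [||-> ->] := S mode2.
  - by move=> j; rewrite partial_mode2 osc0.
  - by move=> j k; rewrite partial2_mode2 osc0.
  by split; ring.
have [MA MB] := mode_Mop x0; have [BA BB] := mode_Bop x0.
rewrite /Lop /Kop MA MB BA BB /image1 /image2 /mode1 /mode2 !oscE// /E1 /E2.
move: (expR _) (cos _) (sin _) (Mop a rho x) (Qform a rho rho x) (Qform a phi phi x) (Mop a phi x)
  (Qform a phi rho x) (Bop b rho x) (Bop b phi x) (divb b x) (c2 x) => *.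
by split; field.
Qed.

End quasimode.

Section quasimode_bounds.
Context {R : realType} {n : nat}.
Notation mu := (@lebesgue_rV R n).
Implicit Types (u v f h q : 'rV[R]_n -> R) (x : 'rV[R]_n).
Variables (alpha mu0 : R) (a : 'I_n -> 'I_n -> 'rV[R]_n -> R)
  (b : 'I_n -> 'rV[R]_n -> R) (c : 'rV[R]_n -> R) (m1 : R) (phi rho : 'rV[R]_n -> R).
Hypotheses (n1 : (1 <= n)%N) (alpha1 : 1 < alpha) (a_sym : forall j k, a j k = a k j)
  (mu_gt0 : 0 < mu0) (sa : forall j k, sy (- mu0) (a j k)) (sb : forall j, sy (alpha - mu0) (b j))
  (P : wkb_profile_spec alpha a b (divpot alpha a c) m1 phi rho).

Let Grho := prof_rho P.
Let Gphi := prof_phi P.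
Let flat := prof_flat P.
Notation osc := (osc rho phi).
Notation c2 := (divpot alpha a c).
Notation ampl := (@ampl R n alpha).
Notation F1 := (E1 a b c2 phi rho).
Notation F2 := (E2 a b phi rho).
Notation v1 := (mode1 phi rho).
Notation v2 := (mode2 phi rho).
Notation f1 := (image1 alpha a b c phi rho).
Notation f2 := (image2 alpha a b c phi rho).

Lemma prof_grow : exists2 C : R, 0 <= C & forall x, 1 <= enorm x -> expR (rho x) <= C.
Proof.
have [C C0 HC] := prof_size P; exists C; first exact: ltW.
move=> x x1; have /andP[_ h] := HC x x1; apply: (le_trans h); rewrite ler_piMr ?(ltW C0)//.
by apply: powR_le1 => //; rewrite oppr_le0 ltW// ampl_gt0.
Qed.

Lemma powR_wt x (p : R) : 1 <= enorm x -> enorm x `^ p <= 2 `^ `|p| * wt p x.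
Proof.
move=> x1; have r0 : 0 < enorm x by rewrite (lt_le_trans ltr01).
have w0 := oneDenorm_gt0 x.
have [p0|p0] := leP 0 p.
  rewrite ger0_norm// (@le_trans _ _ (wt p x))//.
    by apply: ge0_ler_powR; rewrite ?nnegrE ?(ltW r0) ?(ltW w0)// lerDr.
  by rewrite ler_peMl ?wt_ge0// powR_ge1//; lra.
rewrite ltr0_norm// /wt -[p in leLHS]opprK -[p in X in _ <= _ * X]opprK !(powRN _ (- p)).
rewrite ler_pdivlMr ?powR_gt0// mulrC ler_pdivrMr ?powR_gt0// -powRM ?(ltW r0)//.
by apply: ge0_ler_powR; rewrite ?nnegrE ?mulr_ge0 ?(ltW r0) ?(ltW w0) ?oppr_ge0 ?(ltW p0)//; lra.
Qed.

Lemma wt_small x (p : R) : enorm x <= 1 -> 1 <= 2 `^ `|p| * wt p x.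
Proof.
move=> x1; have w0 := oneDenorm_gt0 x; have e0 := enorm_ge0 x.
have [p0|p0] := leP 0 p.
  by rewrite -[1]mulr1 ler_pM// powR_ge1//; lra.
rewrite ltr0_norm// /wt -[p in X in _ <= _ * X]opprK (powRN _ (- p)) ler_pdivlMr ?powR_gt0// mul1r.
by apply: ge0_ler_powR; rewrite ?nnegrE ?(ltW w0) ?oppr_ge0 ?(ltW p0)//; lra.
Qed.

(** At infinity the bound is the exact size of the amplitude, near the origin
    its flatness. *)
Lemma osc_decay m q1 q2 : sy m q1 -> sy m q2 ->
  exists2 C : R, 0 <= C & forall x, `|osc q1 q2 x| <= C * wt (m - ampl) x.
Proof.
move=> S1 S2; have [C C0 HC] := osc_flat phi flat S1 S2.
have [C1 C10 H1] := sy_bound S1; have [C2 C20 H2] := sy_bound S2.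
have [D D0 HD] := prof_size P.
pose E := 2 `^ `|m - ampl|.
have E0 : 0 <= E by exact: powR_ge0.
exists ((C + D * (C1 + C2)) * E); first by rewrite mulr_ge0// addr_ge0// mulr_ge0 ?(ltW D0)// addr_ge0.
have DC : 0 <= D * (C1 + C2) by rewrite mulr_ge0 ?(ltW D0)// addr_ge0.
move=> x; have e0 := enorm_ge0 x; have [x1|x1] := leP (enorm x) 1.
  apply: (le_trans (HC x x1)); rewrite -mulrA mulrDl.
  have h := wt_small (m - ampl) x1.
  apply: (@le_trans _ _ (C * (E * wt (m - ampl) x))).
    by rewrite ler_wpM2l// (le_trans _ h)// expr_le1.
  by rewrite lerDl mulr_ge0// (le_trans ler01).
have x0 : Omega x by rewrite /Omega /= -enorm_gt0 (lt_trans ltr01).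
have r0 := enorm_Omega x0.
have /andP[_ h] := HD x (ltW x1).
apply: (le_trans (osc_le _ _ _ _ x0)).
apply: (@le_trans _ _ (D * enorm x `^ (- ampl) * ((C1 + C2) * enorm x `^ m))).
  by apply: ler_pM => //; rewrite mulrDl lerD ?H1 ?H2 ?ltW.
rewrite mulrACA -powRD ?(gt_eqF r0) ?implybT// (addrC (- ampl)).
apply: (@le_trans _ _ (D * (C1 + C2) * (E * wt (m - ampl) x))).
  by rewrite ler_wpM2l// powR_wt// ltW.
by rewrite -[leRHS]mulrA (mulrDl C) lerDr mulr_ge0// mulr_ge0// wt_ge0.
Qed.

Let s1 : sy 0 (fun _ : 'rV[R]_n => 1) := sy_const 1.
Let s0 : sy 0 (fun _ : 'rV[R]_n => 0) := sy_const 0.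

Lemma osc_square_integrable m q1 q2 : sy m q1 -> sy m q2 -> 2 * (m - ampl) < - n%:R ->
  measurable_fun setT (osc q1 q2) /\
  mu.-integrable setT (EFin \o (fun x => osc q1 q2 x ^+ 2)).
Proof.
move=> S1 S2 h.
have T0 : tcl 0 (wt `|m|) (osc q1 q2).
  have H := osc_tcl0 (prof_crho P) (prof_cphi P) flat prof_grow S1 S2; exact: H.
have mo := tcl_measurable T0; split => //.
have [C C0 HC] := osc_decay S1 S2.
apply: (integrable_le measurableT _ (integrable_cmul measurableT (C ^+ 2) (integrable_wt h))).
  exact: measurable_funX.
move=> x _; rewrite normrX (_ : 2 * (m - ampl) = m - ampl + (m - ampl)); last by ring.
by rewrite -wtD -expr2 -exprMn lerXn2r ?nnegrE ?mulr_ge0 ?wt_ge0.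
Qed.

(** The square of the amplitude is of order - (n - 1 + alpha), which is
    below - n exactly because alpha > 1, the condition for classical
    trajectories to reach infinity in finite time. *)
Lemma mode_square_integrable :
  [/\ measurable_fun setT v1, measurable_fun setT v2,
   mu.-integrable setT (EFin \o (fun x => v1 x ^+ 2)) &
   mu.-integrable setT (EFin \o (fun x => v2 x ^+ 2))].
Proof.
have h : 2 * (0 - ampl) < - n%:R by have al := alpha1; rewrite /ampl; lra.
have [A1 A2] := osc_square_integrable s1 s0 h.
by have [B1 B2] := osc_square_integrable s0 s1 h.
Qed.

(** The residuals are of order at most 0 and alpha / 2 - 1, and the squares of
    the products have order at most - (n - 1 + alpha) and - n - 1. *)
Lemma image_square_integrable :
  [/\ measurable_fun setT f1, measurable_fun setT f2,
   mu.-integrable setT (EFin \o (fun x => f1 x ^+ 2)) &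
   mu.-integrable setT (EFin \o (fun x => f2 x ^+ 2))].
Proof.
pose m := Num.max 0 (alpha / 2 - 1).
have h : 2 * (m - ampl) < - n%:R.
  have al := alpha1; rewrite /ampl /m.
  by case: (leP 0 (alpha / 2 - 1)) => _; lra.
have S1 : sy m F1 by apply: sy_weaken (prof_E1 P); rewrite le_max lexx.
have S2 : sy m F2 by apply: sy_weaken (prof_E2 P); rewrite le_max lexx orbT.
have [A1 A2] := osc_square_integrable S1 (sy_opp S2) h.
by have [B1 B2] := osc_square_integrable S2 S1 h.
Qed.

Lemma mode_tcl : exists2 M : R, 0 <= M & tcl 2 (wt M) v1 /\ tcl 2 (wt M) v2.
Proof.
have [M M0 HM] := osc_tcl Grho Gphi (prof_crho P) (prof_cphi P) flat prof_grow 2 s1 s0.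
have [M' M'0 HM'] := osc_tcl Grho Gphi (prof_crho P) (prof_cphi P) flat prof_grow 2 s0 s1.
exists (M + M'); first exact: addr_ge0.
by split; [apply: tcl_weaken HM; rewrite lerDl|apply: tcl_weaken HM'; rewrite lerDr].
Qed.

End quasimode_bounds.

(** * The energy flux through large spheres *)

Section energy_flux.
Context {R : realType} {n : nat}.
Notation mu := (@lebesgue_rV R n).
Implicit Types (u v f h q : 'rV[R]_n -> R) (x : 'rV[R]_n).
Variables (alpha mu0 : R) (a : 'I_n -> 'I_n -> 'rV[R]_n -> R)
  (b : 'I_n -> 'rV[R]_n -> R) (c : 'rV[R]_n -> R) (m1 : R) (phi rho : 'rV[R]_n -> R).
Hypotheses (n1 : (1 <= n)%N) (alpha1 : 1 < alpha) (a_sym : forall j k, a j k = a k j)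
  (mu_gt0 : 0 < mu0) (sa : forall j k, sy (- mu0) (a j k)) (sb : forall j, sy (alpha - mu0) (b j))
  (P : wkb_profile_spec alpha a b (divpot alpha a c) m1 phi rho).

Let Grho := prof_rho P.
Let Gphi := prof_phi P.
Notation c2 := (divpot alpha a c).
Notation ampl := (@ampl R n alpha).
Notation F2 := (E2 a b phi rho).
Notation v1 := (mode1 phi rho).
Notation v2 := (mode2 phi rho).
Notation f1 := (image1 alpha a b c phi rho).
Notation f2 := (image2 alpha a b c phi rho).

Let rho2 x : R := 2 * rho x.
Let zero : 'rV[R]_n -> R := fun=> 0.
Notation dens := (osc rho2 zero).
(** The current exp (2 rho) (g grad phi + b / 2), in the form of an oscillating
    function of phase 0 so that its extension by 0 to the origin is
    differentiable. *)
Definition Flux j := dens (flux a b phi j) (fun=> 0).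

Lemma Fluxx j x : Omega x -> Flux j x = expR (rho x) ^+ 2 * flux a b phi j x.
Proof.
move=> x0; rewrite /Flux oscE// cos0 mulr1 mul0r addr0; congr (_ * _).
by rewrite /rho2 -expRM_natl.
Qed.

Let s0 : sy 0 (fun _ : 'rV[R]_n => 0) := sy_const 0.
Let m2 : R := `|m1| + `|alpha|.

Lemma sy_flux j : sy m2 (flux a b phi j).
Proof.
have h1 := ler_norm m1; have h2 := ler_norm alpha; have h3 := normr_ge0 m1; have h4 := normr_ge0 alpha.
have m0 := mu_gt0.
apply: sy_add.
  apply: sy_sum => k; apply: sy_weaken (sy_mul (sy_gmat sa j k mu_gt0) (gsy_sy k Gphi)).
  by rewrite /m2; lra.
by apply: sy_cmul; apply: sy_weaken (sb j); rewrite /m2; lra.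
Qed.

Lemma is_derive_rho2 x j : Omega x -> is_derive x (delta_mx ord0 j) rho2 (2 * partial j rho x).
Proof. by move=> x0; exact: (is_derive_cmul 2 (gsy_derive j Grho x0)). Qed.

Lemma gsy_rho2 : gsy m1 rho2.
Proof.
move=> j; split; first by move=> x x0; have [] := is_derive_rho2 j x0.
apply: sy_ext (sy_cmul 2 (gsy_sy j Grho)) => x x0.
by have [_ E] := is_derive_rho2 j x0; rewrite [RHS]E.
Qed.

Lemma gsy_zero : gsy m1 zero.
Proof.
move=> j; split; first by move=> x _; have [] := is_derive_const 0 x (delta_mx ord0 j : 'rV[R]_n).
by apply: sy_ext (sy_zero (m1 - 1)) => x _; rewrite /zero partial_cst.
Qed.

Lemma rho2_continuous x : Omega x -> {for x, continuous rho2}.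
Proof.
move=> x0; apply: (@continuousM _ _ (fun=> 2) rho); first exact: cst_continuous.
exact: prof_crho P x x0.
Qed.

Lemma flat2 (N : R) : exists2 C : R, 0 <= C & forall x, Omega x -> enorm x <= 1 ->
  expR (rho2 x) <= C * enorm x `^ N.
Proof.
have [C C0 HC] := prof_flat P (N / 2); exists (C ^+ 2); first exact: exprn_ge0.
move=> x x0 x1; have r0 := enorm_Omega x0.
have -> : expR (rho2 x) = expR (rho x) ^+ 2 by rewrite /rho2 -expRM_natl.
rewrite (_ : enorm x `^ N = (enorm x `^ (N / 2)) ^+ 2); last first.
  by rewrite -powR_mulrn ?powR_ge0// -powRrM divfK.
by rewrite -exprMn lerXn2r ?nnegrE ?expR_ge0 ?mulr_ge0 ?powR_ge0// HC.
Qed.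

Lemma grow2 : exists2 C : R, 0 <= C & forall x, 1 <= enorm x -> expR (rho2 x) <= C.
Proof.
have [C C0 HC] := prof_grow n1 alpha1 P; exists (C ^+ 2); first exact: exprn_ge0.
move=> x x1; have -> : expR (rho2 x) = expR (rho x) ^+ 2 by rewrite /rho2 -expRM_natl.
by rewrite lerXn2r ?nnegrE ?expR_ge0// HC.
Qed.

Lemma Flux_tcl : exists2 M : R, 0 <= M & forall j, tcl 1 (wt M) (Flux j).
Proof.
have zc x : Omega x -> {for x, continuous zero} by move=> _; exact: cst_continuous.
have sz : sy m2 (fun _ : 'rV[R]_n => 0) by apply: sy_weaken s0; rewrite /m2 addr_ge0.
have /choice[M HM] : forall j, exists M : R, 0 <= M /\ tcl 1 (wt M) (Flux j).
  move=> j; have [M M0 H] := osc_tcl gsy_rho2 gsy_zero rho2_continuous zc flat2 grow2 1 (sy_flux j)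
    sz.
  by exists M.
exists (\sum_(j < n) M j); first by apply: sumr_ge0 => j _; have [] := HM j.
move=> j; apply: tcl_weaken (HM j).2; rewrite (bigD1 j)//= lerDl.
by apply: sumr_ge0 => i _; have [] := HM i.
Qed.

Lemma partial_flux j x : Omega x -> partial j (flux a b phi j) x =
  \sum_(k < n) (gmat a j k x * partial j (partial k phi) x + partial j (a j k) x * partial k phi x) +
    2^-1 * partial j (b j) x.
Proof.
move=> x0.
have Dg k : is_derive x (delta_mx ord0 j) (gmat a j k) (partial j (a j k) x).
  rewrite -[X in is_derive _ _ _ X]add0r.
  exact: (is_derive_add (is_derive_const (j == k)%:R x (delta_mx ord0 j : 'rV[R]_n)) (sy_derive j (sa j k) x0)).
have [_ E] := is_derive_add (is_derive_bigsum (index_enum 'I_n)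
   (fun k => is_derive_mul (Dg k) (sy_derive j (gsy_sy k Gphi) x0)))
   (is_derive_cmul 2^-1 (sy_derive j (sb j) x0)).
rewrite [LHS]E; congr (_ + _); apply: eq_bigr => k _; rewrite addrC.
by congr (_ + _).
Qed.

(** The transport residual is - exp (- 2 rho) times the divergence of the
    current, and the imaginary part of f times the conjugate of v is exp (2 rho)
    times this residual. *)
Lemma flux_balance x : f2 x * v1 x - f1 x * v2 x = - \sum_(j < n) partial j (Flux j) x.
Proof.
have sz : sy m2 (fun _ : 'rV[R]_n => 0).
  by apply: sy_weaken s0; rewrite /m2 addr_ge0.
have E j : partial j (Flux j) = dens
    (fun y => partial j (flux a b phi j) y + partial j rho2 y * flux a b phi j y + partial j zero y * 0)
    (fun y => partial j (fun=> 0) y + partial j rho2 y * 0 - partial j zero y * flux a b phi j y).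
  exact: (partial_osc gsy_rho2 gsy_zero flat2 (sy_flux j) sz j).
have [->|x0] := eqVneq x 0.
  rewrite /mode1 /mode2 !osc0 !mulr0 subrr big1 ?oppr0// => j _.
  by rewrite E osc0.
transitivity (expR (rho x) ^+ 2 * F2 x).
  rewrite /mode1 /mode2 /image1 /image2 !oscE//.
  have := cos2Dsin2 (phi x); move: (expR _) (cos _) (sin _) (F2 x) (E1 _ _ _ _ _ x) => e cc ss q2 q1 h.
  have -> : e ^+ 2 * q2 = e ^+ 2 * q2 * (cc ^+ 2 + ss ^+ 2) by rewrite h mulr1.
  by ring.
have -> : \sum_(j < n) partial j (Flux j) x =
    expR (rho x) ^+ 2 * \sum_(j < n) (partial j (flux a b phi j) x + 2 * partial j rho x * flux a b phi j x).
  rewrite mulr_sumr; apply: eq_bigr => j _; rewrite E oscE// cos0 sin0 !mulr0 !addr0 mulr1.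
  have [_ D] := is_derive_rho2 j x0; rewrite (D : partial j rho2 x = _).
  by congr (_ * _); rewrite /rho2 -expRM_natl.
rewrite -mulrN; congr (_ * _); rewrite /E2; congr (- _).
rewrite (QformC a_sym phi rho) /Qform /Mop /Bop /divb !mulr_sumr -!big_split/=; apply: eq_bigr => j _.
rewrite partial_flux// /flux mulrDr mulr_sumr [in RHS]mulr_sumr.
transitivity (\sum_(k < n) (gmat a j k x * partial j (partial k phi) x + partial j (a j k) x * partial k phi x) +
  \sum_(k < n) 2 * (gmat a j k x * (partial j rho x * partial k phi x)) +
    (b j x * partial j rho x + 2^-1 * partial j (b j) x)).
  by rewrite !addrA; congr (_ + _ + _); rewrite addrC.
have -> : \sum_(k < n) 2 * partial j rho x * (gmat a j k x * partial k phi x) =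
    \sum_(k < n) 2 * (gmat a j k x * (partial j rho x * partial k phi x)).
  by apply: eq_bigr => k _; move: (gmat a j k x) (partial j rho x) (partial k phi x) => *; ring.
move: (\sum_(k < n) _) (\sum_(k < n) _) => S1 S2.
move: (b j x) (partial j rho x) (partial j (b j) x) => *; by field.
Qed.

End energy_flux.

Section cutoff.
Context {R : realType} {n : nat}.
Notation mu := (@lebesgue_rV R n).
Implicit Types (f h : 'rV[R]_n -> R) (x z : 'rV[R]_n).

Lemma tcl_cst k M (r : R) : 0 <= M -> tcl k (wt M) (fun _ : 'rV[R]_n => r).
Proof.
move=> M0; apply: (tcl_weaken M0).
by apply: (cls_weight_le T_ge0) (cls_const openT T_ge0 k r) => x _; rewrite wt0.
Qed.

Lemma tcl_coord k i : tcl k (wt 1) (fun x : 'rV[R]_n => x ord0 i).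
Proof.
have c0 : cls0 setT (wt 1) (fun x : 'rV[R]_n => x ord0 i).
  split; first by move=> x _; exact: coord_continuous.
  exists 1 => // x _; rewrite mul1r /wt powRr1 ?(ltW (oneDenorm_gt0 x))//.
  by rewrite (le_trans (coord_le_enorm x i))// lerDr.
case: k => [//|k]; apply: tclSI => // j; exists (fun=> (delta_mx ord0 j : 'rV[R]_n) ord0 i).
  by move=> x; exact: is_derive_coord.
exact: tcl_cst.
Qed.

Lemma tcl_dotp k : tcl k (wt 2) (fun x : 'rV[R]_n => dotp x x).
Proof.
apply: tcl_sum => j; rewrite (_ : 2 = 1 + 1 :> R)//.
by apply: tcl_mul; exact: tcl_coord.
Qed.

(** Its negative powers are cutoffs that decay polynomially, at the scale
    ka^(-1/2).  They replace the balls of the divergence theorem, and their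
    gradient is explicit and radial. *)
Definition bump (ka : R) x : R := 1 + ka * dotp x x.

Lemma bump_ge1 ka x : 0 <= ka -> 1 <= bump ka x.
Proof. by move=> k0; rewrite lerDl mulr_ge0 ?dotp_ge0. Qed.

Lemma bump_powR_tcl k ka s : 0 < ka -> tcl k (wt (- 2 * s)) (fun x => bump ka x `^ (- s)).
Proof.
move=> k0; pose d := Num.min 1 ka / 2.
have d0 : 0 < d by rewrite divr_gt0// lt_min ltr01.
have T : tcl k (wt 2) (bump ka).
  by apply: tcl_add; [exact: tcl_cst|apply: tcl_cmul; exact: tcl_dotp].
have L : forall x : 'rV[R]_n, [set: 'rV[R]_n] x -> d * wt 2 x <= bump ka x.
  move=> x _; have e0 := enorm_ge0 x; have w0 := oneDenorm_gt0 x.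
  rewrite /wt powR_mulrn ?(ltW w0)// /bump -sqr_enorm /d.
  have h1 : Num.min 1 ka <= 1 by rewrite ge_min lexx.
  have h2 : Num.min 1 ka <= ka by rewrite ge_min lexx orbT.
  have h3 : 0 < Num.min 1 ka by rewrite lt_min ltr01.
  have h4 : (1 + enorm x) ^+ 2 <= 2 * (1 + enorm x ^+ 2) by have := sqr_ge0 (1 - enorm x); lra.
  apply: (@le_trans _ _ (Num.min 1 ka * (1 + enorm x ^+ 2))).
    by rewrite -mulrA ler_wpM2l ?(ltW h3)// mulrC ler_pdivrMr// mulrC.
  by rewrite mulrDr mulr1 lerD// ler_wpM2r ?sqr_ge0.
have := cls_powR openT T_ge0 (- s) d0 (fun x _ => wt_gt0 2 x) L T.
apply: (cls_weight_le T_ge0) => x _.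
by rewrite /wt -powRrM (_ : 2 * - s = - 2 * s); last by ring.
Qed.

Lemma bump_powR_derive ka s x j : 0 <= ka ->
  is_derive x (delta_mx ord0 j) (fun y : 'rV[R]_n => bump ka y `^ s)
    (s * bump ka x `^ (s - 1) * (ka * (2 * x ord0 j))).
Proof.
move=> k0; have b0 : 0 < bump ka x by rewrite (lt_le_trans ltr01)// bump_ge1.
have D : is_derive x (delta_mx ord0 j) (bump ka) (ka * (2 * x ord0 j)).
  rewrite -[X in is_derive _ _ _ X]add0r.
  exact: (is_derive_add (is_derive_const 1 x (delta_mx ord0 j)) (is_derive_cmul ka (is_derive_sqnorm x j))).
exact: (is_derive_compo (F := fun t => t `^ s) (is_derive1_powR s b0) D).
Qed.

Lemma bump_powR_le1 ka s x : 0 <= ka -> 0 <= s -> bump ka x `^ (- s) <= 1.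
Proof. by move=> k0 s0; apply: powR_le1; [exact: bump_ge1|rewrite oppr_le0]. Qed.

Section profile_constant.
Variable (p : R).
Hypothesis (p1 : 1 <= p).

(** The limit density: the flux |x|^2 / |x|^n through a sphere, weighted by the
    derivative of the cutoff at scale 1. *)
Definition core z : R := bump 1 z `^ (- p) * (dotp z z * wt (- n%:R) z).

Lemma weighted_core_tcl ka : 0 < ka -> tcl 0 (wt (- n%:R + 2 - 2 * p))
  (fun x : 'rV[R]_n => bump ka x `^ (- p) * (dotp x x * wt (- n%:R) x)).
Proof.
move=> k0; rewrite (_ : - n%:R + 2 - 2 * p = - 2 * p + (2 + - n%:R)); last by ring.
apply: tcl_mul; first exact: bump_powR_tcl.
apply: tcl_mul; first exact: tcl_dotp.
split; last by exists 1 => // x _; rewrite mul1r ger0_norm ?wt_ge0.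
move=> x _; apply: (@continuous_comp _ _ _ (fun y : 'rV[R]_n => 1 + enorm y) (fun y => y `^ (- n%:R))).
  exact: oneDenorm_continuous.
exact: (derive_continuous (is_derive1_powR _ (oneDenorm_gt0 x))).
Qed.

Hypothesis (pn : - n%:R + 2 - 2 * p < - n%:R).

Lemma core_integrable : mu.-integrable setT (EFin \o core).
Proof. exact: tcl_integrable pn (weighted_core_tcl ltr01). Qed.

Lemma core_ge0 z : 0 <= core z.
Proof. by rewrite !mulr_ge0 ?powR_ge0 ?dotp_ge0. Qed.

(** Under x = K z the bump becomes the one at scale 1, while |x|^2 (1 + |x|)^-n
    dx becomes at least K^2 times the same density in z: up to that factor the
    flux does not decrease with the radius. *)
Lemma core_scaling (K : R) : 1 <= K ->
  \int[mu]_z core z <= K ^- 2 *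
    \int[mu]_x (bump (K ^- 2) x `^ (- p) * (dotp x x * wt (- n%:R) x)).
Proof.
move=> K1; have K0 : 0 < K by rewrite (lt_le_trans ltr01).
have ka0 : 0 < K ^- 2 by rewrite invr_gt0 exprn_gt0.
have iT := tcl_integrable pn (weighted_core_tcl ka0).
have [iS <-] := Rintegral_affine 0 K0 iT.
rewrite mulrA -RintegralZl//.
apply: (le_Rintegral measurableT core_integrable); first exact: integrable_cmul.
move=> z _; rewrite addr0.
have E : bump (K ^- 2) (K *: z) = bump 1 z.
  by rewrite /bump dotpZl dotpZr; field; rewrite gt_eqF.
rewrite E dotpZl dotpZr /core.
have b0 := powR_ge0 (bump 1 z) (- p); have d0 := dotp_ge0 z.
have W : wt (- n%:R) z <= K ^+ n * wt (- n%:R) (K *: z).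
  have w0 := oneDenorm_gt0 z; have w1 := oneDenorm_gt0 (K *: z).
  rewrite /wt !powRN !powR_mulrn ?(ltW w0) ?(ltW w1)// ler_pdivlMr ?exprn_gt0// mulrC.
  rewrite ler_pdivrMr ?exprn_gt0// -exprMn lerXn2r ?nnegrE ?mulr_ge0 ?(ltW w0) ?(ltW w1) ?(ltW K0)//.
  by rewrite enormZ gtr0_norm// mulrDr mulr1 lerD2r.
apply: (@le_trans _ _ (bump 1 z `^ (- p) * (dotp z z * (K ^+ n * wt (- n%:R) (K *: z))))).
  by rewrite !ler_wpM2l.
rewrite le_eqVlt; apply/orP; left; apply/eqP; move: (bump 1 z `^ (- p)) (dotp z z) (wt _ _) (K ^+ n) => *.
by field; rewrite gt_eqF.
Qed.

(** The density is bounded below on a cube of volume 1 that avoids the origin. *)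
Lemma core_integral_gt0 : (1 <= n)%N -> 0 < \int[mu]_z core z.
Proof.
move=> n1.
pose B : set 'rV[R]_n := box (fun=> `[1, 2]%classic).
have mB : measurable B by apply: measurable_box => i; exact: measurable_itv.
have muB : mu B = 1%E.
  rewrite [LHS](lebesgue_rV_box (A := fun=> `[1, 2]%classic))//.
  rewrite big1// => i _; rewrite lebesgue_measure_itv/= lte_fin ltr1n/= -EFinB.
  by congr EFin; ring.
pose b1 : R := 1 + 4 * n%:R.
have b10 : 0 < b1 by rewrite ltr_pwDl// mulr_ge0.
pose d : R := b1 `^ (- p) * (1 + b1) `^ (- n%:R).
have d0 : 0 < d by rewrite mulr_gt0 ?powR_gt0// ltr_pwDl// ltW.
have H z : B z -> d <= core z.
  move=> Bz; have zi i : 1 <= z ord0 i <= 2 by have := Bz i; rewrite /= in_itv.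
  have hd : dotp z z <= 4 * n%:R.
    apply: (@le_trans _ _ (\sum_(j < n) 4)); last by rewrite sumr_const card_ord mulr_natr.
    by apply: ler_sum => j _; have /andP[] := zi j; nra.
  have hd1 : 1 <= dotp z z.
    rewrite /dotp (bigD1 (Ordinal n1))//= -[leLHS]addr0 lerD//.
      by have /andP[] := zi (Ordinal n1); nra.
    by apply: sumr_ge0 => j _; rewrite -expr2 sqr_ge0.
  have e0 := enorm_ge0 z.
  have he : enorm z <= b1 by have := sqr_enorm z; rewrite /b1; nra.
  rewrite /core; apply: ler_pM; rewrite ?powR_ge0//.
    rewrite !powRN lef_pV2 ?posrE ?powR_gt0// ?(lt_le_trans ltr01 (bump_ge1 z ler01))//.
    apply: ge0_ler_powR; rewrite ?nnegrE ?(le_trans ler01 (bump_ge1 z ler01)) ?(ltW b10) ?(le_trans ler01 p1)//.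
    by rewrite /bump /b1 mul1r lerD2l.
  apply: (@le_trans _ _ (1 * wt (- n%:R) z)); last by rewrite ler_wpM2r ?wt_ge0.
  rewrite mul1r /wt !powRN lef_pV2 ?posrE ?powR_gt0 ?oneDenorm_gt0//; last by rewrite ltr_pwDl// ltW.
  apply: ge0_ler_powR; rewrite ?nnegrE ?(ltW (oneDenorm_gt0 z)) ?addr_ge0 ?(ltW b10)//.
  by rewrite lerD2l.
have iI : mu.-integrable setT (EFin \o (\1_B : 'rV[R]_n -> R)).
  apply/integrableP; split; first by apply/measurable_EFinP; exact: measurable_indic.
  under eq_integral => x _ do rewrite /= ger0_norm//.
  by rewrite integral_indic// setIT; rewrite [X in (X < _)%E]muB ltry.
have EI : \int[mu]_z (\1_B z : R) = 1.
  by rewrite /Rintegral integral_indic// setIT [X in fine X]muB.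
apply: (lt_le_trans d0); rewrite -[d]mulr1 -EI -RintegralZl//.
apply: le_Rintegral => //; first exact: integrable_cmul.
  exact: core_integrable.
move=> z _; rewrite indicE; case: (boolP (z \in B)) => zB; last by rewrite mulr0 core_ge0.
by rewrite mulr1; apply: H; exact: set_mem.
Qed.

End profile_constant.

End cutoff.

Section outgoing_flux.
Context {R : realType} {n : nat}.
Notation mu := (@lebesgue_rV R n).
Implicit Types (f h : 'rV[R]_n -> R) (x z : 'rV[R]_n).
Variables (F : 'I_n -> 'rV[R]_n -> R) (h : 'rV[R]_n -> R) (M c0 C1 : R).
Hypotheses (n1 : (1 <= n)%N) (M0 : 0 <= M) (HF : forall j, tcl 1 (wt M) (F j))
  (hE : forall x, h x = - \sum_(j < n) partial j (F j) x)
  (ih : mu.-integrable setT (EFin \o h)) (c00 : 0 < c0) (C10 : 0 <= C1)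
  (G_ge : forall x, c0 * (dotp x x * wt (- n%:R) x) - C1 * wt (- n.+1%:R) x <=
     \sum_(j < n) x ord0 j * F j x).

Let G x := \sum_(j < n) x ord0 j * F j x.
Variable N : R.
Hypothesis NE : N = M + n.+1%:R.

Let N1 : 1 <= N.
Proof. by have h1 : 1 <= n.+1%:R :> R; [rewrite ler1n|rewrite NE; have := M0; lra]. Qed.

(** The product rule; the derivative of the cutoff is radial and brings in the
    radial component of F. *)
Lemma cutoff_identity ka x : 0 < ka -> bump ka x `^ (- N) * h x =
  - \sum_(j < n) partial j (fun y => bump ka y `^ (- N) * F j y) x
  - 2 * N * (ka * (bump ka x `^ (- (N + 1)) * G x)).
Proof.
move=> k0; rewrite hE /G.
have D j : partial j (fun y => bump ka y `^ (- N) * F j y) x =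
    - N * bump ka x `^ (- N - 1) * (ka * (2 * x ord0 j)) * F j x + bump ka x `^ (- N) * partial j (F j) x.
  by have [_ E] := is_derive_mul (bump_powR_derive (- N) x j (ltW k0)) (tcl_derive x j (HF j)); exact: E.
under [in RHS]eq_bigr => j _ do rewrite D.
rewrite (_ : - (N + 1) = - N - 1); last by ring.
rewrite big_split/= mulrN mulr_sumr opprD.
have -> : \sum_(j < n) - N * bump ka x `^ (- N - 1) * (ka * (2 * x ord0 j)) * F j x =
   - (2 * N * (ka * (bump ka x `^ (- N - 1) * \sum_(j < n) x ord0 j * F j x))).
  rewrite !mulr_sumr -sumrN; apply: eq_bigr => j _.
  move: (bump ka x `^ (- N - 1)) (x ord0 j) (F j x) => *; ring.
by rewrite opprK addrAC subrr add0r.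
Qed.

Lemma weighted_G_integrable ka : 0 < ka ->
  mu.-integrable setT (EFin \o (fun x => bump ka x `^ (- (N + 1)) * G x)).
Proof.
move=> k0.
have TG : tcl 0 (wt (1 + M)) G.
  by apply: tcl_sum => j; apply: (tcl_mul (tcl_coord 0 j)); exact: clsS.
apply: tcl_integrable (tcl_mul (bump_powR_tcl 0 (N + 1) k0) TG).
by rewrite NE -natr1; have := M0; have : 0 <= n%:R :> R by []; lra.
Qed.

Lemma cutoff_integral ka : 0 < ka -> \int[mu]_x (bump ka x `^ (- N) * h x) =
  - (2 * N * (ka * \int[mu]_x (bump ka x `^ (- (N + 1)) * G x))).
Proof.
move=> k0; rewrite (eq_Rintegral _ (fun x _ => cutoff_identity x k0)).
have w : - 2 * N + M < - n%:R.
  by rewrite NE -natr1; have := M0; have : 0 <= n%:R :> R by []; lra.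
have T j : tcl 1 (wt (- 2 * N + M)) (fun y => bump ka y `^ (- N) * F j y).
  by apply: tcl_mul => //; exact: bump_powR_tcl.
have I j := tcl_integrable w (tcl_partial j (T j)).
have [J E] := Rintegral_sum measurableT (index_enum 'I_n) I.
have iG := weighted_G_integrable k0.
have iN := integrable_cmul measurableT (-1) J.
have iK := integrable_cmul measurableT (2 * N) (integrable_cmul measurableT ka iG).
transitivity (\int[mu]_x (-1 * (\sum_(j < n) partial j (fun y => bump ka y `^ (- N) * F j y) x)
    - 2 * N * (ka * (bump ka x `^ (- (N + 1)) * G x)))).
  by apply: eq_Rintegral => x _; rewrite mulN1r.
rewrite RintegralB// !RintegralZl//; last exact: integrable_cmul.
by rewrite E big1 ?mulr0 ?sub0r// => j _; exact: integral_partial_eq0 w (T j).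
Qed.

Let pn : - n%:R + 2 - 2 * (N + 1) < - n%:R :> R.
Proof. by have := N1; lra. Qed.

Let A := \int[mu]_z core (N + 1) z.
Let B := \int[mu]_z wt (- n.+1%:R) z.

(** The radial component of F is at least c0 |x|^2 / (1 + |x|)^n up to an
    integrable error, and the error is multiplied by K^-2. *)
Lemma cutoff_lower (K : R) : 1 <= K ->
  c0 * A - K ^- 2 * (C1 * B) <= K ^- 2 * \int[mu]_x (bump (K ^- 2) x `^ (- (N + 1)) * G x).
Proof.
move=> K1; have K0 : 0 < K by rewrite (lt_le_trans ltr01).
set ka := K ^- 2; have k0 : 0 < ka by rewrite invr_gt0 exprn_gt0.
have iT := tcl_integrable pn (weighted_core_tcl (N + 1) k0).
have iw := integrable_wt (@wt_Sn R n).
have iG := weighted_G_integrable k0.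
apply: (@le_trans _ _ (ka * \int[mu]_x (c0 * (bump ka x `^ (- (N + 1)) * (dotp x x * wt (- n%:R) x))
    - C1 * wt (- n.+1%:R) x))).
  rewrite RintegralB//; [|exact: integrable_cmul..].
  rewrite !RintegralZl// mulrBr lerD2r mulrCA ler_wpM2l ?(ltW c00)//.
  by apply: core_scaling.
rewrite ler_wpM2l ?(ltW k0)//; apply: le_Rintegral => //.
  have i1 := integrable_cmul measurableT c0 iT; have i2 := integrable_cmul measurableT C1 iw.
  by apply: eq_integrable (integrableB measurableT i1 i2).
move=> x _; have b0 := powR_ge0 (bump ka x) (- (N + 1)).
have b1 : bump ka x `^ (- (N + 1)) <= 1.
  by apply: bump_powR_le1; [exact: ltW|have := N1; lra].
have w0 := wt_ge0 (- n.+1%:R) x.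
apply: (le_trans _ (ler_wpM2l b0 (G_ge x))).
rewrite mulrBr mulrCA lerD2l lerN2 mulrCA ler_wpM2l// ler_piMl//.
Qed.

(** By the divergence theorem the integral of h is minus the limit of the fluxes
    of F through large spheres.  The strength r^(2 - n) of x . F is that of
    r^(1 - n) for the normal component, so that the fluxes stay away from 0. *)
Lemma outgoing_flux_lt0 : \int[mu]_x h x < 0.
Proof.
have A0 : 0 < A by apply: core_integral_gt0 pn n1; have := N1; lra.
pose ka (k : nat) : R := k.+1%:R ^- 2.
have K1 (k : nat) : 1 <= k.+1%:R :> R by rewrite ler1n.
have ka0 k : 0 < ka k by rewrite invr_gt0 exprn_gt0.
have kac : ka k @[k --> \oo] --> (0 : R).
  rewrite (_ : ka = (fun k => k.+1%:R^-1 * k.+1%:R^-1 : R)); last first.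
    by apply/funext => k; rewrite /ka expr2 invfM.
  by rewrite -(mulr0 0); apply: cvgM; exact: cvg_harmonic.
have ka1 k : ka k <= 1 by rewrite invf_le1 ?exprn_gt0// exprn_ege1.
have L : \int[mu]_x (bump (ka k) x `^ (- N) * h x) @[k --> \oo] --> \int[mu]_x h x.
  apply: (Rintegral_dominated measurableT (g := fun x => `|h x|)) => [k|x _||k x _].
  - apply: measurable_funM; last by have /integrableP[/measurable_EFinP] := ih.
    exact: tcl_measurable (bump_powR_tcl 0 N (ka0 k)).
  - have H : bump (ka k) x `^ (- N) @[k --> \oo] --> (1 : R).
      have H1 : bump (ka k) x @[k --> \oo] --> (1 : R).
        rewrite -[X in _ --> X](addr0 1) -(mul0r (dotp x x)).
        by apply: cvgD; [exact: cvg_cst|exact: cvgMr_tmp].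
      have E1 : (1 : R) `^ (- N) = 1 by rewrite powR1.
      rewrite -E1; apply: (cvg_comp (fun k => bump (ka k) x) (fun t => t `^ (- N)) H1).
      exact: (derive_continuous (is_derive1_powR (- N) ltr01)).
    by rewrite -[h x in X in _ --> X]mul1r; apply: cvgMr_tmp.
  - exact: integrable_norm ih.
  - rewrite normrM ger0_norm ?powR_ge0// ler_piMl//.
    by apply: bump_powR_le1; [exact: ltW|exact: le_trans ler01 N1].
have U k : \int[mu]_x (bump (ka k) x `^ (- N) * h x) <= - (2 * N * (c0 * A - ka k * (C1 * B))).
  rewrite cutoff_integral// lerN2 ler_wpM2l//; last exact: cutoff_lower.
  by have := N1; lra.
have UL : - (2 * N * (c0 * A - ka k * (C1 * B))) @[k --> \oo] --> - (2 * N * (c0 * A - 0 * (C1 * B))).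
  apply: cvgN; apply: cvgMl_tmp; apply: cvgB; first exact: cvg_cst.
  exact: cvgMr_tmp.
apply: (le_lt_trans (ler_cvg_to L UL (nearW _ U))); rewrite mul0r subr0 oppr_lt0 !mulr_gt0//.
exact: lt_le_trans ltr01 N1.
Qed.

End outgoing_flux.

Section flux_sign.
Context {R : realType} {n : nat}.
Notation mu := (@lebesgue_rV R n).
Implicit Types (u v f h q : 'rV[R]_n -> R) (x : 'rV[R]_n).
Variables (alpha mu0 : R) (a : 'I_n -> 'I_n -> 'rV[R]_n -> R)
  (b : 'I_n -> 'rV[R]_n -> R) (c : 'rV[R]_n -> R) (m1 : R) (phi rho : 'rV[R]_n -> R).
Hypotheses (n1 : (1 <= n)%N) (alpha1 : 1 < alpha) (a_sym : forall j k, a j k = a k j)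
  (mu_gt0 : 0 < mu0) (sa : forall j k, sy (- mu0) (a j k)) (sb : forall j, sy (alpha - mu0) (b j))
  (P : wkb_profile_spec alpha a b (divpot alpha a c) m1 phi rho).
Notation ampl := (@ampl R n alpha).
Notation v1 := (mode1 phi rho).
Notation v2 := (mode2 phi rho).
Notation f1 := (image1 alpha a b c phi rho).
Notation f2 := (image2 alpha a b c phi rho).
Notation Fl := (Flux a b phi rho).

(** exp (2 rho) has size |x|^-(n - 1 + alpha) and the radial component of the
    current has size |x|^(1 + alpha); the product is |x|^(2 - n).  Inside the
    ball of radius R0 the error term compensates for everything. *)
Lemma Flux_outgoing M : 0 <= M -> (forall j, tcl 1 (wt M) (Fl j)) ->
  exists c0 C1 : R, [/\ 0 < c0, 0 <= C1 & forall x,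
    c0 * (dotp x x * wt (- n%:R) x) - C1 * wt (- n.+1%:R) x <= \sum_(j < n) x ord0 j * Fl j x].
Proof.
move=> M0 HF.
have TG : tcl 0 (wt (1 + M)) (fun x => \sum_(j < n) x ord0 j * Fl j x).
  by apply: tcl_sum => j; apply: (tcl_mul (tcl_coord 0 j)); exact: clsS.
have [_ [D D0 HD]] := cls_cls0 TG.
have [C C0 HC] := prof_size P; have [R0 R1 HR] := prof_flux P.
pose c0 := 2^-1 * C ^- 2.
have c00 : 0 < c0 by rewrite mulr_gt0 ?invr_gt0 ?exprn_gt0.
pose S := D * (1 + R0) `^ (1 + M) + c0 * R0 ^+ 2.
have RR : 0 < 1 + R0 by lra.
have S0 : 0 <= S by rewrite addr_ge0// mulr_ge0 ?powR_ge0 ?(ltW c00) ?sqr_ge0.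
exists c0, (S * (1 + R0) ^+ n.+1); split => //; first by rewrite mulr_ge0// exprn_ge0// ltW.
move=> x; have e0 := enorm_ge0 x; have w0 := oneDenorm_gt0 x.
have [xR|xR] := leP R0 (enorm x).
  have r0 : 0 < enorm x by lra.
  have x0 : Omega x by rewrite /Omega /= -enorm_gt0.
  have x1 : 1 <= enorm x by lra.
  have -> : \sum_(j < n) x ord0 j * Fl j x = expR (rho x) ^+ 2 * \sum_(j < n) x ord0 j * flux a b phi j x.
    by rewrite mulr_sumr; apply: eq_bigr => j _; rewrite Fluxx// mulrCA.
  have h1 := HR x xR; have /andP[h2 _] := HC x x1.
  apply: (@le_trans _ _ (c0 * (dotp x x * wt (- n%:R) x))).
    by rewrite gerBl mulr_ge0 ?wt_ge0// mulr_ge0// exprn_ge0// ltW.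
  apply: (@le_trans _ _ ((C^-1 * enorm x `^ (- ampl)) ^+ 2 * (2^-1 * enorm x `^ (1 + alpha)))).
    have -> : (C^-1 * enorm x `^ (- ampl)) ^+ 2 * (2^-1 * enorm x `^ (1 + alpha)) =
        c0 * (dotp x x * enorm x `^ (- n%:R)).
      rewrite exprMn exprVn mulrACA -(mulrC 2^-1) -/c0; congr (_ * _).
      rewrite -powR_mulrn ?powR_ge0// -powRrM -sqr_enorm -powR_mulrn//.
      rewrite -!powRD ?(gt_eqF r0) ?implybT//; congr (_ `^ _).
      by rewrite /ampl; field.
    rewrite ler_wpM2l ?(ltW c00)// ler_wpM2l ?dotp_ge0// /wt !powRN lef_pV2 ?posrE ?powR_gt0//.
    by apply: ge0_ler_powR; rewrite ?nnegrE ?(ltW w0)// lerDr.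
  apply: ler_pM => //.
  - by rewrite exprn_ge0// mulr_ge0 ?powR_ge0 ?invr_ge0 ?(ltW C0).
  - by rewrite mulr_ge0 ?powR_ge0.
  - by rewrite lerXn2r ?nnegrE ?expR_ge0// mulr_ge0 ?powR_ge0 ?invr_ge0 ?(ltW C0).
have h1 := HD x I.
have h2 : wt (1 + M) x <= (1 + R0) `^ (1 + M).
  by apply: ge0_ler_powR; rewrite ?nnegrE ?(ltW w0) ?(ltW RR) ?addr_ge0//; lra.
have h3 : c0 * (dotp x x * wt (- n%:R) x) <= c0 * R0 ^+ 2.
  rewrite ler_wpM2l ?(ltW c00)// -sqr_enorm -[leRHS]mulr1 ler_pM ?sqr_ge0 ?wt_ge0//.
    by rewrite lerXn2r ?nnegrE//; lra.
  by rewrite -[leRHS](wt0 x); apply: wt_le; rewrite oppr_le0.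
have h4 : S <= S * (1 + R0) ^+ n.+1 * wt (- n.+1%:R) x.
  rewrite -mulrA ler_peMr// /wt powRN powR_mulrn ?(ltW w0)// ler_pdivlMr ?exprn_gt0// mul1r.
  by rewrite lerXn2r ?nnegrE ?(ltW w0) ?(ltW RR)//; lra.
have h5 : D * wt (1 + M) x <= D * (1 + R0) `^ (1 + M) by rewrite ler_wpM2l.
have := ler_norm (- (\sum_(j < n) x ord0 j * Fl j x)); rewrite normrN.
by rewrite /S in h4 *; lra.
Qed.

(** The integral is minus the flux of the current through the sphere at
    infinity, and the current is outgoing. *)
Lemma pairing_lt0 : \int[mu]_x (f2 x * v1 x - f1 x * v2 x) < 0.
Proof.
have [M M0 HF] := Flux_tcl n1 alpha1 mu_gt0 sa sb P.
have [c0 [C1 [c00 C10 HG]]] := Flux_outgoing M0 HF.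
have [mv1 mv2 iv1 iv2] := mode_square_integrable n1 alpha1 P.
have [mf1 mf2 if1 if2] := image_square_integrable n1 alpha1 P.
have ih : mu.-integrable setT (EFin \o (fun x => f2 x * v1 x - f1 x * v2 x)).
  pose S x := f2 x ^+ 2 + v1 x ^+ 2 + (f1 x ^+ 2 + v2 x ^+ 2).
  have iS : mu.-integrable setT (EFin \o S).
    have i1 := integrableD measurableT if2 iv1; have i2 := integrableD measurableT if1 iv2.
    by apply: eq_integrable (integrableD measurableT i1 i2).
  apply: (integrable_le measurableT _ iS).
    by apply: measurable_funB; apply: measurable_funM.
  move=> x _; rewrite /S; move: (f1 x) (f2 x) (v1 x) (v2 x) => p q r s.
  have := sqr_ge0 (q - r); have := sqr_ge0 (q + r); have := sqr_ge0 (p - s); have := sqr_ge0 (p + s).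
  by rewrite ler_norml; nra.
exact: (outgoing_flux_lt0 n1 M0 HF (flux_balance a_sym mu_gt0 sa sb P) ih c00 C10 HG erefl).
Qed.

End flux_sign.

(** * Square-integrable functions, adjoints and closures *)

Section square_integrable.
Context {R : realType} {n : nat}.
Notation mu := (@lebesgue_rV R n).
Notation normc := ComplexField.Normc.normc.
Implicit Types (u v w f g : 'rV[R]_n -> R[i]) (x : 'rV[R]_n).

Definition cmeas u : Prop := measurable_fun setT (fun x => complex.Re (u x)) /\
  measurable_fun setT (fun x => complex.Im (u x)).

Lemma sqr_normc (z : R[i]) : normc z ^+ 2 = complex.Re z ^+ 2 + complex.Im z ^+ 2.
Proof. by case: z => p q; rewrite /normc /= sqr_sqrtr// addr_ge0 ?sqr_ge0. Qed.

Lemma normc_ge0 (z : R[i]) : 0 <= normc z.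
Proof. by case: z => p q; exact: sqrtr_ge0. Qed.

Lemma normc_measurable u : cmeas u -> measurable_fun setT (fun x => normc (u x)).
Proof.
move=> [m1 m2].
have E : (fun x => normc (u x)) = (fun x => (complex.Re (u x) ^+ 2 + complex.Im (u x) ^+ 2) `^ 2^-1).
  apply/funext => x; rewrite -sqr_normc -powR_mulrn ?normc_ge0// -powRrM mulfV// powRr1//.
  exact: normc_ge0.
rewrite E; have m : measurable_fun setT (fun x => complex.Re (u x) ^+ 2 + complex.Im (u x) ^+ 2).
  by apply: measurable_funD; exact: measurable_funX.
exact: (measurableT_comp (@measurable_powR R 2^-1) m).
Qed.

Lemma L2_intro u : cmeas u -> mu.-integrable setT (EFin \o (fun x => complex.Re (u x) ^+ 2)) ->
  mu.-integrable setT (EFin \o (fun x => complex.Im (u x) ^+ 2)) -> L2 u.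
Proof.
move=> mu_ i1 i2; have [m1 m2] := mu_; split=> //; split=> //.
rewrite /L2norm unlock; apply: poweR_lty.
have /integrableP[_] := integrableD measurableT i1 i2.
apply: le_lt_trans; apply: ge0_le_integral => //.
- by move=> x _; exact: poweR_ge0.
- apply/measurable_EFinP.
  have m : measurable_fun setT (fun x => normc (u x) `^ 2).
    exact: (measurableT_comp (@measurable_powR R 2) (normc_measurable mu_)).
  by apply: eq_measurable_fun m => x _ /=; rewrite ger0_norm ?normc_ge0.
- apply: measurableT_comp => //; apply/measurable_EFinP.
  by apply: measurable_funD; exact: measurable_funX.
- move=> x _ /=; rewrite lee_fin ger0_norm ?normc_ge0// powR_mulrn ?normc_ge0// sqr_normc.
  exact: ler_norm.
Qed.

Definition dotRe u v x : R := complex.Re (u x) * complex.Re (v x) + complex.Im (u x) * complex.Im (v x).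
Definition dotIm u v x : R := complex.Im (u x) * complex.Re (v x) - complex.Re (u x) * complex.Im (v x).

Lemma L2dotE u v : L2dot u v = ((\int[mu]_x dotRe u v x) +i* (\int[mu]_x dotIm u v x))%C.
Proof.
rewrite /L2dot /cintegral; congr (_ +i* _)%C; apply: eq_Rintegral => x _.
  by rewrite /dotRe; case: (u x) (v x) => p q [r s] /=; ring.
by rewrite /dotIm; case: (u x) (v x) => p q [r s] /=; ring.
Qed.

Lemma dot_le_normc (p q r s : R) : `|p * r + q * s| <= normc (p +i* q)%C * normc (r +i* s)%C.
Proof.
rewrite -[leRHS]ger0_norm; last by rewrite mulr_ge0 ?normc_ge0.
by rewrite -ler_sqr ?nnegrE// !real_normK ?num_real// exprMn !sqr_normc /=; have := sqr_ge0 (p * s - q * r); lra.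
Qed.

Lemma dotRe_le u v x : `|dotRe u v x| <= normc (u x) * normc (v x).
Proof. by rewrite /dotRe; case: (u x) (v x) => p q [r s]; exact: dot_le_normc. Qed.

Lemma dotIm_le u v x : `|dotIm u v x| <= normc (u x) * normc (v x).
Proof.
rewrite /dotIm; case: (u x) (v x) => p q [r s] /=.
have := dot_le_normc q (- p) r s.
by rewrite mulNr (_ : normc (q +i* - p)%C = normc (p +i* q)%C)// /normc/= sqrrN addrC.
Qed.

Lemma dot_measurable u v : cmeas u -> cmeas v ->
  measurable_fun setT (dotRe u v) /\ measurable_fun setT (dotIm u v).
Proof.
move=> [m1 m2] [m3 m4]; split.
  by apply: measurable_funD; exact: measurable_funM.
by apply: measurable_funB; exact: measurable_funM.
Qed.

Lemma cauchy_schwarz u v : cmeas u -> cmeas v -> (L2norm u < +oo)%E -> (L2norm v < +oo)%E ->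
  [/\ mu.-integrable setT (EFin \o dotRe u v), mu.-integrable setT (EFin \o dotIm u v),
   `|\int[mu]_x dotRe u v x| <= fine (L2norm u) * fine (L2norm v) &
   `|\int[mu]_x dotIm u v x| <= fine (L2norm u) * fine (L2norm v)].
Proof.
move=> mu_ mv u2 v2.
have [mR mI] := dot_measurable mu_ mv.
have nu := normc_measurable mu_; have nv := normc_measurable mv.
have p2 : (2^-1 + 2^-1 = 1 :> R) by lra.
have H := hoelder mu nu nv (ltr0Sn R 1) (ltr0Sn R 1) p2.
have fu : L2norm u \is a fin_num by rewrite ge0_fin_numE// Lnorm_ge0.
have fv : L2norm v \is a fin_num by rewrite ge0_fin_numE// Lnorm_ge0.
have L1 : (\int[mu]_x (normc (u x) * normc (v x))%:E <= L2norm u * L2norm v)%E.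
  apply: le_trans H; rewrite Lnorm1 le_eqVlt; apply/orP; left; apply/eqP.
  by apply: eq_integral => x _; rewrite /= ger0_norm// mulr_ge0 ?normc_ge0.
have iN : mu.-integrable setT (EFin \o (fun x => normc (u x) * normc (v x))).
  apply/integrableP; split; first by apply/measurable_EFinP; exact: measurable_funM.
  apply: le_lt_trans (_ : L2norm u * L2norm v < +oo)%E.
    apply: le_trans L1; rewrite le_eqVlt; apply/orP; left; apply/eqP.
    by apply: eq_integral => x _; rewrite /= ger0_norm// mulr_ge0 ?normc_ge0.
  by rewrite -(fineK fu) -(fineK fv) -EFinM ltry.
have L : \int[mu]_x (normc (u x) * normc (v x)) <= fine (L2norm u) * fine (L2norm v).
  rewrite /Rintegral -fineM//; apply: fine_le => //; last by rewrite fin_numM.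
  exact: (integrable_fin_num measurableT iN).
have iR := integrable_le measurableT mR iN (fun x _ => dotRe_le u v x).
have iI := integrable_le measurableT mI iN (fun x _ => dotIm_le u v x).
split => //.
  exact: le_trans (Rintegral_le_bound measurableT mR iN (fun x _ => dotRe_le u v x)) L.
exact: le_trans (Rintegral_le_bound measurableT mI iN (fun x _ => dotIm_le u v x)) L.
Qed.

Lemma L2dot_close u u' v (e : R) : L2 u -> L2 u' -> L2 v -> (L2dist u u' < e%:E)%E ->
  `|complex.Re (L2dot u v) - complex.Re (L2dot u' v)| <= e * fine (L2norm v) /\
  `|complex.Im (L2dot u v) - complex.Im (L2dot u' v)| <= e * fine (L2norm v).
Proof.
move=> [m1 [m2 u2]] [m1' [m2' u2']] [m3 [m4 v2]] d.
have md : cmeas (fun x => u x - u' x).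
  split; [rewrite (_ : (fun x => _) = (fun x => complex.Re (u x) - complex.Re (u' x)))|
    rewrite (_ : (fun x => _) = (fun x => complex.Im (u x) - complex.Im (u' x)))];
  first exact: measurable_funB; try exact: measurable_funB.
    by apply/funext => x; case: (u x) (u' x) => p q [r s].
  by apply/funext => x; case: (u x) (u' x) => p q [r s].
have d2 : (L2norm (fun x => (u x - u' x)%R) < +oo)%E by apply: lt_trans d _; rewrite ltry.
have fd : L2norm (fun x => u x - u' x) \is a fin_num by rewrite ge0_fin_numE// Lnorm_ge0.
have de : fine (L2norm (fun x => u x - u' x)) <= e.
  by rewrite -lee_fin fineK// ltW.
have [i1 i2 B1 B2] := cauchy_schwarz md (conj m3 m4) d2 v2.
have [j1 j2 _ _] := cauchy_schwarz (conj m1 m2) (conj m3 m4) u2 v2.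
have [k1 k2 _ _] := cauchy_schwarz (conj m1' m2') (conj m3 m4) u2' v2.
have nv : 0 <= fine (L2norm v) by rewrite fine_ge0// Lnorm_ge0.
rewrite !L2dotE /= -!RintegralB//; split.
  have -> : \int[mu]_x (dotRe u v x - dotRe u' v x) = \int[mu]_x dotRe (fun x => u x - u' x) v x.
    by apply: eq_Rintegral => x _; rewrite /dotRe; case: (u x) (u' x) => p q [r s] /=; ring.
  by apply: (le_trans B1); rewrite ler_wpM2r.
have -> : \int[mu]_x (dotIm u v x - dotIm u' v x) = \int[mu]_x dotIm (fun x => u x - u' x) v x.
  by apply: eq_Rintegral => x _; rewrite /dotIm; case: (u x) (u' x) => p q [r s] /=; ring.
by apply: (le_trans B2); rewrite ler_wpM2r.
Qed.

Lemma eq_of_close (p q K : R) : (forall e, 0 < e -> `|p - q| <= e * K) -> p = q.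
Proof.
move=> H; apply/eqP; rewrite -subr_eq0 -normr_eq0 eq_le normr_ge0 andbT.
apply/ler_addgt0Pr => e e0; rewrite add0r.
have K1 : 0 < `|K| + 1 by rewrite ltr_pwDr.
apply: (le_trans (H _ (divr_gt0 e0 K1))); rewrite mulrAC ler_pdivrMr// ler_wpM2l ?(ltW e0)//.
by rewrite (le_trans (ler_norm K))// lerDl.
Qed.

(** Both sides of the adjoint relation are continuous for convergence in L2 of
    the pair in the graph. *)
Lemma adjoint_closure (G : set (('rV[R]_n -> R[i]) * ('rV[R]_n -> R[i]))) v f :
  (forall p, G p -> L2 p.1 /\ L2 p.2) -> L2 v -> L2 f ->
  (forall p, G p -> L2dot p.2 v = L2dot p.1 f) -> graph_adjoint (graph_closure G) (v, f).
Proof.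
move=> GL Lv Lf HG; split=> //; split=> // -[u w] /= [Lu [Lw Hc]].
pose K := fine (L2norm v) + fine (L2norm f).
have H e : 0 < e -> `|complex.Re (L2dot w v) - complex.Re (L2dot u f)| <= e * K /\
    `|complex.Im (L2dot w v) - complex.Im (L2dot u f)| <= e * K.
  move=> e0; have [[u' w'] Gp /= [d1 d2]] := Hc e e0.
  have [Lu' Lw'] := GL _ Gp; have E := HG _ Gp.
  have [A1 A2] := L2dot_close Lw Lw' Lv d2.
  have [B1 B2] := L2dot_close Lu Lu' Lf d1.
  rewrite /= in E; rewrite E in A1 A2; rewrite distrC in B1; rewrite distrC in B2.
  rewrite /K mulrDr; split.
    by apply: le_trans (ler_distD (complex.Re (L2dot u' f)) _ _) _; exact: lerD.
  by apply: le_trans (ler_distD (complex.Im (L2dot u' f)) _ _) _; exact: lerD.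
have E1 := eq_of_close (fun e e0 => (H e e0).1).
have E2 := eq_of_close (fun e e0 => (H e e0).2).
by move: E1 E2; case: (L2dot w v) (L2dot u f) => p q [r s] /= -> ->.
Qed.

(** If the adjoint of G were G, the pair (v, f) could be tested against itself:
    <f, v> = <v, f> would be real. *)
Lemma not_selfadjoint (G : set (('rV[R]_n -> R[i]) * ('rV[R]_n -> R[i]))) v f :
  graph_adjoint G (v, f) -> complex.Im (L2dot f v) != 0 -> ~ selfadjoint G.
Proof.
move=> Gvf H S; have G1 : G (v, f) by rewrite -S.
have [_ [_ /(_ _ G1)]] := Gvf; rewrite /= => E.
move: H; have : complex.Im (L2dot f v) = complex.Im (L2dot v f) by rewrite E.
rewrite !L2dotE /=; have [Lv [Lf _]] := Gvf.
have [_ iI _ _] := cauchy_schwarz (conj Lf.1 Lf.2.1) (conj Lv.1 Lv.2.1) Lf.2.2 Lv.2.2.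
have -> : \int[mu]_x dotIm v f x = - \int[mu]_x dotIm f v x.
  rewrite -mulN1r -RintegralZl//; apply: eq_Rintegral => x _.
  by rewrite /dotIm; ring.
by move=> X; rewrite (_ : \int[mu]_x dotIm f v x = 0) ?eqxx//; lra.
Qed.

End square_integrable.

Section test_functions.
Context {R : realType} {n : nat}.
Implicit Types (u : 'rV[R]_n -> R[i]) (f : 'rV[R]_n -> R).

Lemma partial_vanish (K : set 'rV[R]_n) f j : closed K -> (forall x, ~ K x -> f x = 0) ->
  forall x, ~ K x -> partial j f x = 0.
Proof.
move=> cK f0 x nKx.
have oK : open (~` K) by exact: closed_openC.
have D : is_derive x (delta_mx ord0 j) f 0.
  apply: (is_derive_local oK nKx (f := fun=> 0)) (is_derive_const 0 x _).
  by move=> y nKy; rewrite f0.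
by have [_ E] := D; exact: E.
Qed.

Lemma multi_partial_smooth f beta : smooth f -> smooth (multi_partial beta f).
Proof.
move=> sf; rewrite /multi_partial; elim: (enum 'I_n) => [//|j s IH] /=.
by elim: (beta j) => [//|k IHk] /=; exact: smooth_partial.
Qed.

Lemma multi_partial_vanish (K : set 'rV[R]_n) f beta : closed K -> (forall x, ~ K x -> f x = 0) ->
  forall x, ~ K x -> multi_partial beta f x = 0.
Proof.
move=> cK f0; rewrite /multi_partial; elim: (enum 'I_n) => [//|j s IH] /=.
by elim: (beta j) => [//|k IHk] /=; exact: partial_vanish.
Qed.

Lemma compact_continuous_bounded (K : set 'rV[R]_n) f : compact K ->
  (forall x, {for x, continuous f}) -> (forall x, ~ K x -> f x = 0) ->
  exists C : R, forall x, `|f x| <= C.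
Proof.
move=> cK cf f0.
have cI : compact ((f : 'rV[R]_n -> R^o) @` K).
  by apply: continuous_compact => //; apply: continuous_subspaceT => x; exact: cf.
have [M [_ HM]] := compact_bounded cI.
exists (`|M| + 1) => x; have [Kx|nKx] := pselect (K x).
  apply: HM; last by exists x.
  by rewrite (le_lt_trans (ler_norm M))// ltrDl.
by rewrite f0// normr0 addr_ge0.
Qed.

(** All derivatives vanish outside a compact set, on which continuous functions
    are bounded. *)
Lemma Cc_infty_schwartz u : Cc_infty u -> schwartz u.
Proof.
move=> [[s1 s2] cK]; split=> // beta gamma.
set K := closure _ in cK.
have clK : closed K by exact: closed_closure.
have u0 x : ~ K x -> u x = 0.
  by move=> nK; apply/eqP; apply/negP => /negP ux; apply: nK; exact: subset_closure.
have B (f : 'rV[R]_n -> R) : smooth f -> (forall x, ~ K x -> f x = 0) -> exists C : R, forall x : 'rV[R]_n,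
    `|\prod_(j < n) x ord0 j ^+ gamma j| * `|multi_partial beta f x| <= C.
  move=> sf f0.
  have sm := multi_partial_smooth beta sf.
  have [C HC] : exists C : R, forall x : 'rV[R]_n, `|\prod_(j < n) x ord0 j ^+ gamma j * multi_partial beta f x| <= C.
    apply: (compact_continuous_bounded cK).
      move=> x; apply: (@continuousM _ _ (fun x : 'rV[R]_n => \prod_(j < n) x ord0 j ^+ gamma j)
        (multi_partial beta f)); last exact: smooth_cont sm.
      have T k (s : seq 'I_n) : exists M, tcl k (wt M) (fun x : 'rV[R]_n => \prod_(j <- s) x ord0 j ^+ gamma j).
        elim: s => [|j s [M IH]].
          exists 0; apply: cls_ext (tcl_cst k 1 (lexx 0)); first exact: openT.
          by move=> y _; rewrite big_nil.
        have [M' HM'] : exists M', tcl k (wt M') (fun x : 'rV[R]_n => x ord0 j ^+ gamma j).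
          elim: (gamma j) => [|p [M' IHp]]; first by exists 0; exact: tcl_cst.
          exists (1 + M'); apply: cls_ext (tcl_mul (tcl_coord k j) IHp); first exact: openT.
          by move=> y _; rewrite exprS.
        exists (M' + M); apply: cls_ext (tcl_mul HM' IH); first exact: openT.
        by move=> y _; rewrite big_cons.
      by have [M HM] := T 0%N (index_enum 'I_n); exact: cls_cont HM I.
    by move=> x nK; rewrite (multi_partial_vanish _ clK f0)// mulr0.
  by exists C => x; rewrite -normrM.
have [C1 H1] := B _ s1 (fun x nK => congr1 (@complex.Re R) (u0 x nK)).
have [C2 H2] := B _ s2 (fun x nK => congr1 (@complex.Im R) (u0 x nK)).
exists (C1 + C2) => x.
apply: (@le_trans _ _ (`|\prod_(j < n) x ord0 j ^+ gamma j| *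
   (`|multi_partial beta (fun y => complex.Re (u y)) x| + `|multi_partial beta (fun y => complex.Im (u y)) x|))).
  rewrite ler_wpM2l// /cmulti_partial.
  move: (multi_partial _ _ _) (multi_partial _ _ _) => p q.
  rewrite -ler_sqr ?nnegrE ?normc_ge0 ?addr_ge0// sqr_normc /= sqrrD !real_normK ?num_real//.
  by rewrite addrAC lerDl mulrn_wge0// mulr_ge0.
by rewrite mulrDr lerD.
Qed.

End test_functions.

(** * Failure of essential self-adjointness *)

Section quasimode_adjoint.
Context {R : realType} {n : nat}.
Notation mu := (@lebesgue_rV R n).
Variables (alpha mu0 : R) (a : 'I_n -> 'I_n -> 'rV[R]_n -> R)
  (b : 'I_n -> 'rV[R]_n -> R) (c : 'rV[R]_n -> R).
Hypotheses (n1 : (1 <= n)%N) (alpha1 : 1 < alpha) (mu_gt0 : 0 < mu0) (mu12 : mu0 < 1 / 2)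
  (a_sym : forall j k, a j k = a k j)
  (a_smooth : forall j k, smooth (a j k)) (b_smooth : forall j, smooth (b j)) (c_smooth : smooth c)
  (a_bound : forall j k, symbol_bound (- mu0) (a j k))
  (b_bound : forall j, symbol_bound (alpha - mu0) (b j))
  (c_bound : symbol_bound (2 * alpha - mu0) c).

Let sa j k : sy (- mu0) (a j k) := sy_smooth (a_smooth j k) (a_bound j k).
Let sb j : sy (alpha - mu0) (b j) := sy_smooth (b_smooth j) (b_bound j).

Lemma sy_divpot : sy (2 * alpha - mu0) (fun x => divpot alpha a c x + jap x `^ (2 * alpha)).
Proof.
have al := alpha1; have m0 := mu_gt0.
have S2 : sy (2 * alpha - mu0) (fun x => c x - 4^-1 * \sum_(j < n) \sum_(k < n) partial j (partial k (a j k)) x).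
  apply: sy_sub; first exact: sy_smooth.
  apply: sy_cmul; do 2 apply: sy_sum => ?; apply: sy_weaken (sy_partial _ (sy_partial _ (sa _ _))); lra.
apply: sy_ext S2 => x _; rewrite /divpot.
by move: (\sum_(j < n) _) (jap x `^ _) => p q; ring.
Qed.

Let M0 := 2 * alpha.

Lemma coefficients_tcl : [/\ 0 <= M0, forall j k l, tcl l (wt M0) (a j k),
  forall j l, tcl l (wt M0) (b j) & forall l, tcl l (wt M0) c].
Proof.
have al := alpha1; have m0 := mu_gt0; rewrite /M0; split; first by lra.
- by move=> j k l; apply: tcl_weaken (tcl_symbol l (a_smooth j k) (a_bound j k)); lra.
- by move=> j l; apply: tcl_weaken (tcl_symbol l (b_smooth j) (b_bound j)); lra.
- by move=> l; apply: tcl_weaken (tcl_symbol l c_smooth c_bound); lra.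
Qed.

(** f is the image of the quasimode v under the differential operator, and
    Schwartz functions u cannot see the boundary form of v at infinity: the
    Green formulas for u and v have no boundary term.  The pairing of f with v
    itself does see it. *)
Lemma nonsymmetric_pair : exists v f : 'rV[R]_n -> R[i], [/\ L2 v, L2 f,
  (forall u, schwartz u -> L2 u -> L2 (hamiltonian alpha a b c u) ->
     L2dot (hamiltonian alpha a b c u) v = L2dot u f) &
  complex.Im (L2dot f v) != 0].
Proof.
have [m1 [phi [rho P]]] := profile_exists n1 a_sym sa sb mu_gt0 alpha1 mu12 sy_divpot.
have [M00 Ta Tb Tc] := coefficients_tcl.
pose v1 := mode1 phi rho; pose v2 := mode2 phi rho.
pose f1 := image1 alpha a b c phi rho; pose f2 := image2 alpha a b c phi rho.
have [mv1 mv2 iv1 iv2] := mode_square_integrable n1 alpha1 P.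
have [mf1 mf2 if1 if2] := image_square_integrable n1 alpha1 P.
pose v x := (v1 x +i* v2 x)%C; pose f x := (f1 x +i* f2 x)%C.
have Lv : L2 v by apply: L2_intro => //; split.
have Lf : L2 f by apply: L2_intro => //; split.
exists v, f; split => //; last first.
  by rewrite L2dotE /= /dotIm /= lt_eqF// (pairing_lt0 n1 alpha1 a_sym mu_gt0 sa sb P).
move=> u Su Lu LH; rewrite !L2dotE.
have [H1 H2] := schwartz_rapid Su.
set u1 := fun y => complex.Re (u y) in H1; set u2 := fun y => complex.Im (u y) in H2.
have [M M_0 [T1 T2]] := mode_tcl n1 alpha1 P.
have [J1 _ Z1 _] := green_integrals alpha c a_sym M00 Ta Tb H1 T1.
have [J2 _ Z2 _] := green_integrals alpha c a_sym M00 Ta Tb H2 T2.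
have [_ J3 _ Z3] := green_integrals alpha c a_sym M00 Ta Tb H2 T1.
have [_ J4 _ Z4] := green_integrals alpha c a_sym M00 Ta Tb H1 T2.
have [J5 _ Z5 _] := green_integrals alpha c a_sym M00 Ta Tb H2 T1.
have [J6 _ Z6 _] := green_integrals alpha c a_sym M00 Ta Tb H1 T2.
have [_ J7 _ Z7] := green_integrals alpha c a_sym M00 Ta Tb H1 T1.
have [_ J8 _ Z8] := green_integrals alpha c a_sym M00 Ta Tb H2 T2.
have E x : hamiltonian alpha a b c u x =
    ((Lop alpha a c u1 x + Kop b u2 x) +i* (Lop alpha a c u2 x - Kop b u1 x))%C.
  exact: (hamiltonianE alpha a_sym M00 Ta Tb Tc x Su).
have I x := mode_image a_sym P x.
have [a1 a2 _ _] := cauchy_schwarz (conj LH.1 LH.2.1) (conj Lv.1 Lv.2.1) LH.2.2 Lv.2.2.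
have [b1 b2 _ _] := cauchy_schwarz (conj Lu.1 Lu.2.1) (conj Lf.1 Lf.2.1) Lu.2.2 Lf.2.2.
have zero4 (p q r s : 'rV[R]_n -> R) :
    mu.-integrable setT (EFin \o p) -> mu.-integrable setT (EFin \o q) ->
    mu.-integrable setT (EFin \o r) -> mu.-integrable setT (EFin \o s) ->
    \int[mu]_x p x = 0 -> \int[mu]_x q x = 0 -> \int[mu]_x r x = 0 -> \int[mu]_x s x = 0 ->
    \int[mu]_x ((p x + q x) + (r x - s x)) = 0.
  move=> ip iq ir is_ p0 q0 r0 s0.
  have i1 : mu.-integrable setT (EFin \o (fun x => p x + q x)).
    by apply: eq_integrable (integrableD measurableT ip iq).
  have i2 : mu.-integrable setT (EFin \o (fun x => r x - s x)).
    by apply: eq_integrable (integrableB measurableT ir is_).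
  rewrite (RintegralD measurableT i1 i2).
  by rewrite RintegralD// RintegralB// p0 q0 r0 s0 addr0 subr0 addr0.
congr (_ +i* _)%C; apply/eqP; rewrite -subr_eq0 -RintegralB//; apply/eqP.
  rewrite -[RHS](zero4 _ _ _ _ J1 J3 J2 J4 Z1 Z3 Z2 Z4); apply: eq_Rintegral => x _.
  rewrite /dotRe E /= /f1 /f2 -(I x).1 -(I x).2 -/(u1 x) -/(u2 x) -/v1 -/v2.
  move: (Lop _ _ _ u1 x) (Lop _ _ _ u2 x) (Kop _ u1 x) (Kop _ u2 x) (Lop _ _ _ v1 x) (Lop _ _ _ v2 x)
    (Kop _ v1 x) (Kop _ v2 x) (u1 x) (u2 x) (v1 x) (v2 x) => *; ring.
have J7' := integrable_cmul measurableT (-1) J7.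
have Z7' : \int[mu]_x (-1 * (Kop b u1 x * v1 x + u1 x * Kop b v1 x)) = 0.
  by rewrite RintegralZl// Z7 mulr0.
have J6' := integrable_cmul measurableT (-1) J6.
have Z6' : \int[mu]_x (-1 * (Lop alpha a c u1 x * v2 x - u1 x * Lop alpha a c v2 x)) = 0.
  by rewrite RintegralZl// Z6 mulr0.
rewrite -[RHS](zero4 _ _ _ _ J5 J7' J6' J8 Z5 Z7' Z6' Z8); apply: eq_Rintegral => x _.
rewrite /dotIm E /= /f1 /f2 -(I x).1 -(I x).2 -/(u1 x) -/(u2 x) -/v1 -/v2.
move: (Lop _ _ _ u1 x) (Lop _ _ _ u2 x) (Kop _ u1 x) (Kop _ u2 x) (Lop _ _ _ v1 x) (Lop _ _ _ v2 x)
  (Kop _ v1 x) (Kop _ v2 x) (u1 x) (u2 x) (v1 x) (v2 x) => *; ring.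
Qed.

Lemma not_essentially_selfadjoint (D : set ('rV[R]_n -> R[i])) : D `<=` schwartz ->
  ~ essentially_selfadjoint D (hamiltonian alpha a b c).
Proof.
move=> DS; have [v [f [Lv Lf HA HI]]] := nonsymmetric_pair.
apply: (not_selfadjoint (adjoint_closure _ Lv Lf _) HI).
  by move=> p [_ [L1 [L2_ _]]].
move=> p [Dp [L1 [Lp E]]]; have LH : L2 (hamiltonian alpha a b c p.1) by rewrite -E.
by rewrite E; exact: (HA _ (DS _ Dp) L1 LH).
Qed.

End quasimode_adjoint.

Theorem corollary1p5 (R : realType) (n : nat) (hn : (1 <= n)%N)
  (alpha mu : R) (hmu0 : 0 < mu) (hmu1 : mu < 1 / 2)
  (a : 'I_n -> 'I_n -> 'rV[R]_n -> R) (b : 'I_n -> 'rV[R]_n -> R)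
  (c : 'rV[R]_n -> R)
  (ha_sym : forall j k, a j k = a k j)
  (ha_smooth : forall j k, smooth (a j k))
  (hb_smooth : forall j, smooth (b j))
  (hc_smooth : smooth c)
  (ha : forall j k, symbol_bound (- mu) (a j k))
  (hb : forall j, symbol_bound (alpha - mu) (b j))
  (hc : symbol_bound (2 * alpha - mu) c)
  (hell : forall M : R, 0 < M -> exists C RM : R, 0 < C /\ 0 < RM /\
    forall x xi : 'rV[R]_n, enorm x <= M -> RM <= enorm xi ->
      C * jap xi ^+ 2 <= `|psymbol alpha a b c x xi|)
  (halpha : 1 < alpha) :
  ~ essentially_selfadjoint Cc_infty (hamiltonian alpha a b c) /\
  ~ essentially_selfadjoint schwartz (hamiltonian alpha a b c).
Proof.
have H := not_essentially_selfadjoint hn halpha hmu0 hmu1 ha_sym ha_smooth hb_smooth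
  hc_smooth ha hb hc.
by split; apply: H => //; exact: Cc_infty_schwartz.
Qed.
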